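(* Let $\mathbf A,\mathbf B$ be dg-categories. Assume that $\mathbf A$ is triangulated and smooth, and that $\mathbf B$ is locally perfect. Let $T\colon\mathbf A\to\mathbf B$ be a quasi-functor. Then $T$ admits both a left adjoint and a right adjoint (quasi-functors $\mathbf B\to\mathbf A$).
   Context: Fix a commutative ring $\mathbf k$. A dg-category is a category (with a set of objects) enriched over cochain complexes of $\mathbf k$-modules; $\mathsf C_{dg}(\mathbf k)$ is the dg-category of complexes. For a dg-category $\mathbf A$, $\mathsf C_{dg}(\mathbf A)$ is the dg-category of right $\mathbf A$-dg-modules (dg-functors $\mathbf A^{op}\to \mathsf C_{dg}(\mathbf k)$); left $\mathbf A$-dg-modules are right $\mathbf A^{op}$-dg-modules. Put $\mathsf K(\mathbf A)=H^0(\mathsf C_{dg}(\mathbf A))$; quasi-isomorphisms and acyclicity are defined objectwise, and $\mathsf D(\mathbf A)$ is the (triangulated) localisation of $\mathsf K(\mathbf A)$ at quasi-isomorphisms. A dg-module $P$ is h-projective if $\mathsf K(\mathbf A)(P,N)=0$ for all acyclic $N$; $Q(M)\to M$ denotes a (functorial) h-projective resolution. Representables: $h_A=\mathbf A(-,A)$ (right module), $h^A=\mathbf A(A,-)$ (left module); the diagonal bimodule $h_{\mathbf A}$ is $(A,A')\mapsto \mathbf A(A,A')$. $\mathrm{per}(\mathbf A)$ is the smallest strictly full thick (closed under direct summands) triangulated subcategory of $\mathsf D(\mathbf A)$ containing all $h_A$; its objects are called perfect. $\mathrm{per}(\mathbf k)$ is the case of $\mathbf k$ viewed as a dg-category with one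 object. $\mathbf A$ is triangulated if the derived Yoneda embedding $H^0(\mathbf A)\to\mathrm{per}(\mathbf A)$, $A\mapsto h_A$, is an equivalence. $\mathbf A$ is locally perfect if $\mathbf A(A,A')\in\mathrm{per}(\mathbf k)$ for all $A,A'\in\mathbf A$. $\mathbf A$ is smooth if the diagonal bimodule is perfect: $h_{\mathbf A}\in\mathrm{per}(\mathbf A\otimes^{\mathbb L}\mathbf A^{op})$. A dg-category is h-projective if all its hom-complexes are h-projective complexes of $\mathbf k$-modules; every dg-category $\mathbf A$ has an h-projective resolution (a quasi-equivalence $\mathbf A^{hp}\to\mathbf A$ with $\mathbf A^{hp}$ h-projective, which can be taken to be the identity on objects), and $\mathbf A\otimes^{\mathbb L}\mathbf B=\mathbf A^{hp}\otimes\mathbf B$ up to quasi-equivalence. Set $\mathsf D(\mathbf A,\mathbf B)=\mathsf D(\mathbf B\otimes^{\mathbb L}\mathbf A^{op})$. Convention: when working with $\mathsf D(\mathbf A,\mathbf B)$, dg-categories are identified with their h-projective resolutions, so an object $T\in\mathsf D(\mathbf A,\mathbf B)$ is a dg-bimodule $T\colon\mathbf B^{op}\otimes\mathbf A\to\mathsf C_{dg}(\mathbf k)$, covariant in $\mathbf A$ and contravariant in $\mathbf B$, with components $T_A=T(-,A)$ (right $\mathbf B$-module) and $T^B=T(B,-)$ (left $\mathbf A$-module). A quasi-functor $\mathbf A\to\mathbf B$ is an object $T\in\mathsf D(\mathbf A,\mathbf B)$ which is right quasi-representable: for every $A\in\mathbf A$ the right $\mathbf B$-module $T_A$ is quasi-isomorphic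 to $h_{F(A)}$ for some $F(A)\in\mathbf B$. Composition of bimodules $F$ ($\mathbf A$-$\mathbf B$) and $G$ ($\mathbf B$-$\mathbf C$) is the coend (tensor product over $\mathbf B$) $(G\diamond F)^C_A=\int^B F^B_A\otimes G^C_B$, i.e. the cokernel of $\bigoplus_{B_1,B_2}F^{B_2}_A\otimes\mathbf B(B_1,B_2)\otimes G^C_{B_1}\to\bigoplus_B F^B_A\otimes G^C_B$, $x\otimes f\otimes y\mapsto xf\otimes y-x\otimes fy$; its derived version is $G\diamond^{\mathbb L}F=Q(G)\diamond Q(F)$. With this composition, dg-categories, objects of $\mathsf D(\mathbf A,\mathbf B)$ and morphisms of $\mathsf D(\mathbf A,\mathbf B)$ form a bicategory $\mathsf{DBimod}$ whose unit $1$-morphisms are the diagonal bimodules. For quasi-functors $T\colon\mathbf A\to\mathbf B$ and $S\colon\mathbf B\to\mathbf A$, $T$ is left adjoint to $S$ (and $S$ is right adjoint to $T$) if $T\dashv S$ in $\mathsf{DBimod}$, i.e. there are $2$-morphisms $h_{\mathbf A}\to S\diamond^{\mathbb L}T$ and $T\diamond^{\mathbb L}S\to h_{\mathbf B}$ satisfying the triangular identities. *)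

(* Defs.v *)
From HB Require Import structures.
From mathcomp Require Import all_boot all_order all_algebra.
From mathcomp Require Import boolp.
From mathcomp Require Import zify.

Set Implicit Arguments.
Unset Strict Implicit.
Unset Printing Implicit Defensive.

Import GRing.Theory.
Local Open Scope quotient_scope.
Local Open Scope ring_scope.

Section Presentation.
Variables (k : comPzRingType) (G : Type).

Inductive mterm : Type :=
| MGen of G
| MZero
| MAdd of mterm & mterm
| MOpp of mterm
| MScale of k & mterm.

HB.instance Definition _ := gen_eqMixin mterm.
HB.instance Definition _ := gen_choiceMixin mterm.

Variable rel : mterm -> mterm -> Prop.

Inductive mcong : mterm -> mterm -> Prop :=
| mc_rel s t : rel s t -> mcong s t
| mc_refl s : mcong s s
| mc_sym s t : mcong s t -> mcong t s
| mc_trans t s u : mcong s t -> mcong t u -> mcong s u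
| mc_add s s' t t' : mcong s s' -> mcong t t' -> mcong (MAdd s t) (MAdd s' t')
| mc_opp s s' : mcong s s' -> mcong (MOpp s) (MOpp s')
| mc_scale c s s' : mcong s s' -> mcong (MScale c s) (MScale c s')
| mc_addA s t u : mcong (MAdd s (MAdd t u)) (MAdd (MAdd s t) u)
| mc_addC s t : mcong (MAdd s t) (MAdd t s)
| mc_add0 s : mcong (MAdd MZero s) s
| mc_addN s : mcong (MAdd (MOpp s) s) MZero
| mc_scaleA c c' s : mcong (MScale c (MScale c' s)) (MScale (c * c') s)
| mc_scale1 s : mcong (MScale 1 s) s
| mc_scaleDr c s t :
    mcong (MScale c (MAdd s t)) (MAdd (MScale c s) (MScale c t))
| mc_scaleDl s c c' :
    mcong (MScale (c + c') s) (MAdd (MScale c s) (MScale c' s)).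

Definition mcongb (s t : mterm) : bool := `[< mcong s t >].

Lemma mcongb_refl : reflexive mcongb.
Proof. by move=> s; apply/asboolP; exact: mc_refl. Qed.

Lemma mcongb_sym : symmetric mcongb.
Proof.
by move=> s t; apply/idP/idP => /asboolP h; apply/asboolP; exact: mc_sym.
Qed.

Lemma mcongb_trans : transitive mcongb.
Proof.
by move=> t s u /asboolP h /asboolP h'; apply/asboolP; exact: mc_trans h h'.
Qed.

Definition mcong_equiv : equiv_rel mterm :=
  EquivRel mcongb mcongb_refl mcongb_sym mcongb_trans.

Definition mpres : Type := {eq_quot mcong_equiv}.

HB.instance Definition _ := Choice.on mpres.

Definition mcls (s : mterm) : mpres := \pi_{eq_quot mcong_equiv} s.

Lemma mclsE s t : mcong s t <-> mcls s = mcls t.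
Proof.
split=> [h|h]; first by apply/eqmodP; apply/asboolP.
by have /eqmodP/asboolP : s = t %[mod {eq_quot mcong_equiv}] by exact: h.
Qed.

Definition mrep (x : mpres) : mterm := repr (x : {eq_quot mcong_equiv}).

Lemma mrepK x : mcls (mrep x) = x.
Proof. exact: reprK. Qed.

Lemma mrep_cls s : mcong (mrep (mcls s)) s.
Proof. by apply/mclsE; rewrite mrepK. Qed.

Definition mp_zero : mpres := mcls MZero.
Definition mp_add (x y : mpres) : mpres := mcls (MAdd (mrep x) (mrep y)).
Definition mp_opp (x : mpres) : mpres := mcls (MOpp (mrep x)).
Definition mp_scale (c : k) (x : mpres) : mpres := mcls (MScale c (mrep x)).

Lemma mp_addE s t : mp_add (mcls s) (mcls t) = mcls (MAdd s t).
Proof. by apply/mclsE; apply: mc_add; exact: mrep_cls. Qed.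
Lemma mp_oppE s : mp_opp (mcls s) = mcls (MOpp s).
Proof. by apply/mclsE; apply: mc_opp; exact: mrep_cls. Qed.
Lemma mp_scaleE c s : mp_scale c (mcls s) = mcls (MScale c s).
Proof. by apply/mclsE; apply: mc_scale; exact: mrep_cls. Qed.

Lemma mp_addA : associative mp_add.
Proof.
move=> x y z; rewrite -(mrepK x) -(mrepK y) -(mrepK z) !mp_addE.
by apply/mclsE; exact: mc_addA.
Qed.
Lemma mp_addC : commutative mp_add.
Proof.
move=> x y; rewrite -(mrepK x) -(mrepK y) !mp_addE.
by apply/mclsE; exact: mc_addC.
Qed.
Lemma mp_add0 : left_id mp_zero mp_add.
Proof.
by move=> x; rewrite -(mrepK x) !mp_addE; apply/mclsE; exact: mc_add0.
Qed.
Lemma mp_addN : left_inverse mp_zero mp_opp mp_add.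
Proof.
move=> x; rewrite -(mrepK x) mp_oppE mp_addE.
by apply/mclsE; exact: mc_addN.
Qed.

HB.instance Definition _ :=
  GRing.isZmodule.Build mpres mp_addA mp_addC mp_add0 mp_addN.

Lemma mp_scaleA c c' x : mp_scale c (mp_scale c' x) = mp_scale (c * c') x.
Proof.
by rewrite -(mrepK x) !mp_scaleE; apply/mclsE; exact: mc_scaleA.
Qed.
Lemma mp_scale1 : left_id 1 mp_scale.
Proof.
by move=> x; rewrite -(mrepK x) !mp_scaleE; apply/mclsE; exact: mc_scale1.
Qed.
Lemma mp_scaleDr : right_distributive mp_scale +%R.
Proof.
move=> c x y; rewrite -(mrepK x) -(mrepK y).
rewrite [X in mp_scale c X]mp_addE !mp_scaleE [RHS]mp_addE.
by apply/mclsE; exact: mc_scaleDr.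
Qed.
Lemma mp_scaleDl x : {morph mp_scale^~ x : c c' / c + c'}.
Proof.
move=> c c'; rewrite -(mrepK x) !mp_scaleE [RHS]mp_addE.
by apply/mclsE; exact: mc_scaleDl.
Qed.

HB.instance Definition _ :=
  GRing.Zmodule_isLmodule.Build k mpres
    mp_scaleA mp_scale1 mp_scaleDr mp_scaleDl.

Lemma mcls_lin c s t : mcls (MAdd (MScale c s) t) = c *: mcls s + mcls t.
Proof. by rewrite [X in X + _]mp_scaleE [RHS]mp_addE. Qed.

Section Lift.
Variables (V : lmodType k) (phi : G -> V).

Fixpoint meval (s : mterm) : V :=
  match s with
  | MGen g => phi g
  | MZero => 0
  | MAdd s t => meval s + meval t
  | MOpp s => - meval s
  | MScale c s => c *: meval s
  end.

Definition mlift (x : mpres) : V := meval (mrep x).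

Hypothesis phi_rel : forall s t, rel s t -> meval s = meval t.

Lemma meval_cong s t : mcong s t -> meval s = meval t.
Proof.
elim=> //= {s t}.
- by move=> t s u _ -> _ ->.
- by move=> s s' t t' _ -> _ ->.
- by move=> s s' _ ->.
- by move=> c s s' _ ->.
- by move=> s t u; rewrite addrA.
- by move=> s t; rewrite addrC.
- by move=> s; rewrite add0r.
- by move=> s; rewrite addNr.
- by move=> c c' s; rewrite scalerA.
- by move=> s; rewrite scale1r.
- by move=> c s t; rewrite scalerDr.
- by move=> s c c'; rewrite scalerDl.
Qed.

Lemma mliftE s : mlift (mcls s) = meval s.
Proof. by apply: meval_cong; exact: mrep_cls. Qed.

Lemma mlift_gen g : mlift (mcls (MGen g)) = phi g.
Proof. exact: mliftE. Qed.

Lemma mlift_lin : linear mlift.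
Proof.
move=> c x y; rewrite -(mrepK x) -(mrepK y).
by rewrite [c *: _]mp_scaleE [_ + _]mp_addE !mliftE.
Qed.

End Lift.

Lemma mpres_ext (V : lmodType k) (f g : mpres -> V) :
  linear f -> linear g ->
  (forall t, f (mcls (MGen t)) = g (mcls (MGen t))) -> f =1 g.
Proof.
move=> lf lg fg x; rewrite -(mrepK x).
have l0 (h : mpres -> V) : linear h -> h 0 = 0.
  by move=> lh; have := lh (-1) 0 0; rewrite scaler0 addr0 scaleN1r addNr.
have lD (h : mpres -> V) : linear h -> forall x y, h (x + y) = h x + h y.
  by move=> lh u v; have := lh 1 u v; rewrite !scale1r.
have lZ (h : mpres -> V) : linear h -> forall c x, h (c *: x) = c *: h x.
  by move=> lh c u; have := lh c u 0; rewrite !addr0 l0 ?addr0.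
elim: (mrep x) => [t| |s IHs t IHt|s IHs|c s IHs].
- exact: fg.
- by rewrite -[mcls MZero]/(0 : mpres) !l0.
- by rewrite -mp_addE !lD // IHs IHt.
- have -> : mcls (MOpp s) = -1 *: mcls s by rewrite scaleN1r [RHS]mp_oppE.
  by rewrite !lZ // IHs.
- by rewrite -mp_scaleE !lZ // IHs.
Qed.

End Presentation.

Section LinearFacts.
Variables (k : comPzRingType) (U V W : lmodType k).

Lemma lin0 (f : U -> V) : linear f -> f 0 = 0.
Proof. by move=> h; have := h (-1) 0 0; rewrite scaler0 addr0 scaleN1r addNr. Qed.
Lemma linD (f : U -> V) : linear f -> forall x y, f (x + y) = f x + f y.
Proof. by move=> h x y; have := h 1 x y; rewrite !scale1r. Qed.
Lemma linZ (f : U -> V) : linear f -> forall c x, f (c *: x) = c *: f x.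
Proof. by move=> h c x; have := h c x 0; rewrite !addr0 lin0 ?addr0. Qed.
Lemma linN (f : U -> V) : linear f -> forall x, f (- x) = - f x.
Proof. by move=> h x; rewrite -!scaleN1r linZ. Qed.

Lemma lin_id : linear (fun x : U => x).
Proof. by []. Qed.
Lemma lin_zero : linear (fun _ : U => 0 : V).
Proof. by move=> c x y; rewrite scaler0 addr0. Qed.
Lemma lin_comp (f : V -> W) (g : U -> V) :
  linear f -> linear g -> linear (fun x => f (g x)).
Proof. by move=> lf lg c x y; rewrite lg lf. Qed.
Lemma lin_add (f g : U -> V) :
  linear f -> linear g -> linear (fun x => f x + g x).
Proof. by move=> lf lg c x y; rewrite lf lg scalerDr addrACA. Qed.
Lemma lin_scale c (f : U -> V) : linear f -> linear (fun x => c *: f x).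
Proof.
by move=> lf a x y; rewrite lf scalerDr !scalerA mulrC.
Qed.
End LinearFacts.

(** [ksgn k i] is the Koszul sign (-1)^i. *)
Definition ksgn (k : comPzRingType) (i : int) : k := (-1) ^+ (absz i).

Section Signs.
Variable k : comPzRingType.
Implicit Types i j : int.

Lemma odd_abszD i j : odd (absz (i + j)) = odd (absz i) (+) odd (absz j).
Proof. lia. Qed.

Lemma ksgn_odd i : ksgn k i = (-1) ^+ odd (absz i).
Proof. by rewrite /ksgn signr_odd. Qed.

Lemma ksgnD i j : ksgn k (i + j) = ksgn k i * ksgn k j.
Proof. by rewrite !ksgn_odd odd_abszD signr_addb. Qed.

Lemma ksgn0 : ksgn k 0 = 1. Proof. by []. Qed.
Lemma ksgn1 : ksgn k 1 = -1. Proof. by rewrite /ksgn expr1. Qed.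

Lemma ksgnS i : ksgn k (i + 1) = - ksgn k i.
Proof. by rewrite ksgnD ksgn1 mulrN1. Qed.

Lemma ksgn_sqr i : ksgn k i * ksgn k i = 1.
Proof. by rewrite ksgn_odd -signr_addb addbb. Qed.
End Signs.

(** Cochain complexes.  As for every degree below, the target degree of the
    differential is a variable constrained by an equation, so that no statement
    needs transport along equalities of integers. *)
Record complex (k : comPzRingType) := Complex {
  cx :> int -> lmodType k;
  cd : forall i j, i + 1 = j -> cx i -> cx j;
  cd_lin : forall i j (e : i + 1 = j), linear (cd e);
  cdd : forall i j l (e : i + 1 = j) (e' : j + 1 = l) x, cd e' (cd e x) = 0 }.
Arguments cd {k} c {i j} e x.

Record dgcat (k : comPzRingType) := DgCat {
  ob : Type;
  hom : ob -> ob -> complex k;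
  comp : forall X Y Z i j n, i + j = n ->
    hom Y Z i -> hom X Y j -> hom X Z n;
  idm : forall X, hom X X 0;
  comp_linl : forall X Y Z i j n (e : i + j = n) (f : hom X Y j),
    linear (fun g : hom Y Z i => comp e g f);
  comp_linr : forall X Y Z i j n (e : i + j = n) (g : hom Y Z i),
    linear (fun f : hom X Y j => comp e g f);
  comp_d : forall X Y Z i j n i' j' n' (e : i + j = n) (en : n + 1 = n')
      (ei : i + 1 = i') (ej : j + 1 = j') (e1 : i' + j = n') (e2 : i + j' = n')
      (g : hom Y Z i) (f : hom X Y j),
    cd _ en (comp e g f)
      = comp e1 (cd _ ei g) f + ksgn k i *: comp e2 g (cd _ ej f);
  idm_d : forall X j (e : 0 + 1 = j), cd _ e (idm X) = 0;
  comp1m : forall X Y i (e : 0 + i = i) (f : hom X Y i), comp e (idm Y) f = f;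
  compm1 : forall X Y i (e : i + 0 = i) (f : hom X Y i), comp e f (idm X) = f;
  compA : forall W X Y Z i j l ij jl n (e1 : j + l = jl) (e2 : i + jl = n)
      (e3 : i + j = ij) (e4 : ij + l = n)
      (h : hom Y Z i) (g : hom X Y j) (f : hom W X l),
    comp e2 h (comp e1 g f) = comp e4 (comp e3 h g) f }.
Arguments comp {k A X Y Z i j n} e g f : rename.
Arguments idm {k A} X : rename.

Record dgfunctor (k : comPzRingType) (A B : dgcat k) := DgFunctor {
  fo :> ob A -> ob B;
  fm : forall X Y i, hom X Y i -> hom (fo X) (fo Y) i;
  fm_lin : forall X Y i, linear (@fm X Y i);
  fm_d : forall X Y i j (e : i + 1 = j) (f : hom X Y i),
    fm (cd _ e f) = cd _ e (fm f);
  fm_comp : forall X Y Z i j n (e : i + j = n) (g : hom Y Z i) (f : hom X Y j),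
    fm (comp e g f) = comp e (fm g) (fm f);
  fm_id : forall X, fm (idm X) = idm (fo X) }.
Arguments fm {k A B} d {X Y i} f : rename.

Definition idfunctor (k : comPzRingType) (A : dgcat k) : dgfunctor A A.
Proof. by refine (@DgFunctor k A A id (fun _ _ _ f => f) _ _ _ _). Defined.

Section UnitDgCat.
Variable k : comPzRingType.

Definition khom (i : int) : lmodType k :=
  match i with Posz 0 => k^o | _ => 'rV[k]_0 end.

Definition kval (i : int) : khom i -> k :=
  match i with Posz 0 => id | _ => fun _ => 0 end.
Definition kinj (i : int) : k -> khom i :=
  match i with Posz 0 => id | _ => fun _ => 0 end.

Lemma kval_lin i : linear (@kval i : khom i -> k^o).
Proof.
by move: i => [[|n]|n] c x y //=; rewrite scaler0 addr0.
Qed.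
Lemma kinj_lin i : linear (@kinj i : k^o -> khom i).
Proof. by move: i => [[|n]|n] c x y //=; rewrite scaler0 addr0. Qed.
Lemma kinj0 i : kinj i 0 = 0.
Proof. exact: lin0 (@kinj_lin i). Qed.
Lemma kval0 i : kval (0 : khom i) = 0.
Proof. exact: lin0 (@kval_lin i). Qed.
Lemma kval_ne i (x : khom i) : i <> 0 -> kval x = 0.
Proof. by move: i x => [[|n]|n]. Qed.
Lemma kinjK i (x : khom i) : kinj i (kval x) = x.
Proof. by move: i x => [[|n]|n] x //=; rewrite [x]thinmx0. Qed.

Lemma kval_mul i j n (e : i + j = n) (x : khom i) (y : khom j) :
  kval (kinj n (kval x * kval y)) = kval x * kval y.
Proof.
have [en|ne] := pselect (n = 0); first by subst n; rewrite en.
have [ei|ni] := pselect (i = 0).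
  rewrite (kval_ne y); last by move=> ej; apply: ne; rewrite -e ei ej.
  by rewrite mulr0 kinj0 kval0.
by rewrite (kval_ne x) // mul0r kinj0 kval0.
Qed.

Definition kcx : complex k.
Proof.
refine (@Complex k khom (fun _ _ _ _ => 0) _ _) => //.
by move=> i j e; exact: lin_zero.
Defined.

Definition kcat : dgcat k.
Proof.
refine (@DgCat k unit (fun _ _ => kcx)
  (fun _ _ _ i j n _ f g => kinj n (kval f * kval g)) (fun _ => kinj 0 1)
  _ _ _ _ _ _ _) => //=.
- move=> X Y Z i j n e f c x y.
  by rewrite -kinj_lin (kval_lin c x y) /= mulrDl -mulrA.
- move=> X Y Z i j n e f c x y.
  by rewrite -kinj_lin (kval_lin c x y) /= mulrDr mulrCA.
- by intros; rewrite !kval0 mulr0 mul0r kinj0 scaler0 addr0.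
- by move=> X Y i e f; rewrite mul1r kinjK.
- by move=> X Y i e f; rewrite mulr1 kinjK.
- by intros; rewrite !(kval_mul) // mulrA.
Defined.

(** The dg-functor [k -> A] with value the object [X]. *)
Definition kpt_map (A : dgcat k) (X : ob A) (i : int) : khom i -> hom X X i :=
  match i with Posz 0 => fun c => c *: idm X | _ => fun _ => 0 end.

Lemma kpt_lin (A : dgcat k) (X : ob A) i : linear (@kpt_map A X i).
Proof.
move: i => [[|n]|n] c x y /=; try by rewrite scaler0 addr0.
by rewrite scalerDl scalerA.
Qed.

Lemma kpt_ne (A : dgcat k) (X : ob A) i (x : khom i) : i <> 0 -> kpt_map X x = 0.
Proof. by move: i x => [[|n]|n]. Qed.

Definition kpt (A : dgcat k) (X : ob A) : dgfunctor kcat A.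
Proof.
refine (@DgFunctor k kcat A (fun _ => X) (fun _ _ i => @kpt_map A X i) _ _ _ _).
- by move=> X' Y' i; exact: kpt_lin.
- move=> X' Y' i j e f /=; rewrite (lin0 (@kpt_lin A X j)).
  move: i e f => [[|n]|n] e f /=; rewrite ?(lin0 (cd_lin e)) //.
  by rewrite (linZ (cd_lin e)) idm_d scaler0.
- move=> X' Y' Z' i j n e g f /=.
  have [ei|ni] := pselect (i = 0); last first.
    rewrite (kval_ne g) // (kpt_ne X g) // mul0r kinj0 (lin0 (@kpt_lin A X n)).
    by rewrite (lin0 (comp_linl e _)).
  have [ej|nj] := pselect (j = 0); last first.
    rewrite (kval_ne f) // (kpt_ne X f) // mulr0 kinj0 (lin0 (@kpt_lin A X n)).
    by rewrite (lin0 (comp_linr e _)).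
  subst i j n; rewrite /=.
  by rewrite (linZ (comp_linl _ _)) (linZ (comp_linr _ _)) comp1m scalerA.
- by move=> _ /=; rewrite scale1r.
Defined.

End UnitDgCat.

(** An [A]-[B]-dg-bimodule is a dg-functor [B^op (x) A -> C_dg(k)], written out:
    complexes [bc M b a], contravariant in [b] (right [B]-action) and covariant
    in [a] (left [A]-action), the two actions commuting.  With the convention
    that [f^op] acts by [m |-> (-1)^(|f||m|) m f], functoriality on [B^op] is
    the associativity and the Leibniz rule of a right action. *)
Record bimod (k : comPzRingType) (A B : dgcat k) := Bimod {
  bc : ob B -> ob A -> complex k;
  ract : forall b b' a i j n, i + j = n ->
    bc b a i -> hom b' b j -> bc b' a n;
  lact : forall b a a' i j n, i + j = n ->
    hom a a' i -> bc b a j -> bc b a' n;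
  ract_linl : forall b b' a i j n (e : i + j = n) (f : hom b' b j),
    linear (fun m : bc b a i => ract e m f);
  ract_linr : forall b b' a i j n (e : i + j = n) (m : bc b a i),
    linear (fun f : hom b' b j => ract e m f);
  lact_linl : forall b a a' i j n (e : i + j = n) (m : bc b a j),
    linear (fun g : hom a a' i => lact e g m);
  lact_linr : forall b a a' i j n (e : i + j = n) (g : hom a a' i),
    linear (fun m : bc b a j => lact e g m);
  ract1 : forall b a i (e : i + 0 = i) (m : bc b a i), ract e m (idm b) = m;
  lact1 : forall b a i (e : 0 + i = i) (m : bc b a i), lact e (idm a) m = m;
  ractA : forall b b' b'' a i j l ij jl n
      (e1 : i + j = ij) (e2 : ij + l = n) (e3 : j + l = jl) (e4 : i + jl = n)
      (m : bc b a i) (f : hom b' b j) (g : hom b'' b' l),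
    ract e2 (ract e1 m f) g = ract e4 m (comp e3 f g);
  lactA : forall b a a' a'' i j l ij jl n
      (e1 : j + l = jl) (e2 : i + jl = n) (e3 : i + j = ij) (e4 : ij + l = n)
      (g : hom a' a'' i) (f : hom a a' j) (m : bc b a l),
    lact e2 g (lact e1 f m) = lact e4 (comp e3 g f) m;
  lractA : forall b b' a a' i j l ij jl n
      (e1 : i + j = ij) (e2 : ij + l = n) (e3 : j + l = jl) (e4 : i + jl = n)
      (g : hom a a' i) (m : bc b a j) (f : hom b' b l),
    ract e2 (lact e1 g m) f = lact e4 g (ract e3 m f);
  ract_d : forall b b' a i j n i' j' n' (e : i + j = n) (en : n + 1 = n')
      (ei : i + 1 = i') (ej : j + 1 = j') (e1 : i' + j = n') (e2 : i + j' = n')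
      (m : bc b a i) (f : hom b' b j),
    cd _ en (ract e m f)
      = ract e1 (cd _ ei m) f + ksgn k i *: ract e2 m (cd _ ej f);
  lact_d : forall b a a' i j n i' j' n' (e : i + j = n) (en : n + 1 = n')
      (ei : i + 1 = i') (ej : j + 1 = j') (e1 : i' + j = n') (e2 : i + j' = n')
      (g : hom a a' i) (m : bc b a j),
    cd _ en (lact e g m)
      = lact e1 (cd _ ei g) m + ksgn k i *: lact e2 g (cd _ ej m) }.
Arguments bc {k A B} M b a : rename.
Arguments ract {k A B} M {b b' a i j n} e m f : rename.
Arguments lact {k A B} M {b a a' i j n} e g m : rename.

(** The diagonal bimodule [h_A]. *)
Definition diag (k : comPzRingType) (A : dgcat k) : bimod A A.
Proof.
refine (@Bimod k A A (fun b a => hom b a)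
  (fun b b' a i j n e m f => comp e m f)
  (fun b a a' i j n e g m => comp e g m) _ _ _ _ _ _ _ _ _ _ _).
- by move=> *; exact: comp_linl.
- by move=> *; exact: comp_linr.
- by move=> *; exact: comp_linl.
- by move=> *; exact: comp_linr.
- by move=> *; exact: compm1.
- by move=> *; exact: comp1m.
- by move=> *; symmetry; exact: compA.
- by move=> *; exact: compA.
- by move=> *; symmetry; exact: compA.
- by move=> *; exact: comp_d.
- by move=> *; exact: comp_d.
Defined.

Definition restrict (k : comPzRingType) (A A' B B' : dgcat k)
  (phi : dgfunctor A' A) (psi : dgfunctor B' B) (M : bimod A B) : bimod A' B'.
Proof.
refine (@Bimod k A' B' (fun b a => bc M (psi b) (phi a))
  (fun b b' a i j n e m f => ract M e m (fm psi f))
  (fun b a a' i j n e g m => lact M e (fm phi g) m) _ _ _ _ _ _ _ _ _ _ _).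
- by move=> *; exact: ract_linl.
- move=> b b' a i j n e m.
  exact: (lin_comp (ract_linr e m) (@fm_lin _ _ _ psi _ _ _)).
- move=> b a a' i j n e m.
  exact: (lin_comp (lact_linl e m) (@fm_lin _ _ _ phi _ _ _)).
- by move=> *; exact: lact_linr.
- by move=> *; rewrite fm_id ract1.
- by move=> *; rewrite fm_id lact1.
- by move=> *; rewrite fm_comp; exact: ractA.
- by move=> *; rewrite fm_comp; exact: lactA.
- by move=> *; exact: lractA.
- by move=> *; rewrite fm_d; exact: ract_d.
- by move=> *; rewrite fm_d; exact: lact_d.
Defined.

(** Right [A]-modules are [k]-[A]-bimodules, left [A]-modules are
    [A]-[k]-bimodules, and complexes are [k]-[k]-bimodules ([A (x) k = A]). *)
Definition rmod (k : comPzRingType) (A : dgcat k) := bimod (kcat k) A.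

(** [T_a = T(-, a)]. *)
Definition rcomponent (k : comPzRingType) (A B : dgcat k) (T : bimod A B)
  (a : ob A) : rmod B := restrict (kpt a) (idfunctor B) T.

(** [h_X = A(-, X)] and [h^X = A(X, -)]. *)
Definition hright (k : comPzRingType) (A : dgcat k) (X : ob A) : rmod A :=
  rcomponent (diag A) X.
Definition hleft (k : comPzRingType) (A : dgcat k) (X : ob A)
  : bimod A (kcat k) := restrict (idfunctor A) (kpt X) (diag A).

(** The complex of [k]-modules [A(X, Y)]. *)
Definition homk (k : comPzRingType) (A : dgcat k) (X Y : ob A) : rmod (kcat k) :=
  restrict (kpt Y) (kpt X) (diag A).

Record bmap (k : comPzRingType) (A B : dgcat k) (M N : bimod A B) := BMap {
  bm :> forall b a i, bc M b a i -> bc N b a i;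
  bm_lin : forall b a i, linear (@bm b a i);
  bm_d : forall b a i j (e : i + 1 = j) (x : bc M b a i),
    @bm b a j (cd _ e x) = cd _ e (@bm b a i x);
  bm_r : forall b b' a i j n (e : i + j = n) (x : bc M b a i) (f : hom b' b j),
    @bm b' a n (ract M e x f) = ract N e (@bm b a i x) f;
  bm_l : forall b a a' i j n (e : i + j = n) (g : hom a a' i) (x : bc M b a j),
    @bm b a' n (lact M e g x) = lact N e g (@bm b a j x) }.
Arguments bm {k A B M N} b0 b a i _ : rename.

Definition bid (k : comPzRingType) (A B : dgcat k) (M : bimod A B) : bmap M M.
Proof. by refine (@BMap k A B M M (fun _ _ _ x => x) _ _ _ _). Defined.

Definition bcomp (k : comPzRingType) (A B : dgcat k) (L M N : bimod A B)
  (g : bmap M N) (f : bmap L M) : bmap L N.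
Proof.
refine (@BMap k A B L N (fun b a i x => g b a i (f b a i x)) _ _ _ _).
- by move=> b a i; exact: lin_comp (@bm_lin _ _ _ _ _ g _ _ _) (@bm_lin _ _ _ _ _ f _ _ _).
- by intros; rewrite !bm_d.
- by intros; rewrite !bm_r.
- by intros; rewrite !bm_l.
Defined.

(** [f - g = d h + h d] for a morphism [h] of degree -1. *)
Definition homotopic (k : comPzRingType) (A B : dgcat k) (M N : bimod A B)
  (f g : bmap M N) : Prop :=
  exists h : forall b a i j, j + 1 = i -> bc M b a i -> bc N b a j,
  [/\ forall b a i j (e : j + 1 = i), linear (h b a i j e),
      forall b b' a i j i' n n' (e : i + j = n) (ei : i' + 1 = i)
        (en : n' + 1 = n) (e' : i' + j = n') (x : bc M b a i) (f : hom b' b j),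
        h b' a n n' en (ract M e x f) = ract N e' (h b a i i' ei x) f,
      forall b a a' i j j' n n' (e : i + j = n) (ej : j' + 1 = j)
        (en : n' + 1 = n) (e' : i + j' = n') (g : hom a a' i) (x : bc M b a j),
        h b a' n n' en (lact M e g x)
          = ksgn k i *: lact N e' g (h b a j j' ej x)
    & forall b a i j l (ej : j + 1 = i) (el : i + 1 = l) (x : bc M b a i),
        f b a i x - g b a i x
          = cd _ ej (h b a i j ej x) + h b a l i el (cd _ el x)].

(** The map induced on [H^i] is bijective for all [i]. *)
Definition cx_quasi_iso (k : comPzRingType) (C D : complex k)
  (f : forall i, C i -> D i) : Prop :=
  (forall i j l (ei : j + 1 = i) (el : i + 1 = l) (x : C i) (y : D j),
     cd C el x = 0 -> f i x = cd D ei y -> exists z, x = cd C ei z) /\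
  (forall i j l (ei : j + 1 = i) (el : i + 1 = l) (y : D i),
     cd D el y = 0 ->
     exists x z, cd C el x = 0 /\ y = f i x + cd D ei z).

Definition quasi_iso (k : comPzRingType) (A B : dgcat k) (M N : bimod A B)
  (f : bmap M N) : Prop := forall b a, cx_quasi_iso (f b a).

Definition acyclic (k : comPzRingType) (A B : dgcat k) (M : bimod A B) : Prop :=
  forall b a i j l (ei : j + 1 = i) (el : i + 1 = l) (x : bc M b a i),
    cd _ el x = 0 -> exists z, x = cd _ ei z.

(** [K(P, N) = 0] for every acyclic [N]. *)
Definition hproj (k : comPzRingType) (A B : dgcat k) (P : bimod A B) : Prop :=
  forall N : bimod A B, acyclic N -> forall f g : bmap P N, homotopic f g.

Section Derived.
Variables (k : comPzRingType) (A B : dgcat k).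
Implicit Types L M N : bimod A B.

(** Gabriel-Zisman localisation of [K(A, B)] at quasi-isomorphisms: morphisms
    are formal composites, considered up to the congruence [Deq]. *)
Inductive Dhom : bimod A B -> bimod A B -> Type :=
| Dof M N of bmap M N : Dhom M N
| Dinv M N (w : bmap M N) of quasi_iso w : Dhom N M
| Dcomp L M N of Dhom M N & Dhom L M : Dhom L N.

Definition Did M : Dhom M M := Dof (bid M).

Inductive Deq : forall M N, Dhom M N -> Dhom M N -> Prop :=
| Deq_refl M N (f : Dhom M N) : Deq f f
| Deq_sym M N (f g : Dhom M N) : Deq f g -> Deq g f
| Deq_trans M N (f g h : Dhom M N) : Deq f g -> Deq g h -> Deq f h
| Deq_congr L M N (g g' : Dhom M N) (f f' : Dhom L M) :
    Deq g g' -> Deq f f' -> Deq (Dcomp g f) (Dcomp g' f')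
| Deq_assoc K L M N (h : Dhom M N) (g : Dhom L M) (f : Dhom K L) :
    Deq (Dcomp h (Dcomp g f)) (Dcomp (Dcomp h g) f)
| Deq_1l M N (f : Dhom M N) : Deq (Dcomp (Did N) f) f
| Deq_1r M N (f : Dhom M N) : Deq (Dcomp f (Did M)) f
| Deq_htpy M N (f g : bmap M N) : homotopic f g -> Deq (Dof f) (Dof g)
| Deq_comp L M N (g : bmap M N) (f : bmap L M) :
    Deq (Dcomp (Dof g) (Dof f)) (Dof (bcomp g f))
| Deq_invr M N (w : bmap M N) (Hw : quasi_iso w) :
    Deq (Dcomp (Dof w) (Dinv Hw)) (Did N)
| Deq_invl M N (w : bmap M N) (Hw : quasi_iso w) :
    Deq (Dcomp (Dinv Hw) (Dof w)) (Did M).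

Definition Dinverse M N (f : Dhom M N) (g : Dhom N M) : Prop :=
  Deq (Dcomp g f) (Did M) /\ Deq (Dcomp f g) (Did N).

Definition Diso M N : Prop := exists f : Dhom M N, exists g, Dinverse f g.

Definition Dzero M : Prop :=
  (forall N (f g : Dhom M N), Deq f g) /\ (forall N (f g : Dhom N M), Deq f g).

(** [(M[s])^i = M^(i+s)], with differential [(-1)^s d] and left action twisted
    by [(-1)^(s|g|)]. *)
Definition shift_cx (s : int) (C : complex k) : complex k.
Proof.
refine (@Complex k (fun i => C (i + s))
  (fun i j e x => ksgn k s *: cd C (etrans (addrAC i s 1) (congr1 (+%R^~ s) e)) x)
  _ _).
- by move=> i j e; apply: lin_scale; exact: cd_lin.
- by move=> i j l e e' x; rewrite (linZ (cd_lin _)) cdd !scaler0.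
Defined.

Lemma shift_idx (i j n s : int) : i + j = n -> i + s + j = n + s.
Proof. by move=> <-; rewrite addrAC. Qed.
Lemma shift_idx' (i j n s : int) : i + j = n -> i + (j + s) = n + s.
Proof. by move=> <-; rewrite addrA. Qed.

Definition shift (s : int) (M : bimod A B) : bimod A B.
Proof.
refine (@Bimod k A B (fun b a => shift_cx s (bc M b a))
  (fun b b' a i j n e m f => ract M (shift_idx s e) m f)
  (fun b a a' i j n e g m => ksgn k (s * i) *: lact M (shift_idx' s e) g m)
  _ _ _ _ _ _ _ _ _ _ _) => /=.
- by intros; exact: ract_linl.
- by intros; exact: ract_linr.
- by intros; apply: lin_scale; exact: lact_linl.
- by intros; apply: lin_scale; exact: lact_linr.
- by intros; exact: ract1.
- by intros; rewrite mulr0 ksgn0 scale1r; exact: lact1.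
- by intros; exact: ractA.
- move=> b a a' a'' i j l ij jl n e1 e2 e3 e4 g f m.
  rewrite (linZ (lact_linr _ _)) scalerA -ksgnD -mulrDr e3.
  by congr (_ *: _); exact: lactA.
- intros; rewrite (linZ (ract_linl _ _)); congr (_ *: _); exact: lractA.
- move=> b b' a i j n i' j' n' e en ei ej e1 e2 m f.
  rewrite (ract_d _ _ (etrans (addrAC i s 1) (congr1 (+%R^~ s) ei)) ej
            (shift_idx s e1) (shift_idx s e2)).
  rewrite (linZ (ract_linl _ _)) scalerDr scalerA ksgnD; congr (_ + _ *: _).
  by rewrite mulrC -mulrA ksgn_sqr mulr1.
- move=> b a a' i j n i' j' n' e en ei ej e1 e2 g m.
  rewrite (linZ (cd_lin _)) (lact_d _ _ ei
    (etrans (addrAC j s 1) (congr1 (+%R^~ s) ej))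
    (shift_idx' s e1) (shift_idx' s e2)).
  have -> : ksgn k (s * i') = ksgn k (s * i) * ksgn k s.
    by rewrite -ksgnD -ei mulrDr mulr1.
  rewrite (linZ (lact_linr _ _)) !scalerDr !scalerA.
  congr (_ + _); first by congr (_ *: _); rewrite mulrC.
  by congr (_ *: _); rewrite mulrC -!mulrA; congr (_ * _); rewrite mulrC.
Defined.

Section Pairs.
Variables (U V U' V' : lmodType k).
Lemma lin_pair (f : U -> U') (g : V -> V') :
  linear f -> linear g -> linear (fun x : (U * V)%type => (f x.1, g x.2)).
Proof. by move=> lf lg c x y; rewrite /= lf lg. Qed.
End Pairs.

Lemma pairE (U V : lmodType k) (x x' : U) (y y' : V) :
  ((x, y) : U * V) + (x', y') = (x + x', y + y').
Proof. by []. Qed.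
Lemma pairZ (U V : lmodType k) c (x : U) (y : V) :
  c *: ((x, y) : U * V)  = (c *: x, c *: y).
Proof. by []. Qed.

Lemma cd_irr (C : complex k) i j (e e' : i + 1 = j) (x : C i) :
  cd C e x = cd C e' x.
Proof. by rewrite (eq_irrelevance e e'). Qed.

Definition dsum_cx (C D : complex k) : complex k.
Proof.
refine (@Complex k (fun i => (C i * D i)%type)
  (fun i j e x => (cd C e x.1, cd D e x.2)) _ _).
- by move=> i j e; apply: lin_pair; exact: cd_lin.
- by move=> i j l e e' x /=; rewrite !cdd.
Defined.

Definition cxcast (C : complex k) i j (e : i = j) (x : C i) : C j :=
  ecast i (C i) e x.

Lemma cxcast_lin (C : complex k) i j (e : i = j) :
  linear (cxcast e : C i -> C j).
Proof. by case: j / e. Qed.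

Lemma cxcast_r M b b' a i i' j n n' (e : i + j = n) (e' : i' + j = n')
    (ei : i = i') (en : n = n') (x : bc M b a i) (f : hom b' b j) :
  cxcast en (ract M e x f) = ract M e' (cxcast ei x) f.
Proof.
case: n' / en e'; case: i' / ei => e'.
by rewrite /cxcast /= (eq_irrelevance e' e).
Qed.

Lemma cxcast_l M b a a' i j j' n n' (e : i + j = n) (e' : i + j' = n')
    (ej : j = j') (en : n = n') (g : hom a a' i) (x : bc M b a j) :
  cxcast en (lact M e g x) = lact M e' g (cxcast ej x).
Proof.
case: n' / en e'; case: j' / ej => e'.
by rewrite /cxcast /= (eq_irrelevance e' e).
Qed.

Definition dsum M N : bimod A B.
Proof.
refine (@Bimod k A B (fun b a => dsum_cx (bc M b a) (bc N b a))
  (fun b b' a i j n e m f => (ract M e m.1 f, ract N e m.2 f))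
  (fun b a a' i j n e g m => (lact M e g m.1, lact N e g m.2))
  _ _ _ _ _ _ _ _ _ _ _).
- by intros; move=> c x y; congr pair; exact: ract_linl.
- by intros; move=> c x y; congr pair; exact: ract_linr.
- by intros; move=> c x y; congr pair; exact: lact_linl.
- by intros; move=> c x y; congr pair; exact: lact_linr.
- by move=> b a i e [x y]; rewrite /= !ract1.
- by move=> b a i e [x y]; rewrite /= !lact1.
- by intros; rewrite /=; congr pair; exact: ractA.
- by intros; rewrite /=; congr pair; exact: lactA.
- by intros; rewrite /=; congr pair; exact: lractA.
- by intros; rewrite /= pairZ pairE; congr pair; exact: ract_d.
- by intros; rewrite /= pairZ pairE; congr pair; exact: lact_d.
Defined.

(** [cone(f)^i = M^(i+1) + N^i], [d (m, n) = (- d m, f m + d n)]. *)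
Definition cone_cx M N (f : bmap M N) (b : ob B) (a : ob A) : complex k.
Proof.
refine (@Complex k (fun i => (shift_cx 1 (bc M b a) i * bc N b a i)%type)
  (fun i j e x => (cd (shift_cx 1 (bc M b a)) e x.1,
                   cxcast e (f b a _ x.1) + cd (bc N b a) e x.2)) _ _).
- move=> i j e.
  have l1 : linear (fun x : bc M b a (i + 1) => cxcast e (f b a _ x)).
    exact: lin_comp (@cxcast_lin _ _ _ _) (@bm_lin _ _ _ _ _ _ _ _ _).
  move=> c [x1 x2] [y1 y2] /=.
  rewrite l1 (cd_lin e c x2) [X in (X, _)](cd_lin (c := shift_cx 1 _) e c x1 y1).
  by rewrite pairZ pairE scalerDr addrACA.
- move=> i j l e e' [x y] /=; subst j l; rewrite /cxcast /=.
  congr pair; first by rewrite (linZ (cd_lin _)) cdd !scaler0.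
  rewrite ksgn1 scaleN1r (linN (@bm_lin _ _ _ _ _ f _ _ _)).
  rewrite (linD (cd_lin _)) cdd addr0 bm_d.
  by rewrite [X in - X](cd_irr _ erefl) addNr.
Defined.

Definition cone M N (f : bmap M N) : bimod A B.
Proof.
pose D := dsum (shift 1 M) N.
refine (@Bimod k A B (cone_cx f)
  (fun b b' a i j n e m g => ract D e m g)
  (fun b a a' i j n e g m => lact D e g m)
  _ _ _ _ _ _ _ _ _ _ _).
- exact: (@ract_linl _ _ _ D).
- exact: (@ract_linr _ _ _ D).
- exact: (@lact_linl _ _ _ D).
- exact: (@lact_linr _ _ _ D).
- exact: (@ract1 _ _ _ D).
- exact: (@lact1 _ _ _ D).
- exact: (@ractA _ _ _ D).
- exact: (@lactA _ _ _ D).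
- exact: (@lractA _ _ _ D).
- move=> b b' a i j n i' j' n' e en ei ej e1 e2 [x y] g.
  have := @ract_d _ _ _ D _ _ _ _ _ _ _ _ _ e en ei ej e1 e2 (x, y) g.
  rewrite /= !pairZ !pairE => -[h1 h2]; congr pair; first exact: h1.
  rewrite h2 bm_r (cxcast_r _ e1 ei) addrA (linD (ract_linl _ _)).
  by rewrite -!addrA.
- move=> b a a' i j n i' j' n' e en ei ej e1 e2 g [x y].
  have := @lact_d _ _ _ D _ _ _ _ _ _ _ _ _ e en ei ej e1 e2 g (x, y).
  rewrite /= !pairZ !pairE => -[h1 h2]; congr pair; first exact: h1.
  rewrite h2 (linZ (@bm_lin _ _ _ _ _ f _ _ _)) bm_l.
  rewrite (linZ (@cxcast_lin _ _ _ _)) (cxcast_l _ e2 ej) mul1r.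
  by rewrite (linD (lact_linr _ _)) scalerDr addrCA.
Defined.

(** The smallest strictly full thick triangulated subcategory containing [gen].
    Every distinguished triangle is isomorphic in the derived category to one
    of the form [M -> N -> cone f -> M[1]] with [f] a closed morphism, so
    closure under isomorphisms and cones is closure under triangles. *)
Inductive thick (gen : bimod A B -> Prop) : bimod A B -> Prop :=
| thick_gen M : gen M -> thick gen M
| thick_iso M N : Diso M N -> thick gen M -> thick gen N
| thick_zero M : Dzero M -> thick gen M
| thick_shift s M : thick gen M -> thick gen (shift s M)
| thick_cone M N (f : bmap M N) :
    thick gen M -> thick gen N -> thick gen (cone f)
| thick_summand M N : thick gen (dsum M N) -> thick gen M.

End Derived.

Section Tensor.
Variables (k : comPzRingType) (A B C : dgcat k).
Variables (F : bimod A B) (G : bimod B C).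

Section Degree.
Variables (c : ob C) (a : ob A) (n : int).

Record tgen := TGen {
  tg_b : ob B; tg_i : int; tg_j : int;
  tg_e : tg_i + tg_j = n;
  tg_x : bc F tg_b a tg_i;
  tg_y : bc G c tg_b tg_j }.

Inductive tens_rel : mterm k tgen -> mterm k tgen -> Prop :=
| tr_linl b i j (e : i + j = n) s (x x' : bc F b a i) (y : bc G c b j) :
    tens_rel (MGen k (TGen e (s *: x + x') y))
      (MAdd (MScale s (MGen k (TGen e x y))) (MGen k (TGen e x' y)))
| tr_linr b i j (e : i + j = n) s (x : bc F b a i) (y y' : bc G c b j) :
    tens_rel (MGen k (TGen e x (s *: y + y')))
      (MAdd (MScale s (MGen k (TGen e x y))) (MGen k (TGen e x y')))
| tr_bal b1 b2 i p j i' j' (ei : i + p = i') (ej : p + j = j')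
    (e : i' + j = n) (e' : i + j' = n)
    (x : bc F b2 a i) (f : hom b1 b2 p) (y : bc G c b1 j) :
    tens_rel (MGen k (TGen e (ract F ei x f) y))
      (MGen k (TGen e' x (lact G ej f y))).

Definition tens_mod : lmodType k := mpres tens_rel.

Definition tpure b i j (e : i + j = n) (x : bc F b a i) (y : bc G c b j)
  : tens_mod := mcls tens_rel (MGen k (TGen e x y)).

Lemma tpure_linl b i j (e : i + j = n) (y : bc G c b j) :
  linear (fun x : bc F b a i => tpure e x y).
Proof.
move=> s x x'; rewrite /tpure.
have /mclsE -> := mc_rel (tr_linl e s x x' y).
by rewrite mcls_lin.
Qed.

Lemma tpure_linr b i j (e : i + j = n) (x : bc F b a i) :
  linear (fun y : bc G c b j => tpure e x y).
Proof.
move=> s y y'; rewrite /tpure.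
have /mclsE -> := mc_rel (tr_linr e s x y y').
by rewrite mcls_lin.
Qed.

Lemma tpure_bal b1 b2 i p j i' j' (ei : i + p = i') (ej : p + j = j')
    (e : i' + j = n) (e' : i + j' = n)
    (x : bc F b2 a i) (f : hom b1 b2 p) (y : bc G c b1 j) :
  tpure e (ract F ei x f) y = tpure e' x (lact G ej f y).
Proof. by apply/mclsE; apply: mc_rel; exact: tr_bal. Qed.

Section Lift.
Variables (V : lmodType k)
  (phi : forall b i j, i + j = n -> bc F b a i -> bc G c b j -> V).

Definition tlift : tens_mod -> V :=
  @mlift k tgen tens_rel V (fun g => phi (tg_e g) (tg_x g) (tg_y g)).

Hypotheses
  (phi_l : forall b i j (e : i + j = n) y,
     linear (fun x : bc F b a i => phi e x y))
  (phi_r : forall b i j (e : i + j = n) x,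
     linear (fun y : bc G c b j => phi e x y))
  (phi_b : forall b1 b2 i p j i' j' (ei : i + p = i') (ej : p + j = j')
     (e : i' + j = n) (e' : i + j' = n)
     (x : bc F b2 a i) (f : hom b1 b2 p) (y : bc G c b1 j),
     phi e (ract F ei x f) y = phi e' x (lact G ej f y)).

Lemma tlift_rel s t : tens_rel s t ->
  meval (fun g => phi (tg_e g) (tg_x g) (tg_y g)) s
  = meval (fun g => phi (tg_e g) (tg_x g) (tg_y g)) t.
Proof.
by case=> *; rewrite /= ?phi_l ?phi_r //; exact: phi_b.
Qed.

Lemma tlift_lin : linear tlift.
Proof. exact: mlift_lin tlift_rel. Qed.

Lemma tlift_pure b i j (e : i + j = n) (x : bc F b a i) (y : bc G c b j) :
  tlift (tpure e x y) = phi e x y.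
Proof. exact: (mlift_gen tlift_rel). Qed.

End Lift.

Lemma tens_ext (V : lmodType k) (f g : tens_mod -> V) :
  linear f -> linear g ->
  (forall b i j (e : i + j = n) (x : bc F b a i) (y : bc G c b j),
     f (tpure e x y) = g (tpure e x y)) -> f =1 g.
Proof.
by move=> lf lg fg; apply: mpres_ext => // -[b i j e x y]; exact: fg.
Qed.

Lemma tpure_irr b i j (e e' : i + j = n) (x : bc F b a i) (y : bc G c b j) :
  tpure e x y = tpure e' x y.
Proof. by rewrite (eq_irrelevance e e'). Qed.

End Degree.

Lemma td_idxl (n n' i j : int) : n + 1 = n' -> i + j = n -> i + 1 + j = n'.
Proof. by move=> <- <-; rewrite addrAC. Qed.
Lemma td_idxr (n n' i j : int) : n + 1 = n' -> i + j = n -> i + (j + 1) = n'.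
Proof. by move=> <- <-; rewrite addrA. Qed.
Lemma tl_idx (p m n i j : int) : p + m = n -> i + j = m -> p + i + j = n.
Proof. by move=> <- <-; rewrite addrA. Qed.
Lemma tr_idx (m p n i j : int) : m + p = n -> i + j = m -> i + (j + p) = n.
Proof. by move=> <- <-; rewrite addrA. Qed.

(** [d (x (x) y) = d x (x) y + (-1)^|x| x (x) d y]. *)
Definition td c a n n' (en : n + 1 = n') : tens_mod c a n -> tens_mod c a n' :=
  tlift (fun b i j e x y =>
    tpure (td_idxl en e) (cd _ erefl x) y
    + ksgn k i *: tpure (td_idxr en e) x (cd _ erefl y)).

Definition tlact c a a' p m n (e0 : p + m = n) (g : hom a a' p)
  : tens_mod c a m -> tens_mod c a' n :=
  tlift (fun b i j e x y => tpure (tl_idx e0 e) (lact F erefl g x) y).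

Definition tract c c' a m p n (e0 : m + p = n) (z : tens_mod c a m)
    (h : hom c' c p) : tens_mod c' a n :=
  tlift (fun b i j e x y => tpure (tr_idx e0 e) x (ract G erefl y h)) z.

Section TD.
Variables (c : ob C) (a : ob A) (n n' : int) (en : n + 1 = n').
Let phi b i j (e : i + j = n) (x : bc F b a i) (y : bc G c b j) :=
  tpure (td_idxl en e) (cd _ erefl x) y
  + ksgn k i *: tpure (td_idxr en e) x (cd _ erefl y).

Lemma td_phi_l b i j (e : i + j = n) y :
  linear (fun x : bc F b a i => phi e x y).
Proof.
apply: lin_add; first by move=> s x x'; rewrite (cd_lin _) tpure_linl.
by apply: lin_scale; exact: tpure_linl.
Qed.
Lemma td_phi_r b i j (e : i + j = n) x :
  linear (fun y : bc G c b j => phi e x y).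
Proof.
apply: lin_add; first exact: tpure_linr.
by apply: lin_scale => s y y'; rewrite (cd_lin _) tpure_linr.
Qed.
Lemma td_phi_b b1 b2 i p j i' j' (ei : i + p = i') (ej : p + j = j')
     (e : i' + j = n) (e' : i + j' = n)
     (x : bc F b2 a i) (f : hom b1 b2 p) (y : bc G c b1 j) :
  phi e (ract F ei x f) y = phi e' x (lact G ej f y).
Proof.
subst i' j'; rewrite /phi.
have e1 : i + 1 + p = i + p + 1 by rewrite addrAC.
have e2 : i + (p + 1) = i + p + 1 by rewrite addrA.
have e3 : p + 1 + j = p + j + 1 by rewrite addrAC.
have e4 : p + (j + 1) = p + j + 1 by rewrite addrA.
rewrite (ract_d erefl erefl erefl erefl e1 e2).
rewrite (lact_d erefl erefl erefl erefl e3 e4).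
rewrite (linD (tpure_linl _ _)) (linZ (tpure_linl _ _)).
rewrite (linD (tpure_linr _ _)) (linZ (tpure_linr _ _)).
have E1 : i + 1 + (p + j) = n' by rewrite -en -e' addrAC.
rewrite (tpure_bal e1 erefl _ E1) (tpure_bal e2 e3 _ (td_idxr en e')).
rewrite (tpure_bal (i:=i) (p:=p) (j:=j+1) erefl e4 _ (td_idxr en e')).
rewrite scalerDr scalerA -ksgnD -addrA.
by rewrite (tpure_irr E1 (td_idxl en e')).
Qed.

Lemma td_lin : linear (@td c a n n' en).
Proof. exact: (tlift_lin td_phi_l td_phi_r td_phi_b). Qed.

Lemma td_pure b i j i' j' (e : i + j = n) (ei : i + 1 = i') (ej : j + 1 = j')
    (e1 : i' + j = n') (e2 : i + j' = n') (x : bc F b a i) (y : bc G c b j) :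
  td en (tpure e x y)
    = tpure e1 (cd _ ei x) y + ksgn k i *: tpure e2 x (cd _ ej y).
Proof.
rewrite /td (tlift_pure td_phi_l td_phi_r td_phi_b) /phi; subst i' j'.
by rewrite (tpure_irr e1 (td_idxl en e)) (tpure_irr e2 (td_idxr en e)).
Qed.
End TD.

Section TL.
Variables (c : ob C) (a a' : ob A) (p m n : int) (e0 : p + m = n).
Variable g : hom a a' p.
Let phi b i j (e : i + j = m) (x : bc F b a i) (y : bc G c b j) :=
  tpure (tl_idx e0 e) (lact F erefl g x) y.

Lemma tl_phi_l b i j (e : i + j = m) y :
  linear (fun x : bc F b a i => phi e x y).
Proof. by move=> s x x'; rewrite /phi lact_linr tpure_linl. Qed.
Lemma tl_phi_r b i j (e : i + j = m) x :
  linear (fun y : bc G c b j => phi e x y).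
Proof. exact: tpure_linr. Qed.
Lemma tl_phi_b b1 b2 i q j i' j' (ei : i + q = i') (ej : q + j = j')
     (e : i' + j = m) (e' : i + j' = m)
     (x : bc F b2 a i) (f : hom b1 b2 q) (y : bc G c b1 j) :
  phi e (ract F ei x f) y = phi e' x (lact G ej f y).
Proof.
have e1 : p + i + q = p + i' by rewrite -ei addrA.
by rewrite /phi -(lractA erefl e1) (tpure_bal e1 ej _ (tl_idx e0 e')).
Qed.

Lemma tlact_lin : linear (fun z : tens_mod c a m => tlact e0 g z).
Proof. exact: (tlift_lin tl_phi_l tl_phi_r tl_phi_b). Qed.

Lemma tlact_pure b i j i' (e : i + j = m) (ei : p + i = i') (e1 : i' + j = n)
    (x : bc F b a i) (y : bc G c b j) :
  tlact e0 g (tpure e x y) = tpure e1 (lact F ei g x) y.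
Proof.
rewrite /tlact (tlift_pure tl_phi_l tl_phi_r tl_phi_b) /phi; subst i'.
exact: tpure_irr.
Qed.
End TL.

Section TR.
Variables (c c' : ob C) (a : ob A) (m p n : int) (e0 : m + p = n).
Variable h : hom c' c p.
Let phi b i j (e : i + j = m) (x : bc F b a i) (y : bc G c b j) :=
  tpure (tr_idx e0 e) x (ract G erefl y h).

Lemma tr_phi_l b i j (e : i + j = m) y :
  linear (fun x : bc F b a i => phi e x y).
Proof. exact: tpure_linl. Qed.
Lemma tr_phi_r b i j (e : i + j = m) x :
  linear (fun y : bc G c b j => phi e x y).
Proof. by move=> s y y'; rewrite /phi ract_linl tpure_linr. Qed.
Lemma tr_phi_b b1 b2 i q j i' j' (ei : i + q = i') (ej : q + j = j')
     (e : i' + j = m) (e' : i + j' = m)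
     (x : bc F b2 a i) (f : hom b1 b2 q) (y : bc G c b1 j) :
  phi e (ract F ei x f) y = phi e' x (lact G ej f y).
Proof.
have e1 : q + (j + p) = j' + p by rewrite -ej addrA.
rewrite /phi (lractA ej erefl erefl e1).
exact: tpure_bal.
Qed.

Lemma tract_lin : linear (fun z : tens_mod c a m => tract e0 z h).
Proof. exact: (tlift_lin tr_phi_l tr_phi_r tr_phi_b). Qed.

Lemma tract_pure b i j j' (e : i + j = m) (ej : j + p = j') (e1 : i + j' = n)
    (x : bc F b a i) (y : bc G c b j) :
  tract e0 (tpure e x y) h = tpure e1 x (ract G ej y h).
Proof.
rewrite /tract (tlift_pure tr_phi_l tr_phi_r tr_phi_b) /phi; subst j'.
exact: tpure_irr.
Qed.
End TR.

Definition tens_cx (c : ob C) (a : ob A) : complex k.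
Proof.
refine (@Complex k (tens_mod c a) (fun n n' en => td en) _ _).
- by move=> *; exact: td_lin.
- move=> n n' n'' e e'.
  apply: tens_ext; [exact: lin_comp (td_lin _) (td_lin _)|exact: lin_zero|].
  move=> b i j en x y.
  have e1 : i + 1 + j = n' by exact: td_idxl e en.
  have e2 : i + (j + 1) = n' by exact: td_idxr e en.
  have e3 : i + 1 + 1 + j = n'' by exact: td_idxl e' e1.
  have e4 : i + 1 + (j + 1) = n'' by exact: td_idxr e' e1.
  have e5 : i + (j + 1 + 1) = n'' by exact: td_idxr e' e2.
  rewrite (td_pure _ _ erefl erefl e1 e2) (linD (td_lin _)) (linZ (td_lin _)).
  rewrite (td_pure _ _ erefl erefl e3 e4) (td_pure _ _ erefl erefl e4 e5).
  rewrite !cdd (lin0 (tpure_linl _ _)) (lin0 (tpure_linr _ _)) scaler0 addr0 add0r.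
  by rewrite ksgnS scaleNr addNr.
Defined.

(** [F (x)_B G], that is [G <> F] in the notation of composition. *)
Definition tens : bimod A C.
Proof.
refine (@Bimod k A C tens_cx
  (fun c c' a m p n e z h => tract e z h)
  (fun c a a' p m n e g z => tlact e g z) _ _ _ _ _ _ _ _ _ _ _).
- by move=> *; exact: tract_lin.
- move=> c c' a m p n e z s h h'; move: z.
  apply: tens_ext; [exact: tract_lin| |].
    by apply: lin_add; first apply: lin_scale; exact: tract_lin.
  move=> b i j e0 x y.
  by rewrite !(tract_pure e _ _ erefl (tr_idx e e0)) ract_linr tpure_linr.
- move=> c a a' p m n e z s g g'; move: z.
  apply: tens_ext; [exact: tlact_lin| |].
    by apply: lin_add; first apply: lin_scale; exact: tlact_lin.
  move=> b i j e0 x y.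
  by rewrite !(tlact_pure e _ _ erefl (tl_idx e e0)) lact_linl tpure_linl.
- by move=> *; exact: tlact_lin.
- move=> c a m e; apply: tens_ext; [exact: tract_lin|exact: lin_id|].
  move=> b i j e0 x y.
  by rewrite (tract_pure _ _ _ (addr0 j) e0) ract1.
- move=> c a m e; apply: tens_ext; [exact: tlact_lin|exact: lin_id|].
  move=> b i j e0 x y.
  by rewrite (tlact_pure _ _ _ (add0r i) e0) lact1.
- move=> c c' c'' a m p q mp pq n e1 e2 e3 e4 z h h'; move: z.
  apply: tens_ext; [exact: lin_comp (tract_lin _ _) (tract_lin _ _)
                   |exact: tract_lin|].
  move=> b i j e x y; subst mp pq.
  have E : j + p + q = j + (p + q) by rewrite addrA.
  rewrite (tract_pure _ _ _ erefl (tr_idx erefl e)).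
  rewrite (tract_pure _ _ _ E (tr_idx e4 e)).
  by rewrite (tract_pure _ _ _ erefl (tr_idx e4 e)) (ractA _ _ erefl erefl).
- move=> c a a' a'' p q m pq qm n e1 e2 e3 e4 g g' z; move: z.
  apply: tens_ext; [exact: lin_comp (tlact_lin _ _) (tlact_lin _ _)
                   |exact: tlact_lin|].
  move=> b i j e x y.
  have E : p + (q + i) = pq + i by rewrite -e3 addrA.
  rewrite (tlact_pure _ _ _ erefl (tl_idx e1 e)).
  rewrite (tlact_pure _ _ _ E (tl_idx e4 e)).
  by rewrite (tlact_pure _ _ _ erefl (tl_idx e4 e)) (lactA _ _ e3 erefl).
- move=> c c' a a' p m q pm mq n e1 e2 e3 e4 g z h; move: z.
  apply: tens_ext; [exact: lin_comp (tract_lin _ _) (tlact_lin _ _)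
                   |exact: lin_comp (tlact_lin _ _) (tract_lin _ _)|].
  move=> b i j e x y.
  have E : p + i + (j + q) = n by rewrite -e2 -e1 -e -!addrA.
  rewrite (tlact_pure _ _ _ erefl (tl_idx e1 e)) (tract_pure _ _ _ erefl E).
  by rewrite (tract_pure _ _ _ erefl (tr_idx e3 e)) (tlact_pure _ _ _ erefl E).
- move=> c c' a m p n m' p' n' e en em ep e1 e2 z h; move: z.
  apply: tens_ext.
  + exact: lin_comp (td_lin _) (tract_lin _ _).
  + apply: lin_add; first exact: lin_comp (tract_lin _ _) (td_lin _).
    by apply: lin_scale; exact: tract_lin.
  move=> b i j e0 x y; subst p' n n' m'.
  rewrite /=.
  have E1 : j + 1 + p = j + p + 1 by rewrite addrAC.
  have E2 : j + (p + 1) = j + p + 1 by rewrite addrA.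
  rewrite (tract_pure erefl _ _ erefl (tr_idx erefl e0)).
  rewrite (td_pure _ _ erefl erefl
    (td_idxl erefl (tr_idx erefl e0)) (td_idxr erefl (tr_idx erefl e0))).
  rewrite (td_pure _ _ erefl erefl (td_idxl erefl e0) (td_idxr erefl e0)).
  rewrite (linD (tract_lin _ _)) (linZ (tract_lin _ _)).
  rewrite (tract_pure _ _ _ erefl (td_idxl erefl (tr_idx erefl e0))).
  rewrite (tract_pure _ _ _ E1 (td_idxr erefl (tr_idx erefl e0))).
  rewrite (tract_pure _ _ _ E2 (td_idxr erefl (tr_idx erefl e0))).
  rewrite (ract_d erefl erefl erefl erefl E1 E2).
  rewrite (linD (tpure_linr _ _)) (linZ (tpure_linr _ _)) scalerDr scalerA.
  by rewrite -ksgnD e0 addrA.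
- move=> c a a' p m n p' m' n' e en ep em e1 e2 g z; move: z.
  apply: tens_ext.
  + exact: lin_comp (td_lin _) (tlact_lin _ _).
  + apply: lin_add; first exact: tlact_lin.
    by apply: lin_scale; exact: lin_comp (tlact_lin _ _) (td_lin _).
  move=> b i j e0 x y; subst p' n n' m'.
  rewrite /=.
  have E1 : p + 1 + i = p + i + 1 by rewrite addrAC.
  have E2 : p + (i + 1) = p + i + 1 by rewrite addrA.
  rewrite (tlact_pure erefl _ _ erefl (tl_idx erefl e0)).
  rewrite (td_pure _ _ erefl erefl
    (td_idxl erefl (tl_idx erefl e0)) (td_idxr erefl (tl_idx erefl e0))).
  rewrite (td_pure _ _ erefl erefl (td_idxl erefl e0) (td_idxr erefl e0)).
  rewrite (linD (tlact_lin _ _)) (linZ (tlact_lin _ _)).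
  rewrite (tlact_pure _ _ _ E1 (td_idxl erefl (tl_idx erefl e0))).
  rewrite (tlact_pure _ _ _ E2 (td_idxl erefl (tl_idx erefl e0))).
  rewrite (tlact_pure _ _ _ erefl (td_idxr erefl (tl_idx erefl e0))).
  rewrite (lact_d erefl erefl erefl erefl E1 E2).
  rewrite (linD (tpure_linl _ _)) (linZ (tpure_linl _ _)) scalerDr scalerA.
  by rewrite -ksgnD addrA.
Defined.

End Tensor.
(** Morphisms out of a tensor product, from balanced bilinear families. *)
Record tbil (k : comPzRingType) (A B C : dgcat k) (F : bimod A B)
    (G : bimod B C) (N : bimod A C) := TBil {
  tb :> forall c a b i j n, i + j = n -> bc F b a i -> bc G c b j -> bc N c a n;
  tb_l : forall c a b i j n (e : i + j = n) (y : bc G c b j),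
    linear (fun x : bc F b a i => @tb c a b i j n e x y);
  tb_r : forall c a b i j n (e : i + j = n) (x : bc F b a i),
    linear (fun y : bc G c b j => @tb c a b i j n e x y);
  tb_b : forall c a n b1 b2 i p j i' j' (ei : i + p = i') (ej : p + j = j')
    (e : i' + j = n) (e' : i + j' = n)
    (x : bc F b2 a i) (f : hom b1 b2 p) (y : bc G c b1 j),
    tb e (ract F ei x f) y = tb e' x (lact G ej f y);
  tb_d : forall c a b i j n i' j' n' (e : i + j = n) (en : n + 1 = n')
    (ei : i + 1 = i') (ej : j + 1 = j') (e1 : i' + j = n') (e2 : i + j' = n')
    (x : bc F b a i) (y : bc G c b j),
    cd _ en (tb e x y) = tb e1 (cd _ ei x) y + ksgn k i *: tb e2 x (cd _ ej y);
  tb_ract : forall c c' a b i j p n j' m (e : i + j = m) (e0 : m + p = n)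
    (ej : j + p = j') (e1 : i + j' = n)
    (x : bc F b a i) (y : bc G c b j) (h : hom c' c p),
    ract N e0 (tb e x y) h = tb e1 x (ract G ej y h);
  tb_lact : forall c a a' b p i j n i' m (e : i + j = m) (e0 : p + m = n)
    (ei : p + i = i') (e1 : i' + j = n)
    (g : hom a a' p) (x : bc F b a i) (y : bc G c b j),
    lact N e0 g (tb e x y) = tb e1 (lact F ei g x) y }.

Section TensorMaps.
Variables (k : comPzRingType).

Section Tmor.
Variables (A B C : dgcat k) (F : bimod A B) (G : bimod B C) (N : bimod A C).
Variable phi : tbil F G N.

Definition tmor_fun c a n : bc (tens F G) c a n -> bc N c a n :=
  @tlift k A B C F G c a n (bc N c a n) (fun b i j e x y => phi c a b i j n e x y).

Lemma tmor_lin c a n : linear (@tmor_fun c a n).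
Proof.
apply: tlift_lin => *; [exact: tb_l|exact: tb_r|exact: tb_b].
Qed.

Lemma tmor_pure c a n b i j (e : i + j = n) (x : bc F b a i) (y : bc G c b j) :
  tmor_fun (tpure e x y) = phi _ _ _ _ _ _ e x y.
Proof.
rewrite /tmor_fun tlift_pure //; move=> *; [exact: tb_l|exact: tb_r|exact: tb_b].
Qed.

Definition tmor : bmap (tens F G) N.
Proof.
refine (@BMap k A C (tens F G) N tmor_fun _ _ _ _).
- exact: tmor_lin.
- move=> c a n n' en; apply: tens_ext.
  + exact: lin_comp (@tmor_lin _ _ _) (td_lin _).
  + exact: lin_comp (cd_lin _) (@tmor_lin _ _ _).
  move=> b i j e x y.
  rewrite /= (td_pure en e erefl erefl (td_idxl en e) (td_idxr en e)).
  rewrite (linD (@tmor_lin _ _ _)) (linZ (@tmor_lin _ _ _)) !tmor_pure.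
  by rewrite (tb_d _ e en erefl erefl (td_idxl en e) (td_idxr en e)).
- move=> c c' a m p n e0 z h; move: z; apply: tens_ext.
  + exact: lin_comp (@tmor_lin _ _ _) (tract_lin _ _).
  + exact: lin_comp (ract_linl _ _) (@tmor_lin _ _ _).
  move=> b i j e x y.
  rewrite /= (tract_pure e0 _ e erefl (tr_idx e0 e)) !tmor_pure.
  by rewrite (tb_ract _ e e0 erefl (tr_idx e0 e)).
- move=> c a a' p m n e0 g; apply: tens_ext.
  + exact: lin_comp (@tmor_lin _ _ _) (tlact_lin _ _).
  + exact: lin_comp (lact_linr _ _) (@tmor_lin _ _ _).
  move=> b i j e x y.
  rewrite /= (tlact_pure e0 _ e erefl (tl_idx e0 e)) !tmor_pure.
  by rewrite (tb_lact _ e e0 erefl (tl_idx e0 e)).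
Defined.
End Tmor.

(** [f (x) g]. *)
Definition tmap (A B C : dgcat k) (F F' : bimod A B) (G G' : bimod B C)
  (f : bmap F F') (g : bmap G G') : bmap (tens F G) (tens F' G').
Proof.
apply: tmor.
refine (@TBil k A B C F G (tens F' G')
  (fun c a b i j n e x y => tpure e (f b a i x) (g c b j y)) _ _ _ _ _ _).
- by move=> * s x x'; rewrite bm_lin tpure_linl.
- by move=> * s x x'; rewrite bm_lin tpure_linr.
- by intros; rewrite bm_r bm_l; exact: tpure_bal.
- by intros; rewrite !bm_d; exact: td_pure.
- by intros; rewrite bm_r; exact: tract_pure.
- by intros; rewrite bm_l; exact: tlact_pure.
Defined.

(** [x (x) f |-> x f] and [f (x) x |-> f x]. *)
Definition tunitr (A B : dgcat k) (F : bimod A B) : bmap (tens F (diag B)) F.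
Proof.
apply: tmor.
refine (@TBil k A B B F (diag B) F
  (fun c a b i j n e x y => ract F e x y) _ _ _ _ _ _).
- by intros; exact: ract_linl.
- by intros; exact: ract_linr.
- by intros; exact: ractA.
- by intros; exact: ract_d.
- by intros; exact: ractA.
- by intros; symmetry; exact: lractA.
Defined.

Definition tunitl (A B : dgcat k) (F : bimod A B) : bmap (tens (diag A) F) F.
Proof.
apply: tmor.
refine (@TBil k A A B (diag A) F F
  (fun c a b i j n e x y => lact F e x y) _ _ _ _ _ _).
- by intros; exact: lact_linl.
- by intros; exact: lact_linr.
- by intros; symmetry; exact: lactA.
- by intros; exact: lact_d.
- by intros; exact: lractA.
- by intros; exact: lactA.
Defined.

(** [(x (x) y) (x) z |-> x (x) (y (x) z)]. *)
Section Assoc.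
Variables (A B C D : dgcat k).
Variables (F : bimod A B) (G : bimod B C) (H : bimod C D).

Section Inner.
Variables (d : ob D) (a : ob A) (c : ob C) (m l n : int) (e : m + l = n).
Variable w : bc H d c l.
Let psi b i j (e' : i + j = m) (x : bc F b a i) (y : bc G c b j) :=
  tpure (G := tens G H) (tr_idx e e') x (tpure erefl y w : bc (tens G H) d b _).

Lemma ta_l b i j (e' : i + j = m) y : linear (fun x : bc F b a i => psi e' x y).
Proof. exact: tpure_linl. Qed.
Lemma ta_r b i j (e' : i + j = m) x :
  linear (fun y : bc G c b j => psi e' x y).
Proof.
move=> s y y'; rewrite /psi.
have -> : (tpure erefl (s *: y + y') w : bc (tens G H) d b (j + l))
  = s *: (tpure erefl y w : bc (tens G H) d b _) + tpure erefl y' w.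
  exact: tpure_linl.
exact: tpure_linr.
Qed.
Lemma ta_b b1 b2 i q j i' j' (ei : i + q = i') (ej : q + j = j')
     (e1 : i' + j = m) (e2 : i + j' = m)
     (x : bc F b2 a i) (f : hom b1 b2 q) (y : bc G c b1 j) :
  psi e1 (ract F ei x f) y = psi e2 x (lact G ej f y).
Proof.
have E : q + (j + l) = j' + l by rewrite -ej addrA.
rewrite /psi (tpure_bal ei E _ (tr_idx e e2)); congr tpure.
exact: tlact_pure.
Qed.

Definition ta_fun (z : bc (tens F G) c a m) : bc (tens F (tens G H)) d a n :=
  tlift psi z.

Lemma ta_lin : linear ta_fun.
Proof. exact: tlift_lin ta_l ta_r ta_b. Qed.

Lemma ta_pure b i j jl (e1 : i + j = m) (e2 : j + l = jl) (e3 : i + jl = n)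
    (x : bc F b a i) (y : bc G c b j) :
  ta_fun (tpure e1 x y)
  = tpure (G := tens G H) e3 x (tpure e2 y w : bc (tens G H) d b jl).
Proof.
rewrite /ta_fun (tlift_pure ta_l ta_r ta_b) /psi; subst jl; exact: tpure_irr.
Qed.
End Inner.

Definition tassoc : bmap (tens (tens F G) H) (tens F (tens G H)).
Proof.
apply: tmor.
refine (@TBil k A C D (tens F G) H (tens F (tens G H))
  (fun d a c m l n e z w => ta_fun e w z) _ _ _ _ _ _).
- by intros; exact: ta_lin.
- move=> d a c m l n e z s w w'; move: z; apply: tens_ext.
  + exact: ta_lin.
  + by apply: lin_add; first apply: lin_scale; exact: ta_lin.
  move=> b i j e0 x y; rewrite !(ta_pure e _ e0 erefl (tr_idx e e0)).
  rewrite -(tpure_linr (G := tens G H)); congr tpure; exact: tpure_linr.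
- move=> d a n c1 c2 m p l m' l' em el e e' z f w; move: z; apply: tens_ext.
  + exact: lin_comp (ta_lin _ _) (tract_lin _ _).
  + exact: ta_lin.
  move=> b i j e0 x y; rewrite /=.
  have E : j + p + l = j + l' by rewrite -el addrA.
  rewrite (tract_pure em _ e0 erefl (tr_idx em e0)).
  rewrite (ta_pure e _ _ E (tr_idx e' e0)) (ta_pure e' _ e0 erefl (tr_idx e' e0)).
  by congr tpure; exact: tpure_bal.
- move=> d a c m l n m' l' n' e en em el e1 e2 z w; move: z; apply: tens_ext.
  + exact: lin_comp (td_lin _) (ta_lin _ _).
  + apply: lin_add; first exact: lin_comp (ta_lin _ _) (td_lin _).
    by apply: lin_scale; exact: ta_lin.
  move=> b i j e0 x y; rewrite /=; subst l' n' n m m'.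
  rewrite (ta_pure erefl _ erefl erefl (tr_idx erefl erefl)).
  have E1 : i + 1 + (j + l) = i + j + l + 1 by lia.
  have E2 : i + (j + l + 1) = i + j + l + 1 by lia.
  have F1 : i + 1 + j = i + j + 1 by lia.
  have F2 : i + (j + 1) = i + j + 1 by lia.
  have G1 : j + 1 + l = j + l + 1 by lia.
  have G2 : j + (l + 1) = j + l + 1 by lia.
  rewrite (td_pure (G := tens G H) erefl _ erefl erefl E1 E2).
  rewrite (td_pure erefl erefl erefl erefl F1 F2).
  rewrite (linD (ta_lin _ _)) (linZ (ta_lin _ _)).
  rewrite (ta_pure e1 _ F1 erefl E1) (ta_pure e1 _ F2 G1 E2).
  rewrite (ta_pure e2 _ erefl G2 E2) -[RHS]addrA; congr (_ + _).
  rewrite ksgnD -scalerA -scalerDr; congr (_ *: _).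
  rewrite -(linZ (tpure_linr (G := tens G H) E2 x)).
  rewrite -(linD (tpure_linr (G := tens G H) E2 x)); congr tpure.
  exact: td_pure.
- move=> d d' a c m l p n l' q e e0 el e1 z w h; move: z; apply: tens_ext.
  + exact: lin_comp (tract_lin _ _) (ta_lin _ _).
  + exact: ta_lin.
  move=> b i j e2 x y; rewrite /=; subst l' q.
  have E1 : i + (j + l) = m + l by rewrite -e2 addrA.
  have E2 : i + (j + l + p) = n by rewrite -e0 -e2 !addrA.
  have E3 : j + (l + p) = j + l + p by rewrite addrA.
  rewrite (ta_pure erefl _ e2 erefl E1) (ta_pure e1 _ e2 E3 E2).
  rewrite (tract_pure (G := tens G H) e0 _ E1 erefl E2); congr tpure.
  exact: tract_pure.
- move=> d a a' c p m l n m' q e e0 em e1 g z w; move: z; apply: tens_ext.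
  + exact: lin_comp (tlact_lin _ _) (ta_lin _ _).
  + exact: lin_comp (ta_lin _ _) (tlact_lin _ _).
  move=> b i j e2 x y; rewrite /=; subst m' q.
  have E1 : i + (j + l) = m + l by rewrite -e2 addrA.
  have E2 : p + i + (j + l) = n by rewrite -e0 -e2 !addrA.
  have E3 : p + i + j = p + m by rewrite -e2 addrA.
  rewrite (ta_pure erefl _ e2 erefl E1).
  rewrite (tlact_pure (G := tens G H) e0 _ E1 erefl E2).
  by rewrite (tlact_pure erefl _ e2 erefl E3) (ta_pure e1 _ E3 erefl E2).
Defined.
End Assoc.
End TensorMaps.

Section Perfect.
Variable k : comPzRingType.

(** [per(A)], for right [A]-modules. *)
Definition perfect (A : dgcat k) : rmod A -> Prop :=
  thick (fun M => exists X : ob A, M = hright X).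

(** The bimodule [A(X, -) (x)_k B(-, Y)], representable by [(Y, X)] as a right
    module over [B (x) A^op]. *)
Definition birepresentable (A B : dgcat k) (X : ob A) (Y : ob B) : bimod A B :=
  tens (hleft X) (hright Y).

(** [per(B (x) A^op)]. *)
Definition bperfect (A B : dgcat k) : bimod A B -> Prop :=
  thick (fun M => exists X Y, M = birepresentable X Y).

Definition locally_perfect (A : dgcat k) : Prop :=
  forall X Y : ob A, perfect (homk X Y).

Definition hproj_dgcat (A : dgcat k) : Prop :=
  forall X Y : ob A, hproj (homk X Y).

Definition closed0 (A : dgcat k) (X Y : ob A) (f : hom X Y 0) : Prop :=
  cd _ (add0r 1) f = 0.

Definition cohomologous (A : dgcat k) (X Y : ob A) (f g : hom X Y 0) : Prop :=
  exists h : hom X Y (-1), f - g = cd _ (addNr 1) h.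

Definition H0iso (A : dgcat k) (X Y : ob A) : Prop :=
  exists (f : hom X Y 0) (g : hom Y X 0),
  [/\ closed0 f, closed0 g, cohomologous (comp (add0r 0) g f) (idm X)
    & cohomologous (comp (add0r 0) f g) (idm Y)].

(** A quasi-equivalence: quasi-fully faithful and essentially surjective on
    [H^0]. *)
Definition quasi_equivalence (A B : dgcat k) (p : dgfunctor A B) : Prop :=
  (forall X Y : ob A, cx_quasi_iso (fun i => @fm k A B p X Y i)) /\
  (forall Y : ob B, exists X : ob A, H0iso (p X) Y).

Definition yoneda (A : dgcat k) (X Y : ob A) (f : hom X Y 0) (Hf : closed0 f)
  : bmap (hright X) (hright Y).
Proof.
refine (@BMap k (kcat k) A (hright X) (hright Y)
  (fun b _ i x => comp (add0r i) f x) _ _ _ _) => /=.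
- by intros; exact: comp_linr.
- move=> b a i j e x.
  have e1 : 1 + i = j by rewrite addrC.
  rewrite (comp_d (add0r i) e (add0r 1) e e1 (add0r j)) Hf.
  by rewrite (lin0 (comp_linl _ _)) add0r scale1r.
- by move=> b b' a i j n e x g; exact: compA.
- move=> b a a' i j n e c x.
  have [i0|ni] := pselect (i = 0); last first.
    rewrite !kpt_ne // !(lin0 (comp_linl _ _)).
    by rewrite (lin0 (comp_linr _ _)).
  subst i; have E : j = n by rewrite -e add0r.
  case: n / E e => e.
  have kactE Z Z' (y : hom Z' Z j) : comp e (kpt_map Z c) y = (c : k) *: y.
    by rewrite /= (linZ (comp_linl _ _)) comp1m.
  by rewrite !kactE (linZ (comp_linr _ _)).
Defined.

(** [H^0(A) -> per(A)], [X |-> h_X], is an equivalence: faithful, full and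
    essentially surjective. *)
Definition triangulated (A : dgcat k) : Prop :=
  [/\ forall (X Y : ob A) (f g : hom X Y 0) (Hf : closed0 f) (Hg : closed0 g),
        Deq (Dof (yoneda Hf)) (Dof (yoneda Hg)) -> cohomologous f g,
      forall (X Y : ob A) (z : Dhom (hright X) (hright Y)),
        exists (f : hom X Y 0) (Hf : closed0 f), Deq z (Dof (yoneda Hf))
    & forall M : rmod A, perfect M -> exists X : ob A, Diso M (hright X)].

Definition hproj_resolution (A Ahp : dgcat k) (p : dgfunctor Ahp A) : Prop :=
  hproj_dgcat Ahp /\ quasi_equivalence p.

(** [h_A] is perfect over [A (x)^L A^op = Ahp (x) Ahp^op]. *)
Definition smooth (A Ahp : dgcat k) (p : dgfunctor Ahp A) : Prop :=
  bperfect (restrict p p (diag A)).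

Definition quasi_functor (A B : dgcat k) (T : bimod A B) : Prop :=
  forall a : ob A, exists b : ob B, Diso (rcomponent T a) (hright b).

End Perfect.

(** Functorial h-projective resolutions: a functor [Q : D(A, B) -> K(A, B)]
    with h-projective values and a natural quasi-isomorphism [Q M -> M]. *)
Record resolution (k : comPzRingType) (A B : dgcat k) := Resolution {
  Qob : bimod A B -> bimod A B;
  Qob_hproj : forall M, hproj (Qob M);
  Qpi : forall M, bmap (Qob M) M;
  Qpi_qis : forall M, quasi_iso (Qpi M);
  Qmap : forall M N, Dhom M N -> bmap (Qob M) (Qob N);
  Qmap_eq : forall M N (f g : Dhom M N),
    Deq f g -> homotopic (Qmap f) (Qmap g);
  Qmap_id : forall M, homotopic (Qmap (Did M)) (bid (Qob M));
  Qmap_comp : forall L M N (g : Dhom M N) (f : Dhom L M),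
    homotopic (Qmap (Dcomp g f)) (bcomp (Qmap g) (Qmap f));
  Qpi_nat : forall M N (f : Dhom M N),
    Deq (Dcomp (Dof (Qpi N)) (Dof (Qmap f))) (Dcomp f (Dof (Qpi M))) }.

Section DBimod.
Variable k : comPzRingType.
Variable Q : forall A B : dgcat k, resolution A B.

(** [G <>^L F = Q(G) <> Q(F)], on objects and on morphisms. *)
Definition dcomp (A B C : dgcat k) (G : bimod B C) (F : bimod A B)
  : bimod A C := tens (Qob (Q A B) F) (Qob (Q B C) G).

Definition dcomp2 (A B C : dgcat k) (G G' : bimod B C) (F F' : bimod A B)
  (g : Dhom G G') (f : Dhom F F') : Dhom (dcomp G F) (dcomp G' F') :=
  Dof (tmap (Qmap (Q A B) f) (Qmap (Q B C) g)).

(** The unit isomorphisms [h_B <>^L F -> F] and [F <>^L h_A -> F]. *)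
Definition dunitl (A B : dgcat k) (F : bimod A B)
  : Dhom (dcomp (diag B) F) F :=
  Dof (bcomp (tunitr F) (tmap (Qpi (Q A B) F) (Qpi (Q B B) (diag B)))).

Definition dunitr (A B : dgcat k) (F : bimod A B)
  : Dhom (dcomp F (diag A)) F :=
  Dof (bcomp (tunitl F) (tmap (Qpi (Q A A) (diag A)) (Qpi (Q A B) F))).

(** Both bracketings of a triple derived composite are compared with
    [Q(H) <> Q(G) <> Q(F)], which avoids inverting [Q M -> M] here. *)
Definition dtripler (A B C D : dgcat k)
  (H : bimod C D) (G : bimod B C) (F : bimod A B)
  : Dhom (dcomp H (dcomp G F))
      (tens (Qob (Q A B) F) (tens (Qob (Q B C) G) (Qob (Q C D) H))) :=
  Dof (bcomp (tassoc _ _ _) (tmap (Qpi (Q A C) (dcomp G F)) (bid _))).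

Definition dtriplel (A B C D : dgcat k)
  (H : bimod C D) (G : bimod B C) (F : bimod A B)
  : Dhom (dcomp (dcomp H G) F)
      (tens (Qob (Q A B) F) (tens (Qob (Q B C) G) (Qob (Q C D) H))) :=
  Dof (tmap (bid _) (Qpi (Q B D) (dcomp H G))).

(** [alpha : H <>^L (G <>^L F) -> (H <>^L G) <>^L F] is the associativity
    isomorphism, with inverse [beta].  For h-projective dg-categories
    [dtriplel] and [dtripler] are isomorphisms in the derived category, so
    that the condition determines [alpha] and [beta]. *)
Definition dassociator (A B C D : dgcat k)
  (H : bimod C D) (G : bimod B C) (F : bimod A B)
  (alpha : Dhom (dcomp H (dcomp G F)) (dcomp (dcomp H G) F))
  (beta : Dhom (dcomp (dcomp H G) F) (dcomp H (dcomp G F))) : Prop :=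
  Dinverse alpha beta /\
  Deq (Dcomp (dtriplel H G F) alpha) (dtripler H G F).

(** [L -| R]: a unit and a counit satisfying the triangular identities. *)
Definition adjoint (A B : dgcat k) (L : bimod A B) (R : bimod B A) : Prop :=
  exists (eta : Dhom (diag A) (dcomp R L)) (eps : Dhom (dcomp L R) (diag B)),
  (exists alpha beta, dassociator (H := L) (G := R) (F := L) alpha beta /\
     Deq (Dcomp (dunitl L)
           (Dcomp (dcomp2 eps (Did L))
             (Dcomp alpha (dcomp2 (Did L) eta))))
         (dunitr L)) /\
  (exists alpha beta, dassociator (H := R) (G := L) (F := R) alpha beta /\
     Deq (Dcomp (dunitr R)
           (Dcomp (dcomp2 (Did R) eps)
             (Dcomp beta (dcomp2 eta (Did R)))))
         (dunitl R)).

End DBimod.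

(* Main.v *)
From Stdlib Require Import Setoid.
From HB Require Import structures.
From mathcomp Require Import all_boot all_order all_algebra.
From mathcomp Require Import boolp.
From mathcomp Require Import zify.
Require Import Defs.

Set Implicit Arguments.
Unset Strict Implicit.
Unset Printing Implicit Defensive.

Import GRing.Theory.
Local Open Scope ring_scope.

(** For a quasi-functor [T : A -> B] with h-projective resolution [QT], the right
    adjoint is [Hom_B(QT, B)] and the left adjoint is [Hom_(A^op)(QT, A)].
    In both cases the adjunction comes from an evaluation pairing
    [R (x) L -> diag] whose transpose [R -> Hom(L, diag)] is a quasi-isomorphism.
    Smoothness of [A] turns a module whose values are perfect complexes into a
    perfect module, by tensoring it with the diagonal, and a perfect right module
    is quasi-representable because [A] is triangulated.  As [B] is locally
    perfect, the components of [Hom_B(QT, B)], and the left modules [T(b, -)],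
    have perfect values.  For the left adjoint one passes to duals: duality
    exchanges left and right perfect modules, and these are reflexive.
    Statements about perfect objects are proved by induction over the thick
    subcategory, on h-projective representatives. *)

(** The derived category enters only through h-projective models. A quasi-isomorphism between
    h-projective bimodules is a homotopy equivalence, and every dg-functor preserves homotopy
    equivalences, so tensor products and Hom bimodules may be computed on such models without
    flatness. Components of h-projective bimodules must stay h-projective, and this is what the
    h-projectivity of the hom-complexes of [Ahp] and [Bhp] provides. Triangulatedness concerns right
    modules over [A], whereas the bimodules live over [Ahp]: a perfect module over [Ahp] is induced
    to [A], represented there and restricted back. It is also the reason for the detour through
    duals, since the modules that are known to be perfect for the left adjoint are left modules. The
    unit of an adjunction is not given by a formula. It is lifted through a quasi-isomorphism, which
    makes one triangle identity true by construction; the other one is detected after transposition.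
    Shifts and cones do not commute on the nose with dg-functors, so they are described by equations
    between structure maps, which every dg-functor preserves. *)

Section Parity.
Variable k : comPzRingType.

Lemma ksgn_parity i j : odd (absz i) = odd (absz j) -> ksgn k i = ksgn k j.
Proof. by rewrite !ksgn_odd => ->. Qed.

Lemma odd_abszN i : odd (absz (- i)) = odd (absz i).
Proof. by rewrite abszN. Qed.

Lemma odd_abszM i j : odd (absz (i * j)) = odd (absz i) && odd (absz j).
Proof. by rewrite abszM oddM. Qed.

Lemma odd_absz1 : odd (absz 1) = true. Proof. by []. Qed.
Lemma odd_absz0 : odd (absz 0) = false. Proof. by []. Qed.

Lemma ksgn_mulKl i (V : lmodType k) (x : V) : ksgn k i *: (ksgn k i *: x) = x.
Proof. by rewrite scalerA ksgn_sqr scale1r. Qed.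
End Parity.

(** A Koszul sign depends only on the parity of its exponent. An equality of two signs thus becomes
    a Boolean identity in the parities of the degrees, which is checked by a truth table. *)
Ltac parity :=
  apply: ksgn_parity;
  rewrite ?(odd_abszD, odd_abszM, odd_abszN, odd_absz1, odd_absz0);
  repeat match goal with |- context [odd ?x] => destruct (odd x) end;
  reflexivity.

(** * Graded maps and their Hom complexes *)

Section GradedMaps.
Variables (k : comPzRingType) (A B : dgcat k).

(** Compatibility with the differentials is not imposed: these are all elements of degree [n] of the
    Hom complex. Maps are written to the left of their arguments, so only the left action is passed
    with a Koszul sign. *)
Record gmap (M N : bimod A B) (n : int) := GMap {
  gm : forall b a i j, i + n = j -> bc M b a i -> bc N b a j;
  gm_lin : forall b a i j (e : i + n = j), linear (@gm b a i j e);
  gm_r : forall b b' a i p j l m (e : i + p = j) (el : i + n = l)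
      (em : j + n = m) (e' : l + p = m) (x : bc M b a i) (f : hom b' b p),
    gm em (ract M e x f) = ract N e' (gm el x) f;
  gm_l : forall b a a' p i j l m (e : p + i = j) (el : i + n = l)
      (em : j + n = m) (e' : p + l = m) (g : hom a a' p) (x : bc M b a i),
    gm em (lact M e g x) = ksgn k (n * p) *: lact N e' g (gm el x) }.

Lemma gmapP (M N : bimod A B) n (f g : gmap M N n) :
  (forall b a i j (e : i + n = j) x, gm f (b:=b) (a:=a) e x = gm g e x) -> f = g.
Proof.
case: f g => f f1 f2 f3 [g g1 g2 g3] /= fg.
have E : f = g.
  by do 5! apply: functional_extensionality_dep => ?; apply/funext => x; exact: fg.
subst g; congr GMap; exact: Prop_irrelevance.
Qed.

Section Module.
Variables (M N : bimod A B) (n : int).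

HB.instance Definition _ := gen_eqMixin (gmap M N n).
HB.instance Definition _ := gen_choiceMixin (gmap M N n).

Definition gzero : gmap M N n.
Proof.
refine (@GMap M N n (fun _ _ _ _ _ _ => 0) _ _ _) => //.
- by intros; exact: lin_zero.
- by intros; rewrite (lin0 (ract_linl _ _)).
- by intros; rewrite (lin0 (lact_linr _ _)) scaler0.
Defined.

Definition gadd (f g : gmap M N n) : gmap M N n.
Proof.
refine (@GMap M N n (fun _ _ _ _ e x => gm f e x + gm g e x) _ _ _).
- by intros; apply: lin_add; exact: gm_lin.
- move=> b b' a i p j l m e el em e' x h.
  by rewrite !(gm_r _ e el em e') (linD (ract_linl _ _)).
- move=> b a a' p i j l m e el em e' h x.
  by rewrite !(gm_l _ e el em e') (linD (lact_linr _ _)) scalerDr.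
Defined.

Definition gscale (c : k) (f : gmap M N n) : gmap M N n.
Proof.
refine (@GMap M N n (fun _ _ _ _ e x => c *: gm f e x) _ _ _).
- by intros; apply: lin_scale; exact: gm_lin.
- move=> b b' a i p j l m e el em e' x h.
  by rewrite !(gm_r _ e el em e') (linZ (ract_linl _ _)).
- move=> b a a' p i j l m e el em e' h x.
  by rewrite !(gm_l _ e el em e') (linZ (lact_linr _ _)) !scalerA mulrC.
Defined.

Definition gopp (f : gmap M N n) : gmap M N n := gscale (-1) f.

Lemma gaddA : associative gadd.
Proof. by move=> f g h; apply: gmapP => *; exact: addrA. Qed.
Lemma gaddC : commutative gadd.
Proof. by move=> f g; apply: gmapP => *; exact: addrC. Qed.
Lemma gadd0 : left_id gzero gadd.
Proof. by move=> f; apply: gmapP => *; exact: add0r. Qed.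
Lemma gaddN : left_inverse gzero gopp gadd.
Proof. by move=> f; apply: gmapP => * /=; rewrite scaleN1r addNr. Qed.

HB.instance Definition _ :=
  GRing.isZmodule.Build (gmap M N n) gaddA gaddC gadd0 gaddN.

Lemma gscaleA c c' f : gscale c (gscale c' f) = gscale (c * c') f.
Proof. by apply: gmapP => *; exact: scalerA. Qed.
Lemma gscale1 : left_id 1 gscale.
Proof. by move=> f; apply: gmapP => *; exact: scale1r. Qed.
Lemma gscaleDr : right_distributive gscale +%R.
Proof. by move=> c f g; apply: gmapP => *; exact: scalerDr. Qed.
Lemma gscaleDl f : {morph gscale^~ f : c c' / c + c'}.
Proof. by move=> c c'; apply: gmapP => *; exact: scalerDl. Qed.

HB.instance Definition _ :=
  GRing.Zmodule_isLmodule.Build k (gmap M N n)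
    gscaleA gscale1 gscaleDr gscaleDl.

Lemma gmD (f g : gmap M N n) b a i j (e : i + n = j) (x : bc M b a i) :
  gm (f + g) e x = gm f e x + gm g e x.
Proof. by []. Qed.
Lemma gmZ c (f : gmap M N n) b a i j (e : i + n = j) (x : bc M b a i) :
  gm (c *: f) e x = c *: gm f e x.
Proof. by []. Qed.
Lemma gmN (f : gmap M N n) b a i j (e : i + n = j) (x : bc M b a i) :
  gm (- f) e x = - gm f e x.
Proof. by rewrite -scaleN1r. Qed.
Lemma gm0 b a i j (e : i + n = j) (x : bc M b a i) :
  gm (0 : gmap M N n) e x = 0.
Proof. by []. Qed.

Lemma gm_irr (f : gmap M N n) b a i j (e e' : i + n = j) (x : bc M b a i) :
  gm f e x = gm f e' x.
Proof. by rewrite (eq_irrelevance e e'). Qed.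
End Module.

Lemma gdeg1 (n n' i j : int) : n + 1 = n' -> i + n' = j -> i + n + 1 = j.
Proof. by move=> <- <-; rewrite addrA. Qed.
Lemma gdeg2 (n n' i j : int) : n + 1 = n' -> i + n' = j -> i + 1 + n = j.
Proof. by move=> <- <-; rewrite addrAC addrA. Qed.

Definition gd_fun (M N : bimod A B) n n' (en : n + 1 = n') (f : gmap M N n)
    b a i j (e : i + n' = j) (x : bc M b a i) : bc N b a j :=
  cd _ (gdeg1 en e) (gm f erefl x) - ksgn k n *: gm f (gdeg2 en e) (cd _ erefl x).

(** The definition fixes the intermediate degrees by reflexivity; here they are freed. Lemmas of
    this shape let a computation choose degrees in which both sides have literally the same type. *)
Lemma gd_funE (M N : bimod A B) n n' (en : n + 1 = n') (f : gmap M N n)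
    b a i j l m (e : i + n' = j) (e1 : i + n = l) (e2 : l + 1 = j)
    (e3 : i + 1 = m) (e4 : m + n = j) (x : bc M b a i) :
  gd_fun en f e x = cd _ e2 (gm f e1 x) - ksgn k n *: gm f e4 (cd _ e3 x).
Proof.
subst l m; rewrite /gd_fun (cd_irr e2 (gdeg1 en e)).
by rewrite (gm_irr f e4 (gdeg2 en e)).
Qed.

Definition gd (M N : bimod A B) n n' (en : n + 1 = n') (f : gmap M N n)
  : gmap M N n'.
Proof.
refine (@GMap M N n' (fun b a i j e x => gd_fun en f e x) _ _ _).
- move=> b a i j e; apply: lin_add.
    exact: lin_comp (cd_lin _) (gm_lin _ _).
  move=> c x y; rewrite (cd_lin _ c) (gm_lin _ _ c) scalerDr opprD !scalerA.
  by rewrite mulrC -scalerA scalerN.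
- move=> b b' a i p j l m e el em e' x h.
  have E1 : i + n + p = j + n by rewrite -e addrAC.
  have E2 : j + n + 1 = m by lia.
  have E3 : i + n + 1 = l by lia.
  have E4 : i + n + (p + 1) = m by lia.
  have E5 : j + 1 + n = m by lia.
  have E6 : i + 1 + p = j + 1 by lia.
  have E7 : i + (p + 1) = j + 1 by lia.
  have E8 : i + 1 + n = l by lia.
  rewrite (gd_funE en f em erefl E2 erefl E5) (gd_funE en f el erefl E3 erefl E8).
  rewrite (gm_r f e erefl erefl E1) (ract_d E1 E2 E3 erefl e' E4).
  rewrite (ract_d e erefl erefl erefl E6 E7).
  rewrite (linD (gm_lin _ _)) (linZ (gm_lin _ _)).
  rewrite (gm_r f E6 E8 E5 e') (gm_r f E7 erefl E5 E4).
  rewrite (linD (ract_linl _ _)) (linN (ract_linl _ _)) (linZ (ract_linl _ _)).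
  (* The two terms in which the differential falls on [h] cancel. *)
  by rewrite scalerDr scalerA opprD -ksgnD [n + i]addrC addrACA subrr addr0.
- move=> b a a' p i j l m e el em e' h x.
  have E1 : p + (i + n) = j + n by rewrite -e addrA.
  have E2 : j + n + 1 = m by lia.
  have E3 : i + n + 1 = l by lia.
  have E4 : p + 1 + (i + n) = m by lia.
  have E5 : j + 1 + n = m by lia.
  have E6 : p + 1 + i = j + 1 by lia.
  have E7 : p + (i + 1) = j + 1 by lia.
  have E8 : i + 1 + n = l by lia.
  rewrite (gd_funE en f em erefl E2 erefl E5) (gd_funE en f el erefl E3 erefl E8).
  rewrite (gm_l f e erefl erefl E1) (linZ (cd_lin _)) (lact_d E1 E2 erefl E3 E4 e').
  rewrite (lact_d e erefl erefl erefl E6 E7).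
  rewrite (linD (gm_lin _ _)) (linZ (gm_lin _ _)).
  rewrite (gm_l f E6 erefl E5 E4) (gm_l f E7 E8 E5 e').
  rewrite (linD (lact_linr _ _)) (linN (lact_linr _ _)) (linZ (lact_linr _ _)).
  rewrite !scalerDr opprD !scalerA -!ksgnD scalerN scalerA -!ksgnD addrACA.
  have -> : ksgn k (n + n * (p + 1)) = ksgn k (n * p) by parity.
  rewrite subrr add0r; congr (_ *: _ - _ *: _); subst n'; parity.
Defined.

Lemma gdE (M N : bimod A B) n n' (en : n + 1 = n') (f : gmap M N n)
    b a i j l m (e : i + n' = j) (e1 : i + n = l) (e2 : l + 1 = j)
    (e3 : i + 1 = m) (e4 : m + n = j) (x : bc M b a i) :
  gm (gd en f) e x = cd _ e2 (gm f e1 x) - ksgn k n *: gm f e4 (cd _ e3 x).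
Proof. exact: gd_funE. Qed.

Lemma gd_lin (M N : bimod A B) n n' (en : n + 1 = n') :
  linear (@gd M N n n' en).
Proof.
move=> c f g; apply: gmapP => b a i j e x.
rewrite /= /gd_fun !gmD !gmZ (cd_lin _ c) scalerDr opprD !scalerA.
by rewrite addrACA mulrC -scalerA -scalerN -scalerDr.
Qed.

Lemma gdd (M N : bimod A B) n m l (en : n + 1 = m) (em : m + 1 = l)
    (f : gmap M N n) : gd em (gd en f) = 0.
Proof.
apply: gmapP => b a i j e x; subst m l.
have E1 : i + (n + 1) + 1 = j by lia.
have E2 : i + 1 + (n + 1) = j by lia.
have E3 : i + n + 1 = i + (n + 1) by lia.
have E4 : i + 1 + n = i + (n + 1) by lia.
have E5 : i + 1 + 1 + n = j by lia.
rewrite (gdE _ _ e erefl E1 erefl E2) (gdE _ _ erefl erefl E3 erefl E4).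
rewrite (gdE _ _ E2 E4 E1 erefl E5) !cdd (linD (cd_lin _)) cdd add0r.
rewrite (lin0 (gm_lin _ _)) scaler0 subr0 (linN (cd_lin _)) (linZ (cd_lin _)).
by rewrite ksgnS scaleNr opprK addNr.
Qed.

Definition gHom (M N : bimod A B) : complex k :=
  @Complex k (fun n => gmap M N n) (fun n n' en => gd en)
    (fun n n' en => gd_lin en) (fun n m l en em f => gdd en em f).

Lemma gdegc (n m l i j : int) : n + m = l -> i + l = j -> i + m + n = j.
Proof. by move=> <- <-; rewrite [n + m]addrC addrA. Qed.

Definition gcomp (L M N : bimod A B) n m l (e : n + m = l)
  (g : gmap M N n) (f : gmap L M m) : gmap L N l.
Proof.
refine (@GMap L N l (fun b a i j ej x => gm g (gdegc e ej) (gm f erefl x)) _ _ _).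
- by intros; exact: lin_comp (gm_lin _ _) (gm_lin _ _).
- move=> b b' a i p j u v e1 eu ev e2 x h.
  have E1 : i + m + p = j + m by rewrite -e1 addrAC.
  by rewrite (gm_r f e1 erefl erefl E1) (gm_r g E1 (gdegc e eu) _ e2).
- move=> b a a' p i j u v e1 eu ev e2 h x.
  have E1 : p + (i + m) = j + m by rewrite -e1 addrA.
  rewrite (gm_l f e1 erefl erefl E1) (linZ (gm_lin _ _)).
  rewrite (gm_l g E1 (gdegc e eu) _ e2) scalerA -ksgnD; congr (_ *: _).
  rewrite -[X in _ = ksgn k (X * _)]e; parity.
Defined.

Lemma gcompE (L M N : bimod A B) n m l (e : n + m = l) (g : gmap M N n)
    (f : gmap L M m) b a i j u (ej : i + l = j) (e1 : i + m = u) (e2 : u + n = j)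
    (x : bc L b a i) :
  gm (gcomp e g f) ej x = gm g e2 (gm f e1 x).
Proof. by subst u; rewrite /=; exact: gm_irr. Qed.

Lemma gcomp_linl (L M N : bimod A B) n m l (e : n + m = l) (f : gmap L M m) :
  linear (fun g : gmap M N n => gcomp e g f).
Proof. by move=> c g g'; apply: gmapP. Qed.

Lemma gcomp_linr (L M N : bimod A B) n m l (e : n + m = l) (g : gmap M N n) :
  linear (fun f : gmap L M m => gcomp e g f).
Proof. by move=> c f f'; apply: gmapP => *; rewrite /= (gm_lin _ _ c). Qed.

Lemma gcompA (K L M N : bimod A B) i j l ij jl n (e1 : j + l = jl)
    (e2 : i + jl = n) (e3 : i + j = ij) (e4 : ij + l = n)
    (h : gmap M N i) (g : gmap L M j) (f : gmap K L l) :
  gcomp e2 h (gcomp e1 g f) = gcomp e4 (gcomp e3 h g) f.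
Proof.
subst jl ij; apply: gmapP => b a u v e x.
have E1 : u + l + (i + j) = v by lia.
have E2 : u + (j + l) + i = v by lia.
have E3 : u + l + j = u + (j + l) by lia.
rewrite (gcompE e4 _ _ e erefl E1) (gcompE erefl _ _ E1 E3 E2).
by rewrite (gcompE e2 _ _ e erefl E2) (gcompE erefl _ _ erefl erefl E3).
Qed.

Lemma gcomp_d (L M N : bimod A B) i j n i' j' n' (e : i + j = n)
    (en : n + 1 = n') (ei : i + 1 = i') (ej : j + 1 = j') (e1 : i' + j = n')
    (e2 : i + j' = n') (g : gmap M N i) (f : gmap L M j) :
  gd en (gcomp e g f) = gcomp e1 (gd ei g) f + ksgn k i *: gcomp e2 g (gd ej f).
Proof.
subst i' j' n n'; apply: gmapP => b a u v E x.
have E1 : u + (i + j) + 1 = v by lia.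
have E2 : u + 1 + (i + j) = v by lia.
have E3 : u + j + i = u + (i + j) by lia.
have E4 : u + 1 + j + i = v by lia.
have E5 : u + j + (i + 1) = v by lia.
have E6 : u + j + 1 + i = v by lia.
have E7 : u + (j + 1) + i = v by lia.
have E8 : u + j + 1 = u + (j + 1) by lia.
have E9 : u + 1 + j = u + (j + 1) by lia.
rewrite (gdE _ _ E erefl E1 erefl E2) (gcompE _ _ _ erefl erefl E3).
rewrite (gcompE _ _ _ E2 E9 E7) gmD gmZ (gcompE e1 _ _ E erefl E5).
rewrite (gcompE e2 _ _ E erefl E7) (gdE _ _ E5 E3 E1 E8 E7).
rewrite (gdE _ _ erefl erefl E8 erefl E9) (linD (gm_lin _ _)) (linN (gm_lin _ _)).
rewrite (linZ (gm_lin _ _)) scalerDr scalerN scalerA -ksgnD.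
by symmetry; exact: subrKA.
Qed.

Definition gid (M : bimod A B) : gmap M M 0.
Proof.
refine (@GMap M M 0 (fun b a i j e x => cxcast (etrans (esym (addr0 i)) e) x) _ _ _).
- by intros; exact: cxcast_lin.
- by intros; exact: cxcast_r.
- by intros; rewrite mul0r ksgn0 scale1r; exact: cxcast_l.
Defined.

Lemma gidE (M : bimod A B) b a i (e : i + 0 = i) (x : bc M b a i) :
  gm (gid M) e x = x.
Proof. by rewrite /= /cxcast (eq_irrelevance (etrans _ _) erefl). Qed.
End GradedMaps.

(** * Transport along equalities of degrees *)

Section Casts.
Variables (k : comPzRingType).

Lemma ksgnN1 : ksgn k (-1) = -1. Proof. by rewrite /ksgn expr1. Qed.

Lemma cxcast_id (C : complex k) i (e : i = i) (x : C i) : cxcast e x = x.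
Proof. by rewrite /cxcast (eq_irrelevance e erefl). Qed.

Lemma cxcast_trans (C : complex k) i j l (e : i = j) (e' : j = l) (x : C i) :
  cxcast e' (cxcast e x) = cxcast (etrans e e') x.
Proof. by case: l / e'; case: j / e. Qed.

Lemma cd_cast (C : complex k) i i' j (e : i = i') (ej : i' + 1 = j)
    (ej' : i + 1 = j) (x : C i) :
  cd C ej (cxcast e x) = cd C ej' x.
Proof. by case: i' / e ej => ej; exact: cd_irr. Qed.

Lemma cast_cd (C : complex k) i j j' (e : j = j') (ej : i + 1 = j)
    (ej' : i + 1 = j') (x : C i) :
  cxcast e (cd C ej x) = cd C ej' x.
Proof. by case: j' / e ej' => ej'; exact: cd_irr. Qed.

Variables (A B : dgcat k) (M N : bimod A B).

Lemma bm_cast (f : bmap M N) b a i j (e : i = j) (x : bc M b a i) :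
  f b a j (cxcast e x) = cxcast e (f b a i x).
Proof. by case: j / e. Qed.

Lemma bm0 (f : bmap M N) b a i : f b a i 0 = 0.
Proof. exact: lin0 (@bm_lin _ _ _ _ _ f _ _ _). Qed.
Lemma bmD (f : bmap M N) b a i x y : f b a i (x + y) = f b a i x + f b a i y.
Proof. exact: linD (@bm_lin _ _ _ _ _ f _ _ _) _ _. Qed.
Lemma bmN (f : bmap M N) b a i x : f b a i (- x) = - f b a i x.
Proof. exact: linN (@bm_lin _ _ _ _ _ f _ _ _) _. Qed.
Lemma bmZ (f : bmap M N) b a i c x : f b a i (c *: x) = c *: f b a i x.
Proof. exact: linZ (@bm_lin _ _ _ _ _ f _ _ _) _ _. Qed.

Lemma cast_gm n (f : gmap M N n) b a i j j' (e : j = j') (ej : i + n = j)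
    (ej' : i + n = j') (x : bc M b a i) :
  cxcast e (gm f ej x) = gm f ej' x.
Proof. by case: j' / e ej' => ej'; exact: gm_irr. Qed.
End Casts.

(** * Closed maps and homotopies inside the Hom complex *)

Section Homotopy.
Variables (k : comPzRingType) (A B : dgcat k).
Implicit Types L M N P : bimod A B.

(** A [bmap] preserves the degree, whereas a [gmap] of degree zero lands in any [j] with
    [i + 0 = j]; the transport reconciles the two. *)
Definition gofb M N (f : bmap M N) : gmap M N 0.
Proof.
refine (@GMap k A B M N 0
  (fun b a i j e x => cxcast (etrans (esym (addr0 i)) e) (f b a i x)) _ _ _).
- by intros; exact: lin_comp (@cxcast_lin _ _ _ _ _) (@bm_lin _ _ _ _ _ f _ _ _).
- by intros; rewrite bm_r; exact: cxcast_r.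
- by intros; rewrite mul0r ksgn0 scale1r bm_l; exact: cxcast_l.
Defined.

Lemma gofbE M N (f : bmap M N) b a i (e : i + 0 = i) (x : bc M b a i) :
  gm (gofb f) e x = f b a i x.
Proof. exact: cxcast_id. Qed.

Lemma gm_deg0 M N (f : gmap M N 0) b a i (e : i + 0 = i) j (e' : i + 0 = j)
    (x : bc M b a i) : gm f e' x = cxcast (etrans (esym (addr0 i)) e') (gm f e x).
Proof. by rewrite (cast_gm _ _ _ e'). Qed.

Lemma gmap0P M N (f g : gmap M N 0) :
  (forall b a i x, gm f (b:=b) (a:=a) (addr0 i) x = gm g (addr0 i) x) -> f = g.
Proof.
move=> fg; apply: gmapP => b a i j e x.
by rewrite (gm_deg0 f (addr0 i)) (gm_deg0 g (addr0 i)) fg.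
Qed.

Lemma gofb_closed M N (f : bmap M N) : gd (add0r 1) (gofb f) = 0.
Proof.
apply: gmapP => b a i j e x; subst j.
rewrite (gdE _ _ _ (addr0 i) erefl erefl (addr0 (i + 1))) !gofbE bm_d.
by rewrite ksgn0 scale1r subrr.
Qed.

Definition bofg M N (f : gmap M N 0) (H : gd (add0r 1) f = 0) : bmap M N.
Proof.
refine (@BMap k A B M N (fun b a i x => gm f (addr0 i) x) _ _ _ _).
- by move=> b a i; exact: gm_lin.
- move=> b a i j e x; have := congr1 (fun g => gm g e x) H.
  rewrite (gdE _ _ e (addr0 i) e e (addr0 j)) ksgn0 scale1r.
  by move/eqP; rewrite subr_eq0 => /eqP ->.
- by intros; exact: gm_r.
- by intros; rewrite (gm_l f _ (addr0 _) _ e) mul0r ksgn0 scale1r.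
Defined.

Lemma bofgE M N (f : gmap M N 0) (H : gd (add0r 1) f = 0) b a i x :
  bofg H b a i x = gm f (addr0 i) x.
Proof. by []. Qed.

Lemma bcompE L M N (g : bmap M N) (f : bmap L M) b a i x :
  bcomp g f b a i x = g b a i (f b a i x).
Proof. by []. Qed.

Lemma gofbK M N (f : gmap M N 0) (H : gd (add0r 1) f = 0) : gofb (bofg H) = f.
Proof.
by apply: gmapP => b a i j e x; rewrite (gm_deg0 f (addr0 i)).
Qed.

Lemma gofb_comp L M N (g : bmap M N) (f : bmap L M) (e : 0 + 0 = 0) :
  gofb (bcomp g f) = gcomp e (gofb g) (gofb f).
Proof.
apply: gmap0P => b a i x.
by rewrite (gcompE _ _ _ _ (addr0 i) (addr0 i)) !gofbE.
Qed.

Lemma gofb_id M : gofb (bid M) = gid M.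
Proof.
by apply: gmap0P => b a i x; rewrite gofbE gidE.
Qed.

Lemma gcomp1l M N n (e : 0 + n = n) (f : gmap M N n) : gcomp e (gid N) f = f.
Proof.
apply: gmapP => b a i j ej x.
by rewrite (gcompE _ _ _ ej ej (addr0 j)) gidE.
Qed.

Lemma gcomp1r M N n (e : n + 0 = n) (f : gmap M N n) : gcomp e f (gid M) = f.
Proof.
apply: gmapP => b a i j ej x.
by rewrite (gcompE _ _ _ ej (addr0 i) ej) gidE.
Qed.

(** The sign that a homotopy shows against the left action is the Koszul sign of degree -1, and
    [d h + h d] is the boundary of an element of that degree. From here on homotopies are handled by
    the Leibniz rule for [gcomp] alone. *)
Lemma homotopicP M N (f g : bmap M N) :
  homotopic f g <-> exists h : gmap M N (-1), gofb f - gofb g = gd (addNr 1) h.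
Proof.
split.
- case=> h [h1 h2 h3 h4].
  have E (i j : int) : i + (-1) = j -> j + 1 = i by lia.
  have hirr b a i j (e e' : j + 1 = i) (x : bc M b a i) :
      h b a i j e x = h b a i j e' x by rewrite (eq_irrelevance e e').
  have H1 b a i j (e : i + (-1) = j) : linear (h b a i j (E _ _ e)) by [].
  have H2 b b' a i p j l m (e : i + p = j) (el : i + (-1) = l)
      (em : j + (-1) = m) (e' : l + p = m) (x : bc M b a i) (y : hom b' b p) :
      h b' a j m (E _ _ em) (ract M e x y) = ract N e' (h b a i l (E _ _ el) x) y.
    exact: h2.
  have H3 b a a' p i j l m (e : p + i = j) (el : i + (-1) = l)
      (em : j + (-1) = m) (e' : p + l = m) (y : hom a a' p) (x : bc M b a i) :
      h b a' j m (E _ _ em) (lact M e y x)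
      = ksgn k ((-1) * p) *: lact N e' y (h b a i l (E _ _ el) x).
    rewrite (h3 b a a' p i l j m e (E _ _ el) (E _ _ em) e' y x).
    by congr (_ *: _); rewrite mulN1r; parity.
  exists (@GMap k A B M N (-1) (fun b a i j e => h b a i j (E _ _ e)) H1 H2 H3).
  apply: gmap0P => b a i x; rewrite gmD gmN !gofbE.
  have E1 : i + 1 + -1 = i by lia.
  have E2 : i - 1 + 1 = i by lia.
  rewrite (gdE _ _ _ erefl E2 erefl E1) /= (h4 b a i (i - 1) (i + 1) E2 erefl).
  rewrite (hirr _ _ _ _ _ E2) (hirr _ _ (i + 1) _ _ erefl).
  by rewrite ksgnN1 scaleN1r opprK.
case=> h H.
have E (i j : int) : j + 1 = i -> i + (-1) = j by lia.
exists (fun b a i j e => gm h (E i j e)); split.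
- by intros; exact: gm_lin.
- by intros; exact: gm_r.
- intros; rewrite (gm_l h e (E _ _ ej) _ e'); congr (_ *: _).
  by rewrite mulN1r; parity.
- move=> b a i j l ej el x; have := congr1 (fun g => gm g (addr0 i) x) H.
  rewrite gmD gmN !gofbE => ->.
  rewrite (gdE _ _ _ (E i j ej) ej el (E l i el)).
  by rewrite ksgnN1 scaleN1r opprK.
Qed.

Lemma gd_comp_closedl L M N i j n i' j' n' (e : i + j = n) (en : n + 1 = n')
    (ei : i + 1 = i') (ej : j + 1 = j') (e2 : i + j' = n')
    (g : gmap M N i) (f : gmap L M j) :
  gd ei g = 0 -> gd en (gcomp e g f) = ksgn k i *: gcomp e2 g (gd ej f).
Proof.
move=> g0; have e1 : i' + j = n' by rewrite -en -e -ei addrAC.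
by rewrite (gcomp_d e en ei ej e1 e2) g0 (lin0 (gcomp_linl _ _)) add0r.
Qed.

Lemma gd_comp_closedr L M N i j n i' j' n' (e : i + j = n) (en : n + 1 = n')
    (ei : i + 1 = i') (ej : j + 1 = j') (e1 : i' + j = n')
    (g : gmap M N i) (f : gmap L M j) :
  gd ej f = 0 -> gd en (gcomp e g f) = gcomp e1 (gd ei g) f.
Proof.
move=> f0; have e2 : i + j' = n' by rewrite -en -e -ej addrA.
by rewrite (gcomp_d e en ei ej e1 e2) f0 (lin0 (gcomp_linr _ _)) scaler0 addr0.
Qed.

Lemma homotopic_refl M N (f : bmap M N) : homotopic f f.
Proof.
by apply/homotopicP; exists 0; rewrite subrr (lin0 (gd_lin _)).
Qed.

Lemma homotopic_sym M N (f g : bmap M N) : homotopic f g -> homotopic g f.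
Proof.
move=> /homotopicP[h H]; apply/homotopicP; exists (- h).
by rewrite (linN (gd_lin _)) -H opprB.
Qed.

Lemma homotopic_trans M N (f g h : bmap M N) :
  homotopic f g -> homotopic g h -> homotopic f h.
Proof.
move=> /homotopicP[u U] /homotopicP[v V]; apply/homotopicP; exists (u + v).
by rewrite (linD (gd_lin _)) -U -V addrA subrK.
Qed.

Lemma homotopic_compl L M N (g : bmap M N) (f f' : bmap L M) :
  homotopic f f' -> homotopic (bcomp g f) (bcomp g f').
Proof.
move=> /homotopicP[u U]; apply/homotopicP; exists (gcomp (add0r (-1)) (gofb g) u).
rewrite (gd_comp_closedl _ _ (addNr 1) (add0r 0) _ (gofb_closed g)).
rewrite ksgn0 scale1r -U !(gofb_comp _ _ (add0r 0)).
by rewrite (linD (gcomp_linr _ _)) (linN (gcomp_linr _ _)).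
Qed.

Lemma homotopic_compr L M N (g g' : bmap M N) (f : bmap L M) :
  homotopic g g' -> homotopic (bcomp g f) (bcomp g' f).
Proof.
move=> /homotopicP[u U]; apply/homotopicP; exists (gcomp (addr0 (-1)) u (gofb f)).
rewrite (gd_comp_closedr _ _ (addNr 1) (add0r 0) _ (gofb_closed f)).
rewrite -U !(gofb_comp _ _ (add0r 0)).
by rewrite (linD (gcomp_linl _ _)) (linN (gcomp_linl _ _)).
Qed.

Lemma homotopic_comp L M N (g g' : bmap M N) (f f' : bmap L M) :
  homotopic g g' -> homotopic f f' -> homotopic (bcomp g f) (bcomp g' f').
Proof.
move=> hg hf; apply: homotopic_trans (homotopic_compl g hf) _.
exact: homotopic_compr.
Qed.

Lemma eqb_homotopic M N (f g : bmap M N) :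
  (forall b a i x, f b a i x = g b a i x) -> homotopic f g.
Proof.
move=> fg; apply/homotopicP; exists 0; rewrite (lin0 (gd_lin _)).
apply/eqP; rewrite subr_eq0; apply/eqP; apply: gmapP => b a i j e x /=.
by rewrite fg.
Qed.
End Homotopy.

(** * Shifts, cones and h-projective bimodules *)

Section ShiftCone.
Variables (k : comPzRingType) (A B : dgcat k).
Implicit Types L M N P C : bimod A B.

(** For a dg-functor [F], the bimodules [F (shift s M)] and [shift s (F M)] are different. Arguments
    therefore refer to these equations, which [F] preserves, and not to the concrete model of the
    shift. *)
Record shiftdata (s : int) M C := ShiftData {
  sd_u : gmap M C (- s);
  sd_v : gmap C M s;
  sd_vu : forall e : s + - s = 0, gcomp e sd_v sd_u = gid M;
  sd_uv : forall e : - s + s = 0, gcomp e sd_u sd_v = gid C;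
  sd_du : forall n (e : - s + 1 = n), gd e sd_u = 0;
  sd_dv : forall n (e : s + 1 = n), gd e sd_v = 0 }.

Lemma shu_idx (s i j : int) : i + - s = j -> i = j + s.
Proof. by move=> <-; rewrite subrK. Qed.

Definition sh_u s M : gmap M (shift s M) (- s).
Proof.
refine (@GMap k A B M (shift s M) (- s)
  (fun b a i j e x => cxcast (shu_idx e) x) _ _ _).
- by move=> b a i j e; exact: (@cxcast_lin k (bc M b a) _ _ (shu_idx e)).
- by intros; rewrite /=; exact: cxcast_r.
- intros; rewrite /= (cxcast_l _ (shift_idx' s e') (shu_idx el)).
  by rewrite scalerA -ksgnD mulNr addNr ksgn0 scale1r.
Defined.

Definition sh_v s M : gmap (shift s M) M s.
Proof.
refine (@GMap k A B (shift s M) M s (fun b a i j e x => cxcast e x) _ _ _).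
- by move=> b a i j e; exact: (@cxcast_lin k (bc M b a) _ _ e).
- by intros; rewrite /=; exact: cxcast_r.
- intros; rewrite /= (linZ (@cxcast_lin _ _ _ _ _)).
  by congr (_ *: _); exact: cxcast_l.
Defined.

Lemma sh_uE s M b a i j (e : i + - s = j) (e' : i = j + s) (x : bc M b a i) :
  gm (sh_u s M) e x = cxcast e' x.
Proof. by rewrite /= (eq_irrelevance (shu_idx e) e'). Qed.

Definition shift_data s M : shiftdata s M (shift s M).
Proof.
apply: (@ShiftData s M (shift s M) (sh_u s M) (sh_v s M)).
- move=> e; apply: gmap0P => b a i x.
  have E1 : i - s + s = i by rewrite subrK.
  rewrite (gcompE _ _ _ _ erefl E1) gidE (sh_uE _ (esym E1)) /=.
  by rewrite cxcast_trans cxcast_id.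
- move=> e; apply: gmap0P => b a i x.
  have E1 : i + s - s = i by rewrite addrK.
  by rewrite (gcompE _ _ _ _ erefl E1) gidE (sh_uE _ erefl).
- move=> n e; apply: gmapP => b a i j ej x.
  have E1 : i - s + 1 = j by lia.
  have E2 : i + 1 - s = j by lia.
  have E3 : i = i - s + s by lia.
  have E4 : i + 1 = j + s by lia.
  rewrite (gdE _ _ _ erefl E1 erefl E2) (sh_uE _ E3) (sh_uE _ E4) /=.
  rewrite (cd_cast _ _ E4) (cast_cd _ _ E4).
  have -> : ksgn k (- s) = ksgn k s by parity.
  by rewrite subrr.
- move=> n e; apply: gmapP => b a i j ej x.
  have E1 : i + s + 1 = j by lia.
  have E2 : i + 1 + s = j by lia.
  rewrite (gdE _ _ _ erefl E1 erefl E2) /=.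
  rewrite (linZ (@cxcast_lin _ _ _ _ _)) (cast_cd _ _ E1) ksgn_mulKl.
  by rewrite subrr.
Defined.

(** The cone as a twisted direct sum: the four maps split [C], as a graded bimodule, into [N] and a
    shifted copy of [M], and the last two equations put [f] into the differential. As for shifts, a
    dg-functor preserves all of this. *)
Record conedata M N (f : gmap M N 0) C := ConeData {
  co_i : gmap N C 0;
  co_q : gmap C N 0;
  co_j : gmap M C (-1);
  co_p : gmap C M 1;
  co_qi : forall e : 0 + 0 = 0 :> int, gcomp e co_q co_i = gid N;
  co_pj : forall e : 1 + -1 = 0 :> int, gcomp e co_p co_j = gid M;
  co_qj : forall e : 0 + -1 = -1 :> int, gcomp e co_q co_j = 0;
  co_pi : forall e : 1 + 0 = 1 :> int, gcomp e co_p co_i = 0;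
  co_split : forall (e : 0 + 0 = 0 :> int) (e' : -1 + 1 = 0 :> int),
    gcomp e co_i co_q + gcomp e' co_j co_p = gid C;
  co_di : forall n (e : 0 + 1 = n), gd e co_i = 0;
  co_dp : forall n (e : 1 + 1 = n), gd e co_p = 0;
  co_dj : forall (e : -1 + 1 = 0) (e' : 0 + 0 = 0 :> int),
    gd e co_j = gcomp e' co_i f;
  co_dq : forall (e : 0 + 1 = 1) (e' : 0 + 1 = 1 :> int),
    gd e co_q = - gcomp e' f co_p }.

Lemma cj_idx (i j : int) : i + -1 = j -> i = j + 1.
Proof. by move=> <-; rewrite subrK. Qed.

Section Cone.
Variables (M N : bimod A B) (f : bmap M N).

Lemma pair_eta (U V : Type) (x : U * V) : x = (x.1, x.2). Proof. by case: x. Qed.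

Definition cone_i : gmap N (cone f) 0.
Proof.
refine (@GMap k A B N (cone f) 0
  (fun b a i j e x => (0, cxcast (etrans (esym (addr0 i)) e) x)) _ _ _).
- intros; move=> c x y; rewrite (cxcast_lin _ c) /=.
  by rewrite pairZ pairE; congr pair; rewrite scaler0 addr0.
- intros; rewrite /= (cxcast_r _ e' (etrans (esym (addr0 i)) el)).
  by congr pair; rewrite (lin0 (ract_linl _ _)).
- intros; rewrite /= mul0r ksgn0 scale1r.
  rewrite (cxcast_l _ e' (etrans (esym (addr0 i)) el)).
  by congr pair; rewrite (lin0 (lact_linr _ _)) scaler0.
Defined.

Definition cone_q : gmap (cone f) N 0.
Proof.
refine (@GMap k A B (cone f) N 0
  (fun b a i j e x => cxcast (etrans (esym (addr0 i)) e) x.2) _ _ _).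
- by intros; move=> c x y; rewrite /= (cxcast_lin _ c).
- by intros; rewrite /=; exact: cxcast_r.
- by intros; rewrite /= mul0r ksgn0 scale1r; exact: cxcast_l.
Defined.

Definition cone_j : gmap M (cone f) (-1).
Proof.
refine (@GMap k A B M (cone f) (-1)
  (fun b a i j e x => (cxcast (cj_idx e) x, 0)) _ _ _).
- intros; move=> c x y; rewrite (cxcast_lin _ c) /=.
  by rewrite pairZ pairE; congr pair; rewrite scaler0 addr0.
- intros; rewrite /= (cxcast_r _ (shift_idx 1 e') (cj_idx el)).
  by congr pair; rewrite (lin0 (ract_linl _ _)).
- intros; rewrite /= (cxcast_l _ (shift_idx' 1 e') (cj_idx el)).
  rewrite pairZ scalerA -ksgnD mulN1r mul1r addNr ksgn0 scale1r.
  by congr pair; rewrite (lin0 (lact_linr _ _)) scaler0.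
Defined.

Definition cone_p : gmap (cone f) M 1.
Proof.
refine (@GMap k A B (cone f) M 1 (fun b a i j e x => cxcast e x.1) _ _ _).
- by intros; move=> c x y; rewrite /= (cxcast_lin _ c).
- by intros; rewrite /=; exact: cxcast_r.
- intros; rewrite /= (linZ (@cxcast_lin _ _ _ _ _)).
  by congr (_ *: _); exact: cxcast_l.
Defined.

Lemma cone_iE b a i (e : i + 0 = i) (x : bc N b a i) : gm cone_i e x = (0, x).
Proof. by rewrite /= cxcast_id. Qed.
Lemma cone_qE b a i (e : i + 0 = i) (x : bc (cone f) b a i) :
  gm cone_q e x = x.2.
Proof. by rewrite /= cxcast_id. Qed.
Lemma cone_jE b a i j (e : i + -1 = j) (e' : i = j + 1) (x : bc M b a i) :
  gm cone_j e x = (cxcast e' x, 0).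
Proof. by rewrite /= (eq_irrelevance (cj_idx e) e'). Qed.

Lemma cone_dE b a i j (e : i + 1 = j) (e' : i + 1 + 1 = j + 1)
    (x : bc (cone f) b a i) :
  cd (cone_cx f b a) e x = (- cd (bc M b a) e' x.1,
              cxcast e (f b a _ x.1) + cd (bc N b a) e x.2).
Proof. by rewrite /= ksgn1 scaleN1r; congr (- _, _); exact: cd_irr. Qed.

Definition cone_data : conedata (gofb f) (cone f).
Proof.
apply: (@ConeData M N (gofb f) (cone f) cone_i cone_q cone_j cone_p).
- move=> e; apply: gmap0P => b a i x.
  by rewrite (gcompE _ _ _ _ (addr0 i) (addr0 i)) gidE cone_iE cone_qE.
- move=> e; apply: gmap0P => b a i x.
  have E1 : i - 1 + 1 = i by rewrite subrK.
  rewrite (gcompE _ _ _ _ erefl E1) gidE (cone_jE _ (esym E1)) /=.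
  by rewrite cxcast_trans cxcast_id.
- move=> e; apply: gmapP => b a i j ej x.
  by rewrite (gcompE _ _ _ _ ej (addr0 j)) (cone_jE _ (cj_idx ej)) cone_qE.
- move=> e; apply: gmapP => b a i j ej x.
  rewrite (gcompE _ _ _ _ (addr0 i) ej) cone_iE /=.
  exact: lin0 (@cxcast_lin _ _ _ _ _).
- move=> e e'; apply: gmap0P => b a i x.
  have E1 : i + 1 - 1 = i by rewrite addrK.
  rewrite gmD (gcompE _ _ _ _ (addr0 i) (addr0 i)) gidE cone_iE cone_qE.
  rewrite (gcompE _ _ _ _ erefl E1) (cone_jE _ erefl) /=.
  by rewrite pairE add0r addr0 [RHS]pair_eta.
- move=> n e; apply: gmapP => b a i j ej x.
  have E1 : i + 1 = j by lia.
  rewrite (gdE _ _ _ (addr0 i) E1 E1 (addr0 j)) !cone_iE ksgn0 scale1r.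
  have E2 : i + 1 + 1 = j + 1 by lia.
  rewrite (cone_dE _ E2) /= (lin0 (cd_lin _)) oppr0.
  by rewrite bm0 (lin0 (@cxcast_lin _ _ _ _ _)) add0r subrr.
- move=> n e; apply: gmapP => b a i j ej x.
  have E1 : i + 1 + 1 = j by lia.
  rewrite (gdE _ _ _ erefl E1 erefl E1) (cone_dE _ erefl) /= ksgn1 scaleN1r.
  rewrite (linN (@cxcast_lin _ _ _ _ _)) (cast_cd _ _ E1).
  by rewrite opprK subrr.
- move=> e e'; apply: gmap0P => b a i x.
  have E1 : i - 1 + 1 = i by rewrite subrK.
  have E2 : i + 1 - 1 = i by rewrite addrK.
  have E3 : i - 1 + 1 + 1 = i + 1 by lia.
  rewrite (gdE _ _ _ erefl E1 erefl E2) (cone_jE _ (esym E1)) (cone_jE _ erefl).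
  rewrite (gcompE _ _ _ _ (addr0 i) (addr0 i)) gofbE cone_iE.
  rewrite (cone_dE _ E3) /= ksgnN1 scaleN1r opprK (lin0 (cd_lin _)) addr0.
  rewrite (cd_cast _ _ erefl) bm_cast cxcast_trans cxcast_id.
  by rewrite pairE addNr addr0.
- move=> e e'; apply: gmapP => b a i j ej x.
  rewrite (gdE _ _ _ (addr0 i) ej ej (addr0 j)) !cone_qE ksgn0 scale1r.
  rewrite gmN (gcompE _ _ _ _ ej (addr0 j)) gofbE.
  have E2 : i + 1 + 1 = j + 1 by lia.
  rewrite (cone_dE _ E2) /= bm_cast.
  by rewrite opprD addrA addrAC subrr sub0r.
Defined.
End Cone.
End ShiftCone.

(** * Acyclicity, h-projectivity and quasi-isomorphisms *)

Section Acyclic.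
Variables (k : comPzRingType) (A B : dgcat k).
Implicit Types M N P C X : bimod A B.

Lemma acyclic_shift s N : acyclic N -> acyclic (shift s N).
Proof.
move=> aN b a i j l ei el x; rewrite /= => /(congr1 (fun y => ksgn k s *: y)).
rewrite ksgn_mulKl scaler0 => dx.
have E : j + s + 1 = i + s by rewrite -ei addrAC.
have [z ->] := aN b a _ (j + s) _ E _ x dx.
exists (ksgn k s *: z).
by rewrite (linZ (cd_lin _)) ksgn_mulKl; exact: cd_irr.
Qed.

(** A cocycle [(m, n)] satisfies [d m = 0] and [w m = d (- n)], so [m = d z] by injectivity on
    cohomology. Then [n + w z] is a cocycle, hence equal to [w x + d y] with [x] closed, and
    [(m, n)] is the boundary of [(x - z, y)]. *)
Lemma acyclic_cone M N (w : bmap M N) : quasi_iso w -> acyclic (cone w).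
Proof.
move=> qw b a i j l ei el [m n]; subst i l.
have E : j + 1 + 1 + 1 = j + 1 + 1 + 1 by [].
rewrite (cone_dE _ E) /= => -[/eqP]; rewrite oppr_eq0 => /eqP dm h.
have [inj surj] := qw b a.
have dn : w b a _ m = cd _ erefl (- n).
  by rewrite (linN (cd_lin _)); apply/eqP; rewrite -addr_eq0; apply/eqP.
have [z mz] := inj _ _ _ erefl E m _ dm dn.
have dnz : cd _ erefl (n + w b a _ z) = 0.
  by rewrite (linD (cd_lin _)) -bm_d -mz [LHS]addrC.
have [x [y [dx nx]]] := surj _ j _ erefl erefl _ dnz.
exists (x - z, y); rewrite /= ksgn1 scaleN1r; congr pair.
  rewrite (cd_irr _ erefl) (linD (cd_lin _)) (linN (cd_lin _)) dx sub0r opprK mz.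
  exact: cd_irr.
by rewrite bmD bmN [RHS]addrAC -nx [RHS]addrK.
Qed.

Lemma hprojP P : hproj P <-> forall N, acyclic N ->
  forall f : gmap P N 0, gd (add0r 1) f = 0 ->
  exists h : gmap P N (-1), f = gd (addNr 1) h.
Proof.
split=> [hP N aN f df|H N aN f g].
  have d0 : gd (add0r 1) (0 : gmap P N 0) = 0 by exact: lin0 (gd_lin _).
  have /homotopicP[h] := hP N aN (bofg df) (bofg d0).
  by rewrite !gofbK subr0; exists h.
apply/homotopicP; apply: H => //.
by rewrite (linD (gd_lin _)) (linN (gd_lin _)) !gofb_closed subrr.
Qed.

(** h-projectivity speaks of maps of degree zero. Composition with the closed isomorphism of degree
    [- n] from [N] to its shift reduces every degree to that one, so the whole complex [gHom P N] is
    acyclic. *)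
Lemma hproj_bound P N (hP : hproj P) (aN : acyclic N) n n' m (e : n' + 1 = n)
    (em : n + 1 = m) (f : gmap P N n) :
  gd em f = 0 -> exists h : gmap P N n', f = gd e h.
Proof.
move=> df; pose D := shift_data n N.
have E : - n + n = 0 by rewrite addNr.
have E1 : - n + m = 1 by lia.
have d0 : gd (add0r 1) (gcomp E (sd_u D) f) = 0.
  rewrite (gd_comp_closedl _ _ em E1 _ (sd_du D erefl)) df.
  by rewrite (lin0 (gcomp_linr _ _)) scaler0.
have [h hh] := (hprojP P).1 hP _ (@acyclic_shift n N aN) _ d0.
have E2 : n + -1 = n' by lia.
exists (ksgn k n *: gcomp E2 (sd_v D) h).
rewrite (linZ (gd_lin _)).
rewrite (gd_comp_closedl _ _ (addNr 1) (addr0 n) _ (sd_dv D erefl)) ksgn_mulKl -hh.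
by rewrite (gcompA _ _ (subrr n) (add0r n)) sd_vu gcomp1l.
Qed.

Lemma hproj_shiftdata s M C : shiftdata s M C -> hproj M -> hproj C.
Proof.
move=> D hM; apply/hprojP => N aN f df.
have E : 0 + - s = - s by rewrite add0r.
have E1 : 1 + - s = - s + 1 by rewrite addrC.
have E2 : - s - 1 + 1 = - s by rewrite subrK.
have d0 : gd erefl (gcomp E f (sd_u D)) = 0.
  by rewrite (gd_comp_closedr _ _ (add0r 1) E1 _ (sd_du D erefl)) df (lin0 (gcomp_linl _ _)).
have [h hh] := hproj_bound hM aN E2 d0.
have E3 : - s - 1 + s = -1 by lia.
have E4 : - s + s = 0 by rewrite addNr.
exists (gcomp E3 h (sd_v D)).
rewrite (gd_comp_closedr _ _ E2 E4 _ (sd_dv D erefl)) -hh.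
by rewrite -(gcompA E4 (add0r 0)) sd_uv gcomp1r.
Qed.

(** If [s] bounds the restriction of [g] along [co_i], subtracting [d (s q)] makes that restriction
    vanish. The restriction of the remainder along [co_j] is then closed, hence of the form [d t],
    and the remainder itself is [d (t p)]. *)
Lemma hproj_conedata M N (f : gmap M N 0) C :
  conedata f C -> hproj M -> hproj N -> hproj C.
Proof.
move=> D hM hN; apply/hprojP => X aX g dg.
have E00 : 0 + 0 = 0 :> int by [].
have d1 : gd (add0r 1) (gcomp E00 g (co_i D)) = 0.
  by rewrite (gd_comp_closedr _ _ (add0r 1) (addr0 1) _ (co_di D erefl)) dg (lin0 (gcomp_linl _ _)).
have [s hs] := hproj_bound hN aX (addNr 1) d1.
pose g' := g - gd (addNr 1) (gcomp (addr0 _) s (co_q D)).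
have dg' : gd (add0r 1) g' = 0.
  by rewrite /g' (linD (gd_lin _)) (linN (gd_lin _)) dg gdd subrr.
have gi : gcomp E00 g' (co_i D) = 0.
  rewrite /g' (linD (gcomp_linl _ _)) (linN (gcomp_linl _ _)) hs.
  rewrite (gcomp_d _ (addNr 1) (addNr 1) (add0r 1) (addr0 0) (addNr 1)).
  rewrite (linD (gcomp_linl _ _)) (linZ (gcomp_linl _ _)).
  rewrite -(gcompA E00 (addr0 0)) co_qi gcomp1r.
  rewrite -(gcompA (addr0 1) (addNr 1)) (co_dq D _ (add0r 1)).
  rewrite (linN (gcomp_linl _ _)) -(gcompA (addr0 1) (add0r 1)) co_pi.
  by rewrite !(lin0 (gcomp_linr _ _)) oppr0 (lin0 (gcomp_linr _ _)) scaler0 addr0 subrr.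
have E01 : 0 + -1 = -1 :> int by [].
have d2 : gd (addNr 1) (gcomp E01 g' (co_j D)) = 0.
  rewrite (gd_comp_closedl _ _ (addNr 1) E00 _ dg') (co_dj D _ E00).
  by rewrite (gcompA _ _ E00 E00) gi (lin0 (gcomp_linl _ _)) scaler0.
have E2 : -2%:Z + 1 = -1 by [].
have [t ht] := hproj_bound hM aX E2 d2.
have E3 : -2%:Z + 1 = -1 :> int by [].
exists (gcomp (addr0 _) s (co_q D) + gcomp E3 t (co_p D)).
rewrite (linD (gd_lin _)).
rewrite [X in _ = _ + X](gd_comp_closedr _ _ E2 (addNr 1) _ (co_dp D erefl)) -ht.
rewrite -(gcompA (addNr 1) E00).
have -> : gcomp E00 g' (gcomp (addNr 1) (co_j D) (co_p D)) = g'.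
  rewrite -[RHS](gcomp1r E00) -(co_split D E00 (addNr 1)) (linD (gcomp_linr _ _)).
  by rewrite [X in _ = X + _](gcompA _ _ E00 E00) gi (lin0 (gcomp_linl _ _)) add0r.
by rewrite /g' addrC subrK.
Qed.

Lemma hproj_shift s M : hproj M -> hproj (shift s M).
Proof. exact: hproj_shiftdata (shift_data s M). Qed.

Lemma hproj_cone M N (f : bmap M N) : hproj M -> hproj N -> hproj (cone f).
Proof. exact: hproj_conedata (cone_data f). Qed.

Definition dsum_i1 M N : bmap M (dsum M N).
Proof.
refine (@BMap k A B M (dsum M N) (fun b a i x => (x, 0)) _ _ _ _).
- by intros; move=> c x y; rewrite pairZ pairE scaler0 addr0.
- by intros; rewrite /= (lin0 (cd_lin _)).
- by intros; rewrite /= (lin0 (ract_linl _ _)).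
- by intros; rewrite /= (lin0 (lact_linr _ _)).
Defined.

Definition dsum_i2 M N : bmap N (dsum M N).
Proof.
refine (@BMap k A B N (dsum M N) (fun b a i x => (0, x)) _ _ _ _).
- by intros; move=> c x y; rewrite pairZ pairE scaler0 addr0.
- by intros; rewrite /= (lin0 (cd_lin _)).
- by intros; rewrite /= (lin0 (ract_linl _ _)).
- by intros; rewrite /= (lin0 (lact_linr _ _)).
Defined.

Definition dsum_p1 M N : bmap (dsum M N) M.
Proof. by refine (@BMap k A B (dsum M N) M (fun b a i x => x.1) _ _ _ _). Defined.
Definition dsum_p2 M N : bmap (dsum M N) N.
Proof. by refine (@BMap k A B (dsum M N) N (fun b a i x => x.2) _ _ _ _). Defined.

Lemma dsum_split M N (e : 0 + 0 = 0 :> int) :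
  gcomp e (gofb (dsum_i1 M N)) (gofb (dsum_p1 M N))
  + gcomp e (gofb (dsum_i2 M N)) (gofb (dsum_p2 M N)) = gid _.
Proof.
rewrite -!gofb_comp -gofb_id; apply: gmap0P => b a i x; rewrite gmD !gofbE /=.
by rewrite pairE addr0 add0r [RHS]pair_eta.
Qed.

Lemma hproj_dsum M N : hproj M -> hproj N -> hproj (dsum M N).
Proof.
move=> hM hN; apply/hprojP => X aX f df.
have E00 : 0 + 0 = 0 :> int by [].
have d1 L (u : bmap L (dsum M N)) : gd (add0r 1) (gcomp E00 f (gofb u)) = 0.
  by rewrite (gd_comp_closedr _ _ (add0r 1) (addr0 1) _ (gofb_closed u)) df (lin0 (gcomp_linl _ _)).
have [s hs] := hproj_bound hM aX (addNr 1) (d1 _ (dsum_i1 M N)).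
have [t ht] := hproj_bound hN aX (addNr 1) (d1 _ (dsum_i2 M N)).
exists (gcomp (addr0 _) s (gofb (dsum_p1 M N)) + gcomp (addr0 _) t (gofb (dsum_p2 M N))).
rewrite (linD (gd_lin _)).
rewrite (gd_comp_closedr _ _ (addNr 1) E00 _ (gofb_closed (dsum_p1 M N))) -hs.
rewrite (gd_comp_closedr _ _ (addNr 1) E00 _ (gofb_closed (dsum_p2 M N))) -ht.
rewrite -!(gcompA E00 E00) -(linD (gcomp_linr _ _)).
by rewrite dsum_split gcomp1r.
Qed.

Lemma hproj_retract M N (s : bmap M N) (r : bmap N M) :
  homotopic (bcomp r s) (bid M) -> hproj N -> hproj M.
Proof.
move=> rs hN X aX f g.
have H (u : bmap M X) : homotopic (bcomp (bcomp u r) s) u.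
  apply: homotopic_trans (eqb_homotopic _) (homotopic_trans (homotopic_compl u rs) _).
    by [].
  exact: eqb_homotopic.
apply: homotopic_trans (homotopic_sym (H f)) (homotopic_trans _ (H g)).
by apply: homotopic_compr; exact: hN.
Qed.

Section Lift.
Variables (P M N : bimod A B) (w : bmap M N).
Hypotheses (hP : hproj P) (qw : quasi_iso w).
Let D := cone_data w.

(** Followed by the inclusion into the acyclic cone of [w], the map [f] becomes a boundary [d h].
    The component of [h] in [M] is the lift, and the component in [N] is the homotopy. *)
Lemma hproj_lift (f : bmap P N) : exists g : bmap P M, homotopic (bcomp w g) f.
Proof.
have E00 : 0 + 0 = 0 :> int by [].
have d1 : gd (add0r 1) (gcomp E00 (co_i D) (gofb f)) = 0.
  rewrite (gd_comp_closedl _ _ (add0r 1) (add0r 1) _ (co_di D erefl)) gofb_closed.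
  by rewrite (lin0 (gcomp_linr _ _)) scaler0.
have [h hh] := hproj_bound hP (acyclic_cone qw) (addNr 1) d1.
have d2 : gd (add0r 1) (gcomp (subrr 1) (co_p D) h) = 0.
  rewrite (gd_comp_closedl _ _ (addNr 1) (addr0 1) _ (co_dp D erefl)) -hh.
  rewrite (gcompA _ _ (addr0 1) (addr0 1)) co_pi (lin0 (gcomp_linl _ _)).
  by rewrite scaler0.
exists (bofg d2); apply: homotopic_sym; apply/homotopicP.
exists (gcomp (add0r (-1)) (co_q D) h).
rewrite (gofb_comp _ _ E00) gofbK.
rewrite (gcomp_d _ (addNr 1) (add0r 1) (addNr 1) (subrr 1) E00) -hh.
rewrite (co_dq D _ (add0r 1)) (linN (gcomp_linl _ _)) -(gcompA (subrr 1) E00).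
by rewrite [X in _ *: X](gcompA _ _ E00 E00) co_qi gcomp1l ksgn0 scale1r addrC.
Qed.

(** If [w u = d h] for [u = g - g'], then [u] and [- h] are the components of a cocycle of degree -1
    with values in the cone of [w]. The cone is acyclic, and up to sign the component in [M] of a
    primitive bounds [u]. *)
Lemma hproj_inj (g g' : bmap P M) :
  homotopic (bcomp w g) (bcomp w g') -> homotopic g g'.
Proof.
have E00 : 0 + 0 = 0 :> int by [].
move=> /homotopicP[h]; rewrite !(gofb_comp _ _ E00).
rewrite -(linN (gcomp_linr _ _)) -(linD (gcomp_linr _ _)); set u := _ - _ => hh.
have du : gd (add0r 1) u = 0.
  by rewrite (linD (gd_lin _)) (linN (gd_lin _)) !gofb_closed subrr.
apply/homotopicP; rewrite -/u.
pose t := gcomp (addr0 (-1)) (co_j D) u - gcomp (add0r (-1)) (co_i D) h.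
have dt : gd (addNr 1) t = 0.
  rewrite /t (linD (gd_lin _)) (linN (gd_lin _)).
  rewrite (gd_comp_closedr _ _ (addNr 1) E00 _ du) (co_dj D _ E00).
  rewrite (gd_comp_closedl _ _ (addNr 1) E00 _ (co_di D erefl)) -hh ksgn0 scale1r.
  by rewrite -(gcompA E00 E00) subrr.
have E2 : -2%:Z + 1 = -1 by [].
have [s hs] := hproj_bound hP (acyclic_cone qw) E2 dt.
have E3 : 1 + -2%:Z = -1 by [].
exists (- gcomp E3 (co_p D) s); rewrite (linN (gd_lin _)).
rewrite (gd_comp_closedl _ _ E2 (subrr 1) _ (co_dp D erefl)) -hs ksgn1 scaleN1r opprK.
rewrite /t (linD (gcomp_linr _ _)) (linN (gcomp_linr _ _)).
rewrite (gcompA _ _ (subrr 1) E00) co_pj gcomp1l.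
by rewrite (gcompA _ _ (addr0 1) (subrr 1)) co_pi (lin0 (gcomp_linl _ _)) subr0.
Qed.
End Lift.

Definition heq M N : Prop := exists (f : bmap M N) (g : bmap N M),
  homotopic (bcomp g f) (bid M) /\ homotopic (bcomp f g) (bid N).

(** Whitehead's theorem. Lifting the identity of [N] gives a right inverse up to homotopy; it is
    also a left inverse because composition with [w] is injective on homotopy classes. *)
Lemma hproj_qis_inv M N (w : bmap M N) : hproj M -> hproj N -> quasi_iso w ->
  exists g : bmap N M, homotopic (bcomp g w) (bid M) /\ homotopic (bcomp w g) (bid N).
Proof.
move=> hM hN qw; have [g hg] := hproj_lift hN qw (bid N).
exists g; split => //; apply: (hproj_inj hM qw).
apply: homotopic_trans (homotopic_trans (homotopic_compr w hg) _).
  exact: eqb_homotopic.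
exact: eqb_homotopic.
Qed.

Lemma homotopic_qis M N (f g : bmap M N) :
  homotopic f g -> quasi_iso f -> quasi_iso g.
Proof.
case=> h [hl _ _ H] qf b a; have [i1 i2] := qf b a; split=> i j l ei el.
- move=> x y dx gx; apply: (i1 _ _ _ ei el x (y + h b a i j ei x) dx).
  have := H b a i j l ei el x; rewrite dx (lin0 (hl _ _ _ _ _)) addr0 gx.
  by move=> /eqP; rewrite subr_eq => /eqP ->; rewrite [LHS]addrC; rewrite (linD (cd_lin _)).
- move=> y dy; have [x [z [dx ->]]] := i2 _ _ _ ei el y dy.
  exists x, (z + h b a i j ei x); split => //.
  have := H b a i j l ei el x; rewrite dx (lin0 (hl _ _ _ _ _)) addr0.
  move=> /eqP; rewrite subr_eq => /eqP ->; rewrite (linD (cd_lin _)).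
  by rewrite [LHS]addrAC [LHS]addrC; congr (_ + _); rewrite [LHS]addrC.
Qed.

Lemma quasi_iso_comp L M N (g : bmap M N) (f : bmap L M) :
  quasi_iso g -> quasi_iso f -> quasi_iso (bcomp g f).
Proof.
move=> qg qf b a; have [i1 i2] := qf b a; have [j1 j2] := qg b a.
split=> i j l ei el.
- move=> x y dx gx.
  have dfx : cd _ el (f b a i x) = 0 by rewrite -bm_d dx bm0.
  have [z hz] := j1 _ _ _ ei el _ y dfx gx.
  exact: (i1 _ _ _ ei el _ z dx hz).
- move=> y dy; have [x [z [dx ->]]] := j2 _ _ _ ei el y dy.
  have [u [v [du ->]]] := i2 _ _ _ ei el x dx.
  by exists u, (g b a j v + z); split => //; rewrite bmD bm_d (linD (cd_lin _)) addrA.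
Qed.

Lemma quasi_iso_cancell L M N (g : bmap M N) (f : bmap L M) :
  quasi_iso (bcomp g f) -> quasi_iso g -> quasi_iso f.
Proof.
move=> qh qg b a; have [i1 i2] := qh b a; have [j1 j2] := qg b a.
split=> i j l ei el.
- move=> x y dx fx; apply: (i1 _ _ _ ei el x (g b a j y) dx) => /=.
  by rewrite fx bm_d.
- move=> y dy; have dgy : cd _ el (g b a i y) = 0 by rewrite -bm_d dy bm0.
  have [x [z [dx hx]]] := i2 _ _ _ ei el _ dgy.
  have d0 : cd _ el (y - f b a i x) = 0.
    by rewrite (linD (cd_lin _)) (linN (cd_lin _)) dy -bm_d dx bm0 subrr.
  have hz : g b a i (y - f b a i x) = cd _ ei z.
    by rewrite bmD bmN hx /= [LHS]addrC addKr.
  have [u hu] := j1 _ _ _ ei el _ z d0 hz.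
  by exists x, u; split => //; rewrite -hu [RHS]addrC subrK.
Qed.

Lemma quasi_iso_cancelr L M N (g : bmap M N) (f : bmap L M) :
  quasi_iso (bcomp g f) -> quasi_iso f -> quasi_iso g.
Proof.
move=> qh qf b a; have [i1 i2] := qh b a; have [j1 j2] := qf b a.
split=> i j l ei el.
- move=> x y dx gx; have [u [v [du hx]]] := j2 _ _ _ ei el _ dx.
  have hu : g b a i (f b a i u) = cd _ ei (y - g b a j v).
    by rewrite (linD (cd_lin _)) (linN (cd_lin _)) -gx -bm_d hx bmD addrK.
  have [z hz] := i1 _ _ _ ei el u _ du hu.
  by exists (f b a j z + v); rewrite (linD (cd_lin _)) -bm_d -hz.
- move=> y dy; have [x [z [dx ->]]] := i2 _ _ _ ei el _ dy.
  by exists (f b a i x), z; split => //; rewrite -bm_d dx bm0.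
Qed.

Lemma quasi_iso_id M : quasi_iso (bid M).
Proof.
move=> b a; split=> i j l ei el; first by move=> x y _ xy; exists y.
by move=> y dy; exists y, 0; rewrite (lin0 (cd_lin _)) addr0.
Qed.

Lemma heq_qis M N (f : bmap M N) (g : bmap N M) :
  homotopic (bcomp g f) (bid M) -> homotopic (bcomp f g) (bid N) -> quasi_iso f.
Proof.
move=> gf fg.
have q1 := homotopic_qis (homotopic_sym gf) (quasi_iso_id M).
have q2 := homotopic_qis (homotopic_sym fg) (quasi_iso_id N).
move=> b a; have [i1 i2] := q1 b a; have [j1 j2] := q2 b a.
split=> i j l ei el.
- move=> x y dx fx; apply: (i1 _ _ _ ei el x (g b a j y) dx) => /=.
  by rewrite fx bm_d.
- move=> y dy; have [x [z [dx ->]]] := j2 _ _ _ ei el _ dy.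
  by exists (g b a i x), z; split => //; rewrite -bm_d dx bm0.
Qed.

Lemma quasi_iso_bij M N (f : bmap M N) (g : forall b a i, bc N b a i -> bc M b a i) :
  (forall b a i x, g b a i (f b a i x) = x) ->
  (forall b a i y, f b a i (g b a i y) = y) -> quasi_iso f.
Proof.
move=> gf fg b a; split=> i j l ei el.
- move=> x y dx fx; exists (g b a j y).
  by rewrite -[LHS]gf fx -[in LHS](fg _ _ _ y) -bm_d gf.
- move=> y dy; exists (g b a i y), 0; rewrite fg (lin0 (cd_lin _)) addr0.
  by split=> //; rewrite -[LHS]gf bm_d fg dy -[RHS]gf bm0.
Qed.
End Acyclic.

(** * Morphisms of the derived category *)

Section DerivedHom.
Variables (k : comPzRingType) (A B : dgcat k).
Implicit Types L M N P : bimod A B.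

(** The action of a morphism of the derived category on the homotopy classes
    [K(P, -)], as a relation. *)
Fixpoint Ev P M N (z : Dhom M N) : bmap P M -> bmap P N -> Prop :=
  match z with
  | Dof _ _ f => fun u v => homotopic v (bcomp f u)
  | Dinv _ _ w _ => fun u v => homotopic (bcomp w v) u
  | Dcomp _ _ _ g f => fun u v => exists t, Ev f u t /\ Ev g t v
  end.

Section HProj.
Variables (P : bimod A B) (hP : hproj P).

Lemma Ev_total M N (z : Dhom M N) (u : bmap P M) : exists v, Ev z u v.
Proof.
elim: z u => {M N} [M N f|M N w qw|L M N g IHg f IHf] u /=.
- by exists (bcomp f u); exact: homotopic_refl.
- exact: hproj_lift.
- have [t ht] := IHf u; have [v hv] := IHg t.
  by exists v, t.
Qed.

Lemma Ev_homotopic M N (z : Dhom M N) (u u' : bmap P M) (v v' : bmap P N) :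
  homotopic u u' -> homotopic v v' -> Ev z u v -> Ev z u' v'.
Proof.
elim: z u u' v v' => {M N} [M N f|M N w qw|L M N g IHg f IHf] u u' v v' hu hv /=.
- move=> h; apply: homotopic_trans (homotopic_sym hv) (homotopic_trans h _).
  exact: homotopic_compl.
- move=> h; apply: homotopic_trans (homotopic_trans h hu).
  exact: homotopic_sym (homotopic_compl w hv).
- case=> t [h1 h2]; exists t; split.
    exact: IHf hu (homotopic_refl t) h1.
  exact: IHg (homotopic_refl t) hv h2.
Qed.

(** A formal inverse acts by lifting along [w], and its two defining relations hold because lifts
    from [P] exist and are unique up to homotopy. This identifies derived morphisms out of [P] with
    homotopy classes, without a calculus of fractions. *)
Lemma Ev_Deq M N (z z' : Dhom M N) : Deq z z' ->
  forall (u : bmap P M) (v : bmap P N), Ev z u v <-> Ev z' u v.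
Proof.
elim=> {M N z z'}.
- by [].
- by move=> M N f g _ IH u v; rewrite IH.
- by move=> M N f g h _ IH _ IH' u v; rewrite IH.
- by move=> L M N g g' f f' _ IHg _ IHf u v /=; split=> -[t [/IHf h1 /IHg h2]];
    exists t.
- move=> K L M N h g f u v /=; split.
    by case=> t [[s [h1 h2]] h3]; exists s; split=> //; exists t.
  by case=> s [h1 [t [h2 h3]]]; exists t; split=> //; exists s.
- move=> M N f u v /=; split.
    case=> t [h1 h2]; apply: Ev_homotopic h1; first exact: homotopic_refl.
    by apply: homotopic_sym; apply: homotopic_trans h2 _; exact: eqb_homotopic.
  by move=> h; exists v; split=> //; exact: eqb_homotopic.
- move=> M N f u v /=; split.
    case=> t [h1 h2]; apply: Ev_homotopic h2; last exact: homotopic_refl.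
    by apply: homotopic_trans h1 _; exact: eqb_homotopic.
  by move=> h; exists u; split=> //; exact: eqb_homotopic.
- move=> M N f g fg u v /=; split=> h; apply: (homotopic_trans h).
    exact: homotopic_compr.
  by apply: homotopic_compr; exact: homotopic_sym.
- move=> L M N g f u v /=; split.
    case=> t [h1 h2]; apply: homotopic_trans h2 _.
    by apply: homotopic_trans (homotopic_compl g h1) _; exact: eqb_homotopic.
  move=> h; exists (bcomp f u); split; first exact: homotopic_refl.
  by apply: homotopic_trans h _; exact: eqb_homotopic.
- move=> M N w qw u v /=; split.
    case=> t [h1 h2]; apply: homotopic_trans h2 _; apply: homotopic_trans h1 _.
    exact: eqb_homotopic.
  move=> h; have [t ht] := hproj_lift hP qw u.
  exists t; split=> //; apply: homotopic_trans h _.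
  by apply: homotopic_sym; apply: homotopic_trans ht _; exact: eqb_homotopic.
- move=> M N w qw u v /=; split.
    case=> t [h1 h2]; apply: homotopic_trans (_ : homotopic u _); last first.
      exact: eqb_homotopic.
    by apply: (hproj_inj hP qw); exact: homotopic_trans h2 h1.
  move=> h; exists (bcomp w u); split; first exact: homotopic_refl.
  apply: homotopic_compl; apply: homotopic_trans h _; exact: eqb_homotopic.
Qed.
End HProj.

Lemma Ev_Dcomp P M N (z : Dhom M N) (u : bmap P M) (v : bmap P N) :
  Ev z u v -> Deq (Dcomp z (Dof u)) (Dof v).
Proof.
elim: z u v => {M N} [M N f|M N w qw|L M N g IHg f IHf] u v /=.
- by move=> h; apply: Deq_trans (Deq_comp _ _) (Deq_htpy (homotopic_sym h)).
- move=> h; apply: Deq_trans (_ : Deq (Dcomp (Dinv qw) (Dcomp (Dof w) (Dof v))) _).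
    apply: Deq_congr (Deq_refl _) _.
    exact: Deq_trans (Deq_htpy (homotopic_sym h)) (Deq_sym (Deq_comp _ _)).
  apply: Deq_trans (Deq_assoc _ _ _) _.
  apply: Deq_trans (Deq_congr (Deq_invl qw) (Deq_refl _)) _.
  exact: Deq_1l.
- case=> t [h1 h2]; apply: Deq_trans (Deq_sym (Deq_assoc _ _ _)) _.
  apply: Deq_trans (Deq_congr (Deq_refl _) (IHf _ _ h1)) _.
  exact: IHg.
Qed.

(** Both morphisms are evaluated on the identity of [M], which is possible because [M] itself is
    h-projective. *)
Lemma Deq_homotopic M N (f g : bmap M N) :
  hproj M -> Deq (Dof f) (Dof g) -> homotopic f g.
Proof.
move=> hM fg; have := (Ev_Deq hM fg (bid M) f).1 => /= H.
apply: homotopic_trans (H _) _; first exact: eqb_homotopic.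
exact: eqb_homotopic.
Qed.

Lemma Dhom_hproj M N (z : Dhom M N) : hproj M -> exists f, Deq z (Dof f).
Proof.
move=> hM; have [v hv] := Ev_total hM z (bid M); exists v.
apply: Deq_trans (Ev_Dcomp hv); apply: Deq_sym; exact: Deq_1r.
Qed.

Lemma Diso_refl M : Diso M M.
Proof. by exists (Did M), (Did M); split; exact: Deq_1l. Qed.

Lemma Diso_sym M N : Diso M N -> Diso N M.
Proof. by case=> f [g [h1 h2]]; exists g, f. Qed.

Lemma Dinverse_comp L M N (g : Dhom M N) (g' : Dhom N M) (f : Dhom L M)
    (f' : Dhom M L) :
  Dinverse g g' -> Dinverse f f' -> Dinverse (Dcomp g f) (Dcomp f' g').
Proof.
have key X Y Z (a : Dhom X Y) (a' : Dhom Y X) (c : Dhom Z X) (c' : Dhom X Z) :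
    Deq (Dcomp a' a) (Did X) -> Deq (Dcomp c' c) (Did Z) ->
    Deq (Dcomp (Dcomp c' a') (Dcomp a c)) (Did Z).
  move=> h1 h2; apply: Deq_trans (Deq_sym (Deq_assoc _ _ _)) _.
  apply: Deq_trans (Deq_congr (Deq_refl _) (Deq_assoc _ _ _)) _.
  apply: Deq_trans (Deq_congr (Deq_refl _) (Deq_congr h1 (Deq_refl _))) _.
  exact: Deq_trans (Deq_congr (Deq_refl _) (Deq_1l _)) h2.
by move=> [g1 g2] [f1 f2]; split; exact: key.
Qed.

Lemma Diso_trans L M N : Diso L M -> Diso M N -> Diso L N.
Proof.
case=> f [f' hf] [g [g' hg]]; exists (Dcomp g f), (Dcomp f' g').
exact: Dinverse_comp.
Qed.

Lemma qis_Dinverse M N (w : bmap M N) (qw : quasi_iso w) :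
  Dinverse (Dof w) (Dinv qw).
Proof. by split; [exact: Deq_invl|exact: Deq_invr]. Qed.

Lemma qis_Diso M N (w : bmap M N) : quasi_iso w -> Diso M N.
Proof. by move=> qw; exists (Dof w), (Dinv qw); exact: qis_Dinverse. Qed.

Lemma heq_Diso M N : heq M N -> Diso M N.
Proof. by case=> f [g [gf fg]]; exact: qis_Diso (heq_qis gf fg). Qed.

Lemma Dinverse_homotopic M N (f : bmap M N) (g : bmap N M) :
  hproj M -> hproj N -> Dinverse (Dof f) (Dof g) ->
  homotopic (bcomp g f) (bid M) /\ homotopic (bcomp f g) (bid N).
Proof.
move=> hM hN [h1 h2]; split; apply: Deq_homotopic => //.
  exact: Deq_trans (Deq_sym (Deq_comp _ _)) h1.
exact: Deq_trans (Deq_sym (Deq_comp _ _)) h2.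
Qed.

Lemma Diso_heq M N : hproj M -> hproj N -> Diso M N -> heq M N.
Proof.
move=> hM hN [f [g [gf fg]]].
have [u hu] := Dhom_hproj f hM; have [v hv] := Dhom_hproj g hN.
exists u, v; apply: Dinverse_homotopic => //; split.
  exact: Deq_trans (Deq_congr (Deq_sym hv) (Deq_sym hu)) gf.
exact: Deq_trans (Deq_congr (Deq_sym hu) (Deq_sym hv)) fg.
Qed.

End DerivedHom.

Section Functors.
Variables (k : comPzRingType) (A B C D : dgcat k).

(** The functor extends to formal composites by recursion, an inverted quasi-isomorphism going to an
    inverted quasi-isomorphism; the extension respects each generator of [Deq], so it preserves
    isomorphisms. *)
Lemma Diso_functor (F : bimod A B -> bimod C D)
    (Fm : forall M N, bmap M N -> bmap (F M) (F N)) :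
  (forall M, homotopic (Fm M M (bid M)) (bid (F M))) ->
  (forall L M N (g : bmap M N) (f : bmap L M),
     homotopic (Fm _ _ (bcomp g f)) (bcomp (Fm _ _ g) (Fm _ _ f))) ->
  (forall M N (f g : bmap M N), homotopic f g -> homotopic (Fm _ _ f) (Fm _ _ g)) ->
  (forall M N (w : bmap M N), quasi_iso w -> quasi_iso (Fm _ _ w)) ->
  forall M N, Diso M N -> Diso (F M) (F N).
Proof.
move=> Fid Fcomp Fhtpy Fqis.
pose FD := fix FD M N (z : Dhom M N) : Dhom (F M) (F N) :=
  match z with
  | Dof _ _ f => Dof (Fm _ _ f)
  | Dinv _ _ w qw => Dinv (Fqis _ _ w qw)
  | Dcomp _ _ _ g f => Dcomp (FD _ _ g) (FD _ _ f)
  end.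
have FD_eq M N (z z' : Dhom M N) : Deq z z' -> Deq (FD _ _ z) (FD _ _ z').
  elim=> {M N z z'} /=.
  - by move=> *; exact: Deq_refl.
  - by move=> *; exact: Deq_sym.
  - by move=> M N f g h _ h1 _ h2; exact: Deq_trans h1 h2.
  - by move=> *; exact: Deq_congr.
  - by move=> *; exact: Deq_assoc.
  - move=> M N f; apply: Deq_trans (Deq_1l _); apply: Deq_congr (Deq_refl _).
    exact: Deq_htpy (Fid _).
  - move=> M N f; apply: Deq_trans (Deq_1r _); apply: Deq_congr; first exact: Deq_refl.
    exact: Deq_htpy (Fid _).
  - by move=> M N f g fg; exact: Deq_htpy (Fhtpy _ _ _ _ fg).
  - move=> L M N g f; apply: Deq_trans (Deq_comp _ _) _.
    exact: Deq_htpy (homotopic_sym (Fcomp _ _ _ _ _)).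
  - move=> M N w qw; apply: Deq_trans (Deq_invr _) (Deq_htpy _).
    exact: homotopic_sym (Fid _).
  - move=> M N w qw; apply: Deq_trans (Deq_invl _) (Deq_htpy _).
    exact: homotopic_sym (Fid _).
move=> M N [f [g [gf fg]]]; exists (FD _ _ f), (FD _ _ g); split.
  exact: Deq_trans (FD_eq _ _ _ _ gf) (Deq_htpy (Fid _)).
exact: Deq_trans (FD_eq _ _ _ _ fg) (Deq_htpy (Fid _)).
Qed.
End Functors.

(** * The five lemma for cones *)

Lemma five_rearrange (V : zmodType) (x y z s t : V) :
  y + z + s = x + y + z + (s - t) + t - x.
Proof.
have -> : x + y + z + (s - t) + t = x + (y + z + s) by rewrite !addrA subrK.
by rewrite [RHS]addrAC subrr add0r.
Qed.

Section ConeChase.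
Variables (k : comPzRingType) (A B : dgcat k).
Implicit Types M N P C X : bimod A B.

Section Elements.
Variables (M N C : bimod A B) (f : bmap M N) (D : conedata (gofb f) C).

Definition cfi b a i (n : bc N b a i) : bc C b a i := gm (co_i D) (addr0 i) n.
Definition cfq b a i (x : bc C b a i) : bc N b a i := gm (co_q D) (addr0 i) x.
Definition cfj b a i j (e : j + 1 = i) (m : bc M b a i) : bc C b a j :=
  gm (co_j D) (etrans (congr1 (fun l => l + -1) (esym e)) (addrK 1 j)) m.
Definition cfp b a i j (e : i + 1 = j) (x : bc C b a i) : bc M b a j :=
  gm (co_p D) e x.

Lemma cfjE b a i j (e : j + 1 = i) (e' : i + -1 = j) (m : bc M b a i) :
  gm (co_j D) e' m = cfj e m.
Proof. exact: gm_irr. Qed.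

Lemma cf_qi b a i (n : bc N b a i) : cfq (cfi n) = n.
Proof.
have := congr1 (fun g => gm g (addr0 i) n) (co_qi D (addr0 0)).
by rewrite (gcompE _ _ _ _ (addr0 i) (addr0 i)) gidE.
Qed.
Lemma cf_pj b a i j (e : j + 1 = i) (m : bc M b a i) : cfp e (cfj e m) = m.
Proof.
have := congr1 (fun g => gm g (addr0 i) m) (co_pj D (subrr 1)).
have E : i + -1 = j by rewrite -e addrK.
by rewrite (gcompE _ _ _ _ E e) gidE (cfjE e).
Qed.
Lemma cf_pi b a i j (e : i + 1 = j) (n : bc N b a i) : cfp e (cfi n) = 0.
Proof.
have := congr1 (fun g => gm g e n) (co_pi D (addr0 1)).
by rewrite (gcompE _ _ _ _ (addr0 i) e).
Qed.
Lemma cf_split b a i j (e : i + 1 = j) (x : bc C b a i) :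
  cfi (cfq x) + cfj e (cfp e x) = x.
Proof.
have := congr1 (fun g => gm g (addr0 i) x) (co_split D (addr0 0) (addNr 1)).
have E : j + -1 = i by rewrite -e addrK.
rewrite gmD (gcompE _ _ _ _ (addr0 i) (addr0 i)) (gcompE _ _ _ _ e E) gidE.
by rewrite (cfjE e).
Qed.
Lemma cf_di b a i j (e : i + 1 = j) (n : bc N b a i) :
  cd _ e (cfi n) = cfi (cd _ e n).
Proof.
have := congr1 (fun g => gm g e n) (co_di D erefl).
rewrite (gdE _ _ _ (addr0 i) e e (addr0 j)) ksgn0 scale1r => /eqP.
by rewrite subr_eq0 => /eqP.
Qed.
Lemma cf_dp b a i j l (e : i + 1 = j) (e' : j + 1 = l) (x : bc C b a i) :
  cfp e' (cd _ e x) = - cd _ e' (cfp e x).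
Proof.
have E : i + (1 + 1) = l by rewrite addrA e.
have := congr1 (fun g => gm g E x) (co_dp D erefl).
rewrite (gdE _ _ _ e e' e e') ksgn1 scaleN1r opprK => /eqP.
by rewrite addrC addr_eq0 => /eqP.
Qed.
Lemma cf_dj b a i j l (e : j + 1 = i) (e' : i + 1 = l) (m : bc M b a i) :
  cd _ e (cfj e m) = cfi (f b a i m) - cfj e' (cd _ e' m).
Proof.
have := congr1 (fun g => gm g (addr0 i) m) (co_dj D (addNr 1) (addr0 0)).
have E : i + -1 = j by rewrite -e addrK.
have E1 : l + -1 = i by rewrite -e' addrK.
rewrite (gdE _ _ _ E e e' E1) (gcompE _ _ _ _ (addr0 i) (addr0 i)) gofbE.
rewrite ksgnN1 scaleN1r opprK (cfjE e) (cfjE e') => /eqP.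
by rewrite eq_sym -subr_eq => /eqP ->.
Qed.
Lemma cfi_lin b a i : linear (@cfi b a i). Proof. exact: gm_lin. Qed.
Lemma cfj_lin b a i j (e : j + 1 = i) : linear (@cfj b a i j e).
Proof. exact: gm_lin. Qed.
Lemma cfp_lin b a i j (e : i + 1 = j) : linear (@cfp b a i j e).
Proof. exact: gm_lin. Qed.
Lemma cfi_inj b a i (n n' : bc N b a i) : cfi n = cfi n' -> n = n'.
Proof. by move=> h; rewrite -[n]cf_qi h cf_qi. Qed.
Lemma cf_ker b a i j (e : i + 1 = j) (x : bc C b a i) :
  cfp e x = 0 -> x = cfi (cfq x).
Proof. by move=> h; rewrite -[LHS](cf_split e) h (lin0 (cfj_lin _)) addr0. Qed.
End Elements.
Arguments cfi_lin {M N C f} D {b a i}.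
Arguments cfj_lin {M N C f} D {b a i j} e.
Arguments cfp_lin {M N C f} D {b a i j} e.

Section Five.
Variables (M N C M' N' C' : bimod A B) (f : bmap M N) (f' : bmap M' N').
Variables (D : conedata (gofb f) C) (D' : conedata (gofb f') C').
Variables (u : bmap M M') (v : bmap N N') (t : bmap C C').
Hypothesis ti : forall b a i (n : bc N b a i), t b a i (cfi D n) = cfi D' (v b a i n).
Hypothesis pt : forall b a i j (e : i + 1 = j) (x : bc C b a i),
  cfp D' e (t b a i x) = u b a j (cfp D e x).
Hypotheses (qu : quasi_iso u) (qv : quasi_iso v).

(** The assumptions on [t] involve only the inclusions and the projections of the triangles. So [t]
    may mix the two splittings, as it does when it contains a homotopy, and the long exact sequence
    is replaced by a chase on elements. *)
Lemma conedata_qis : quasi_iso t.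
Proof.
move=> b a; split=> i j l ei el.
- move=> x y dx tx; subst i.
  have dm : cd _ erefl (cfp D el x) = 0.
    by apply/eqP; rewrite -oppr_eq0 -(cf_dp D el erefl) dx (lin0 (cfp_lin _ _)).
  have um : u b a l (cfp D el x) = cd _ el (- cfp D' erefl y).
    by rewrite -pt tx (cf_dp D' erefl el) (linN (cd_lin _)).
  have [z mz] := (qu b a).1 _ _ _ el erefl _ _ dm um.
  (* Since [p x = d z] and [p (d (j z)) = - d z], this cohomologous cocycle comes from [N]. *)
  pose x1 := x + cd _ erefl (cfj D erefl z).
  have px1 : cfp D el x1 = 0.
    by rewrite (linD (cfp_lin _ _)) mz (cf_dp D erefl el) cf_pj subrr.
  have dx1 : cd _ el x1 = 0 by rewrite (linD (cd_lin _)) cdd dx addr0.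
  pose n := cfq D x1; have x1n : x1 = cfi D n by exact: cf_ker px1.
  have dn : cd _ el n = 0.
    by apply: (cfi_inj (D := D)); rewrite -cf_di -x1n dx1 (lin0 (cfi_lin _)).
  pose y1 := y + t b a j (cfj D erefl z).
  have dy1 : cd _ erefl y1 = cfi D' (v b a _ n).
    by rewrite (linD (cd_lin _)) -bm_d -tx -bmD -ti -x1n.
  have dm1 : cd _ el (cfp D' erefl y1) = 0.
    by apply/eqP; rewrite -oppr_eq0 -(cf_dp D' erefl el) dy1 cf_pi.
  have [m2 [z' [dm2 hm2]]] := (qu b a).2 _ _ _ erefl el _ dm1.
  have Ej : j - 1 + 1 = j by rewrite subrK.
  (* The class of [p' y1] is that of [u m2]. Removing [t (j m2)] and correcting by a boundary leaves
     an element of [N'], at the price of replacing [n] by [n - f m2]. *)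
  pose y2 := y1 + cd _ Ej (cfj D' Ej z') - t b a j (cfj D erefl m2).
  have py2 : cfp D' erefl y2 = 0.
    rewrite (linD (cfp_lin _ _)) (linN (cfp_lin _ _)) (linD (cfp_lin _ _)).
    by rewrite (cf_dp D' Ej erefl) cf_pj hm2 [X in X - _]addrK pt cf_pj subrr.
  have y2n := cf_ker py2.
  have dn' : v b a _ (n - f b a _ m2) = cd _ erefl (cfq D' y2).
    apply: (cfi_inj (D := D')).
    rewrite -cf_di -y2n (linD (cd_lin _)) (linN (cd_lin _)) (linD (cd_lin _)) cdd.
    rewrite addr0 dy1 -bm_d (cf_dj _ _ el) dm2 (lin0 (cfj_lin _ _)) subr0 ti.
    by rewrite bmD bmN (linD (cfi_lin _)) (linN (cfi_lin _)).
  have dnf : cd _ el (n - f b a _ m2) = 0.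
    by rewrite (linD (cd_lin _)) (linN (cd_lin _)) dn -bm_d dm2 bm0 subrr.
  have [n2 hn2] := (qv b a).1 _ _ _ erefl el _ _ dnf dn'.
  exists (cfj D erefl m2 + cfi D n2 - cfj D erefl z).
  rewrite (linD (cd_lin _)) (linN (cd_lin _)) (linD (cd_lin _)) cf_di -hn2.
  rewrite [cd _ _ (cfj D erefl m2)](cf_dj _ _ el) dm2 (lin0 (cfj_lin _ _)) subr0.
  rewrite -(linD (cfi_lin _)) [X in cfi D X]addrC subrK -x1n.
  by rewrite [RHS]addrK.
- move=> y dy; subst i.
  have dm : cd _ erefl (cfp D' el y) = 0.
    by apply/eqP; rewrite -oppr_eq0 -(cf_dp D' el erefl) dy (lin0 (cfp_lin _ _)).
  have [m [z [dm' hm]]] := (qu b a).2 _ _ _ el erefl _ dm.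
  pose y1 := y + cd _ erefl (cfj D' erefl z).
  have py1 : cfp D' el y1 = u b a _ m.
    by rewrite (linD (cfp_lin _ _)) hm (cf_dp D' erefl el) cf_pj [LHS]addrK.
  pose y2 := y1 - t b a _ (cfj D el m).
  have py2 : cfp D' el y2 = 0.
    by rewrite (linD (cfp_lin _ _)) (linN (cfp_lin _ _)) py1 pt cf_pj subrr.
  have y2n := cf_ker py2.
  have dn' : v b a _ (- f b a _ m) = cd _ el (cfq D' y2).
    apply: (cfi_inj (D := D')).
    rewrite -cf_di -y2n (linD (cd_lin _)) (linN (cd_lin _)) (linD (cd_lin _)) cdd.
    rewrite dy addr0 -bm_d (cf_dj _ _ erefl) dm' (lin0 (cfj_lin _ _)) subr0 ti.
    by rewrite bmN (linN (cfi_lin _)) sub0r.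
  have dfm : cd _ erefl (- f b a _ m) = 0.
    by rewrite (linN (cd_lin _)) -bm_d dm' bm0 oppr0.
  have [n0 hn0] := (qv b a).1 _ _ _ el erefl _ _ dfm dn'.
  (* As [- f m = d n0], this completes [m] to a cocycle of the cone; what is left of [y] then comes
     from a cocycle of [N']. *)
  pose x0 := cfj D el m + cfi D n0.
  have dx0 : cd _ el x0 = 0.
    rewrite (linD (cd_lin _)) (cf_dj _ _ erefl) dm' (lin0 (cfj_lin _ _)) subr0.
    by rewrite cf_di -hn0 (linN (cfi_lin _)) subrr.
  have dn1 : cd _ el (cfq D' y2 - v b a _ n0) = 0.
    by rewrite (linD (cd_lin _)) (linN (cd_lin _)) -dn' -bm_d -hn0 subrr.
  have [n1 [n2 [dn1' hn1]]] := (qv b a).2 _ _ _ erefl el _ dn1.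
  exists (x0 + cfi D n1), (cfi D' n2 - cfj D' erefl z); split.
    by rewrite (linD (cd_lin _)) dx0 cf_di dn1' (lin0 (cfi_lin _)) addr0.
  have hy : y2 = t b a _ (cfi D n0) + t b a _ (cfi D n1) + cd _ erefl (cfi D' n2).
    rewrite [LHS]y2n cf_di !ti -!(linD (cfi_lin _)); congr (cfi D' _).
    by rewrite -[RHS]addrA -hn1 addrC subrK.
  rewrite (linD (cd_lin _)) (linN (cd_lin _)) !bmD.
  apply: (addIr (cd _ erefl (cfj D' erefl z))); rewrite -/y1.
  apply: (addIr (- t b a _ (cfj D el m))); rewrite -/y2 hy.
  exact: five_rearrange.
Qed.
End Five.

End ConeChase.
Arguments cfi_lin {k A B M N C f} D {b a i}.
Arguments cfj_lin {k A B M N C f} D {b a i j} e.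
Arguments cfp_lin {k A B M N C f} D {b a i j} e.

(** * Thick subcategories and dg-functors *)

Section ThickClosure.
Variables (k : comPzRingType) (A B : dgcat k).
Implicit Types M N P C X : bimod A B.

(** The map [i' q + j' p] is the identity read in the two splittings, and it is closed because both
    cones are twisted by the same [f]. *)
Lemma conedata_Diso M N (f : bmap M N) C (D : conedata (gofb f) C) :
  Diso C (cone f).
Proof.
pose D' := cone_data f.
pose g := gcomp (addr0 0) (co_i D') (co_q D) + gcomp (addNr 1) (co_j D') (co_p D).
have dg : gd (add0r 1) g = 0.
  rewrite (linD (gd_lin _)).
  rewrite (gd_comp_closedl _ _ (add0r 1) (add0r 1) _ (co_di D' erefl)).
  rewrite (gd_comp_closedr _ _ (addNr 1) (add0r 1) _ (co_dp D erefl)).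
  rewrite ksgn0 scale1r (co_dq D _ (add0r 1)) (co_dj D' _ (addr0 0)).
  by rewrite (linN (gcomp_linr _ _)) (gcompA _ _ (addr0 0) (add0r 1)) addNr.
have gE b a i j (e : i + 1 = j) (x : bc C b a i) :
    bofg dg b a i x = cfi D' (cfq D x) + cfj D' e (cfp D e x).
  have E : j + -1 = i by rewrite -e addrK.
  rewrite bofgE gmD (gcompE _ _ _ _ (addr0 i) (addr0 i)) (gcompE _ _ _ _ e E).
  by rewrite (cfjE D' e).
apply: (@qis_Diso _ _ _ _ _ (bofg dg)).
apply: (conedata_qis (D := D) (D' := D') (u := bid M) (v := bid N)).
- move=> b a i n; rewrite (gE _ _ _ _ erefl) cf_qi cf_pi.
  by rewrite (lin0 (cfj_lin _ _)) addr0.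
- move=> b a i j e x; rewrite (gE _ _ _ _ e) (linD (cfp_lin _ _)).
  by rewrite cf_pi cf_pj add0r.
- exact: quasi_iso_id.
- exact: quasi_iso_id.
Qed.

Lemma shiftdata_Diso s M C (D : shiftdata s M C) : Diso C (shift s M).
Proof.
pose D' := shift_data s M.
have E : - s + s = 0 by rewrite addNr.
have E' : s + - s = 0 by rewrite subrr.
have cl X Y (D1 : shiftdata s M X) (D2 : shiftdata s M Y) :
    gd (add0r 1) (gcomp E (sd_u D1) (sd_v D2)) = 0.
  have E1 : - s + (s + 1) = 1 by rewrite addKr.
  rewrite (gd_comp_closedl _ _ erefl E1 _ (sd_du D1 erefl)) sd_dv.
  by rewrite (lin0 (gcomp_linr _ _)) scaler0.
have inv X Y (D1 : shiftdata s M X) (D2 : shiftdata s M Y) :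
    homotopic (bcomp (bofg (cl _ _ D1 D2)) (bofg (cl _ _ D2 D1))) (bid X).
  apply/homotopicP; exists 0; rewrite (lin0 (gd_lin _)) (gofb_comp _ _ (addr0 0)).
  rewrite !gofbK gofb_id -(gcompA (addr0 s) E).
  rewrite [X in gcomp E _ X](gcompA _ _ E' (add0r s)) sd_vu gcomp1l sd_uv.
  by rewrite subrr.
apply: heq_Diso; exists (bofg (cl _ _ D' D)), (bofg (cl _ _ D D')).
by split; exact: inv.
Qed.

Definition bzero M N : bmap M N.
Proof.
refine (@BMap k A B M N (fun b a i x => 0) _ _ _ _).
- by intros; exact: lin_zero.
- by intros; rewrite (lin0 (cd_lin _)).
- by intros; rewrite (lin0 (ract_linl _ _)).
- by intros; rewrite (lin0 (lact_linr _ _)).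
Defined.

Lemma gofb0 M N : gofb (bzero M N) = 0.
Proof. by apply: gmap0P => b a i x; rewrite gofbE. Qed.

Definition contractible M : Prop := homotopic (bid M) (bzero M M).

(** [Dhom] consists of formal composites and carries no addition. That a composite with a zero map
    is again a zero map is therefore shown by induction on the formal composite, from either
    side. *)
Lemma contractible_Dzero M : contractible M -> Dzero M.
Proof.
move=> c; have D0 : Deq (Did M) (Dof (bzero M M)) by exact: Deq_htpy.
have key X Y (f g : bmap X Y) : gofb f = 0 -> gofb g = 0 -> Deq (Dof f) (Dof g).
  move=> f0 g0; apply: Deq_htpy; apply/homotopicP; exists 0.
  by rewrite f0 g0 subrr (lin0 (gd_lin _)).
have out N (f : Dhom M N) : Deq f (Dcomp f (Dof (bzero M M))).
  by apply: Deq_trans (Deq_sym (Deq_1r f)) (Deq_congr (Deq_refl _) D0).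
have into N (f : Dhom N M) : Deq f (Dcomp (Dof (bzero M M)) f).
  by apply: Deq_trans (Deq_sym (Deq_1l f)) (Deq_congr D0 (Deq_refl _)).
have zr X Y Z (f : Dhom Y Z) :
    Deq (Dcomp f (Dof (bzero X Y))) (Dof (bzero X Z)).
  elim: f X => {Y Z} [Y Z f|Y Z w qw|W Y Z g IHg f IHf] X.
  - apply: Deq_trans (Deq_comp _ _) (key _ _ _ _ _ _); last exact: gofb0.
    by apply: gmap0P => b a i x; rewrite gofbE /= bm0.
  - apply: Deq_trans (Deq_congr (Deq_refl _) _) _; last first.
      apply: Deq_trans (Deq_assoc _ _ _) _.
      exact: Deq_trans (Deq_congr (Deq_invl qw) (Deq_refl _)) (Deq_1l _).
    apply: Deq_trans (_ : Deq _ (Dof (bcomp w (bzero X Y)))) (Deq_sym (Deq_comp _ _)).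
    apply: key; first exact: gofb0.
    by apply: gmap0P => b a i x; rewrite gofbE /= bm0.
  - apply: Deq_trans (Deq_sym (Deq_assoc _ _ _)) _.
    exact: Deq_trans (Deq_congr (Deq_refl _) (IHf X)) (IHg X).
have zl X Y Z (f : Dhom X Y) :
    Deq (Dcomp (Dof (bzero Y Z)) f) (Dof (bzero X Z)).
  elim: f Z => {X Y} [X Y f|Y X w qw|W X Y g IHg f IHf] Z.
  - apply: Deq_trans (Deq_comp _ _) (key _ _ _ _ _ _); last exact: gofb0.
    by apply: gmap0P => b a i x; rewrite gofbE.
  - apply: Deq_trans (Deq_congr _ (Deq_refl _)) _; last first.
      apply: Deq_trans (Deq_sym (Deq_assoc _ _ _)) _.
      exact: Deq_trans (Deq_congr (Deq_refl _) (Deq_invr qw)) (Deq_1r _).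
    apply: Deq_trans (_ : Deq _ (Dof (bcomp (bzero X Z) w))) (Deq_sym (Deq_comp _ _)).
    apply: key; first exact: gofb0.
    by apply: gmap0P => b a i x; rewrite gofbE.
  - apply: Deq_trans (Deq_assoc _ _ _) _.
    exact: Deq_trans (Deq_congr (IHg Z) (Deq_refl _)) (IHf Z).
split=> N f g.
  apply: Deq_trans (out _ f) (Deq_trans (zr _ _ _ f) _).
  exact: Deq_trans (Deq_sym (zr _ _ _ g)) (Deq_sym (out _ g)).
apply: Deq_trans (into _ f) (Deq_trans (zl _ _ _ f) _).
exact: Deq_trans (Deq_sym (zl _ _ _ g)) (Deq_sym (into _ g)).
Qed.

Lemma Dzero_contractible M P : hproj P -> Diso P M -> Dzero M -> contractible P.
Proof.
move=> hP [f [g [gf _]]] [z _]; apply: Deq_homotopic => //.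
apply: Deq_trans (Deq_sym gf) (Deq_trans (Deq_congr _ (Deq_refl f)) _).
  exact: (z _ g (Dcomp (Dof (bzero P P)) g)).
apply: Deq_trans (Deq_sym (Deq_assoc _ _ _)) _.
exact: Deq_trans (Deq_congr (Deq_refl _) gf) (Deq_1r _).
Qed.

Section ThickGen.
Variable gen : bimod A B -> Prop.

Lemma thick_conedata M N (f : bmap M N) C : conedata (gofb f) C ->
  thick gen M -> thick gen N -> thick gen C.
Proof.
move=> /conedata_Diso/Diso_sym iso tM tN.
exact: thick_iso iso (thick_cone _ tM tN).
Qed.

Lemma thick_shiftdata s M C : shiftdata s M C -> thick gen M -> thick gen C.
Proof.
move=> /shiftdata_Diso/Diso_sym iso tM; exact: thick_iso iso (thick_shift _ tM).
Qed.
End ThickGen.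

Definition bpair M N C (p1 : bmap C M) (p2 : bmap C N) : bmap C (dsum M N).
Proof.
refine (@BMap k A B C (dsum M N) (fun b a i x => (p1 b a i x, p2 b a i x)) _ _ _ _).
- by move=> b a i c x y; rewrite !bmD !bmZ.
- by intros; rewrite !bm_d.
- by intros; rewrite !bm_r.
- by intros; rewrite !bm_l.
Defined.

Lemma dsum_Diso M N C (p1 : bmap C M) (p2 : bmap C N) (i1 : bmap M C) (i2 : bmap N C) :
  (forall b a i x, p1 b a i (i1 b a i x) = x) ->
  (forall b a i x, p2 b a i (i2 b a i x) = x) ->
  (forall b a i x, p1 b a i (i2 b a i x) = 0) ->
  (forall b a i x, p2 b a i (i1 b a i x) = 0) ->
  (forall b a i x, i1 b a i (p1 b a i x) + i2 b a i (p2 b a i x) = x) ->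
  Diso C (dsum M N).
Proof.
move=> p1i1 p2i2 p1i2 p2i1 s; apply: (@qis_Diso _ _ _ _ _ (bpair p1 p2)).
apply: (@quasi_iso_bij _ _ _ C (dsum M N) (bpair p1 p2)
  (fun b a i (x : bc (dsum M N) b a i) => i1 b a i x.1 + i2 b a i x.2)).
  by move=> b a i x; exact: s.
by move=> b a i [x y]; rewrite /= !bmD p1i1 p2i2 p1i2 p2i1 addr0 add0r.
Qed.

Definition dsum_map M M' N N' (f : bmap M M') (g : bmap N N')
  : bmap (dsum M N) (dsum M' N') :=
  bpair (bcomp f (dsum_p1 M N)) (bcomp g (dsum_p2 M N)).

Lemma dsum_map_qis M M' N N' (f : bmap M M') (g : bmap N N') :
  quasi_iso f -> quasi_iso g -> quasi_iso (dsum_map f g).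
Proof.
move=> qf qg b a; have [i1 i2] := qf b a; have [j1 j2] := qg b a.
split=> i j l ei el.
- move=> [x y] [x' y'] /= [dx dy] [fx gy].
  have [z ->] := i1 _ _ _ ei el _ _ dx fx; have [t ->] := j1 _ _ _ ei el _ _ dy gy.
  by exists (z, t).
- move=> [x y] /= [dx dy].
  have [z [z' [dz ->]]] := i2 _ _ _ ei el _ dx.
  have [t [t' [dt ->]]] := j2 _ _ _ ei el _ dy.
  by exists (z, t), (z', t'); split=> //=; rewrite dz dt.
Qed.

(** In the induction over a thick subcategory, the step for a summand must conclude about a
    prescribed representative [P] of [M], so the representative of the sum has to contain [P]
    itself. *)
Lemma resolution_dsum (Q : resolution A B) M N P :
  hproj P -> Diso P M -> Diso (dsum P (Qob Q N)) (dsum M N).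
Proof.
move=> hP /Diso_sym MP.
have [f [g [gf fg]]] := Diso_heq (@Qob_hproj _ _ _ Q M) hP (Diso_trans (qis_Diso (@Qpi_qis _ _ _
  Q M)) MP).
apply: (@Diso_trans _ _ _ _ (dsum (Qob Q M) (Qob Q N))).
  apply: Diso_sym; apply: (@qis_Diso _ _ _ _ _ (dsum_map f (bid _))).
  exact: dsum_map_qis (heq_qis gf fg) (quasi_iso_id _).
apply: (@qis_Diso _ _ _ _ _ (dsum_map (Qpi Q M) (Qpi Q N))).
exact: dsum_map_qis (Qpi_qis _ _) (Qpi_qis _ _).
Qed.

Definition shift_map s M N (f : bmap M N) : bmap (shift s M) (shift s N).
Proof.
refine (@BMap k A B (shift s M) (shift s N) (fun b a i x => f b a (i + s) x) _ _ _ _).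
- by move=> b a i; exact: (@bm_lin _ _ _ _ _ f b a (i + s)).
- by intros; rewrite /= bmZ bm_d.
- by intros; rewrite /= bm_r.
- by intros; rewrite /= bmZ bm_l.
Defined.

Lemma shift_map_qis s M N (f : bmap M N) : quasi_iso f -> quasi_iso (shift_map s f).
Proof.
move=> qf b a; have [i1 i2] := qf b a.
have E i j : j + 1 = i -> j + s + 1 = i + s by move=> <-; rewrite addrAC.
have unsg (C : complex k) i (x : C i) : ksgn k s *: x = 0 -> x = 0.
  by move=> h; rewrite -[x](ksgn_mulKl s) h scaler0.
split=> i j l ei el.
- move=> x y /= /unsg dx; rewrite -(linZ (cd_lin _)) (cd_irr _ (E _ _ ei)) => fx.
  have [z ->] := i1 _ _ _ (E _ _ ei) _ x _ dx fx.
  by exists (ksgn k s *: z); rewrite (linZ (cd_lin _)) ksgn_mulKl; exact: cd_irr.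
- move=> y /= /unsg dy; have [x [z [dx ->]]] := i2 _ _ _ (E _ _ ei) _ y dy.
  exists x, (ksgn k s *: z); rewrite dx scaler0; split=> //.
  by rewrite (linZ (cd_lin _)) ksgn_mulKl; congr (_ + _); exact: cd_irr.
Qed.

(** The lift [g] makes the square over [f] commute only up to a homotopy [h]. The summand [i' h p]
    of the map of cones compensates for this; it vanishes on [co_i] and under [co_p], so the five
    lemma still applies. *)
Lemma cone_lift (Q : resolution A B) M N (f : bmap M N) :
  exists g : bmap (Qob Q M) (Qob Q N), Diso (cone g) (cone f).
Proof.
pose u := Qpi Q M; pose v := Qpi Q N.
have [g hg] := hproj_lift (@Qob_hproj _ _ _ Q M) (@Qpi_qis _ _ _ Q N) (bcomp f u).
exists g; have E00 := addr0 (0 : int).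
have /homotopicP[h hh] := hg.
rewrite !(gofb_comp _ _ E00) in hh.
pose D := cone_data g; pose D' := cone_data f.
have E10 : 0 + 1 = 1 :> int := add0r 1.
pose t := gcomp E00 (co_i D') (gcomp E00 (gofb v) (co_q D))
  + gcomp (addNr 1) (co_j D') (gcomp E10 (gofb u) (co_p D))
  + gcomp E00 (co_i D') (gcomp (addNr 1) h (co_p D)).
have dt : gd (add0r 1) t = 0.
  rewrite !(linD (gd_lin _)).
  rewrite (gd_comp_closedl _ _ (add0r 1) E10 _ (co_di D' erefl)).
  rewrite (gd_comp_closedl _ _ (add0r 1) E10 _ (gofb_closed v)).
  rewrite (gd_comp_closedl _ _ (add0r 1) E10 _ (co_di D' erefl)).
  rewrite (gd_comp_closedr _ _ (addNr 1) E10 _ (co_dp D erefl)) -hh.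
  have du : gd erefl (gcomp E10 (gofb u) (co_p D)) = 0.
    rewrite (gd_comp_closedl _ _ erefl (add0r _) _ (gofb_closed u)) co_dp.
    by rewrite (lin0 (gcomp_linr _ _)) scaler0.
  rewrite (gd_comp_closedr _ _ (addNr 1) E10 _ du) (co_dj D' _ E00).
  rewrite !ksgn0 !scale1r (co_dq D _ E10) (linN (gcomp_linr _ _)).
  rewrite (linN (gcomp_linr _ _)) (linD (gcomp_linl _ _)) (linN (gcomp_linl _ _)).
  rewrite (linD (gcomp_linr _ _)) (linN (gcomp_linr _ _)).
  rewrite (gcompA E10 E10 E00 E10 (gofb v)).
  rewrite -[X in _ + X + _](gcompA E10 E10 E00 E10).
  rewrite [X in _ + gcomp _ _ X + _](gcompA E10 E10 E00 E10).
  by rewrite -/v addrACA addNr subrr addr0.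
have tE b a i j (e : i + 1 = j) (x : bc (cone g) b a i) :
    bofg dt b a i x = cfi D' (v b a i (cfq D x)) + cfj D' e (u b a j (cfp D e x))
      + cfi D' (gm h (etrans (congr1 (fun l => l + -1) (esym e)) (addrK 1 i)) (cfp D e x)).
  have E : j + -1 = i by rewrite -e addrK.
  rewrite bofgE [LHS]gmD [X in X + _]gmD.
  rewrite (gcompE _ _ _ _ (addr0 i) (addr0 i)) (gcompE _ _ _ _ (addr0 i) (addr0 i)) gofbE.
  rewrite (gcompE _ _ _ _ e E) (gcompE _ _ _ _ e (addr0 j)) gofbE (cfjE D' e).
  rewrite (gcompE _ _ _ _ (addr0 i) (addr0 i)) (gcompE _ _ _ _ e E).
  by rewrite (gm_irr h E (etrans (congr1 (fun l => l + -1) (esym e)) (addrK 1 i))).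
apply: (@qis_Diso _ _ _ _ _ (bofg dt)).
apply: (conedata_qis (D := D) (D' := D') (u := u) (v := v)).
- move=> b a i n; rewrite (tE _ _ _ _ erefl) cf_qi cf_pi bm0 (lin0 (gm_lin _ _)).
  by rewrite (lin0 (cfj_lin _ _)) (lin0 (cfi_lin _)) !addr0.
- move=> b a i j e x; rewrite (tE _ _ _ _ e) !(linD (cfp_lin _ _)) !cf_pi cf_pj.
  by rewrite add0r addr0.
- exact: Qpi_qis.
- exact: Qpi_qis.
Qed.

(** Induction over a thick subcategory, carried out on h-projective
    representatives, where isomorphisms become homotopy equivalences. *)
Lemma thick_hproj_ind (Q : resolution A B) (gen R : bimod A B -> Prop) :
  (forall M N, hproj M -> hproj N -> heq M N -> R M -> R N) ->
  (forall M, hproj M -> contractible M -> R M) ->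
  (forall s M, hproj M -> R M -> R (shift s M)) ->
  (forall M N (f : bmap M N), hproj M -> hproj N -> R M -> R N -> R (cone f)) ->
  (forall M N, hproj M -> hproj N -> R (dsum M N) -> R M) ->
  (forall M, gen M -> hproj M /\ R M) ->
  forall M, thick gen M -> forall P, hproj P -> Diso P M -> R P.
Proof.
move=> Rheq R0 Rsh Rcone Rsum Rgen M.
have Riso M1 M2 : hproj M1 -> hproj M2 -> Diso M1 M2 -> R M1 -> R M2.
  by move=> h1 h2 iso; apply: Rheq => //; exact: Diso_heq.
have hQ := @Qob_hproj _ _ _ Q.
have isoQ L : Diso (Qob Q L) L by exact: qis_Diso (@Qpi_qis _ _ _ Q L).
elim=> {M}.
- move=> M /Rgen[hM RM] P hP /Diso_sym iso; exact: Riso RM.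
- move=> M N MN _ IH P hP PN; apply: IH => //.
  exact: Diso_trans PN (Diso_sym MN).
- by move=> M zM P hP PM; apply: R0 => //; exact: Dzero_contractible PM zM.
- move=> s M _ IH P hP PM.
  apply: (Riso (shift s (Qob Q M))) => //; first exact: hproj_shift.
    apply: Diso_trans (Diso_sym PM).
    exact: qis_Diso (shift_map_qis s (@Qpi_qis _ _ _ Q M)).
  by apply: Rsh => //; apply: IH.
- move=> M N f _ IHM _ IHN P hP PM.
  have [g iso] := cone_lift Q f.
  apply: (Riso (cone g)) => //; first exact: hproj_cone.
    exact: Diso_trans iso (Diso_sym PM).
  by apply: Rcone => //; [apply: IHM|apply: IHN].
- move=> M N _ IH P hP PM; apply: (Rsum P (Qob Q N)) => //.
  apply: IH; first exact: hproj_dsum.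
  exact: resolution_dsum.
Qed.
End ThickClosure.

(** * Dg-functors between categories of bimodules *)

Section DGFunctors.
Variables (k : comPzRingType) (A B C D : dgcat k).

(** The action is given on whole Hom complexes and not only on closed maps of degree zero.
    Homotopies and the structure maps of shifts and cones are thereby transported as well. *)
Record dgF := DGF {
  dF :> bimod A B -> bimod C D;
  dFm : forall M N n, gmap M N n -> gmap (dF M) (dF N) n;
  dFm_lin : forall M N n, linear (@dFm M N n);
  dFm_d : forall M N n n' (e : n + 1 = n') (f : gmap M N n),
    gd e (dFm f) = dFm (gd e f);
  dFm_comp : forall L M N n m l (e : n + m = l) (g : gmap M N n) (f : gmap L M m),
    dFm (gcomp e g f) = gcomp e (dFm g) (dFm f);
  dFm_id : forall M, dFm (gid M) = gid (dF M) }.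

Variable F : dgF.
Implicit Types M N P X : bimod A B.

Lemma dFm_closed M N n n' (e : n + 1 = n') (f : gmap M N n) :
  gd e f = 0 -> gd e (dFm F f) = 0.
Proof. by move=> h; rewrite dFm_d h (lin0 (@dFm_lin _ _ _ _)). Qed.

Definition dFb M N (f : bmap M N) : bmap (F M) (F N) :=
  bofg (dFm_closed (gofb_closed f)).

Lemma gofb_dFb M N (f : bmap M N) : gofb (dFb f) = dFm F (gofb f).
Proof. exact: gofbK. Qed.

Lemma dFb_homotopic M N (f g : bmap M N) : homotopic f g -> homotopic (dFb f) (dFb g).
Proof.
move=> /homotopicP[h hh]; apply/homotopicP; exists (dFm F h).
by rewrite !gofb_dFb dFm_d -hh (linD (@dFm_lin _ _ _ _)) (linN (@dFm_lin _ _ _ _)).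
Qed.

Lemma gofb_inj (A' B' : dgcat k) (M N : bimod A' B') (f g : bmap M N) :
  gofb f = gofb g -> forall b a i x, f b a i x = g b a i x.
Proof. by move=> h b a i x; rewrite -!(gofbE _ (addr0 i)) h. Qed.

Lemma gofb_homotopic (A' B' : dgcat k) (M N : bimod A' B') (f g : bmap M N) :
  gofb f = gofb g -> homotopic f g.
Proof. by move=> h; apply: eqb_homotopic; exact: gofb_inj. Qed.

Lemma dFb_id M : homotopic (dFb (bid M)) (bid (F M)).
Proof. by apply: gofb_homotopic; rewrite gofb_dFb !gofb_id dFm_id. Qed.

Lemma gofb_dFb_comp L M N (g : bmap M N) (f : bmap L M) :
  gofb (dFb (bcomp g f)) = gofb (bcomp (dFb g) (dFb f)).
Proof. by rewrite gofb_dFb !(gofb_comp _ _ (addr0 0)) dFm_comp !gofb_dFb. Qed.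

Lemma dFb_comp L M N (g : bmap M N) (f : bmap L M) :
  homotopic (dFb (bcomp g f)) (bcomp (dFb g) (dFb f)).
Proof. by apply: gofb_homotopic; exact: gofb_dFb_comp. Qed.

Lemma dFb_inverse M N (f : bmap M N) (g : bmap N M) :
  homotopic (bcomp g f) (bid M) -> homotopic (bcomp (dFb g) (dFb f)) (bid (F M)).
Proof.
move=> h; apply: homotopic_trans (homotopic_sym (dFb_comp _ _)) _.
exact: homotopic_trans (dFb_homotopic h) (dFb_id M).
Qed.

Lemma dF_heq M N : heq M N -> heq (F M) (F N).
Proof. by case=> f [g [gf fg]]; exists (dFb f), (dFb g); split; exact: dFb_inverse. Qed.

Lemma dF_contractible M : contractible M -> contractible (F M).
Proof.
move=> /dFb_homotopic h; apply: homotopic_trans (homotopic_sym (dFb_id M)) _.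
apply: homotopic_trans h _; apply: gofb_homotopic.
by rewrite gofb_dFb !gofb0 (lin0 (@dFm_lin _ _ _ _)).
Qed.

Definition dF_shiftdata s M X : shiftdata s M X -> shiftdata s (F M) (F X).
Proof.
move=> S; apply: (@ShiftData _ _ _ s _ _ (dFm F (sd_u S)) (dFm F (sd_v S))).
- by move=> e; rewrite -dFm_comp sd_vu dFm_id.
- by move=> e; rewrite -dFm_comp sd_uv dFm_id.
- by move=> n e; apply: dFm_closed; exact: sd_du.
- by move=> n e; apply: dFm_closed; exact: sd_dv.
Defined.

Definition dF_conedata M N (f : bmap M N) X :
  conedata (gofb f) X -> conedata (gofb (dFb f)) (F X).
Proof.
move=> S; rewrite gofb_dFb.
apply: (@ConeData _ _ _ _ _ _ _ (dFm F (co_i S)) (dFm F (co_q S))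
          (dFm F (co_j S)) (dFm F (co_p S))).
- by move=> e; rewrite -dFm_comp co_qi dFm_id.
- by move=> e; rewrite -dFm_comp co_pj dFm_id.
- by move=> e; rewrite -dFm_comp co_qj (lin0 (@dFm_lin _ _ _ _)).
- by move=> e; rewrite -dFm_comp co_pi (lin0 (@dFm_lin _ _ _ _)).
- by move=> e e'; rewrite -!dFm_comp -(linD (@dFm_lin _ _ _ _)) co_split dFm_id.
- by move=> n e; apply: dFm_closed; exact: co_di.
- by move=> n e; apply: dFm_closed; exact: co_dp.
- by move=> e e'; rewrite dFm_d (co_dj _ _ e') dFm_comp.
- by move=> e e'; rewrite dFm_d (co_dq _ _ e') (linN (@dFm_lin _ _ _ _)) dFm_comp.
Defined.

Lemma dF_dsum M N : Diso (F (dsum M N)) (dsum (F M) (F N)).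
Proof.
have E (L K P : bimod A B) (g : bmap K P) (f : bmap L K) (h : bmap L P) :
    gofb (bcomp g f) = gofb h ->
    forall b a i x, dFb g b a i (dFb f b a i x) = dFb h b a i x.
  move=> gh b a i x; rewrite -[LHS]/(bcomp (dFb g) (dFb f) b a i x).
  apply: gofb_inj; rewrite -gofb_dFb_comp !gofb_dFb; congr (dFm F _).
  exact: gh.
have Eid (L : bimod A B) b a i x : dFb (bid L) b a i x = x.
  rewrite -[RHS]/(bid (F L) b a i x); apply: gofb_inj.
  by rewrite gofb_dFb !gofb_id dFm_id.
have E0 (L K : bimod A B) b a i x : dFb (bzero L K) b a i x = 0.
  rewrite -[RHS]/(bzero (F L) (F K) b a i x); apply: gofb_inj.
  by rewrite gofb_dFb !gofb0 (lin0 (@dFm_lin _ _ _ _)).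
apply: (@dsum_Diso _ _ _ _ _ _ (dFb (dsum_p1 M N)) (dFb (dsum_p2 M N))
  (dFb (dsum_i1 M N)) (dFb (dsum_i2 M N))).
- move=> b a i x; rewrite (E _ _ _ _ _ (bid M)) ?Eid //.
  by apply: gmap0P => b' a' j y; rewrite !gofbE.
- move=> b a i x; rewrite (E _ _ _ _ _ (bid N)) ?Eid //.
  by apply: gmap0P => b' a' j y; rewrite !gofbE.
- move=> b a i x; rewrite (E _ _ _ _ _ (bzero N M)) ?E0 //.
  by apply: gmap0P => b' a' j y; rewrite !gofbE.
- move=> b a i x; rewrite (E _ _ _ _ _ (bzero M N)) ?E0 //.
  by apply: gmap0P => b' a' j y; rewrite !gofbE.
- move=> b a i x.
  have := congr1 (fun g => gm (dFm F g) (addr0 i) x) (dsum_split M N (addr0 0)).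
  rewrite (linD (@dFm_lin _ _ _ _)) !dFm_comp -!gofb_dFb dFm_id gidE gmD.
  by rewrite !(gcompE _ _ _ _ (addr0 i) (addr0 i)) !gofbE.
Qed.

(** The value of [F] on an h-projective representative is the value of its left derived functor,
    which respects shifts, cones and summands; only the generators have to be examined. *)
Lemma thick_functor (Q : resolution A B) (gen : bimod A B -> Prop)
    (gen' : bimod C D -> Prop) :
  (forall M, gen M -> hproj M /\ thick gen' (F M)) ->
  forall M, thick gen M -> forall P, hproj P -> Diso P M -> thick gen' (F P).
Proof.
move=> Hgen; apply: (thick_hproj_ind Q) => //.
- move=> M N _ _ /dF_heq/heq_Diso; exact: thick_iso.
- by move=> M _ /dF_contractible/contractible_Dzero; exact: thick_zero.
- by move=> s M _; apply: thick_shiftdata; apply: dF_shiftdata; exact: shift_data.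
- move=> M N f _ _; apply: (thick_conedata (f := dFb f)); apply: dF_conedata.
  exact: cone_data.
- by move=> M N _ _ /(thick_iso (dF_dsum M N)); exact: thick_summand.
Qed.
End DGFunctors.

(** * The tensor product as a dg-functor of each variable *)

Section GradedTensor.
Variables (k : comPzRingType) (A B C : dgcat k).

Section FromTensor.
Variables (F : bimod A B) (G : bimod B C) (N : bimod A C) (n : int).
Variable phi : forall c a b i j m, i + j + n = m ->
  bc F b a i -> bc G c b j -> bc N c a m.
Hypotheses
  (phi_l : forall c a b i j m (e : i + j + n = m) (y : bc G c b j),
     linear (fun x : bc F b a i => phi e x y))
  (phi_r : forall c a b i j m (e : i + j + n = m) (x : bc F b a i),
     linear (fun y : bc G c b j => phi e x y))
  (phi_b : forall c a m b1 b2 i p j i' j' (ei : i + p = i') (ej : p + j = j')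
     (e : i' + j + n = m) (e' : i + j' + n = m)
     (x : bc F b2 a i) (f : hom b1 b2 p) (y : bc G c b1 j),
     phi e (ract F ei x f) y = phi e' x (lact G ej f y))
  (phi_ract : forall c c' a b i j p m l j' (e : i + j + n = m) (el : m + p = l)
     (ej : j + p = j') (e' : i + j' + n = l)
     (x : bc F b a i) (y : bc G c b j) (h : hom c' c p),
     phi e' x (ract G ej y h) = ract N el (phi e x y) h)
  (phi_lact : forall c a a' b i j p m l i' (e : i + j + n = m) (el : p + m = l)
     (ei : p + i = i') (e' : i' + j + n = l)
     (g : hom a a' p) (x : bc F b a i) (y : bc G c b j),
     phi e' (lact F ei g x) y = ksgn k (n * p) *: lact N el g (phi e x y)).

Lemma gt_idx (i j l m : int) : i + j = l -> l + n = m -> i + j + n = m.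
Proof. by move=> ->. Qed.

Definition gtmor_fun c a l m (e : l + n = m) : bc (tens F G) c a l -> bc N c a m :=
  tlift (fun b i j e' x y => phi (gt_idx e' e) x y).

Lemma gtmor_lin c a l m (e : l + n = m) : linear (@gtmor_fun c a l m e).
Proof. by apply: tlift_lin => *; [exact: phi_l|exact: phi_r|exact: phi_b]. Qed.

Lemma gtmor_pure c a l m (e : l + n = m) b i j (e' : i + j = l) (e1 : i + j + n = m)
    (x : bc F b a i) (y : bc G c b j) :
  gtmor_fun e (tpure e' x y) = phi e1 x y.
Proof.
rewrite /gtmor_fun tlift_pure; last 3 [idtac].
- by rewrite (eq_irrelevance (gt_idx e' e) e1).
- by move=> *; exact: phi_l.
- by move=> *; exact: phi_r.
- by move=> *; exact: phi_b.
Qed.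

Definition gtmor : gmap (tens F G) N n.
Proof.
refine (@GMap k A C (tens F G) N n gtmor_fun _ _ _).
- exact: gtmor_lin.
- move=> c c' a i p j l m e el em e' z h; move: z; apply: tens_ext.
  + exact: lin_comp (gtmor_lin _) (tract_lin _ _).
  + exact: lin_comp (ract_linl _ _) (gtmor_lin _).
  move=> b u v e0 x y.
  have E : u + v + n = l by rewrite e0.
  have E' : u + (v + p) + n = m by rewrite -em -e -e0 !addrA.
  rewrite /= (tract_pure e _ e0 erefl (tr_idx e e0)).
  by rewrite (gtmor_pure _ _ E') (gtmor_pure _ _ E) (phi_ract E e' erefl E').
- move=> c a a' p i j l m e el em e' g; apply: tens_ext.
  + exact: lin_comp (gtmor_lin _) (tlact_lin _ _).
  + by apply: lin_scale; exact: lin_comp (lact_linr _ _) (gtmor_lin _).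
  move=> b u v e0 x y.
  have E : u + v + n = l by rewrite e0.
  have E' : p + u + v + n = m by rewrite -em -e -e0 !addrA.
  rewrite /= (tlact_pure e _ e0 erefl (tl_idx e e0)).
  by rewrite (gtmor_pure _ _ E') (gtmor_pure _ _ E) (phi_lact E e' erefl E').
Defined.

Lemma gtmorE c a l m (e : l + n = m) b i j (e' : i + j = l) (e1 : i + j + n = m)
    (x : bc F b a i) (y : bc G c b j) :
  gm gtmor e (tpure e' x y) = phi e1 x y.
Proof. exact: gtmor_pure. Qed.
End FromTensor.

Lemma gtens_ext (F : bimod A B) (G : bimod B C) (N : bimod A C) n
    (f g : gmap (tens F G) N n) :
  (forall c a b i j l m (e : i + j = l) (em : l + n = m)
     (x : bc F b a i) (y : bc G c b j),
     gm f em (tpure e x y : bc (tens F G) c a l) = gm g em (tpure e x y : bc (tens F G) c a l)) ->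
  f = g.
Proof.
move=> h; apply: gmapP => c a l m em; apply: tens_ext.
- exact: (@gm_lin _ _ _ _ _ _ f c a l m em).
- exact: (@gm_lin _ _ _ _ _ _ g c a l m em).
- by move=> b i j e x y; exact: h.
Qed.

Lemma cd_tpure (F : bimod A B) (G : bimod B C) c a n n' b i j i' j' (e : i + j = n)
    (en : n + 1 = n') (ei : i + 1 = i') (ej : j + 1 = j') (e1 : i' + j = n')
    (e2 : i + j' = n') (x : bc F b a i) (y : bc G c b j) :
  cd (bc (tens F G) c a) en (tpure e x y)
  = tpure e1 (cd _ ei x) y + ksgn k i *: tpure e2 x (cd _ ej y).
Proof. exact: td_pure. Qed.

Lemma ract_tpure (F : bimod A B) (G : bimod B C) c c' a b m p n i j j' (e0 : m + p = n)
    (e : i + j = m) (ej : j + p = j') (e1 : i + j' = n)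
    (x : bc F b a i) (y : bc G c b j) (h : hom c' c p) :
  ract (tens F G) e0 (tpure e x y : bc (tens F G) c a m) h
  = tpure e1 x (ract G ej y h).
Proof. exact: tract_pure. Qed.

Lemma lact_tpure (F : bimod A B) (G : bimod B C) c a a' b p m n i j i' (e0 : p + m = n)
    (e : i + j = m) (ei : p + i = i') (e1 : i' + j = n)
    (g : hom a a' p) (x : bc F b a i) (y : bc G c b j) :
  lact (tens F G) e0 g (tpure e x y : bc (tens F G) c a m)
  = tpure e1 (lact F ei g x) y.
Proof. exact: tlact_pure. Qed.

Lemma gm_tens_lin (F : bimod A B) (G : bimod B C) (N : bimod A C) n
    (f : gmap (tens F G) N n) c a l m (e : l + n = m) :
  linear (fun z : tens_mod F G c a l => gm f e (z : bc (tens F G) c a l)).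
Proof. exact: (@gm_lin _ _ _ _ _ _ f c a l m e). Qed.

Lemma gtl_idx (n i j m : int) : i + j + n = m -> i + n + j = m.
Proof. by move=> <-; rewrite addrAC. Qed.
Lemma gtr_idx (n i j m : int) : i + j + n = m -> i + (j + n) = m.
Proof. by move=> <-; rewrite addrA. Qed.

Definition gtensl (F F' : bimod A B) (G : bimod B C) n (f : gmap F F' n) :
  gmap (tens F G) (tens F' G) n.
Proof.
refine (@gtmor F G (tens F' G) n
  (fun c a b i j m e x y => tpure (gtl_idx e) (gm f erefl x) y) _ _ _ _ _).
- by intros; exact: lin_comp (tpure_linl _ _) (gm_lin _ _).
- by intros; exact: tpure_linr.
- move=> c a m b1 b2 i p j i' j' ei ej e e' x h y.
  have E : i + n + p = i' + n by rewrite -ei addrAC.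
  by rewrite (gm_r f ei erefl erefl E); exact: tpure_bal.
- by intros; symmetry; exact: tract_pure.
- move=> c a a' b i j p m l i' e el ei e' g x y.
  have E : p + (i + n) = i' + n by rewrite -ei addrA.
  rewrite (gm_l f ei erefl erefl E) (linZ (tpure_linl _ _)); congr (_ *: _).
  by symmetry; exact: tlact_pure.
Defined.

Lemma gtenslE (F F' : bimod A B) (G : bimod B C) n (f : gmap F F' n)
    c a b i j l m i' (e : i + j = l) (em : l + n = m) (ei : i + n = i')
    (e' : i' + j = m) (x : bc F b a i) (y : bc G c b j) :
  gm (gtensl G f) em (tpure e x y) = tpure e' (gm f ei x) y.
Proof.
subst i'; have E : i + j + n = m by rewrite e.
by rewrite /gtensl (gtmorE _ _ _ _ _ _ _ E) (tpure_irr (gtl_idx E) e').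
Qed.

(** The sign comes from moving [f] past the left factor; in [gtensl] nothing is passed. *)
Definition gtensr (F : bimod A B) (G G' : bimod B C) n (f : gmap G G' n) :
  gmap (tens F G) (tens F G') n.
Proof.
refine (@gtmor F G (tens F G') n
  (fun c a b i j m e x y => ksgn k (n * i) *: tpure (gtr_idx e) x (gm f erefl y))
  _ _ _ _ _).
- by intros; apply: lin_scale; exact: tpure_linl.
- by intros; apply: lin_scale; exact: lin_comp (tpure_linr _ _) (gm_lin _ _).
- move=> c a m b1 b2 i p j i' j' ei ej e e' x h y.
  have E : p + (j + n) = j' + n by rewrite -ej addrA.
  rewrite (gm_l f ej erefl erefl E) (linZ (tpure_linr _ _)) scalerA -ksgnD.
  rewrite (tpure_bal ei E _ (gtr_idx e')); congr (_ *: _).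
  by rewrite -ei -mulrDr.
- move=> c c' a b i j p m l j' e el ej e' x y h.
  have E : j + n + p = j' + n by rewrite -ej addrAC.
  rewrite (gm_r f ej erefl erefl E) [RHS](linZ (tract_lin _ _)); congr (_ *: _).
  by symmetry; exact: tract_pure.
- move=> c a a' b i j p m l i' e el ei e' g x y.
  rewrite [X in _ = _ *: X](linZ (tlact_lin _ _)) scalerA -ksgnD -mulrDr ei.
  by congr (_ *: _); symmetry; exact: tlact_pure.
Defined.

Lemma gtensrE (F : bimod A B) (G G' : bimod B C) n (f : gmap G G' n)
    c a b i j l m j' (e : i + j = l) (em : l + n = m) (ej : j + n = j')
    (e' : i + j' = m) (x : bc F b a i) (y : bc G c b j) :
  gm (gtensr F f) em (tpure e x y) = ksgn k (n * i) *: tpure e' x (gm f ej y).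
Proof.
subst j'; have E : i + j + n = m by rewrite e.
by rewrite /gtensr (gtmorE _ _ _ _ _ _ _ E) (tpure_irr (gtr_idx E) e').
Qed.

Definition tensl (G : bimod B C) : dgF A B A C.
Proof.
refine (@DGF k A B A C (fun F => tens F G) (fun F F' n f => gtensl G f) _ _ _ _).
- move=> F F' n c f g; apply: gtens_ext => c' a b i j l m e em x y.
  have E : i + n + j = m by rewrite -em -e addrAC.
  by rewrite gmD gmZ !(gtenslE _ _ _ erefl E) tpure_linl.
- move=> F F' n n' en f; apply: gtens_ext => c' a b i j l m e em x y.
  have E1 : l + n + 1 = m by rewrite -em -en addrA.
  have E2 : l + 1 + n = m by rewrite addrAC.
  have E3 : i + n + j = l + n by rewrite -e addrAC.
  have E4 : i + 1 + j = l + 1 by rewrite -e addrAC.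
  have E5 : i + (j + 1) = l + 1 by rewrite -e addrA.
  have E6 : i + 1 + n + j = m by rewrite -E2 -e; lia.
  have E7 : i + n + (j + 1) = m by rewrite -E2 -e; lia.
  have E8 : i + n + 1 = i + n' by rewrite -en addrA.
  have E9 : i + n' + j = m by rewrite -em -e addrAC.
  have E10 : i + n + 1 + j = m by rewrite E8.
  have E11 : i + 1 + n = i + n' by rewrite addrAC.
  rewrite (gdE _ _ _ erefl E1 erefl E2) (gtenslE _ _ _ erefl E3).
  rewrite (cd_tpure _ _ E8 erefl E9 E7) (cd_tpure _ erefl erefl erefl E4 E5).
  rewrite (linD (gm_tens_lin _ _)) (linZ (gm_tens_lin _ _)) (gtenslE _ _ _ E11 E9).
  rewrite (gtenslE _ _ _ erefl E7) (gtenslE _ _ _ erefl E9).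
  rewrite (gdE _ _ erefl erefl E8 erefl E11) (linD (tpure_linl _ _)).
  rewrite (linN (tpure_linl _ _)) (linZ (tpure_linl _ _)) scalerDr opprD scalerA.
  by rewrite [ksgn k n * _]mulrC -ksgnD addrACA subrr addr0.
- move=> F F' F'' n m l e g f; apply: gtens_ext => c' a b i j u v e1 ev x y.
  have E1 : u + m + n = v by rewrite -ev -e [n + m]addrC addrA.
  have E2 : i + l + j = v by rewrite -ev -e1 addrAC.
  have E3 : i + m + j = u + m by rewrite -e1 addrAC.
  have E4 : i + m + n = i + l by rewrite -e [n + m]addrC addrA.
  rewrite (gtenslE _ _ _ erefl E2) (gcompE _ _ _ _ erefl E1).
  by rewrite (gtenslE _ _ _ erefl E3) (gtenslE _ _ _ E4 E2) (gcompE _ _ _ _ erefl E4).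
- move=> F; apply: gtens_ext => c' a b i j u v e1 ev x y.
  have E : u = v by rewrite -ev addr0.
  case: v / E ev => ev.
  by rewrite (gtenslE _ _ _ (addr0 i) e1) !gidE.
Defined.

Definition tensr (F : bimod A B) : dgF B C A C.
Proof.
refine (@DGF k B C A C (fun G => tens F G) (fun G G' n f => gtensr F f) _ _ _ _).
- move=> G G' n c f g; apply: gtens_ext => c' a b i j l m e em x y.
  have E : i + (j + n) = m by rewrite -em -e addrA.
  rewrite gmD gmZ !(gtensrE _ _ _ erefl E) (tpure_linr _ _ c) scalerDr !scalerA.
  by rewrite mulrC.
- move=> G G' n n' en f; apply: gtens_ext => c' a b i j l m e em x y.
  have E1 : l + n + 1 = m by rewrite -em -en addrA.
  have E2 : l + 1 + n = m by rewrite addrAC.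
  have E3 : i + (j + n) = l + n by rewrite -e addrA.
  have E4 : i + 1 + j = l + 1 by rewrite -e addrAC.
  have E5 : i + (j + 1) = l + 1 by rewrite -e addrA.
  have E6 : i + 1 + (j + n) = m by lia.
  have E7 : j + n + 1 = j + n' by rewrite -en addrA.
  have E8 : i + (j + n') = m by lia.
  have E9 : j + 1 + n = j + n' by lia.
  rewrite (gdE _ _ _ erefl E1 erefl E2) (gtensrE _ _ _ erefl E3).
  rewrite (linZ (cd_lin _)) (cd_tpure _ _ erefl E7 E6 E8).
  rewrite (cd_tpure _ erefl erefl erefl E4 E5).
  rewrite (linD (gm_tens_lin _ _)) (linZ (gm_tens_lin _ _)) (gtensrE _ _ _ erefl E6).
  rewrite (gtensrE _ _ _ E9 E8) (gtensrE _ _ _ erefl E8).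
  rewrite (gdE _ _ erefl erefl E7 erefl E9) (linD (tpure_linr _ _)).
  rewrite (linN (tpure_linr _ _)) (linZ (tpure_linr _ _)).
  rewrite !scalerDr opprD !scalerN !scalerA -!ksgnD.
  have -> : ksgn k (n + n * (i + 1)) = ksgn k (n * i) by parity.
  rewrite addrACA subrr add0r; subst n'.
  by congr (_ *: _ - _ *: _); parity.
- move=> G G' G'' n m l e g f; apply: gtens_ext => c' a b i j u v e1 ev x y.
  have E1 : u + m + n = v by rewrite -ev -e [n + m]addrC addrA.
  have E2 : i + (j + l) = v by rewrite -ev -e1 addrA.
  have E3 : i + (j + m) = u + m by rewrite -e1 addrA.
  have E4 : j + m + n = j + l by rewrite -e [n + m]addrC addrA.
  rewrite (gtensrE _ _ _ erefl E2) (gcompE _ _ _ _ erefl E1).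
  rewrite (gtensrE _ _ _ erefl E3) (linZ (gm_tens_lin _ _)) (gtensrE _ _ _ E4 E2).
  rewrite (gcompE _ _ _ _ erefl E4) scalerA -ksgnD; congr (_ *: _).
  by rewrite -[X in ksgn k (X * _)]e; parity.
- move=> F'; apply: gtens_ext => c' a b i j u v e1 ev x y.
  have E : u = v by rewrite -ev addr0.
  case: v / E ev => ev.
  by rewrite (gtensrE _ _ _ (addr0 j) e1) !gidE mul0r ksgn0 scale1r.
Defined.
End GradedTensor.

(** * The action of the ground ring on one-sided modules *)

Section KCat.
Variable k : comPzRingType.

Lemma khom_ne0 p (c : khom k p) : p <> 0 -> c = 0.
Proof. by move=> np; rewrite -(kinjK c) kval_ne // kinj0. Qed.

Lemma klactE (B : dgcat k) (M : bimod (kcat k) B) b i (e : 0 + i = i) (c : khom k 0)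
    (x : bc M b tt i) :
  lact M (a:=tt) (a':=tt) e c x = (c : k) *: x.
Proof.
have -> : c = (c : k) *: (1 : k^o) by rewrite [RHS]mulr1.
by rewrite (linZ (lact_linl _ _)) [lact _ _ _ _](lact1 (b:=b) e x) [_ *: (1 : k^o)]mulr1.
Qed.

Lemma kractE (A : dgcat k) (M : bimod A (kcat k)) a i (e : i + 0 = i) (c : khom k 0)
    (x : bc M tt a i) :
  ract M (b:=tt) (b':=tt) e x c = (c : k) *: x.
Proof.
have -> : c = (c : k) *: (1 : k^o) by rewrite [RHS]mulr1.
by rewrite (linZ (ract_linr _ _)) [ract _ _ _ _](ract1 e x) [_ *: (1 : k^o)]mulr1.
Qed.

(** The hom-complex of [kcat] is [k] in degree zero and acts by scalars, so compatibility with this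
    action is nothing but linearity. One of the two actions of a one-sided module is thus dealt with
    once and for all. *)
Lemma klact_gm (B B' : dgcat k) (M : bimod (kcat k) B) (N : bimod (kcat k) B') b b' n
    (phi : forall a i j, i + n = j -> bc M b a i -> bc N b' a j) :
  (forall a i j (e : i + n = j), linear (phi a i j e)) ->
  forall a a' p i j l m (e : p + i = j) (el : i + n = l) (em : j + n = m)
    (e' : p + l = m) (g : hom a a' p) (x : bc M b a i),
  phi a' j m em (lact M e g x) = ksgn k (n * p) *: lact N e' g (phi a i l el x).
Proof.
move=> lphi [] [] p i j l m e el em e' g x.
have [p0|np] := pselect (p = 0); last first.
  rewrite (khom_ne0 g np) (lin0 (lact_linl _ _)) (lin0 (lphi _ _ _ _)).
  by rewrite (lin0 (lact_linl _ _)) scaler0.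
subst p; have E : i = j by rewrite -e add0r.
case: j / E e em => e em; have E : l = m by rewrite -e' add0r.
case: m / E e' em => e' em; rewrite mulr0 ksgn0 scale1r !klactE.
by rewrite (linZ (lphi _ _ _ _)) (eq_irrelevance em el).
Qed.

Lemma kract_gm (A A' : dgcat k) (M : bimod A (kcat k)) (N : bimod A' (kcat k)) a a' n
    (phi : forall b i j, i + n = j -> bc M b a i -> bc N b a' j) :
  (forall b i j (e : i + n = j), linear (phi b i j e)) ->
  forall b b' i p j l m (e : i + p = j) (el : i + n = l)
      (em : j + n = m) (e' : l + p = m) (x : bc M b a i) (f : hom b' b p),
  phi b' j m em (ract M e x f) = ract N e' (phi b i l el x) f.
Proof.
move=> lphi [] [] i p j l m e el em e' x g.
have [p0|np] := pselect (p = 0); last first.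
  rewrite (khom_ne0 g np) (lin0 (ract_linr _ _)) (lin0 (lphi _ _ _ _)).
  by rewrite (lin0 (ract_linr _ _)).
subst p; have E : i = j by rewrite -e addr0.
case: j / E e em => e em; have E : l = m by rewrite -e' addr0.
case: m / E e' em => e' em; rewrite !kractE.
by rewrite (linZ (lphi _ _ _ _)) (eq_irrelevance em el).
Qed.

Lemma klact_bm (B B' : dgcat k) (M : bimod (kcat k) B) (N : bimod (kcat k) B') b b'
    (phi : forall a i, bc M b a i -> bc N b' a i) :
  (forall a i, linear (phi a i)) ->
  forall a a' i j n (e : i + j = n) (g : hom a a' i) (x : bc M b a j),
  phi a' n (lact M e g x) = lact N e g (phi a j x).
Proof.
move=> lphi [] [] p i j e g x.
have [p0|np] := pselect (p = 0); last first.
  by rewrite (khom_ne0 g np) !(lin0 (lact_linl _ _)) (lin0 (lphi _ _)).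
subst p; have E : i = j by rewrite -e add0r.
by case: j / E e => e; rewrite !klactE (linZ (lphi _ _)).
Qed.

Lemma kract_bm (A A' : dgcat k) (M : bimod A (kcat k)) (N : bimod A' (kcat k)) a a'
    (phi : forall b i, bc M b a i -> bc N b a' i) :
  (forall b i, linear (phi b i)) ->
  forall b b' i j n (e : i + j = n) (x : bc M b a i) (f : hom b' b j),
  phi b' n (ract M e x f) = ract N e (phi b i x) f.
Proof.
move=> lphi [] [] i p j e x g.
have [p0|np] := pselect (p = 0); last first.
  by rewrite (khom_ne0 g np) !(lin0 (ract_linr _ _)) (lin0 (lphi _ _)).
subst p; have E : i = j by rewrite -e addr0.
by case: j / E e => e; rewrite !kractE (linZ (lphi _ _)).
Qed.
End KCat.

(** * Left modules of a bimodule, and multiplication maps *)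

Section Components.
Variables (k : comPzRingType) (A B : dgcat k).

Definition lcomponent (T : bimod A B) (b : ob B) : bimod A (kcat k) :=
  restrict (idfunctor A) (kpt b) T.

Lemma lm_idx (n i j : int) : i + n = j -> n + i = j.
Proof. by rewrite addrC. Qed.

Section LMul.
Variable L : bimod A B.

Lemma lmul_fun_lin a a' n (g : hom a a' n) b i j (e : i + n = j) :
  linear (fun x : bc L b a i => lact L (lm_idx e) g x : bc L b a' j).
Proof. by move=> c0 x y; exact: lact_linr. Qed.

Definition lmul a a' n (g : hom a a' n) : gmap (rcomponent L a) (rcomponent L a') n.
Proof.
refine (@GMap k (kcat k) B (rcomponent L a) (rcomponent L a') n
  (fun b _ i j e x => lact L (lm_idx e) g x)
  (fun b _ i j e => lmul_fun_lin g e) _ _).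
- by intros; rewrite /=; symmetry; exact: lractA.
- move=> b; exact: (klact_gm (M := rcomponent L a) (N := rcomponent L a')
    (phi := fun _ i j e x => lact L (lm_idx e) g x)
    (fun _ _ _ e => @lmul_fun_lin _ _ _ g b _ _ e)).
Defined.

Lemma lmulE a a' n (g : hom a a' n) b c i j (e : i + n = j) (e' : n + i = j)
    (x : bc L b a i) :
  gm (lmul g) (b:=b) (a:=c) e x = lact L e' g x.
Proof. by rewrite /= (eq_irrelevance (lm_idx e) e'). Qed.

Lemma lmul_lin a a' n : linear (@lmul a a' n).
Proof.
move=> c g g'; apply: gmapP => b t i j e x.
by rewrite gmD gmZ !(lmulE _ _ _ (lm_idx e)) lact_linl.
Qed.

Lemma lmul_comp a a' a'' n m l (e : n + m = l) (g : hom a' a'' n) (f : hom a a' m) :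
  lmul (comp e g f) = gcomp e (lmul g) (lmul f).
Proof.
apply: gmapP => b t i j ej x.
have E : i + m + n = j by exact: gdegc e ej.
rewrite (gcompE _ _ _ _ erefl E) (lmulE _ _ _ (lm_idx ej)).
rewrite (lmulE _ _ _ (lm_idx erefl)) (lmulE _ _ _ (lm_idx E)).
by rewrite (lactA _ _ e (lm_idx ej)).
Qed.

Lemma lmul_d a a' n n' (e : n + 1 = n') (g : hom a a' n) :
  gd e (lmul g) = lmul (cd _ e g).
Proof.
apply: gmapP => b t i j ej x.
have E1 := gdeg1 e ej; have E2 := gdeg2 e ej.
rewrite (gdE _ _ _ erefl E1 erefl E2).
rewrite (lmulE _ _ _ (lm_idx erefl)) (lmulE _ _ _ (lm_idx E2)) (lmulE _ _ _ (lm_idx ej)).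
by rewrite /= (lact_d _ E1 e erefl (lm_idx ej) (lm_idx E2)) [LHS]addrK.
Qed.

Lemma lmul1 a : lmul (idm a) = gid (rcomponent L a).
Proof.
apply: gmap0P => b t i x.
by rewrite (lmulE _ _ _ (add0r i)) gidE lact1.
Qed.
End LMul.

Section RMul.
Variable R : bimod A B.

Lemma rmul_fun_lin b b' n (f : hom b' b n) a i j (e : i + n = j) :
  linear (fun x : bc R b a i => ksgn k (n * i) *: ract R e x f : bc R b' a j).
Proof. by move=> c0 x y; rewrite (ract_linl e f c0) scalerDr !scalerA mulrC. Qed.

(** A right multiplication is turned into a map written on the left of its argument, which costs the
    sign of passing [f] over [x]. With this sign it is left linear in the graded sense, and it
    reverses composition up to a Koszul sign. *)
Definition rmul b b' n (f : hom b' b n) : gmap (lcomponent R b) (lcomponent R b') n.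
Proof.
refine (@GMap k A (kcat k) (lcomponent R b) (lcomponent R b') n
  (fun _ a i j e x => ksgn k (n * i) *: ract R e x f)
  (fun _ a i j e => rmul_fun_lin f e) _ _).
- move=> c c' a; move: c c'.
  exact: (kract_gm (M := lcomponent R b) (N := lcomponent R b')
    (phi := fun _ i j e x => ksgn k (n * i) *: ract R e x f)
    (fun _ _ _ e => @rmul_fun_lin _ _ _ f a _ _ e)).
- move=> c a a' p i j l m e el em e' g x.
  rewrite /= (linZ (lact_linr _ _)) scalerA -ksgnD -mulrDr e; congr (_ *: _).
  exact: lractA.
Defined.

Lemma rmulE b b' n (f : hom b' b n) a c i j (e : i + n = j) (x : bc R b a i) :
  gm (rmul f) (b:=c) (a:=a) e x = ksgn k (n * i) *: ract R e x f.
Proof. by []. Qed.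

Lemma rmul_lin b b' n : linear (@rmul b b' n).
Proof.
move=> c g g'; apply: gmapP => b0 t i j e x.
by rewrite gmD gmZ !rmulE ract_linr scalerDr !scalerA mulrC.
Qed.

Lemma rmul_comp b b' b'' n m l (e : n + m = l) (e' : m + n = l)
    (g : hom b' b n) (f : hom b'' b' m) :
  rmul (comp e g f) = ksgn k (n * m) *: gcomp e' (rmul f) (rmul g).
Proof.
apply: gmapP => c a i j ej x.
have E : i + n + m = j by exact: gdegc e' ej.
rewrite gmZ (gcompE _ _ _ _ erefl E) !rmulE (linZ (ract_linl _ _)) !scalerA -!ksgnD.
rewrite (ractA erefl E e ej); congr (_ *: _).
by rewrite -[X in ksgn k (X * _) = _]e; parity.
Qed.

Lemma rmul_d b b' n n' (e : n + 1 = n') (f : hom b' b n) :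
  gd e (rmul f) = rmul (cd _ e f).
Proof.
apply: gmapP => c a i j ej x.
have E1 := gdeg1 e ej; have E2 := gdeg2 e ej.
rewrite (gdE _ _ _ erefl E1 erefl E2) !rmulE (linZ (cd_lin _)).
rewrite /= (ract_d _ E1 erefl e E2 ej) scalerDr !scalerA -!ksgnD.
have -> : ksgn k (n + n * (i + 1)) = ksgn k (n * i) by parity.
rewrite [LHS]addrAC subrr add0r; congr (_ *: _).
by rewrite -[X in _ = ksgn k (X * _)]e; parity.
Qed.

Lemma rmul1 b : rmul (idm b) = gid (lcomponent R b).
Proof.
apply: gmap0P => c a i x.
by rewrite rmulE gidE mul0r ksgn0 scale1r ract1.
Qed.
End RMul.
End Components.

(** * Hom bimodules and the tensor-Hom adjunction *)

Section HomBimodules.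
Variables (k : comPzRingType) (A B C : dgcat k).

(** [RHom L N] is [Hom_B(L, N)], taken over the right actions. *)
Definition RHom (L : bimod A B) (N : bimod C B) : bimod C A.
Proof.
refine (@Bimod k C A (fun a c => gHom (rcomponent L a) (rcomponent N c))
  (fun a a' c i j n e phi f => gcomp e phi (lmul L f))
  (fun a c c' i j n e g phi => gcomp e (lmul N g) phi) _ _ _ _ _ _ _ _ _ _ _).
- by intros; exact: gcomp_linl.
- by intros; exact: lin_comp (gcomp_linr _ _) (@lmul_lin _ _ _ _ _ _ _).
- by intros; exact: lin_comp (gcomp_linl _ _) (@lmul_lin _ _ _ _ _ _ _).
- by intros; exact: gcomp_linr.
- by intros; rewrite lmul1; exact: gcomp1r.
- by intros; rewrite lmul1; exact: gcomp1l.
- by intros; rewrite lmul_comp; symmetry; exact: gcompA.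
- by intros; rewrite lmul_comp; exact: gcompA.
- by intros; symmetry; exact: gcompA.
- by intros; rewrite -lmul_d; exact: gcomp_d.
- by intros; rewrite -lmul_d; exact: gcomp_d.
Defined.

Lemma lh_idx (i j n : int) : i + j = n -> j + i = n.
Proof. by rewrite addrC. Qed.

(** [LHom R N] is [Hom_(A^op)(R, N)], taken over the left actions. *)
Definition LHom (R : bimod A B) (N : bimod A C) : bimod B C.
Proof.
refine (@Bimod k B C (fun c b => gHom (lcomponent R b) (lcomponent N c))
  (fun c c' b i j n e phi h => ksgn k (i * j) *: gcomp (lh_idx e) (rmul N h) phi)
  (fun c b b' i j n e g phi => ksgn k (i * j) *: gcomp (lh_idx e) phi (rmul R g))
  _ _ _ _ _ _ _ _ _ _ _).
- by intros; apply: lin_scale; exact: gcomp_linr.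
- by intros; apply: lin_scale; exact: lin_comp (gcomp_linl _ _) (@rmul_lin _ _ _ _ _ _ _).
- by intros; apply: lin_scale; exact: lin_comp (gcomp_linr _ _) (@rmul_lin _ _ _ _ _ _ _).
- by intros; apply: lin_scale; exact: gcomp_linl.
- by intros; rewrite rmul1 mulr0 ksgn0 scale1r; exact: gcomp1l.
- by intros; rewrite rmul1 mul0r ksgn0 scale1r; exact: gcomp1r.
- move=> c c' c'' b i j l ij jl n e1 e2 e3 e4 m f g.
  rewrite (rmul_comp _ e3 (lh_idx e3)) (linZ (gcomp_linl _ _)) (linZ (gcomp_linr _ _)).
  rewrite !scalerA -!ksgnD; subst ij jl; congr (_ *: _); first by parity.
  exact: gcompA.
- move=> c b b' b'' i j l ij jl n e1 e2 e3 e4 g f m.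
  rewrite (rmul_comp _ e3 (lh_idx e3)) (linZ (gcomp_linr _ _)) (linZ (gcomp_linl _ _)).
  rewrite !scalerA -!ksgnD; subst ij jl; congr (_ *: _); first by parity.
  by symmetry; exact: gcompA.
- move=> c c' b b' i j l ij jl n e1 e2 e3 e4 g m f.
  rewrite (linZ (gcomp_linr _ _)) (linZ (gcomp_linl _ _)) !scalerA -!ksgnD.
  subst ij jl; congr (_ *: _); first by parity.
  exact: gcompA.
- move=> c c' b i j n i' j' n' e en ei ej e1 e2 m f.
  rewrite /= (linZ (gd_lin _)) (gcomp_d _ en ej ei (lh_idx e2) (lh_idx e1)) rmul_d.
  rewrite scalerDr addrC !scalerA -!ksgnD; subst i' j'.
  by congr (_ *: _ + _ *: _); parity.
- move=> c b b' i j n i' j' n' e en ei ej e1 e2 g m.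
  rewrite /= (linZ (gd_lin _)) (gcomp_d _ en ej ei (lh_idx e2) (lh_idx e1)) rmul_d.
  rewrite scalerDr addrC !scalerA -!ksgnD; subst i' j'.
  by congr (_ *: _ + _ *: _); parity.
Defined.

Lemma LHom_ractE (R : bimod A B) (N : bimod A C) c c' b i j n (e : i + j = n)
    (phi : bc (LHom R N) c b i) (h : hom c' c j) :
  ract (LHom R N) e phi h = ksgn k (i * j) *: gcomp (lh_idx e) (rmul N h) phi.
Proof. by []. Qed.

Lemma LHom_lactE (R : bimod A B) (N : bimod A C) c b b' i j n (e : i + j = n)
    (g : hom b b' i) (phi : bc (LHom R N) c b j) :
  lact (LHom R N) e g phi = ksgn k (i * j) *: gcomp (lh_idx e) phi (rmul R g).
Proof. by []. Qed.

Lemma RHom_ractE (L : bimod A B) (N : bimod C B) a a' c i j n (e : i + j = n)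
    (phi : bc (RHom L N) a c i) (f : hom a' a j) :
  ract (RHom L N) e phi f = gcomp e phi (lmul L f).
Proof. by []. Qed.

Lemma RHom_lactE (L : bimod A B) (N : bimod C B) a c c' i j n (e : i + j = n)
    (g : hom c c' i) (phi : bc (RHom L N) a c j) :
  lact (RHom L N) e g phi = gcomp e (lmul N g) phi.
Proof. by []. Qed.

Lemma cd_RHomE (L : bimod A B) (N : bimod C B) a c n n' (e : n + 1 = n')
    (phi : bc (RHom L N) a c n) : cd (bc (RHom L N) a c) e phi = gd e phi.
Proof. by []. Qed.

Lemma cd_LHomE (R : bimod A B) (N : bimod A C) c b n n' (e : n + 1 = n')
    (phi : bc (LHom R N) c b n) : cd (bc (LHom R N) c b) e phi = gd e phi.
Proof. by []. Qed.

Lemma acyclic_rcomponent (D E : dgcat k) (N : bimod D E) d :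
  acyclic N -> acyclic (rcomponent N d).
Proof. by move=> aN b a; exact: aN. Qed.
Lemma acyclic_lcomponent (D E : dgcat k) (N : bimod D E) e :
  acyclic N -> acyclic (lcomponent N e).
Proof. by move=> aN b a; exact: aN. Qed.

Lemma acyclic_RHom (L : bimod A B) (N : bimod C B) :
  (forall a, hproj (rcomponent L a)) -> acyclic N -> acyclic (RHom L N).
Proof.
move=> hL aN a c i j l ei el f df.
have [h ->] := hproj_bound (hL a) (@acyclic_rcomponent _ _ N c aN) ei df.
by exists h.
Qed.

Lemma acyclic_LHom (R : bimod A B) (N : bimod A C) :
  (forall b, hproj (lcomponent R b)) -> acyclic N -> acyclic (LHom R N).
Proof.
move=> hR aN c b i j l ei el f df.
have [h ->] := hproj_bound (hR b) (@acyclic_lcomponent _ _ N c aN) ei df.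
by exists h.
Qed.
End HomBimodules.

(** * Maps of one-sided modules from the action that is not the one of [k] *)

Section Builders.
Variables (k : comPzRingType).

Definition rbmap (B B' : dgcat k) (M : bimod (kcat k) B) (N : bimod (kcat k) B)
    (f : forall b a i, bc M b a i -> bc N b a i)
    (fl : forall b a i, linear (@f b a i))
    (fd : forall b a i j (e : i + 1 = j) (x : bc M b a i),
      @f b a j (cd _ e x) = cd _ e (@f b a i x))
    (fr : forall b b' a i j n (e : i + j = n) (x : bc M b a i) (g : hom b' b j),
      @f b' a n (ract M e x g) = ract N e (@f b a i x) g) : bmap M N :=
  BMap fl fd fr (fun b => klact_bm (phi := f b) (fl b)).

Definition lbmap (A : dgcat k) (M N : bimod A (kcat k))
    (f : forall b a i, bc M b a i -> bc N b a i)
    (fl : forall b a i, linear (@f b a i))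
    (fd : forall b a i j (e : i + 1 = j) (x : bc M b a i),
      @f b a j (cd _ e x) = cd _ e (@f b a i x))
    (fg : forall b a a' i j n (e : i + j = n) (g : hom a a' i) (x : bc M b a j),
      @f b a' n (lact M e g x) = lact N e g (@f b a j x)) : bmap M N :=
  BMap fl fd
    (fun b b' a => kract_bm (phi := fun b => f b a) (fun b => fl b a) (b:=b) (b':=b'))
    fg.

Definition kbmap (M N : bimod (kcat k) (kcat k))
    (f : forall b a i, bc M b a i -> bc N b a i)
    (fl : forall b a i, linear (@f b a i))
    (fd : forall b a i j (e : i + 1 = j) (x : bc M b a i),
      @f b a j (cd _ e x) = cd _ e (@f b a i x)) : bmap M N :=
  BMap fl fd
    (fun b b' a => kract_bm (phi := fun b => f b a) (fun b => fl b a) (b:=b) (b':=b'))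
    (fun b => klact_bm (phi := f b) (fl b)).

Definition rgmap (B : dgcat k) (M N : bimod (kcat k) B) n
    (f : forall b a i j, i + n = j -> bc M b a i -> bc N b a j)
    (fl : forall b a i j (e : i + n = j), linear (f b a i j e))
    (fr : forall b b' a i p j l m (e : i + p = j) (el : i + n = l)
      (em : j + n = m) (e' : l + p = m) (x : bc M b a i) (g : hom b' b p),
      f b' a j m em (ract M e x g) = ract N e' (f b a i l el x) g) : gmap M N n :=
  GMap fl fr (fun b => klact_gm (phi := f b) (fl b)).

Definition lgmap (A : dgcat k) (M N : bimod A (kcat k)) n
    (f : forall b a i j, i + n = j -> bc M b a i -> bc N b a j)
    (fl : forall b a i j (e : i + n = j), linear (f b a i j e))
    (fg : forall b a a' p i j l m (e : p + i = j) (el : i + n = l)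
      (em : j + n = m) (e' : p + l = m) (g : hom a a' p) (x : bc M b a i),
      f b a' j m em (lact M e g x) = ksgn k (n * p) *: lact N e' g (f b a i l el x))
    : gmap M N n :=
  GMap fl
    (fun b b' a => kract_gm (phi := fun b => f b a) (fun b => fl b a) (b:=b) (b':=b'))
    fg.

Definition kgmap (M N : bimod (kcat k) (kcat k)) n
    (f : forall b a i j, i + n = j -> bc M b a i -> bc N b a j)
    (fl : forall b a i j (e : i + n = j), linear (f b a i j e)) : gmap M N n :=
  GMap fl
    (fun b b' a => kract_gm (phi := fun b => f b a) (fun b => fl b a) (b:=b) (b':=b'))
    (fun b => klact_gm (phi := f b) (fl b)).
End Builders.

(** * The Yoneda lemma and h-projectivity of representables *)

Section Yoneda.
Variables (k : comPzRingType) (A : dgcat k).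

(** The objects [t] and [t'] of [kcat] are variables of type [unit]; matching on both brings them to
    [tt], where the two values of [N] can be compared. *)
Definition rY (N : rmod A) (X : ob A) t n (z : bc N X t n) : gmap (hright X) N n.
Proof.
refine (@rgmap k A (hright X) N n
  (fun b t' i j e (u : hom b X i) =>
     match t' return bc N b t' j with tt =>
     match t return bc N X t n -> bc N b tt j with tt => fun z =>
       ract N (lm_idx e) z u end z end) _ _).
- move=> b [] i j e; case: t z => z; exact: ract_linr.
- move=> b b' [] i p j l m e el em e' x g; case: t z => z /=.
  by symmetry; exact: ractA.
Defined.

Lemma rYE (N : rmod A) X n (z : bc N X tt n) b i j (e : i + n = j) (e' : n + i = j)
    (u : hom b X i) :
  gm (rY z) (b:=b) (a:=tt) e (u : bc (hright X) b tt i) = ract N e' z u.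
Proof. by rewrite /= (eq_irrelevance (lm_idx e) e'). Qed.

Lemma rY_d (N : rmod A) X n n' (e : n + 1 = n') (z : bc N X tt n) :
  gd e (rY z) = rY (cd _ e z).
Proof.
apply: gmapP => b [] i j ej u.
have E1 := gdeg1 e ej; have E2 := gdeg2 e ej.
rewrite (gdE _ _ _ erefl E1 erefl E2) (rYE _ _ (lm_idx erefl)).
rewrite [X in _ - _ *: X](rYE _ _ (lm_idx E2)) (rYE _ _ (lm_idx ej)).
by rewrite (ract_d _ E1 e erefl (lm_idx ej) (lm_idx E2)) [LHS]addrK.
Qed.

Lemma rYK (N : rmod A) X n (f : gmap (hright X) N n) :
  rY (gm f (add0r n) (idm X : bc (hright X) X tt 0)) = f.
Proof.
apply: gmapP => b [] i j e u; rewrite (rYE _ _ (lm_idx e)).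
by rewrite -(gm_r f (add0r i) (add0r n) e) /= comp1m.
Qed.

Lemma gm_d1 (B C : dgcat k) (M N : bimod B C) n n' (e : n + 1 = n') (f : gmap M N n)
    b a i j l (ei : i + n = j) (ej : i + n' = l) (el : j + 1 = l) (x : bc M b a i) :
  (forall m (em : i + 1 = m), cd _ em x = 0) ->
  gm (gd e f) ej x = cd _ el (gm f ei x).
Proof.
move=> dx; have E : i + 1 + n = l by rewrite -ej -e; lia.
by rewrite (gdE _ _ _ ei el erefl E) dx (lin0 (gm_lin _ _)) scaler0 subr0.
Qed.

(** By Yoneda the complex of maps from [hright X] to [N] is [N(X)]: a closed map is a cocycle there,
    and a primitive of the cocycle is a nullhomotopy. *)
Lemma hproj_hright (X : ob A) : hproj (hright X).
Proof.
apply/hprojP => N aN f df.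
pose z := gm f (add0r 0) (idm X : bc (hright X) X tt 0).
have dz : cd _ (add0r 1) z = 0.
  rewrite -(gm_d1 (add0r 1) f (add0r 0) (add0r 1) (add0r 1)) ?df //.
  by move=> m em; exact: idm_d.
have [y hy] := aN X tt 0 (-1) 1 (addNr 1) (add0r 1) z dz.
by exists (rY y); rewrite rY_d -hy rYK.
Qed.

Definition lY (N : bimod A (kcat k)) (X : ob A) t n (z : bc N t X n)
  : gmap (hleft X) N n.
Proof.
refine (@lgmap k A (hleft X) N n
  (fun t' a i j e (u : hom X a i) =>
     match t' return bc N t' a j with tt =>
     match t return bc N t X n -> bc N tt a j with tt => fun z =>
       ksgn k (n * i) *: lact N e u z end z end) _ _).
- move=> [] a i j e; case: t z => z c x y.
  by rewrite (lact_linl e z c) scalerDr !scalerA mulrC.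
- move=> [] a a' p i j l m e el em e' g x; case: t z => z /=.
  rewrite (linZ (lact_linr _ _)) scalerA -ksgnD -mulrDr e; congr (_ *: _).
  by symmetry; exact: lactA.
Defined.

Lemma lYE (N : bimod A (kcat k)) X n (z : bc N tt X n) a i j (e : i + n = j)
    (u : hom X a i) :
  gm (lY z) (b:=tt) (a:=a) e (u : bc (hleft X) tt a i) = ksgn k (n * i) *: lact N e u z.
Proof. by []. Qed.

Lemma lY_d (N : bimod A (kcat k)) X n n' (e : n + 1 = n') (z : bc N tt X n) :
  gd e (lY z) = lY (cd _ e z).
Proof.
apply: gmapP => -[] a i j ej u.
have E1 := gdeg1 e ej; have E2 := gdeg2 e ej.
rewrite (gdE _ _ _ erefl E1 erefl E2) !lYE (linZ (cd_lin _)).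
rewrite (lact_d _ E1 erefl e E2 ej) scalerDr !scalerA -!ksgnD.
have -> : ksgn k (n + n * (i + 1)) = ksgn k (n * i) by parity.
rewrite [LHS]addrAC subrr add0r; congr (_ *: _).
by rewrite -[X in _ = ksgn k (X * _)]e; parity.
Qed.

Lemma lYK (N : bimod A (kcat k)) X n (f : gmap (hleft X) N n) :
  lY (gm f (add0r n) (idm X : bc (hleft X) tt X 0)) = f.
Proof.
apply: gmapP => -[] a i j e u; rewrite lYE.
rewrite -(gm_l f (addr0 i) (add0r n) e) /=; congr (gm f e _).
exact: compm1.
Qed.

Lemma hproj_hleft (X : ob A) : hproj (hleft X).
Proof.
apply/hprojP => N aN f df.
pose z := gm f (add0r 0) (idm X : bc (hleft X) tt X 0).
have dz : cd _ (add0r 1) z = 0.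
  rewrite -(gm_d1 (add0r 1) f (add0r 0) (add0r 1) (add0r 1)) ?df //.
  by move=> m em; exact: idm_d.
have [y hy] := aN tt X 0 (-1) 1 (addNr 1) (add0r 1) z dz.
by exists (lY y); rewrite lY_d -hy lYK.
Qed.
End Yoneda.

Section HProjHom.
Variables (k : comPzRingType) (A : dgcat k).

Lemma hproj_kmod (M N : bimod (kcat k) (kcat k)) (f : bmap M N) (g : bmap N M) :
  (forall b a i x, g b a i (f b a i x) = x) -> hproj N -> hproj M.
Proof.
move=> gf hN; apply: (hproj_retract (s := f) (r := g)) hN.
exact: eqb_homotopic.
Qed.

(** Both modules are the complex [A(a', a)], but they arise from different restrictions and are not
    convertible. The identity maps exhibit one as a retract of the other. *)
Lemma hproj_homk_l (a a' : ob A) : hproj_dgcat A -> hproj (lcomponent (hright a) a').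
Proof.
move=> /(_ a' a).
pose f := @kbmap k (lcomponent (hright a) a') (homk a' a) (fun _ _ _ x => x)
  (fun _ _ _ _ _ _ => erefl) (fun _ _ _ _ _ _ => erefl).
pose g := @kbmap k (homk a' a) (lcomponent (hright a) a') (fun _ _ _ x => x)
  (fun _ _ _ _ _ _ => erefl) (fun _ _ _ _ _ _ => erefl).
exact: (@hproj_kmod _ _ f g).
Qed.

Lemma hproj_homk_r (a a' : ob A) : hproj_dgcat A -> hproj (rcomponent (hleft a) a').
Proof.
move=> /(_ a a').
pose f := @kbmap k (rcomponent (hleft a) a') (homk a a') (fun _ _ _ x => x)
  (fun _ _ _ _ _ _ => erefl) (fun _ _ _ _ _ _ => erefl).
pose g := @kbmap k (homk a a') (rcomponent (hleft a) a') (fun _ _ _ x => x)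
  (fun _ _ _ _ _ _ => erefl) (fun _ _ _ _ _ _ => erefl).
exact: (@hproj_kmod _ _ f g).
Qed.

End HProjHom.

(** * Components of h-projective bimodules *)

Section HProjComponents.
Variables (k : comPzRingType) (A B : dgcat k).

Section RComponent.
Variables (Y : bimod A B) (a : ob A) (N : rmod B).

Lemma rcur_lin (f : bmap (rcomponent Y a) N) b a' i (y : bc Y b a' i) (t : ob (kcat k))
    j l (e : j + i = l) :
  linear (fun u : hom a' a j => ksgn k (i * j) *: f b t l (lact Y e u y)).
Proof.
apply: lin_scale; apply: lin_comp; last exact: lact_linl.
exact: (@bm_lin _ _ _ _ _ f b t l).
Qed.

Definition rcur_at (f : bmap (rcomponent Y a) N) b a' i (y : bc Y b a' i)
  : gmap (lcomponent (hright a) a') (lcomponent N b) i :=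
  @kgmap k (lcomponent (hright a) a') (lcomponent N b) i
    (fun _ t j l e u => ksgn k (i * j) *: f b t l (lact Y e u y))
    (fun _ t j l e => rcur_lin f y t e).

Lemma rcurE f b a' i (y : bc Y b a' i) t t' j l (e : j + i = l) (u : hom a' a j) :
  gm (rcur_at f y) (b:=t) (a:=t') e u = ksgn k (i * j) *: f b t' l (lact Y e u y).
Proof. by []. Qed.

(** [LHom (hright a) N] is the coinduced bimodule with values [Hom_k(A(a', a), N(b))]. Coinduction
    is right adjoint to taking the component at [a], and this is the transposition. *)
Definition rcur (f : bmap (rcomponent Y a) N) : bmap Y (LHom (hright a) N).
Proof.
refine (@BMap k A B Y (LHom (hright a) N) (fun b a' i y => rcur_at f y) _ _ _ _).
- move=> b a' i c y y'; apply: gmapP => t t' j l e u.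
  rewrite gmD gmZ !rcurE (lact_linr e u c) bmD bmZ scalerDr !scalerA.
  by rewrite mulrC.
- move=> b a' i i' e y; apply: gmapP => t t' j l ej u.
  have E1 := gdeg1 e ej; have E2 := gdeg2 e ej.
  rewrite cd_LHomE (gdE _ _ _ erefl E1 erefl E2) !rcurE.
  have -> : cd (bc (lcomponent N b) t t') E1 (ksgn k (i * j) *: f b t' _ (lact Y erefl u y))
    = ksgn k (i * j) *: (f b t' _ (lact Y E2 (cd _ erefl u) y)
        + ksgn k j *: f b t' l (lact Y ej u (cd _ e y))).
    rewrite (linZ (cd_lin _)) -bmZ -bmD; congr (_ *: _).
    rewrite -[LHS](bm_d f E1); congr (f b t' l _).
    exact: (@lact_d k A B Y b a' a j i _ _ _ _ erefl E1 erefl e E2 ej u y).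
  rewrite scalerDr !scalerA -!ksgnD.
  have -> : ksgn k (i + i * (j + 1)) = ksgn k (i * j) by parity.
  rewrite [RHS]addrAC subrr add0r; congr (_ *: _); subst i'; parity.
- move=> b b' a' i q n e y h; apply: gmapP => t t' j l ej u.
  have E : j + i + q = l by rewrite -ej -e addrA.
  rewrite LHom_ractE gmZ (gcompE _ _ _ _ erefl E) rmulE !rcurE.
  rewrite (linZ (ract_linl _ _)) !scalerA -!ksgnD -bm_r /=.
  rewrite (lractA erefl E e ej); congr (_ *: _); subst n; parity.
- move=> b a' a'' p i n e g y; apply: gmapP => t t' j l ej u.
  have E : j + p + i = l by rewrite -ej -e addrA.
  rewrite LHom_lactE gmZ (gcompE _ _ _ _ erefl E) rmulE (linZ (gm_lin _ _)) !rcurE.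
  rewrite !scalerA -!ksgnD (lactA e ej erefl E); congr (_ *: _); subst n; parity.
Defined.

Definition runcur n (h : gmap Y (LHom (hright a) N) n) : gmap (rcomponent Y a) N n.
Proof.
refine (@rgmap k B (rcomponent Y a) N n
  (fun b t i j e y => gm (gm h (b:=b) (a:=a) e y) (b:=tt) (a:=t) (add0r j) (idm a)) _ _).
- move=> b t i j e c y y'.
  by rewrite (gm_lin h e c) gmD gmZ.
- move=> b b' t i p j l m e el em e' y g.
  rewrite (gm_r h e el em e') LHom_ractE gmZ (gcompE _ _ _ _ (add0r l) e') rmulE.
  rewrite scalerA -ksgnD; have -> : ksgn k (l * p + p * l) = ksgn k 0 by parity.
  by rewrite ksgn0 scale1r.
Defined.

Lemma runcurE n (h : gmap Y (LHom (hright a) N) n) b t i j (e : i + n = j)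
    (y : bc Y b a i) :
  gm (runcur h) (b:=b) (a:=t) e y
  = gm (gm h (b:=b) (a:=a) e y) (b:=tt) (a:=t) (add0r j) (idm a).
Proof. by []. Qed.

Lemma runcur_d n n' (e : n + 1 = n') (h : gmap Y (LHom (hright a) N) n) :
  gd e (runcur h) = runcur (gd e h).
Proof.
apply: gmapP => b t i j ej y.
have E1 := gdeg1 e ej; have E2 := gdeg2 e ej.
rewrite (gdE _ _ _ erefl E1 erefl E2) !runcurE (gdE _ _ _ erefl E1 erefl E2).
rewrite gmD gmN gmZ cd_LHomE (gm_d1 _ _ (add0r _) _ E1) //.
by move=> m em; exact: idm_d.
Qed.

Lemma runcurK (f : bmap (rcomponent Y a) N) : runcur (gofb (rcur f)) = gofb f.
Proof.
apply: gmap0P => b t i y; rewrite runcurE !gofbE rcurE mulr0 ksgn0 scale1r.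
by rewrite lact1.
Qed.

Lemma runcur_lin n : linear (@runcur n).
Proof. by move=> c h h'; apply: gmapP. Qed.

(** Coinduction preserves acyclicity because the complexes [A(a', a)] are h-projective over [k]. Its
    left adjoint, the component at [a], therefore preserves h-projectivity. *)
Lemma hproj_rcomponent_at : hproj_dgcat A -> hproj Y -> acyclic N ->
  forall f g : bmap (rcomponent Y a) N, homotopic f g.
Proof.
move=> hA hY aN f g.
have aL : acyclic (LHom (hright a) N).
  by apply: acyclic_LHom => // a'; exact: hproj_homk_l.
move: (rcur f) (rcur g) (runcurK f) (runcurK g) => u v -uf -vg.
have /homotopicP[h hh] := hY _ aL u v.
apply/homotopicP; exists (runcur h).
by rewrite runcur_d -hh (linD (@runcur_lin _)) (linN (@runcur_lin _)) -uf -vg.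
Qed.
End RComponent.

Lemma hproj_rcomponent (Y : bimod A B) a :
  hproj_dgcat A -> hproj Y -> hproj (rcomponent Y a).
Proof. by move=> hA hY N aN; exact: hproj_rcomponent_at. Qed.

Section LComponent.
Variables (Y : bimod A B) (b : ob B) (N : bimod A (kcat k)).

Lemma lcur_lin (f : bmap (lcomponent Y b) N) a b' i (y : bc Y b' a i) (t : ob (kcat k))
    j l (e : j + i = l) :
  linear (fun u : hom b b' j => f t a l (ract Y (lh_idx e) y u)).
Proof.
apply: lin_comp; last exact: ract_linr.
exact: (@bm_lin _ _ _ _ _ f t a l).
Qed.

Definition lcur_at (f : bmap (lcomponent Y b) N) a b' i (y : bc Y b' a i)
  : gmap (rcomponent (hleft b) b') (rcomponent N a) i :=
  @kgmap k (rcomponent (hleft b) b') (rcomponent N a) i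
    (fun t _ j l e u => f t a l (ract Y (lh_idx e) y u))
    (fun t _ j l e => lcur_lin f y t e).

Lemma lcurE f a b' i (y : bc Y b' a i) t t' j l (e : j + i = l) (e' : i + j = l)
    (u : hom b b' j) :
  gm (lcur_at f y) (b:=t) (a:=t') e u = f t a l (ract Y e' y u).
Proof. by rewrite /= (eq_irrelevance (lh_idx e) e'). Qed.

Definition lcur (f : bmap (lcomponent Y b) N) : bmap Y (RHom (hleft b) N).
Proof.
refine (@BMap k A B Y (RHom (hleft b) N) (fun b' a i y => lcur_at f y) _ _ _ _).
- move=> b' a i c y y'; apply: gmapP => t t' j l e u.
  by rewrite gmD gmZ !(lcurE _ _ _ _ _ (lh_idx e)) (ract_linl _ _ c) bmD bmZ.
- move=> b' a i i' e y; apply: gmapP => t t' j l ej u.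
  have E1 := gdeg1 e ej; have E2 := gdeg2 e ej.
  rewrite cd_RHomE (gdE _ _ _ erefl E1 erefl E2) !(lcurE _ _ _ _ _ (lh_idx ej)).
  rewrite (lcurE _ _ _ _ _ (lh_idx erefl)) (lcurE _ _ _ _ _ (lh_idx E2)).
  have -> : cd (bc (rcomponent N a) t t') E1 (f t a _ (ract Y (lh_idx erefl) y u))
    = f t a l (ract Y (lh_idx ej) (cd _ e y) u)
      + ksgn k i *: f t a l (ract Y (lh_idx E2) y (cd _ erefl u)).
    rewrite -bmZ -bmD -[LHS](bm_d f E1); congr (f t a l _).
    exact: (@ract_d k A B Y b' b a i j _ _ _ _ _ E1 e erefl (lh_idx ej) (lh_idx E2) y u).
  by rewrite [RHS]addrK.
- move=> b1 b2 a i q n e y h; apply: gmapP => t t' j l ej u.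
  have E0 : q + j + i = l by lia.
  rewrite RHom_ractE (gcompE _ _ _ _ (addrC j q) E0) (lmulE _ _ _ erefl).
  rewrite (lcurE _ _ _ _ _ (lh_idx ej)) (lcurE _ _ _ _ _ (lh_idx E0)).
  congr (f t a l _); exact: (@ractA k A B Y b1 b2 b a i q j n (q + j) l e (lh_idx ej) erefl _ y h
    u).
- move=> b' a' a'' p i n e g y; apply: gmapP => t t' j l ej u.
  have E : j + i + p = l by rewrite -ej -e; lia.
  rewrite RHom_lactE (gcompE _ _ _ _ erefl E) (lmulE _ _ _ (lm_idx E)).
  rewrite (lcurE _ _ _ _ _ (lh_idx ej)) (lcurE _ _ _ _ _ (lh_idx erefl)).
  rewrite -[RHS](bm_l f (lm_idx E)); congr (f t _ l _).
  exact: (@lractA k A B Y b' b a' a'' p i j n (j + i) l e (lh_idx ej) (lh_idx erefl) (lm_idx E) g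
    y u).
Defined.

Definition luncur n (h : gmap Y (RHom (hleft b) N) n) : gmap (lcomponent Y b) N n.
Proof.
refine (@lgmap k A (lcomponent Y b) N n
  (fun t a i j e y => gm (gm h (b:=b) (a:=a) e y) (b:=t) (a:=tt) (add0r j) (idm b)) _ _).
- move=> t a i j e c y y'.
  by rewrite (gm_lin h e c) gmD gmZ.
- move=> t a a' p i j l m e el em e' g y.
  rewrite (gm_l h e el em e') RHom_lactE gmZ (gcompE _ _ _ _ (add0r l) (lm_idx e')).
  by rewrite (lmulE _ _ _ e').
Defined.

Lemma luncurE n (h : gmap Y (RHom (hleft b) N) n) t a i j (e : i + n = j)
    (y : bc Y b a i) :
  gm (luncur h) (b:=t) (a:=a) e y
  = gm (gm h (b:=b) (a:=a) e y) (b:=t) (a:=tt) (add0r j) (idm b).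
Proof. by []. Qed.

Lemma luncur_d n n' (e : n + 1 = n') (h : gmap Y (RHom (hleft b) N) n) :
  gd e (luncur h) = luncur (gd e h).
Proof.
apply: gmapP => t a i j ej y.
have E1 := gdeg1 e ej; have E2 := gdeg2 e ej.
rewrite (gdE _ _ _ erefl E1 erefl E2) !luncurE (gdE _ _ _ erefl E1 erefl E2).
rewrite gmD gmN gmZ cd_RHomE (gm_d1 _ _ (add0r _) _ E1) //.
by move=> m em; exact: idm_d.
Qed.

Lemma luncurK (f : bmap (lcomponent Y b) N) : luncur (gofb (lcur f)) = gofb f.
Proof.
apply: gmap0P => t a i y; rewrite luncurE !gofbE (lcurE _ _ _ _ _ (addr0 i)).
by rewrite ract1.
Qed.

Lemma luncur_lin n : linear (@luncur n).
Proof. by move=> c h h'; apply: gmapP. Qed.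

Lemma hproj_lcomponent_at : hproj_dgcat B -> hproj Y -> acyclic N ->
  forall f g : bmap (lcomponent Y b) N, homotopic f g.
Proof.
move=> hB hY aN f g.
have aL : acyclic (RHom (hleft b) N).
  by apply: acyclic_RHom => // b'; exact: hproj_homk_r.
move: (lcur f) (lcur g) (luncurK f) (luncurK g) => u v -uf -vg.
have /homotopicP[h hh] := hY _ aL u v.
apply/homotopicP; exists (luncur h).
by rewrite luncur_d -hh (linD (@luncur_lin _)) (linN (@luncur_lin _)) -uf -vg.
Qed.
End LComponent.

Lemma hproj_lcomponent (Y : bimod A B) b :
  hproj_dgcat B -> hproj Y -> hproj (lcomponent Y b).
Proof. by move=> hB hY N aN; exact: hproj_lcomponent_at. Qed.
End HProjComponents.

(** * Currying, and h-projectivity of tensor products *)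

Section TensorHom.
Variables (k : comPzRingType) (A B C : dgcat k).
Variables (X : bimod C A) (L : bimod A B) (N : bimod C B).

Section Curry.
Variable f : bmap (tens X L) N.

Lemma cur_idx (i j l : int) : j + i = l -> i + j = l. Proof. by rewrite addrC. Qed.

Definition cur_at a c i (x : bc X a c i) : gmap (rcomponent L a) (rcomponent N c) i.
Proof.
refine (@rgmap k B (rcomponent L a) (rcomponent N c) i
  (fun b _ j l e y => f b c l (tpure (cur_idx e) x y : bc (tens X L) b c l)) _ _).
- move=> b t j l e s y y'.
  rewrite -[s *: f _ _ _ _ + _](@bm_lin _ _ _ _ _ f b c l s); congr (f b c l _).
  exact: tpure_linr.
- move=> b b' t j q j' l m e el em e' y h; rewrite -[RHS](bm_r f e').
  by congr (f b' c m _); symmetry; exact: tract_pure.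
Defined.

Lemma curE a c i (x : bc X a c i) b t j l (e : j + i = l) (e' : i + j = l)
    (y : bc L b a j) :
  gm (cur_at x) (b:=b) (a:=t) e y = f b c l (tpure e' x y : bc (tens X L) b c l).
Proof. by rewrite /= (tpure_irr (cur_idx e) e'). Qed.

Definition curry : bmap X (RHom L N).
Proof.
refine (@BMap k C A X (RHom L N) (fun a c i x => cur_at x) _ _ _ _).
- move=> a c i s x x'; apply: gmapP => b t j l e y.
  rewrite gmD gmZ !(curE _ _ _ (cur_idx e)).
  rewrite -[s *: f _ _ _ _ + _](@bm_lin _ _ _ _ _ f b c l s); congr (f b c l _).
  exact: tpure_linl.
- move=> a c i i' e x; apply: gmapP => b t j l ej y.
  have E1 := gdeg1 e ej; have E2 := gdeg2 e ej.
  rewrite cd_RHomE (gdE _ _ _ erefl E1 erefl E2) (curE _ _ _ (cur_idx ej)).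
  rewrite (curE _ _ _ (cur_idx erefl)) (curE _ _ _ (cur_idx E2)).
  have -> : cd (bc (rcomponent N c) b t) E1 (f b c _ (tpure (cur_idx erefl) x y))
    = f b c l (tpure (cur_idx ej) (cd _ e x) y : bc (tens X L) b c l)
      + ksgn k i *: f b c l (tpure (cur_idx E2) x (cd _ erefl y) : bc (tens X L) b c l).
    rewrite -bmZ -bmD -[LHS](bm_d f E1); congr (f b c l _); exact: cd_tpure.
  by rewrite [RHS]addrK.
- move=> a a' c i q n e x h; apply: gmapP => b t j l ej y.
  have E : j + q + i = l by rewrite -ej -e; lia.
  have E' : q + j = j + q by rewrite addrC.
  rewrite RHom_ractE (gcompE _ _ _ _ erefl E) (lmulE _ _ _ E').
  rewrite (curE _ _ _ (cur_idx ej)) (curE _ _ _ (cur_idx E)).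
  by congr (f b c l _); exact: tpure_bal.
- move=> a c c' p i n e g x; apply: gmapP => b t j l ej y.
  have E : j + i + p = l by rewrite -ej -e; lia.
  rewrite RHom_lactE (gcompE _ _ _ _ erefl E) (lmulE _ _ _ (lm_idx E)).
  rewrite (curE _ _ _ (cur_idx ej)) (curE _ _ _ (cur_idx erefl)).
  rewrite -[RHS](bm_l f (lm_idx E)); congr (f b _ l _).
  by symmetry; exact: tlact_pure.
Defined.

Lemma curryE a c i (x : bc X a c i) : curry a c i x = cur_at x.
Proof. by []. Qed.
End Curry.

Lemma unc_idx (i j n m : int) : i + j + n = m -> j + (i + n) = m.
Proof. by move=> <-; rewrite addrCA addrA. Qed.

Definition uncurry n (h : gmap X (RHom L N) n) : gmap (tens X L) N n.
Proof.
refine (@gtmor k C A B X L N n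
  (fun b c a i j m e x y => gm (gm h erefl x) (b:=b) (a:=tt) (unc_idx e) y) _ _ _ _ _).
- by move=> b c a i j m e y s x x'; rewrite (gm_lin h erefl s) gmD gmZ.
- move=> b c a i j m e x.
  exact: (@gm_lin k (kcat k) B (rcomponent L a) (rcomponent N c) (i + n)
    (gm h erefl x) b tt j m (unc_idx e)).
- move=> b c m a1 a2 i p j i' j' ei ej e e' x g y.
  have E : i + n + p = i' + n by rewrite -ei addrAC.
  rewrite (gm_r h ei erefl erefl E) RHom_ractE.
  by rewrite (gcompE _ _ _ _ (lh_idx ej) (unc_idx e')) (lmulE _ _ _ ej).
- move=> b b' c a i j p m l j' e el ej e' x y g.
  by rewrite (gm_r (gm h erefl x) ej (unc_idx e) (unc_idx e') el).
- move=> b c c' a i j p m l i' e el ei e' g x y.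
  have E : p + (i + n) = i' + n by rewrite -ei addrA.
  rewrite (gm_l h ei erefl erefl E) gmZ RHom_lactE.
  rewrite (gcompE _ _ _ _ (unc_idx e) (lm_idx el)).
  by rewrite (lmulE _ _ _ el).
Defined.

Lemma uncurryE n (h : gmap X (RHom L N) n) b c a i j l m r (e : i + j = l)
    (em : l + n = m) (er : i + n = r) (e' : j + r = m)
    (x : bc X a c i) (y : bc L b a j) :
  gm (uncurry h) em (tpure e x y) = gm (gm h er x) (b:=b) (a:=tt) e' y.
Proof.
subst r; have E : i + j + n = m by rewrite e.
by rewrite /uncurry (gtmorE _ _ _ _ _ _ _ E) (gm_irr _ (unc_idx E) e').
Qed.

Lemma uncurry_lin n : linear (@uncurry n).
Proof.
move=> s h h'; apply: gtens_ext => b c a i j l m e em x y.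
have E : j + (i + n) = m by rewrite -em -e addrCA addrA.
by rewrite gmD gmZ !(uncurryE _ _ _ erefl E).
Qed.

Lemma uncurry_d n n' (e : n + 1 = n') (h : gmap X (RHom L N) n) :
  gd e (uncurry h) = uncurry (gd e h).
Proof.
apply: gtens_ext => b c a i j l m el em x y.
have E1 := gdeg1 e em; have E2 := gdeg2 e em.
have F1 : j + (i + n) = l + n by lia.
have F2 : i + 1 + j = l + 1 by lia.
have F3 : i + (j + 1) = l + 1 by lia.
have F4 : j + (i + n') = m by lia.
have F5 : i + 1 + n = i + n' by lia.
have F6 : j + 1 + (i + n) = m by lia.
have F7 : i + n + 1 = i + n' by lia.
rewrite (gdE _ _ _ erefl E1 erefl E2) (uncurryE _ _ _ erefl F1).
rewrite (cd_tpure _ _ erefl erefl F2 F3) (linD (gm_tens_lin _ _)).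
rewrite (linZ (gm_tens_lin _ _)) (uncurryE _ _ _ F5 F4) (uncurryE _ _ _ erefl F6).
rewrite (uncurryE _ _ _ erefl F4) (gdE _ _ _ erefl F7 erefl F5) gmD gmN gmZ.
rewrite cd_RHomE (gdE _ _ _ F1 E1 erefl F6) scalerDr opprD scalerA -ksgnD.
have -> : ksgn k (i + n) = ksgn k (n + i) by parity.
by rewrite [LHS]addrA [LHS]addrAC.
Qed.

Lemma curryK (f : bmap (tens X L) N) : uncurry (gofb (curry f)) = gofb f.
Proof.
apply: gtens_ext => b c a i j l m e em x y.
have E : l = m by rewrite -em addr0.
case: m / E em => em; have E : j + i = l by rewrite addrC.
by rewrite (uncurryE _ _ _ (addr0 i) E) !gofbE curryE (curE _ _ _ _ e).
Qed.

(** Transposition turns maps out of [tens X L] into maps from [X] to [RHom L N], which is acyclic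
    because the components of [L] are h-projective. *)
Lemma hproj_tens : hproj X -> (forall a, hproj (rcomponent L a)) -> acyclic N ->
  forall f g : bmap (tens X L) N, homotopic f g.
Proof.
move=> hX hL aN f g.
move: (curry f) (curry g) (curryK f) (curryK g) => u v -uf -vg.
have /homotopicP[h hh] := hX _ (acyclic_RHom hL aN) u v.
apply/homotopicP; exists (uncurry h).
by rewrite uncurry_d -hh (linD (@uncurry_lin _)) (linN (@uncurry_lin _)) -uf -vg.
Qed.
End TensorHom.

Lemma hproj_tens_hproj (k : comPzRingType) (A B C : dgcat k) (X : bimod C A)
    (L : bimod A B) :
  hproj X -> (forall a, hproj (rcomponent L a)) -> hproj (tens X L).
Proof. by move=> hX hL N aN; exact: hproj_tens. Qed.

(** * Tensor products of morphisms up to homotopy *)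

Section TensorMorphisms.
Variables (k : comPzRingType) (A B C : dgcat k).

Lemma tmorE (F : bimod A B) (G : bimod B C) (N : bimod A C) (phi : tbil F G N)
    c a n b i j (e : i + j = n) (x : bc F b a i) (y : bc G c b j) :
  tmor phi c a n (tpure e x y) = phi _ _ _ _ _ _ e x y.
Proof. exact: tmor_pure. Qed.

Lemma tmapE (F F' : bimod A B) (G G' : bimod B C) (f : bmap F F') (g : bmap G G')
    c a n b i j (e : i + j = n) (x : bc F b a i) (y : bc G c b j) :
  tmap f g c a n (tpure e x y) = tpure e (f b a i x) (g c b j y).
Proof. exact: tmor_pure. Qed.

Lemma tens_bext (F : bimod A B) (G : bimod B C) (N : bimod A C)
    (f g : bmap (tens F G) N) :
  (forall c a n b i j (e : i + j = n) (x : bc F b a i) (y : bc G c b j),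
     f c a n (tpure e x y) = g c a n (tpure e x y)) ->
  forall c a n z, f c a n z = g c a n z.
Proof.
move=> fg c a n; apply: tens_ext.
- exact: (@bm_lin _ _ _ _ _ f c a n).
- exact: (@bm_lin _ _ _ _ _ g c a n).
- by move=> b i j e x y; exact: fg.
Qed.

Lemma tens_bhomotopic (F : bimod A B) (G : bimod B C) (N : bimod A C)
    (f g : bmap (tens F G) N) :
  (forall c a n b i j (e : i + j = n) (x : bc F b a i) (y : bc G c b j),
     f c a n (tpure e x y) = g c a n (tpure e x y)) -> homotopic f g.
Proof. by move=> fg; apply: eqb_homotopic; exact: tens_bext. Qed.

Lemma tmap_dFbl (F F' : bimod A B) (G : bimod B C) (f : bmap F F') :
  gofb (tmap f (bid G)) = gofb (dFb (tensl A G) f).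
Proof.
rewrite gofb_dFb; apply: gtens_ext => c a b i j l m e em x y.
have E : l = m by rewrite -em addr0.
case: m / E em => em.
by rewrite gofbE tmapE [RHS](gtenslE _ _ _ (addr0 i) e) gofbE.
Qed.

Lemma tmap_dFbr (F : bimod A B) (G G' : bimod B C) (g : bmap G G') :
  gofb (tmap (bid F) g) = gofb (dFb (tensr C F) g).
Proof.
rewrite gofb_dFb; apply: gtens_ext => c a b i j l m e em x y.
have E : l = m by rewrite -em addr0.
case: m / E em => em.
by rewrite gofbE tmapE [RHS](gtensrE _ _ _ (addr0 j) e) gofbE mul0r ksgn0 scale1r.
Qed.

(** A tensor product of two maps is a composite of one-sided ones, and these are images under the
    dg-functors [tensl] and [tensr], which preserve homotopies. *)
Lemma tmap_homotopic (F F' : bimod A B) (G G' : bimod B C) (f f' : bmap F F')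
    (g g' : bmap G G') :
  homotopic f f' -> homotopic g g' -> homotopic (tmap f g) (tmap f' g').
Proof.
have split (u : bmap F F') (v : bmap G G') :
    homotopic (tmap u v) (bcomp (tmap u (bid G')) (tmap (bid F) v)).
  by apply: tens_bhomotopic => c a n b i j e x y; rewrite bcompE !tmapE.
move=> hf hg; apply: homotopic_trans (split f g) _.
apply: (homotopic_trans _ (homotopic_sym (split f' g'))).
apply: homotopic_comp.
  apply: homotopic_trans (gofb_homotopic (tmap_dFbl _ f)) _.
  apply: homotopic_trans (dFb_homotopic (tensl A G') hf) _.
  exact: homotopic_sym (gofb_homotopic (tmap_dFbl _ f')).
apply: homotopic_trans (gofb_homotopic (tmap_dFbr _ g)) _.
apply: homotopic_trans (dFb_homotopic (tensr C F) hg) _.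
exact: homotopic_sym (gofb_homotopic (tmap_dFbr _ g')).
Qed.

Lemma tmap_id (F : bimod A B) (G : bimod B C) :
  homotopic (tmap (bid F) (bid G)) (bid (tens F G)).
Proof. by apply: tens_bhomotopic => c a n b i j e x y; rewrite tmapE. Qed.

Lemma tmap_comp (F F' F'' : bimod A B) (G G' G'' : bimod B C) (f : bmap F F')
    (f' : bmap F' F'') (g : bmap G G') (g' : bmap G' G'') :
  homotopic (bcomp (tmap f' g') (tmap f g)) (tmap (bcomp f' f) (bcomp g' g)).
Proof.
by apply: tens_bhomotopic => c a n b i j e x y; rewrite bcompE !tmapE.
Qed.

Lemma tmap_heq (F F' : bimod A B) (G G' : bimod B C) (f : bmap F F')
    (f' : bmap F' F) (g : bmap G G') (g' : bmap G' G) :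
  homotopic (bcomp f' f) (bid F) -> homotopic (bcomp g' g) (bid G) ->
  homotopic (bcomp (tmap f' g') (tmap f g)) (bid (tens F G)).
Proof.
move=> hf hg; apply: homotopic_trans (tmap_comp _ _ _ _) _.
exact: homotopic_trans (tmap_homotopic hf hg) (tmap_id _ _).
Qed.

(** Over h-projective factors a quasi-isomorphism is a homotopy equivalence, so
    that no flatness is needed. *)
Lemma tmap_hproj_qis (F F' : bimod A B) (G G' : bimod B C) (f : bmap F F')
    (g : bmap G G') : hproj F -> hproj F' -> hproj G -> hproj G' ->
  quasi_iso f -> quasi_iso g -> quasi_iso (tmap f g).
Proof.
move=> hF hF' hG hG' qf qg.
have [f' [f1 f2]] := hproj_qis_inv hF hF' qf.
have [g' [g1 g2]] := hproj_qis_inv hG hG' qg.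
by apply: (@heq_qis _ _ _ _ _ _ (tmap f' g')); exact: tmap_heq.
Qed.
End TensorMorphisms.

(** * Unit isomorphisms and the co-Yoneda lemma *)

Section Units.
Variables (k : comPzRingType) (A B : dgcat k).

Lemma tunitrE (F : bimod A B) c a n b i j (e : i + j = n) (x : bc F b a i)
    (y : hom c b j) :
  tunitr F c a n (tpure (G := diag B) e x y) = ract F e x y.
Proof. exact: (tmorE _ e x (y : bc (diag B) c b j)). Qed.

Lemma tunitlE (F : bimod A B) c a n b i j (e : i + j = n) (x : hom b a i)
    (y : bc F c b j) :
  tunitl F c a n (tpure (F := diag A) e x y) = lact F e x y.
Proof. exact: (tmorE _ e (x : bc (diag A) b a i) y). Qed.

Lemma tunitr_qis (F : bimod A B) : quasi_iso (tunitr F).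
Proof.
apply: (@quasi_iso_bij _ _ _ (tens F (diag B)) F (tunitr F)
  (fun b a i x => tpure (G := diag B) (addr0 i) x (idm b))).
- move=> c a n; apply: tens_ext.
  + exact: lin_comp (tpure_linl _ _) (@bm_lin _ _ _ _ _ (tunitr F) c a n).
  + exact: lin_id.
  move=> b i j e x y; rewrite tunitrE.
  rewrite (tpure_bal (G := diag B) e (addr0 j) _ e).
  by congr tpure; exact: compm1.
- by move=> b a i x; rewrite tunitrE ract1.
Qed.

Lemma tunitl_qis (F : bimod A B) : quasi_iso (tunitl F).
Proof.
apply: (@quasi_iso_bij _ _ _ (tens (diag A) F) F (tunitl F)
  (fun b a i x => tpure (F := diag A) (add0r i) (idm a) x)).
- move=> c a n; apply: tens_ext.
  + exact: lin_comp (tpure_linr _ _) (@bm_lin _ _ _ _ _ (tunitl F) c a n).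
  + exact: lin_id.
  move=> b i j e x y; rewrite tunitlE.
  rewrite -(tpure_bal (F := diag A) (add0r i) e e).
  by congr tpure; exact: comp1m.
- by move=> b a i x; rewrite tunitlE lact1.
Qed.

(** The co-Yoneda map. Its inverse inserts the identity of [X]; [cyr] is its mirror image. *)
Definition cyl (N : bimod A B) (X : ob A) : bmap (tens (hright X) N) (rcomponent N X).
Proof.
apply: tmor.
refine (@TBil k (kcat k) A B (hright X) N (rcomponent N X)
  (fun c t b i j n e u y => lact N e (u : hom b X i) y) _ _ _ _ _ _).
- by intros; exact: lact_linl.
- by intros; exact: lact_linr.
- by intros; rewrite /=; symmetry; exact: lactA.
- by intros; rewrite /=; exact: lact_d.
- by intros; rewrite /=; exact: lractA.
- by intros; rewrite /=; exact: lactA.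
Defined.

Lemma cylE (N : bimod A B) X c t n b i j (e : i + j = n) (u : hom b X i)
    (y : bc N c b j) :
  cyl N X c t n (tpure (F := hright X) e (u : bc (hright X) b t i) y) = lact N e u y.
Proof. exact: (tmorE _ e (u : bc (hright X) b t i) y). Qed.

Lemma cyl_qis (N : bimod A B) X : quasi_iso (cyl N X).
Proof.
apply: (@quasi_iso_bij _ _ _ (tens (hright X) N) (rcomponent N X) (cyl N X)
  (fun b a i x => tpure (F := hright X) (add0r i) (idm X : bc (hright X) X a 0) x)).
- move=> c a n; apply: tens_ext.
  + move=> s x y; rewrite (@bm_lin _ _ _ _ _ (cyl N X) c a n s x y).
    exact: (tpure_linr (F := hright X)).
  + exact: lin_id.
  move=> b i j e x y; rewrite cylE.
  rewrite -(tpure_bal (F := hright X) (add0r i) e e).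
  by congr tpure; exact: comp1m.
- by move=> b a i x; rewrite cylE; exact: (@lact1 _ _ _ N).
Qed.

Definition cyr (N : bimod A B) (X : ob B) : bmap (tens N (hleft X)) (lcomponent N X).
Proof.
apply: tmor.
refine (@TBil k A B (kcat k) N (hleft X) (lcomponent N X)
  (fun t a b i j n e x u => ract N e x (u : hom X b j)) _ _ _ _ _ _).
- by intros; exact: ract_linl.
- by intros; exact: ract_linr.
- by intros; rewrite /=; exact: ractA.
- by intros; rewrite /=; exact: ract_d.
- by intros; rewrite /=; exact: ractA.
- by intros; rewrite /=; symmetry; exact: lractA.
Defined.

Lemma cyrE (N : bimod A B) X t a n b i j (e : i + j = n) (x : bc N b a i)
    (u : hom X b j) :
  cyr N X t a n (tpure (G := hleft X) e x (u : bc (hleft X) t b j)) = ract N e x u.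
Proof. exact: (tmorE _ e x (u : bc (hleft X) t b j)). Qed.

Lemma cyr_qis (N : bimod A B) X : quasi_iso (cyr N X).
Proof.
apply: (@quasi_iso_bij _ _ _ (tens N (hleft X)) (lcomponent N X) (cyr N X)
  (fun b a i x => tpure (G := hleft X) (addr0 i) x (idm X : bc (hleft X) b X 0))).
- move=> c a n; apply: tens_ext.
  + move=> s x y; rewrite (@bm_lin _ _ _ _ _ (cyr N X) c a n s x y).
    exact: (tpure_linl (G := hleft X)).
  + exact: lin_id.
  move=> b i j e x y; rewrite cyrE.
  rewrite (tpure_bal (G := hleft X) e (addr0 j) _ e).
  by congr tpure; exact: compm1.
- by move=> b a i x; rewrite cyrE; exact: (@ract1 _ _ _ N).
Qed.
End Units.

(** * Restriction commutes with tensor products *)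

Section TensorRestriction.
Variables (k : comPzRingType).

Definition tens_restr_r (A B C C' : dgcat k) (F : bimod A B) (G : bimod B C)
    (psi : dgfunctor C' C) :
  bmap (tens F (restrict (idfunctor B) psi G))
    (restrict (idfunctor A) psi (tens F G)).
Proof.
apply: tmor.
refine (@TBil k A B C' F (restrict (idfunctor B) psi G)
  (restrict (idfunctor A) psi (tens F G))
  (fun c a b i j n e x y => tpure (c := psi c) e x y) _ _ _ _ _ _).
- by intros; exact: tpure_linl.
- move=> c a b i j n e x; exact: (@tpure_linr k A B C F G (psi c) a n b i j e x).
- by intros; rewrite /=; exact: tpure_bal.
- by intros; rewrite /=; exact: td_pure.
- by intros; rewrite /=; exact: tract_pure.
- by intros; rewrite /=; exact: tlact_pure.
Defined.

Lemma tens_restr_rE (A B C C' : dgcat k) (F : bimod A B) (G : bimod B C)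
    (psi : dgfunctor C' C) c a n b i j (e : i + j = n) (x : bc F b a i)
    (y : bc G (psi c) b j) :
  tens_restr_r F G psi c a n
    (tpure (G := restrict (idfunctor B) psi G) e x y) = tpure e x y.
Proof. exact: (tmorE _ e x (y : bc (restrict (idfunctor B) psi G) c b j)). Qed.

(** At each object both sides have the same generators and relations, but they are quotients of
    different types of terms. The inverse is therefore lifted from pure tensors once more. *)
Lemma tens_restr_r_qis (A B C C' : dgcat k) (F : bimod A B) (G : bimod B C)
    (psi : dgfunctor C' C) : quasi_iso (tens_restr_r F G psi).
Proof.
pose G' := restrict (idfunctor B) psi G.
have L1 c a n b i j (e : i + j = n) (y : bc G (psi c) b j) :
    linear (fun x : bc F b a i => @tpure k A B C' F G' c a n b i j e x y).
  exact: tpure_linl.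
have L2 c a n b i j (e : i + j = n) (x : bc F b a i) :
    linear (fun y : bc G (psi c) b j => @tpure k A B C' F G' c a n b i j e x y).
  exact: (@tpure_linr k A B C' F G' c a n b i j e x).
have L3 c a n b1 b2 i p j i' j' (ei : i + p = i') (ej : p + j = j')
     (e : i' + j = n) (e' : i + j' = n)
     (x : bc F b2 a i) (f : hom b1 b2 p) (y : bc G (psi c) b1 j) :
    @tpure k A B C' F G' c a n _ _ _ e (ract F ei x f) y
    = @tpure k A B C' F G' c a n _ _ _ e' x (lact G ej f y).
  exact: (@tpure_bal k A B C' F G' c a n _ _ _ _ _ _ _ ei ej e e' x f y).
pose h c a n : tens_mod F G (psi c) a n -> tens_mod F (restrict (idfunctor B) psi G) c a n :=
  @tlift k A B C F G (psi c) a n _ (fun b i j e x (y : bc G (psi c) b j) =>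
    @tpure k A B C' F (restrict (idfunctor B) psi G) c a n b i j e x y).
have hE c a n b i j (e : i + j = n) (x : bc F b a i) (y : bc G (psi c) b j) :
    h c a n (tpure e x y) = tpure (G := restrict (idfunctor B) psi G) (c := c) e x y.
  apply: tlift_pure; [exact: L1|exact: L2|exact: L3].
have hl c a n : linear (@h c a n).
  by apply: tlift_lin; [exact: L1|exact: L2|exact: L3].
apply: (@quasi_iso_bij _ _ _ _ _ (tens_restr_r F G psi) (fun c a n z => h c a n z)).
- move=> c a n; apply: tens_ext.
  + exact: lin_comp (hl _ _ _) (@bm_lin _ _ _ _ _ (tens_restr_r F G psi) c a n).
  + exact: lin_id.
  by move=> b i j e x y; rewrite tens_restr_rE hE.
- move=> c a n; apply: tens_ext.
  + exact: lin_comp (@bm_lin _ _ _ _ _ (tens_restr_r F G psi) c a n) (hl _ _ _).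
  + exact: lin_id.
  by move=> b i j e x y; rewrite hE tens_restr_rE.
Qed.

Definition tens_restr_l (A A' B C : dgcat k) (F : bimod A B) (G : bimod B C)
    (phi : dgfunctor A' A) :
  bmap (tens (restrict phi (idfunctor B) F) G)
    (restrict phi (idfunctor C) (tens F G)).
Proof.
apply: tmor.
refine (@TBil k A' B C (restrict phi (idfunctor B) F) G
  (restrict phi (idfunctor C) (tens F G))
  (fun c a b i j n e x y => tpure (a := phi a) e x y) _ _ _ _ _ _).
- move=> c a b i j n e y; exact: (@tpure_linl k A B C F G c (phi a) n b i j e y).
- by intros; exact: tpure_linr.
- by intros; rewrite /=; exact: tpure_bal.
- by intros; rewrite /=; exact: td_pure.
- by intros; rewrite /=; exact: tract_pure.
- by intros; rewrite /=; exact: tlact_pure.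
Defined.

Lemma tens_restr_lE (A A' B C : dgcat k) (F : bimod A B) (G : bimod B C)
    (phi : dgfunctor A' A) c a n b i j (e : i + j = n) (x : bc F b (phi a) i)
    (y : bc G c b j) :
  tens_restr_l F G phi c a n
    (tpure (F := restrict phi (idfunctor B) F) e x y) = tpure e x y.
Proof. exact: (tmorE _ e (x : bc (restrict phi (idfunctor B) F) b a i) y). Qed.

Lemma tens_restr_l_qis (A A' B C : dgcat k) (F : bimod A B) (G : bimod B C)
    (phi : dgfunctor A' A) : quasi_iso (tens_restr_l F G phi).
Proof.
pose F' := restrict phi (idfunctor B) F.
have L1 c a n b i j (e : i + j = n) (y : bc G c b j) :
    linear (fun x : bc F b (phi a) i => @tpure k A' B C F' G c a n b i j e x y).
  exact: (@tpure_linl k A' B C F' G c a n b i j e y).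
have L2 c a n b i j (e : i + j = n) (x : bc F b (phi a) i) :
    linear (fun y : bc G c b j => @tpure k A' B C F' G c a n b i j e x y).
  exact: tpure_linr.
have L3 c a n b1 b2 i p j i' j' (ei : i + p = i') (ej : p + j = j')
     (e : i' + j = n) (e' : i + j' = n)
     (x : bc F b2 (phi a) i) (f : hom b1 b2 p) (y : bc G c b1 j) :
    @tpure k A' B C F' G c a n _ _ _ e (ract F ei x f) y
    = @tpure k A' B C F' G c a n _ _ _ e' x (lact G ej f y).
  exact: (@tpure_bal k A' B C F' G c a n _ _ _ _ _ _ _ ei ej e e' x f y).
pose h c a n : tens_mod F G c (phi a) n -> tens_mod (restrict phi (idfunctor B) F) G c a n :=
  @tlift k A B C F G c (phi a) n _ (fun b i j e (x : bc F b (phi a) i) y =>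
    @tpure k A' B C (restrict phi (idfunctor B) F) G c a n b i j e x y).
have hE c a n b i j (e : i + j = n) (x : bc F b (phi a) i) (y : bc G c b j) :
    h c a n (tpure e x y) = tpure (F := restrict phi (idfunctor B) F) (a := a) e x y.
  apply: tlift_pure; [exact: L1|exact: L2|exact: L3].
have hl c a n : linear (@h c a n).
  by apply: tlift_lin; [exact: L1|exact: L2|exact: L3].
apply: (@quasi_iso_bij _ _ _ _ _ (tens_restr_l F G phi) (fun c a n z => h c a n z)).
- move=> c a n; apply: tens_ext.
  + exact: lin_comp (hl _ _ _) (@bm_lin _ _ _ _ _ (tens_restr_l F G phi) c a n).
  + exact: lin_id.
  by move=> b i j e x y; rewrite tens_restr_lE hE.
- move=> c a n; apply: tens_ext.
  + exact: lin_comp (@bm_lin _ _ _ _ _ (tens_restr_l F G phi) c a n) (hl _ _ _).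
  + exact: lin_id.
  by move=> b i j e x y; rewrite hE tens_restr_lE.
Qed.
End TensorRestriction.

(** * Invertibility of the associator *)

Section Associator.
Variables (k : comPzRingType) (A B C D : dgcat k).
Variables (F : bimod A B) (G : bimod B C) (H : bimod C D).

Lemma tassocE d a n c m b i j l jl (e1 : i + j = m) (e2 : m + l = n)
    (e3 : j + l = jl) (e4 : i + jl = n)
    (x : bc F b a i) (y : bc G c b j) (z : bc H d c l) :
  tassoc F G H d a n (tpure (F := tens F G) e2 (tpure e1 x y : bc (tens F G) c a m) z)
  = tpure (G := tens G H) e4 x (tpure e3 y z : bc (tens G H) d b jl).
Proof.
rewrite /tassoc (tmorE _ e2 (tpure e1 x y : bc (tens F G) c a m) z) /=.
exact: ta_pure.
Qed.

Section Inner.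
Variables (d : ob D) (a : ob A) (b : ob B) (i m n : int) (e : i + m = n).
Variable x : bc F b a i.
Let psi c j l (e' : j + l = m) (y : bc G c b j) (z : bc H d c l) : tens_mod (tens F G) H d a n :=
  tpure (F := tens F G) (tl_idx e e') (tpure erefl x y : bc (tens F G) c a (i + j)) z.

Lemma tb_l' c j l (e' : j + l = m) z : linear (fun y : bc G c b j => psi e' y z).
Proof.
move=> s y y'; rewrite /psi.
have -> : (tpure erefl x (s *: y + y') : bc (tens F G) c a (i + j))
  = s *: (tpure erefl x y : bc (tens F G) c a _) + tpure erefl x y'.
  exact: tpure_linr.
exact: tpure_linl.
Qed.
Lemma tb_r' c j l (e' : j + l = m) y : linear (fun z : bc H d c l => psi e' y z).
Proof. exact: tpure_linr. Qed.
Lemma tb_b' c1 c2 j p l j' l' (ej : j + p = j') (el : p + l = l')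
     (e1 : j' + l = m) (e2 : j + l' = m)
     (y : bc G c2 b j) (f : hom c1 c2 p) (z : bc H d c1 l) :
  psi e1 (ract G ej y f) z = psi e2 y (lact H el f z).
Proof.
have E : i + j + p = i + j' by rewrite -ej addrA.
rewrite /psi -(tpure_bal (F := tens F G) E el (tl_idx e e1)); congr tpure.
by symmetry; exact: tract_pure.
Qed.

Definition tb_fun (w : bc (tens G H) d b m) : tens_mod (tens F G) H d a n := tlift psi w.

Lemma tb_lin : linear tb_fun.
Proof. exact: tlift_lin tb_l' tb_r' tb_b'. Qed.

Lemma tb_pure c j l (e1 : j + l = m) ij (e2 : i + j = ij) (e3 : ij + l = n)
    (y : bc G c b j) (z : bc H d c l) :
  tb_fun (tpure e1 y z)
  = tpure (F := tens F G) e3 (tpure e2 x y : bc (tens F G) c a ij) z.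
Proof.
rewrite /tb_fun (tlift_pure tb_l' tb_r' tb_b') /psi; subst ij; exact: tpure_irr.
Qed.
End Inner.

(** The opposite rebracketing is constructed only as a linear map in each degree. Compatibility with
    differentials and actions need not be checked for it: a bijective bimodule map is a
    quasi-isomorphism. *)
Lemma tassoc_qis : quasi_iso (tassoc F G H).
Proof.
have L1 d a n b i m (e : i + m = n) (w : bc (tens G H) d b m) :
    linear (fun x : bc F b a i => tb_fun e x w).
  move=> s x x'; move: w; apply: tens_ext.
  - exact: tb_lin.
  - by apply: lin_add; first apply: lin_scale; exact: tb_lin.
  move=> c j l e' y z; rewrite !(tb_pure e _ e' erefl (tl_idx e e')).
  rewrite -(tpure_linl (F := tens F G)); congr tpure; exact: tpure_linl.
have L2 d a n b i m (e : i + m = n) (x : bc F b a i) :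
    linear (fun w : bc (tens G H) d b m => tb_fun e x w) by exact: tb_lin.
have L3 d a n b1 b2 i p j i' j' (ei : i + p = i') (ej : p + j = j')
     (e : i' + j = n) (e' : i + j' = n)
     (x : bc F b2 a i) (f : hom b1 b2 p) (w : bc (tens G H) d b1 j) :
    tb_fun e (ract F ei x f) w = tb_fun e' x (lact (tens G H) ej f w).
  move: w; apply: tens_ext.
  - exact: tb_lin.
  - exact: lin_comp (@tb_lin _ _ _ _ _ _ e' x) (tlact_lin _ _).
  move=> c u v e0 y z.
  have E : p + u + v = j' by rewrite -ej -e0 addrA.
  have E1 : i + (p + u) = i' + u by rewrite -ei addrA.
  rewrite (tb_pure e _ e0 erefl (tl_idx e e0)).
  rewrite [lact _ _ _ _](lact_tpure ej e0 erefl E).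
  rewrite (tb_pure e' _ E E1 (tl_idx e e0)); congr tpure.
  exact: tpure_bal.
pose h d a n : tens_mod F (tens G H) d a n -> tens_mod (tens F G) H d a n :=
  tlift (fun b i m e x w => tb_fun e x w).
have hl d a n : linear (@h d a n) by exact: tlift_lin (L1 d a n) (L2 d a n) (L3 d a n).
have hE d a n b i m (e : i + m = n) (x : bc F b a i) (w : bc (tens G H) d b m) :
    h d a n (tpure e x w) = tb_fun e x w.
  exact: tlift_pure (L1 d a n) (L2 d a n) (L3 d a n) _ _ _ _ _ _.
apply: (@quasi_iso_bij _ _ _ _ _ (tassoc F G H) (fun d a n z => h d a n z)).
- move=> d a n; apply: tens_ext.
  + exact: lin_comp (hl _ _ _) (@bm_lin _ _ _ _ _ (tassoc F G H) d a n).
  + exact: lin_id.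
  move=> c m l e z w; move: z; apply: tens_ext.
  + apply: lin_comp (hl _ _ _) _.
    exact: lin_comp (@bm_lin _ _ _ _ _ (tassoc F G H) d a n) (tpure_linl (F := tens F G) _ _).
  + exact: (tpure_linl (F := tens F G)).
  move=> b i j e1 x y; rewrite (tassocE e1 e erefl (tr_idx e e1)) hE.
  exact: tb_pure.
- move=> d a n; apply: tens_ext.
  + exact: lin_comp (@bm_lin _ _ _ _ _ (tassoc F G H) d a n) (hl _ _ _).
  + exact: lin_id.
  move=> b i m e x w; rewrite hE; move: w; apply: tens_ext.
  + exact: lin_comp (@bm_lin _ _ _ _ _ (tassoc F G H) d a n) (@tb_lin _ _ _ _ _ _ e x).
  + exact: (tpure_linr (G := tens G H)).
  move=> c j l e1 y z; rewrite (tb_pure e _ e1 erefl (tl_idx e e1)).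
  exact: tassocE.
Qed.
End Associator.

Lemma tens_bext3 (k : comPzRingType) (A B C D : dgcat k) (F : bimod A B)
    (G : bimod B C) (H : bimod C D) (N : bimod A D) (f g : bmap (tens (tens F G) H) N) :
  (forall d a n c m b i j l (e1 : i + j = m) (e2 : m + l = n)
     (x : bc F b a i) (y : bc G c b j) (z : bc H d c l),
     f d a n (tpure (F := tens F G) e2 (tpure e1 x y : bc (tens F G) c a m) z)
     = g d a n (tpure (F := tens F G) e2 (tpure e1 x y : bc (tens F G) c a m) z)) ->
  forall d a n w, f d a n w = g d a n w.
Proof.
move=> fg; apply: tens_bext => d a n c m l e2 w z; move: w; apply: tens_ext.
- move=> s x y; rewrite -[RHS](@bm_lin _ _ _ _ _ f d a n s).
  congr (f d a n _); exact: (tpure_linl (F := tens F G)).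
- move=> s x y; rewrite -[RHS](@bm_lin _ _ _ _ _ g d a n s).
  congr (g d a n _); exact: (tpure_linl (F := tens F G)).
- by move=> b i j e1 x y; exact: fg.
Qed.

Add Parametric Relation (k : comPzRingType) (A B : dgcat k) (M N : bimod A B) :
    (Dhom M N) (@Deq k A B M N)
  reflexivity proved by (@Deq_refl k A B M N)
  symmetry proved by (@Deq_sym k A B M N)
  transitivity proved by (@Deq_trans k A B M N) as Deq_rel.

Add Parametric Morphism (k : comPzRingType) (A B : dgcat k) (L M N : bimod A B) :
    (@Dcomp k A B L M N)
  with signature (@Deq k A B M N) ==> (@Deq k A B L M) ==> (@Deq k A B L N)
  as Dcomp_mor.
Proof. by move=> g g' gg f f' ff; exact: Deq_congr. Qed.

#[export] Hint Resolve Deq_refl homotopic_refl : core.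

(** * Functoriality of restriction and of Hom *)

Section RestrictionFunctor.
Variables (k : comPzRingType) (A A' B B' : dgcat k).
Variables (phi : dgfunctor A' A) (psi : dgfunctor B' B).

Definition grestrict (M N : bimod A B) n (f : gmap M N n) :
  gmap (restrict phi psi M) (restrict phi psi N) n.
Proof.
refine (@GMap k A' B' (restrict phi psi M) (restrict phi psi N) n
  (fun b a i j e x => gm f e (x : bc M (psi b) (phi a) i)) _ _ _).
- by move=> b a i j e; exact: (@gm_lin _ _ _ _ _ _ f (psi b) (phi a) i j e).
- by intros; exact: (gm_r f).
- by intros; exact: (gm_l f).
Defined.

Definition restrictF : dgF A B A' B'.
Proof.
refine (@DGF k A B A' B' (restrict phi psi) grestrict _ _ _ _).
- by move=> M N n c f g; apply: gmapP.
- by move=> M N n n' e f; apply: gmapP.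
- by move=> L M N n m l e g f; apply: gmapP.
- by move=> M; apply: gmapP.
Defined.

Definition brestrict (M N : bimod A B) (f : bmap M N) :
  bmap (restrict phi psi M) (restrict phi psi N).
Proof.
refine (@BMap k A' B' (restrict phi psi M) (restrict phi psi N)
  (fun b a i x => f (psi b) (phi a) i x) _ _ _ _).
- by move=> b a i; exact: (@bm_lin _ _ _ _ _ f (psi b) (phi a) i).
- by intros; exact: (bm_d f).
- by intros; exact: (bm_r f).
- by intros; exact: (bm_l f).
Defined.

Lemma brestrictE (M N : bimod A B) (f : bmap M N) b a i x :
  brestrict f b a i x = f (psi b) (phi a) i x.
Proof. by []. Qed.

Lemma brestrict_qis (M N : bimod A B) (f : bmap M N) :
  quasi_iso f -> quasi_iso (brestrict f).
Proof. by move=> qf b a; exact: qf. Qed.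

Lemma Diso_restrict (M N : bimod A B) :
  Diso M N -> Diso (restrict phi psi M) (restrict phi psi N).
Proof.
apply: (@Diso_functor _ _ _ _ _ (restrict phi psi) (fun M N => @brestrict M N)).
- by move=> L; apply: eqb_homotopic.
- by move=> K L L' g f; apply: eqb_homotopic.
- move=> L L' f g fg.
  have E (h : bmap L L') : homotopic (brestrict h) (dFb restrictF h).
    by apply: eqb_homotopic => b a i x; rewrite bofgE /= cxcast_id.
  apply: homotopic_trans (E f) (homotopic_trans _ (homotopic_sym (E g))).
  exact: (dFb_homotopic restrictF fg).
- by move=> L L' w; exact: brestrict_qis.
Qed.
End RestrictionFunctor.

Section RHomFunctor.
Variables (k : comPzRingType) (A B E : dgcat k) (L : bimod A B).

Definition gRHom (N N' : bimod E B) n (f : gmap N N' n) :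
  gmap (RHom L N) (RHom L N') n.
Proof.
refine (@GMap k E A (RHom L N) (RHom L N') n
  (fun a c i j e h => gcomp (lm_idx e) (grestrict (kpt c) (idfunctor B) f) h) _ _ _).
- by intros; exact: gcomp_linr.
- by intros; rewrite !RHom_ractE; exact: gcompA.
- move=> a c c' p i j l m e el em e' g h.
  rewrite !RHom_lactE; apply: gmapP => b t u v ev x.
  have E1 : u + i + p = u + j by rewrite -e; lia.
  have E2 : u + j + n = v by rewrite -ev -em addrA.
  have E3 : u + l + p = v by rewrite -ev -e'; lia.
  have E4 : u + i + n = u + l by rewrite -el addrA.
  have E5 : p + (u + l) = v by rewrite addrC.
  rewrite (gcompE _ _ _ _ erefl E2) (gcompE _ _ _ _ erefl E1) gmZ.
  rewrite (gcompE _ _ _ _ erefl E3) (gcompE _ _ _ _ erefl E4).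
  rewrite (lmulE _ _ _ (lm_idx E1)) (lmulE _ _ _ E5).
  exact: (gm_l f (lm_idx E1) E4 E2 E5 g).
Defined.

Definition RHomF : dgF E B E A.
Proof.
refine (@DGF k E B E A (fun N => RHom L N) gRHom _ _ _ _).
- move=> M N n c f g; apply: gmapP => a e i j ej h /=.
  by rewrite -gcomp_linl; congr gcomp; apply: gmapP.
- move=> M N n n' en f; apply: gmapP => a e i j ej h.
  have E1 := gdeg1 en ej; have E2 := gdeg2 en ej.
  rewrite (gdE _ _ _ erefl E1 erefl E2) !cd_RHomE /=.
  rewrite (gcomp_d _ E1 en erefl (lm_idx ej) (lm_idx E2)) [LHS]addrK.
  by congr gcomp; apply: gmapP.
- move=> M N P n m l e g f; apply: gmapP => a c i j ej h.
  have E1 := gdegc e ej.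
  rewrite (gcompE _ _ _ _ erefl E1) /= (gcompA _ _ e (lm_idx ej)).
  by congr gcomp; apply: gmapP.
- move=> M; apply: gmap0P => a c i h; rewrite gidE /=.
  rewrite -[RHS](gcomp1l (add0r i)) (eq_irrelevance (lm_idx _) (add0r i)).
  by congr gcomp; apply: gmapP.
Defined.

Lemma RHomFE (N N' : bimod E B) (f : bmap N N') a c i (h : bc (RHom L N) a c i)
    b t j l (e : j + i = l) (x : bc L b a j) :
  gm (dFb RHomF f a c i h) (b:=b) (a:=t) e x = f b c l (gm h (b:=b) (a:=t) e x).
Proof.
rewrite bofgE -[gm _ (addr0 i) h]/(gcomp (lm_idx (addr0 i)) (grestrict (kpt c) (idfunctor B)
  (gofb f)) h).
rewrite (gcompE _ _ _ e e (addr0 l)); exact: (gofbE f (addr0 l)).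
Qed.
End RHomFunctor.

Section CurryFacts.
Variables (k : comPzRingType) (A B C : dgcat k).
Variables (L : bimod A B).

Lemma curry_pure (X : bimod C A) (N : bimod C B) (f : bmap (tens X L) N)
    a c i (x : bc X a c i) b t j l (e : j + i = l) (e' : i + j = l) (y : bc L b a j) :
  gm (curry f a c i x) (b:=b) (a:=t) e y = f b c l (tpure e' x y).
Proof. by rewrite curryE (curE _ _ _ _ e'). Qed.

Lemma curry_eq (X : bimod C A) (N : bimod C B) (f g : bmap (tens X L) N) :
  (forall b c l a i j (e : i + j = l) (x : bc X a c i) (y : bc L b a j),
     f b c l (tpure e x y) = g b c l (tpure e x y)) ->
  forall a c i x, curry f a c i x = curry g a c i x.
Proof.
move=> fg a c i x; apply: gmapP => b t j l e y.
by rewrite !(curry_pure _ _ _ _ (cur_idx e)) fg.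
Qed.

Lemma curry_homotopic_inj (X : bimod C A) (N : bimod C B) (f g : bmap (tens X L) N) :
  homotopic (curry f) (curry g) -> homotopic f g.
Proof.
move: (curry f) (curry g) (curryK f) (curryK g) => u v uf vg.
move=> /homotopicP[h hh]; apply/homotopicP; exists (uncurry h).
by rewrite uncurry_d -hh (linD (@uncurry_lin _ _ _ _ _ _ _ _)) (linN (@uncurry_lin _ _ _ _ _ _ _
  _)) -uf -vg.
Qed.

Lemma curry_natl (X X' : bimod C A) (N : bimod C B) (u : bmap X' X)
    (f : bmap (tens X L) N) a c i x :
  curry (bcomp f (tmap u (bid L))) a c i x = curry f a c i (u a c i x).
Proof.
apply: gmapP => b t j l e y.
by rewrite !(curry_pure _ _ _ _ (cur_idx e)) bcompE tmapE.
Qed.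

Lemma curry_natr (X : bimod C A) (N N' : bimod C B) (g : bmap N N')
    (f : bmap (tens X L) N) a c i x :
  curry (bcomp g f) a c i x = dFb (RHomF C L) g a c i (curry f a c i x).
Proof.
apply: gmapP => b t j l e y.
by rewrite RHomFE !(curry_pure _ _ _ _ (cur_idx e)).
Qed.

(** The transpose of [h] is the unit of the tensor-Hom adjunction followed by [RHom(L, h)], and the
    dg-functor [RHomF] preserves homotopies. *)
Lemma curry_homotopic (X : bimod C A) (N : bimod C B) (f g : bmap (tens X L) N) :
  homotopic f g -> homotopic (curry f) (curry g).
Proof.
move=> fg; pose c := curry (bid (tens X L)).
have E (h : bmap (tens X L) N) : homotopic (curry h) (bcomp (dFb (RHomF C L) h) c).
  by apply: eqb_homotopic => a d i x; rewrite bcompE -curry_natr; apply: curry_eq.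
apply: homotopic_trans (E f) (homotopic_trans _ (homotopic_sym (E g))).
exact: homotopic_compr _ (dFb_homotopic (RHomF C L) fg).
Qed.
End CurryFacts.

Section RHomRestriction.
Variables (k : comPzRingType) (A B E E' : dgcat k) (L : bimod A B).
Variables (phi : dgfunctor E' E) (N : bimod E B).

(** The two restrictions of [N] have the same complexes and right actions, but their actions of [k]
    are not convertible. The map is rebuilt from its right linearity, linearity over [k] being
    automatic. *)
Definition RHom_restr_at a e i (h : gmap (rcomponent L a) (rcomponent (restrict phi (idfunctor B)
  N) e) i)
  : gmap (rcomponent L a) (rcomponent N (phi e)) i :=
  @rgmap k B (rcomponent L a) (rcomponent N (phi e)) i
    (fun b t j l e0 x => gm h (b:=b) (a:=t) e0 x)
    (fun b t j l e0 => gm_lin h e0)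
    (fun b b' t i0 p j l m e0 el em e' x g => gm_r h e0 el em e' x g).

Definition RHom_restr_inv a e i (h : gmap (rcomponent L a) (rcomponent N (phi e)) i)
  : gmap (rcomponent L a) (rcomponent (restrict phi (idfunctor B) N) e) i :=
  @rgmap k B (rcomponent L a) (rcomponent (restrict phi (idfunctor B) N) e) i
    (fun b t j l e0 x => gm h (b:=b) (a:=t) e0 x)
    (fun b t j l e0 => gm_lin h e0)
    (fun b b' t i0 p j l m e0 el em e' x g => gm_r h e0 el em e' x g).

Definition RHom_restr : bmap (RHom L (restrict phi (idfunctor B) N))
    (restrict phi (idfunctor A) (RHom L N)).
Proof.
refine (@BMap k E' A (RHom L (restrict phi (idfunctor B) N))
  (restrict phi (idfunctor A) (RHom L N)) RHom_restr_at _ _ _ _).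
- by move=> a e i c h h'; apply: gmapP.
- by move=> a e i j e0 h; apply: gmapP.
- by move=> a a' e i j n e0 h f; apply: gmapP.
- by move=> a e e' i j n e0 g h; apply: gmapP.
Defined.

Lemma RHom_restr_qis : quasi_iso RHom_restr.
Proof.
apply: (@quasi_iso_bij _ _ _ (RHom L (restrict phi (idfunctor B) N))
  (restrict phi (idfunctor A) (RHom L N)) RHom_restr RHom_restr_inv).
- by move=> a e i h; apply: gmapP.
- by move=> a e i h; apply: gmapP.
Qed.

Lemma RHom_restrE a e i (h : bc (RHom L (restrict phi (idfunctor B) N)) a e i)
   b t j l (e0 : j + i = l) (x : bc L b a j) :
  gm (RHom_restr a e i h) (b:=b) (a:=t) e0 x = gm h (b:=b) (a:=t) e0 x.
Proof. by []. Qed.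
End RHomRestriction.

(** * Adjunctions from evaluation pairings *)

Section Kappa.
Variables (k : comPzRingType) (A B : dgcat k).
Variables (L : bimod A B) (R : bimod B A) (ev : bmap (tens R L) (diag B)).

(** [(n (x) r) (x) l |-> n ev(r, l)]. *)
Definition kap_unc E (N : bimod E B) : bmap (tens (tens N R) L) N :=
  bcomp (tunitr N) (bcomp (tmap (bid N) ev) (tassoc N R L)).

(** Up to the unit isomorphism, this is the transpose of [ev] when [N] is the diagonal, so it is a
    quasi-isomorphism there. Naturality in [N] and compatibility with restriction carry this over to
    [L], whose components are quasi-representable. *)
Definition kap E (N : bimod E B) : bmap (tens N R) (RHom L N) := curry (kap_unc N).

Lemma kap_uncE E (N : bimod E B) b e m l a c i j jl (e1 : i + j = m) (e2 : m + l = jl)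
    jl' (e3 : j + l = jl') (e4 : i + jl' = jl)
    (n : bc N c e i) (r : bc R a c j) (x : bc L b a l) :
  kap_unc N b e jl (tpure (F := tens N R) e2 (tpure e1 n r : bc (tens N R) a e m) x)
  = ract N e4 n (ev b c jl' (tpure e3 r x)).
Proof.
rewrite /kap_unc !bcompE (tassocE e1 e2 e3 e4) (tmapE (bid N) ev e4).
exact: tunitrE.
Qed.

Lemma kap_nat E (N N' : bimod E B) (f : bmap N N') a e i z :
  kap N' a e i (tmap f (bid R) a e i z) = dFb (RHomF E L) f a e i (kap N a e i z).
Proof.
move: z; apply: (@tens_bext _ _ _ _ _ _ _ (bcomp (kap N') (tmap f (bid R)))
  (bcomp (dFb (RHomF E L) f) (kap N))) => a' e' m c p q e0 n r.
rewrite !bcompE tmapE; apply: gmapP => b t j l ej x.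
have E1 : q + (j) = q + j by [].
have E2 : p + (q + j) = l by rewrite -ej -e0; lia.
rewrite RHomFE !(curry_pure _ _ _ _ (cur_idx ej)).
rewrite (kap_uncE e0 (cur_idx ej) erefl E2) [in RHS](kap_uncE e0 (cur_idx ej) erefl E2).
by rewrite bm_r.
Qed.

Let rho := curry ev.
Hypothesis qrho : quasi_iso rho.

Lemma kap_restr E E' (phi : dgfunctor E' E) (N : bimod E B) a e i z :
  RHom_restr L phi N a e i (kap (restrict phi (idfunctor B) N) a e i z)
  = kap N a (phi e) i (tens_restr_l N R phi a e i z).
Proof.
move: a e i z; apply: (@tens_bext _ _ _ _ _ _ _
  (bcomp (RHom_restr L phi N) (kap (restrict phi (idfunctor B) N)))
  (bcomp (brestrict phi (idfunctor A) (kap N)) (tens_restr_l N R phi))).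
move=> a e m c p q e0 n r; rewrite !bcompE tens_restr_lE brestrictE.
apply: gmapP => b t j l ej x; rewrite RHom_restrE.
have E2 : p + (q + j) = l by rewrite -ej -e0; lia.
rewrite !(curry_pure _ _ _ _ (cur_idx ej)).
rewrite (kap_uncE (N := restrict phi (idfunctor B) N) e0 (cur_idx ej) erefl E2).
by rewrite (kap_uncE e0 (cur_idx ej) erefl E2).
Qed.

Lemma kap_diag a b i z :
  kap (diag B) a b i z = rho a b i (tunitl R a b i z).
Proof.
move: a b i z; apply: (@tens_bext _ _ _ _ _ _ _ (kap (diag B)) (bcomp rho (tunitl R))).
move=> a b' m c p q e0 n r; rewrite bcompE tunitlE.
apply: gmapP => b t j l ej x.
have E2 : p + (q + j) = l by rewrite -ej -e0; lia.
rewrite !(curry_pure _ _ _ _ (cur_idx ej)) (kap_uncE e0 (cur_idx ej) erefl E2).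
have E3 : m + j = l by rewrite addrC.
rewrite -(lact_tpure E2 erefl e0 (cur_idx ej)) bm_l.
by [].
Qed.

Lemma kap_diag_qis : quasi_iso (kap (diag B)).
Proof.
apply: homotopic_qis (quasi_iso_comp qrho (tunitl_qis R)).
by apply: eqb_homotopic => a b i z; rewrite bcompE kap_diag.
Qed.

Lemma kap_restr_qis E E' (phi : dgfunctor E' E) (N : bimod E B) :
  quasi_iso (kap N) -> quasi_iso (kap (restrict phi (idfunctor B) N)).
Proof.
move=> q.
have h : homotopic
    (bcomp (RHom_restr L phi N) (kap (restrict phi (idfunctor B) N)))
    (bcomp (brestrict phi (idfunctor A) (kap N)) (tens_restr_l N R phi)).
  by apply: eqb_homotopic => a e i z; rewrite !bcompE kap_restr.
apply: quasi_iso_cancell (RHom_restr_qis L phi N).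
apply: homotopic_qis (homotopic_sym h) _.
apply: quasi_iso_comp (tens_restr_l_qis _ _ _); exact: brestrict_qis.
Qed.

(** Quasi-isomorphisms are detected object by object, and [kap] commutes with restriction to an
    object of [E]. *)
Lemma kap_qis E (N : bimod E B) :
  (forall e, quasi_iso (kap (rcomponent N e))) -> quasi_iso (kap N).
Proof.
move=> H a e.
have h : homotopic
    (bcomp (RHom_restr L (kpt e) N) (kap (rcomponent N e)))
    (bcomp (brestrict (kpt e) (idfunctor A) (kap N)) (tens_restr_l N R (kpt e))).
  by apply: eqb_homotopic => a' e' i z; rewrite !bcompE kap_restr.
have q : quasi_iso (bcomp (brestrict (kpt e) (idfunctor A) (kap N))
    (tens_restr_l N R (kpt e))).
  by apply: homotopic_qis h _; apply: quasi_iso_comp; [exact: RHom_restr_qis|].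
exact: (quasi_iso_cancelr q (tens_restr_l_qis _ _ _) a tt).
Qed.

Lemma kap_heq E (N N' : bimod E B) :
  heq N N' -> quasi_iso (kap N') -> quasi_iso (kap N).
Proof.
case=> f [g [gf fg]] q.
have h : homotopic (bcomp (kap N') (tmap f (bid R))) (bcomp (dFb (RHomF E L) f) (kap N)).
  by apply: eqb_homotopic => a e i z; rewrite !bcompE kap_nat.
have q1 : quasi_iso (tmap f (bid R)).
  by apply: (@heq_qis _ _ _ _ _ _ (tmap g (bid R))); apply: tmap_heq => //;
    exact: eqb_homotopic.
have q2 : quasi_iso (dFb (RHomF E L) f).
  by apply: (@heq_qis _ _ _ _ _ _ (dFb (RHomF E L) g)); exact: (dFb_inverse (RHomF E L)).
apply: quasi_iso_cancell q2.
apply: homotopic_qis h _; exact: quasi_iso_comp.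
Qed.

(** A representable [hright b] is a restriction of the diagonal, where [kap] is known. The
    components of [L] are h-projective, so their isomorphisms with representables in the derived
    category are homotopy equivalences, under which [kap] is invariant. *)
Lemma kap_quasi_representable :
  hproj_dgcat A -> hproj L ->
  (forall a, exists b, Diso (rcomponent L a) (hright b)) -> quasi_iso (kap L).
Proof.
move=> hA hL rep; apply: kap_qis => a; have [b iso] := rep a.
apply: (@kap_heq _ _ (hright b)).
  by apply: Diso_heq iso; [exact: hproj_rcomponent|exact: hproj_hright].
exact: (kap_restr_qis (kpt b) kap_diag_qis).
Qed.
End Kappa.

(** * Associativity constraints and the triangle identities *)

Section Coherence.
Variable k : comPzRingType.
Variable Q : forall A B : dgcat k, resolution A B.

Let hQ (A B : dgcat k) (M : bimod A B) : hproj (Qob (Q A B) M).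
Proof. exact: Qob_hproj. Qed.

Lemma hproj_dcomp (A B C : dgcat k) (G : bimod B C) (F : bimod A B) :
  hproj_dgcat B -> hproj (dcomp Q G F).
Proof.
move=> hB; apply: hproj_tens_hproj; first exact: hQ.
by move=> b; apply: hproj_rcomponent => //; exact: hQ.
Qed.

(** Derived composites are h-projective because the middle categories are, so both comparisons with
    the strict triple tensor product are quasi-isomorphisms; [alpha] and [beta] are the resulting
    zigzags. The second equation is the form in which [beta] enters the second triangle. *)
Lemma dassociator_exists (A B C D : dgcat k) (H : bimod C D) (G : bimod B C)
    (F : bimod A B) : hproj_dgcat B -> hproj_dgcat C ->
  exists alpha beta, dassociator (Q := Q) (H := H) (G := G) (F := F) alpha beta /\
    Deq (Dcomp (dtripler Q H G F) beta) (dtriplel Q H G F).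
Proof.
move=> hB hC.
have ql : quasi_iso (tmap (bid (Qob (Q A B) F)) (Qpi (Q B D) (dcomp Q H G))).
  apply: tmap_hproj_qis; try exact: hQ; first exact: hproj_dcomp.
    exact: quasi_iso_id.
  exact: Qpi_qis.
have qr : quasi_iso (bcomp (tassoc _ _ _)
    (tmap (Qpi (Q A C) (dcomp Q G F)) (bid (Qob (Q C D) H)))).
  apply: quasi_iso_comp; first exact: tassoc_qis.
  apply: tmap_hproj_qis; try exact: hQ; first exact: hproj_dcomp.
    exact: Qpi_qis.
  exact: quasi_iso_id.
exists (Dcomp (Dinv ql) (dtripler Q H G F)), (Dcomp (Dinv qr) (dtriplel Q H G F)).
have Er : Deq (Dcomp (dtripler Q H G F) (Dcomp (Dinv qr) (dtriplel Q H G F)))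
    (dtriplel Q H G F).
  by rewrite Deq_assoc Deq_invr Deq_1l.
have El : Deq (Dcomp (dtriplel Q H G F) (Dcomp (Dinv ql) (dtripler Q H G F)))
    (dtripler Q H G F).
  by rewrite Deq_assoc Deq_invr Deq_1l.
split=> //; split=> //; split.
  by rewrite -Deq_assoc El; exact: Deq_invl.
by rewrite -Deq_assoc Er; exact: Deq_invl.
Qed.

(** The value of [Qmap] on a morphism is accessible only through its composite with the resolution
    map. This is how it is computed in the triangle identities. *)
Lemma Qpi_Qmap (A B : dgcat k) (M N : bimod A B) (z : Dhom M N) (u : bmap (Qob (Q A B) M) N) :
  Deq (Dcomp z (Dof (Qpi (Q A B) M))) (Dof u) ->
  homotopic (bcomp (Qpi (Q A B) N) (Qmap (Q A B) z)) u.
Proof.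
move=> zu; apply: Deq_homotopic; first exact: hQ.
by rewrite -Deq_comp Qpi_nat zu.
Qed.

Lemma Qpi_Qmap_bmap (A B : dgcat k) (M N : bimod A B) (f : bmap M N) :
  homotopic (bcomp (Qpi (Q A B) N) (Qmap (Q A B) (Dof f))) (bcomp f (Qpi (Q A B) M)).
Proof. by apply: Qpi_Qmap; exact: Deq_comp. Qed.

Lemma bcomp_id (A B : dgcat k) (M N : bimod A B) (f : bmap M N) :
  homotopic (bcomp (bid N) f) f.
Proof. exact: eqb_homotopic. Qed.

Section Adjunction.
Variables (A B : dgcat k) (hA : hproj_dgcat A) (hB : hproj_dgcat B).
Variables (L0 : bimod A B) (R0 : bimod B A).
Let L := Qob (Q A B) L0.
Let R := Qob (Q B A) R0.
Let piL : bmap L L0 := Qpi (Q A B) L0.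
Let piR : bmap R R0 := Qpi (Q B A) R0.
Let A1 := Qob (Q A A) (diag A).
Let piA : bmap A1 (diag A) := Qpi (Q A A) (diag A).
Let B1 := Qob (Q B B) (diag B).
Let piB : bmap B1 (diag B) := Qpi (Q B B) (diag B).
Variable ev : bmap (tens R L) (diag B).
Hypothesis qrho : quasi_iso (curry ev).

Section Unit.
Variable et : bmap A1 (tens L R).
Hypothesis het : homotopic (bcomp (kap ev L) et) (bcomp (curry (tunitl L)) piA).

Let eta : Dhom (diag A) (dcomp Q R0 L0) :=
  Dcomp (Dof et) (Dinv (@Qpi_qis _ _ _ (Q A A) (diag A))).
Let eps : Dhom (dcomp Q L0 R0) (diag B) := Dof ev.

Lemma Qpi_eta : homotopic (bcomp (Qpi (Q A A) (dcomp Q R0 L0)) (Qmap (Q A A) eta)) et.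
Proof.
by apply: Qpi_Qmap; rewrite /eta -Deq_assoc Deq_invl Deq_1r.
Qed.

Lemma Qpi_eps : homotopic (bcomp piB (Qmap (Q B B) eps))
  (bcomp ev (Qpi (Q B B) (dcomp Q L0 R0))).
Proof. exact: Qpi_Qmap_bmap. Qed.

Lemma Qpi_Did (C D : dgcat k) (M : bimod C D) :
  homotopic (bcomp (Qpi (Q C D) M) (Qmap (Q C D) (Did M))) (Qpi (Q C D) M).
Proof.
by apply: homotopic_trans (homotopic_compl _ (Qmap_id _ _)) _; exact: eqb_homotopic.
Qed.

(** This is the choice of [et], transposed back: inserting the unit and evaluating is the left
    action of [A] on [L]. Both triangle identities come down to it. *)
Lemma unit_action : homotopic (bcomp (kap_unc ev L) (tmap et (bid L)))
  (bcomp (tunitl L) (tmap piA (bid L))).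
Proof.
apply: curry_homotopic_inj; apply: homotopic_trans (homotopic_trans _ het) _.
  by apply: eqb_homotopic => a c i x; rewrite curry_natl.
by apply: eqb_homotopic => a c i x; rewrite [RHS]curry_natl.
Qed.

Lemma triangle_left alpha beta :
  dassociator (Q := Q) (H := L0) (G := R0) (F := L0) alpha beta ->
  Deq (Dcomp (dunitl Q L0) (Dcomp (dcomp2 Q eps (Did L0))
        (Dcomp alpha (dcomp2 Q (Did L0) eta)))) (dunitr Q L0).
Proof.
case=> _ hal.
pose E := bcomp (tunitr L0) (tmap piL ev).
(* The counit followed by the unit isomorphism factors through the strict triple tensor product.
   Hence [alpha] only meets [dtriplel], and its defining equation replaces the pair by
   [dtripler]. *)
have e1 : Deq (Dcomp (dunitl Q L0) (dcomp2 Q eps (Did L0)))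
    (Dcomp (Dof E) (dtriplel Q L0 R0 L0)).
  rewrite /dunitl /dcomp2 /dtriplel !Deq_comp; apply: Deq_htpy.
  apply: (@homotopic_trans _ _ _ _ _ _ (bcomp (tunitr L0)
    (tmap (bcomp piL (Qmap (Q A B) (Did L0))) (bcomp piB (Qmap (Q B B) eps))))).
    by apply: tens_bhomotopic => c a n b i j e x y; rewrite !bcompE !tmapE.
  apply: homotopic_trans (homotopic_compl _ (tmap_homotopic (Qpi_Did _) Qpi_eps)) _.
  by apply: tens_bhomotopic => c a n b i j e x y; rewrite !bcompE !tmapE.
rewrite Deq_assoc e1 -Deq_assoc (Deq_assoc (dtriplel Q L0 R0 L0)) hal.
rewrite /dtripler /dcomp2 /dunitr !Deq_comp; apply: Deq_htpy.
apply: (@homotopic_trans _ _ _ _ _ _ (bcomp E (bcomp (tassoc _ _ _)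
  (tmap (bcomp (Qpi (Q A A) (dcomp Q R0 L0)) (Qmap (Q A A) eta))
     (Qmap (Q A B) (Did L0)))))).
  by apply: tens_bhomotopic => c a n b i j e x y; rewrite !bcompE !tmapE.
apply: homotopic_trans (homotopic_compl _ (homotopic_compl _
  (tmap_homotopic Qpi_eta (Qmap_id _ _)))) _.
apply: (@homotopic_trans _ _ _ _ _ _ (bcomp piL (bcomp (kap_unc ev L) (tmap et (bid L))))).
  have key b a n z : bcomp E (tassoc L R L) b a n z = bcomp piL (kap_unc ev L) b a n z.
    move: b a n z; apply: tens_bext3 => d a n c m b i j l e0 e x y w.
    have E1 : i + (j + l) = n by exact: tr_idx e e0.
    rewrite [RHS]bcompE (kap_uncE _ e0 e erefl E1) bm_r.
    by rewrite !bcompE (tassocE e0 e erefl E1) (tmapE piL ev E1) [LHS]tunitrE.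
  apply: eqb_homotopic => b a n z; rewrite !bcompE.
  exact: (key b a n (tmap et (bid L) b a n z)).
apply: homotopic_trans (homotopic_compl _ unit_action) _.
apply: tens_bhomotopic => c a n b i j e x y.
rewrite !bcompE !tmapE (tunitlE e (piA b a i x)) [RHS](tunitlE e (piA b a i x)).
exact: bm_l.
Qed.

(** At stake are two maps from [tens R A1] to [R]. The transpose of [ev] is a quasi-isomorphism and
    [tens R A1] is h-projective, so they may be compared after pairing with [L]; there the
    bilinearity of [ev] leaves the unit only in its action on [L]. *)
Lemma triangle_right alpha beta :
  dassociator (Q := Q) (H := R0) (G := L0) (F := R0) alpha beta ->
  Deq (Dcomp (dtripler Q R0 L0 R0) beta) (dtriplel Q R0 L0 R0) ->
  Deq (Dcomp (dunitr Q R0) (Dcomp (dcomp2 Q (Did R0) eps)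
        (Dcomp beta (dcomp2 Q eta (Did R0))))) (dunitl Q R0).
Proof.
move=> _ hbe.
pose E := bcomp (tunitl R0) (tmap ev piR).
pose a' := Dinv (tassoc_qis R L R).
have hR : hproj (tens R A1).
  apply: hproj_tens_hproj; first exact: hQ.
  by move=> b; apply: hproj_rcomponent => //; exact: hQ.
(* In the derived category the associator has only a formal inverse. The unit, rebracketed so as to
   land in [tens (tens R L) R], is instead obtained by lifting, up to homotopy. *)
have [th hth] := hproj_lift hR (tassoc_qis R L R) (tmap (bid R) et).
have e1 : Deq (Dcomp (dunitr Q R0) (dcomp2 Q (Did R0) eps))
    (Dcomp (Dof E) (Dcomp a' (dtripler Q R0 L0 R0))).
  have -> : Deq (Dcomp a' (dtripler Q R0 L0 R0))
      (Dof (tmap (Qpi (Q B B) (dcomp Q L0 R0)) (bid R))).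
    by rewrite /dtripler -Deq_comp Deq_assoc Deq_invl Deq_1l.
  rewrite /dunitr /dcomp2 !Deq_comp; apply: Deq_htpy.
  apply: (@homotopic_trans _ _ _ _ _ _ (bcomp (tunitl R0)
    (tmap (bcomp piB (Qmap (Q B B) eps)) (bcomp piR (Qmap (Q B A) (Did R0)))))).
    by apply: tens_bhomotopic => c a n b i j e x y; rewrite !bcompE !tmapE.
  apply: homotopic_trans (homotopic_compl _ (tmap_homotopic Qpi_eps (Qpi_Did _))) _.
  by apply: tens_bhomotopic => c a n b i j e x y; rewrite !bcompE !tmapE.
rewrite Deq_assoc e1 -!Deq_assoc (Deq_assoc (dtripler Q R0 L0 R0)) hbe.
have -> : Deq (Dcomp (dtriplel Q R0 L0 R0) (dcomp2 Q eta (Did R0)))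
    (Dcomp (Dof (tassoc R L R)) (Dof th)).
  rewrite /dtriplel /dcomp2 !Deq_comp; apply: Deq_htpy.
  apply: homotopic_trans (homotopic_sym hth).
  apply: homotopic_trans (tmap_comp _ _ _ _) _; apply: tmap_homotopic; last exact: Qpi_eta.
  by apply: homotopic_trans (bcomp_id _) _; exact: Qmap_id.
rewrite (Deq_assoc a') Deq_invl Deq_1l Deq_comp /dunitl; apply: Deq_htpy.
pose X := bcomp (bcomp (tunitl R) (tmap ev (bid R))) th.
pose Y := bcomp (tunitr R) (tmap (bid R) piA).
apply: (@homotopic_trans _ _ _ _ _ _ (bcomp piR X)).
  have key b a n z : E b a n z = bcomp piR (bcomp (tunitl R) (tmap ev (bid R))) b a n z.
    move: b a n z; apply: tens_bext => c a n b i j e x y; rewrite !bcompE !tmapE.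
    rewrite (tunitlE e (ev b a i x)) (tunitlE e (ev b a i x)).
    by rewrite bm_l.
  by apply: eqb_homotopic => b a n z; exact: (key b a n (th b a n z)).
apply: (@homotopic_trans _ _ _ _ _ _ (bcomp piR Y)); last first.
  apply: tens_bhomotopic => c a n b i j e x y.
  by rewrite !bcompE !tmapE !tunitrE bm_r.
apply: homotopic_compl; apply: (hproj_inj hR qrho).
suff h : homotopic (bcomp ev (tmap X (bid L))) (bcomp ev (tmap Y (bid L))).
  apply: homotopic_trans (homotopic_trans _ (curry_homotopic h)) _.
    by apply: eqb_homotopic => a c i x; rewrite [RHS]curry_natl.
  by apply: eqb_homotopic => a c i x; rewrite [LHS]curry_natl.
pose V := bcomp (bcomp ev (tmap (bid R) (kap_unc ev L))) (tassoc R (tens L R) L).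
apply: (@homotopic_trans _ _ _ _ _ _ (bcomp V (tmap (bcomp (tassoc R L R) th) (bid L)))).
  (* On a pure tensor of [x], [l'], [y] and [w] both sides are [ev(x, l') ev(y, w)], by left
     linearity of [ev] on one side and right linearity on the other. *)
  have key b a n z : bcomp ev (tmap (bcomp (tunitl R) (tmap ev (bid R))) (bid L)) b a n z
      = bcomp V (tmap (tassoc R L R) (bid L)) b a n z.
    set f1 := bcomp ev _; set f2 := bcomp V _.
    move: b a n z; apply: tens_bext3 => d a n c m b u v l e0 e z y w.
    move: z; apply: tens_ext.
    - move=> s x x'; rewrite -[RHS](@bm_lin _ _ _ _ _ f1 d a n s).
      congr (f1 d a n _); rewrite -(tpure_linl (F := tens (tens R L) R)).
      congr tpure; exact: (tpure_linl (F := tens R L)).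
    - move=> s x x'; rewrite -[RHS](@bm_lin _ _ _ _ _ f2 d a n s).
      congr (f2 d a n _); rewrite -(tpure_linl (F := tens (tens R L) R)).
      congr tpure; exact: (tpure_linl (F := tens R L)).
    move=> b' i j e1' x l'.
    have E1 : i + (j + v) = m by exact: tr_idx e0 e1'.
    have E2 : i + (j + v + l) = n by exact: tr_idx e E1.
    have E3 : j + (v + l) = j + v + l by rewrite addrA.
    have E4 : u + (v + l) = n by exact: tr_idx e e0.
    rewrite [RHS]bcompE (tmapE _ (bid L) e) (tassocE e1' e0 erefl E1).
    rewrite [RHS]bcompE (tassocE E1 e erefl E2) bcompE (tmapE (bid R) _ E2).
    rewrite [kap_unc ev L _ _ _ _](kap_uncE ev erefl erefl erefl E3).
    rewrite [LHS]bcompE (tmapE _ (bid L) e) [bcomp (tunitl R) _ _ _ _ _]bcompE.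
    rewrite (tmapE ev (bid R) e0) (tunitlE e0 (ev b a u (tpure e1' x l'))).
    rewrite -[tpure e (lact R e0 _ _) _](lact_tpure E4 erefl e0 e) [LHS]bm_l.
    set h := ev d b (v + l) _.
    have -> : tpure E2 (bid R b' a i x) (ract L E3 l' h)
      = ract (tens R L) E4 (tpure e1' x l' : bc (tens R L) b a u) h.
      by symmetry; exact: ract_tpure.
    by rewrite [RHS]bm_r.
  pose f1 := bcomp ev (tmap (bcomp (tunitl R) (tmap ev (bid R))) (bid L)).
  apply: (@homotopic_trans _ _ _ _ _ _ (bcomp f1 (tmap th (bid L)))).
    by apply: tens_bhomotopic => c a n b i j e x y; rewrite !bcompE !tmapE.
  apply: (@homotopic_trans _ _ _ _ _ _
    (bcomp (bcomp V (tmap (tassoc R L R) (bid L))) (tmap th (bid L)))).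
    by apply: eqb_homotopic => b a n z; exact: (key b a n (tmap th (bid L) b a n z)).
  by apply: tens_bhomotopic => c a n b i j e x y; rewrite !bcompE !tmapE.
apply: homotopic_trans (homotopic_compl V (tmap_homotopic hth (homotopic_refl _))) _.
(* [W f] sends a pure tensor of [r], [p] and [l] to [ev(r, f(p, l))]. The unit now occurs only
   inside [f], where [unit_action] replaces it. *)
pose W f := bcomp (bcomp ev (tmap (bid R) f)) (tassoc R A1 L).
apply: (@homotopic_trans _ _ _ _ _ _ (W (bcomp (kap_unc ev L) (tmap et (bid L))))).
  apply: eqb_homotopic; apply: tens_bext3 => d a n c m b i j l e1' e2' x p y.
  have E1 : i + (j + l) = n by exact: tr_idx e2' e1'.
  rewrite /V /W [LHS]bcompE (tmapE _ (bid L) e2') (tmapE (bid R) et e1').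
  rewrite [LHS]bcompE (tassocE e1' e2' erefl E1) [LHS]bcompE (tmapE (bid R) _ E1).
  rewrite [RHS]bcompE (tassocE e1' e2' erefl E1) [RHS]bcompE (tmapE (bid R) _ E1).
  by rewrite [bcomp (kap_unc ev L) _ _ _ _ _]bcompE (tmapE et (bid L)).
apply: (@homotopic_trans _ _ _ _ _ _ (W (bcomp (tunitl L) (tmap piA (bid L))))).
  apply: homotopic_compr; apply: homotopic_compl.
  by apply: tmap_homotopic; [exact: homotopic_refl|exact: unit_action].
apply: eqb_homotopic; apply: tens_bext3 => d a n c m b i j l e1' e2' x p y.
have E1 : i + (j + l) = n by exact: tr_idx e2' e1'.
rewrite /W /Y [LHS]bcompE (tassocE e1' e2' erefl E1) [LHS]bcompE (tmapE (bid R) _ E1).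
rewrite [bcomp (tunitl L) _ _ _ _ _]bcompE (tmapE piA (bid L)).
rewrite [tunitl L _ _ _ _](tunitlE erefl (piA c b j p)).
rewrite [RHS]bcompE (tmapE _ (bid L) e2') [bcomp (tunitr R) _ _ _ _ _]bcompE.
rewrite (tmapE (bid R) piA e1') [tunitr R _ _ _ _](tunitrE e1' _ (piA c b j p)).
by rewrite -[tpure E1 _ _](tpure_bal (F := R) (G := L) e1' erefl e2' E1).
Qed.
End Unit.

(** The right adjoint of a quasi-functor [L] is recognised by an evaluation
    pairing whose transpose [R -> Hom_B(L, B)] is a quasi-isomorphism: the unit
    lifts the action [A -> Hom_B(L, L)] through [L (x) R -> Hom_B(L, L)], which
    is a quasi-isomorphism because [L] is right quasi-representable. *)
Lemma adjoint_of_pairing :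
  (forall a, exists b, Diso (rcomponent L a) (hright b)) -> adjoint Q L0 R0.
Proof.
move=> rep; have qk := kap_quasi_representable qrho hA (@Qob_hproj _ _ _ (Q A B) L0) rep.
have [et het] := hproj_lift (@Qob_hproj _ _ _ (Q A A) (diag A)) qk (bcomp (curry (tunitl L)) piA).
exists (Dcomp (Dof et) (Dinv (@Qpi_qis _ _ _ (Q A A) (diag A)))), (Dof ev); split.
  have [alpha [beta [h _]]] := dassociator_exists L0 R0 L0 hB hA.
  by exists alpha, beta; split=> //; exact: triangle_left h.
have [alpha [beta [h hb]]] := dassociator_exists R0 L0 R0 hA hB.
by exists alpha, beta; split=> //; exact: triangle_right h hb.
Qed.
End Adjunction.
End Coherence.

(** * Natural quasi-isomorphisms *)

Section QuasiIsoClosure.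
Variables (k : comPzRingType) (A B : dgcat k).
Implicit Types M N X Y : bimod A B.

Lemma quasi_iso_retract M M' X X' (s : bmap M X) (r : bmap X M) (s' : bmap M' X')
    (r' : bmap X' M') (f : bmap M M') (g : bmap X X') :
  (forall b a i x, r b a i (s b a i x) = x) ->
  (forall b a i x, r' b a i (s' b a i x) = x) ->
  (forall b a i x, g b a i (s b a i x) = s' b a i (f b a i x)) ->
  (forall b a i x, f b a i (r b a i x) = r' b a i (g b a i x)) ->
  quasi_iso g -> quasi_iso f.
Proof.
move=> rs rs' gs fr qg b a; have [i1 i2] := qg b a; split=> i j l ei el.
- move=> x y dx fx; have ds : cd _ el (s b a i x) = 0 by rewrite -bm_d dx bm0.
  have [z hz] := i1 _ _ _ ei el _ (s' b a j y) ds (etrans (gs _ _ _ _) (etrans (congr1 _ fx)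
    (bm_d _ _ _))).
  by exists (r b a j z); rewrite -bm_d -hz rs.
- move=> y dy; have ds : cd _ el (s' b a i y) = 0 by rewrite -bm_d dy bm0.
  have [x [z [dx hx]]] := i2 _ _ _ ei el _ ds.
  exists (r b a i x), (r' b a j z); split; first by rewrite -bm_d dx bm0.
  by rewrite fr -bm_d -bmD -hx rs'.
Qed.

Lemma contractible_qis M N (f : bmap M N) :
  contractible M -> contractible N -> quasi_iso f.
Proof.
move=> cM cN; apply: (@heq_qis _ _ _ _ _ _ (bzero N M)).
  by apply: homotopic_trans (homotopic_sym cM); apply: eqb_homotopic.
apply: homotopic_trans (homotopic_sym cN); apply: eqb_homotopic => b a i x.
by rewrite bcompE bm0.
Qed.

(** [sd_v] commutes with the differentials up to the sign [ksgn k s], so it identifies the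
    cohomology of a shift with that of the original in another degree, compatibly with [t] and
    [u]. *)
Lemma shiftdata_qis s M M' X X' (D : shiftdata s M X) (D' : shiftdata s M' X')
    (u : bmap M M') (t : bmap X X') :
  (forall b a i j (e : i + s = j) (x : bc X b a i),
     gm (sd_v D') e (t b a i x) = u b a j (gm (sd_v D) e x)) ->
  quasi_iso u -> quasi_iso t.
Proof.
move=> vt qu b a; have [i1 i2] := qu b a.
have dv Y Z (S : shiftdata s Y Z) i j l (e : i + 1 = j) (ei : i + s = i + s)
    (ej : j + s = l) (el : i + s + 1 = l) (x : bc Z b a i) :
    cd _ el (gm (sd_v S) ei x) = ksgn k s *: gm (sd_v S) ej (cd _ e x).
  have E : i + (s + 1) = l by rewrite addrA.
  apply/eqP; rewrite -subr_eq0 -(gdE erefl (sd_v S) E ei el e ej).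
  by rewrite sd_dv.
have vK Y Z (S : shiftdata s Y Z) i j (e : i + s = j) (e' : j + - s = i) (x : bc Z b a i) :
    gm (sd_u S) e' (gm (sd_v S) e x) = x.
  by rewrite -(gcompE (addNr s) _ _ (addr0 i) e e') sd_uv gidE.
have uK Y Z (S : shiftdata s Y Z) i j (e : i + s = j) (e' : j + - s = i) (x : bc Y b a j) :
    gm (sd_v S) e (gm (sd_u S) e' x) = x.
  by rewrite -(gcompE (subrr s) _ _ (addr0 j) e' e) sd_vu gidE.
have E i j : i + s = j -> j + - s = i by move=> <-; rewrite addrK.
have Es i j : i + 1 = j -> i + s + 1 = j + s by move=> <-; rewrite addrAC.
split=> i j l ei el.
- move=> x y dx tx.
  have dvx : cd _ (Es _ _ el) (gm (sd_v D) erefl x) = 0.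
    by rewrite (dv _ _ D _ _ _ el erefl erefl) dx (lin0 (gm_lin _ _)) scaler0.
  have h : u b a _ (gm (sd_v D) erefl x)
      = cd _ (Es _ _ ei) (ksgn k s *: gm (sd_v D') erefl y).
    rewrite -vt tx (linZ (cd_lin _)) (dv _ _ D' _ _ _ ei erefl erefl).
    by rewrite ksgn_mulKl.
  have [z hz] := i1 _ _ _ _ _ _ _ dvx h.
  exists (gm (sd_u D) (E _ _ erefl) (ksgn k s *: z)).
  rewrite -[LHS](vK _ _ D _ _ erefl (E _ _ erefl)) hz.
  rewrite -[RHS](vK _ _ D _ _ erefl (E _ _ erefl)); congr (gm (sd_u D) _ _).
  apply: (can_inj (ksgn_mulKl s (V := _))).
  rewrite -(dv _ _ D _ _ _ ei erefl erefl (Es _ _ ei)) (linZ (gm_lin _ _)).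
  by rewrite (linZ (gm_lin _ _)) (linZ (cd_lin _)) uK.
- move=> y dy.
  have dvy : cd _ (Es _ _ el) (gm (sd_v D') erefl y) = 0.
    by rewrite (dv _ _ D' _ _ _ el erefl erefl) dy (lin0 (gm_lin _ _)) scaler0.
  have [x [z [dx hx]]] := i2 _ _ _ (Es _ _ ei) _ _ dvy.
  exists (gm (sd_u D) (E _ _ erefl) x), (gm (sd_u D') (E _ _ erefl) (ksgn k s *: z)).
  split.
    rewrite -[LHS](vK _ _ D _ _ erefl (E _ _ erefl)).
    rewrite -[gm (sd_v D) _ _](ksgn_mulKl s).
    by rewrite -(dv _ _ D _ _ _ el erefl erefl (Es _ _ el)) uK dx scaler0 (lin0 (gm_lin _ _)).
  rewrite -[LHS](vK _ _ D' _ _ erefl (E _ _ erefl)) hx (linD (gm_lin _ _)).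
  congr (_ + _).
    by rewrite -[RHS](vK _ _ D' _ _ erefl (E _ _ erefl)) vt uK.
  rewrite -[RHS](vK _ _ D' _ _ erefl (E _ _ erefl)); congr (gm (sd_u D') _ _).
  apply: (can_inj (ksgn_mulKl s (V := _))).
  rewrite -(dv _ _ D' _ _ _ ei erefl erefl (Es _ _ ei)) (linZ (gm_lin _ _)).
  by rewrite (linZ (gm_lin _ _)) (linZ (cd_lin _)) uK.
Qed.
End QuasiIsoClosure.

(** [dF_conedata] is obtained by rewriting with [gofb_dFb], so its fields sit behind a transport.
    The types of [co_i] and [co_p] do not mention the twisting map, and the transport disappears
    from them. *)
Lemma conedata_cast (k : comPzRingType) (A B : dgcat k) (M N X : bimod A B)
    (g g' : gmap M N 0) (e : g' = g) (S : conedata g X) :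
  co_i (eq_rect_r (fun h => conedata h X) S e) = co_i S /\
  co_p (eq_rect_r (fun h => conedata h X) S e) = co_p S.
Proof. by subst. Qed.

Section NaturalQuasiIso.
Variables (k : comPzRingType) (A B C D : dgcat k) (F G : dgF A B C D).
Variable t : forall M, bmap (F M) (G M).
Hypothesis t_nat : forall M N n (f : gmap M N n) b a i j (e : i + n = j) (x : bc (F M) b a i),
  t N b a j (gm (dFm F f) e x) = gm (dFm G f) e (t M b a i x).

Lemma nat_bmap M N (f : bmap M N) b a i x :
  t N b a i (dFb F f b a i x) = dFb G f b a i (t M b a i x).
Proof. by rewrite !bofgE t_nat. Qed.

Lemma nat_heq_qis M N : heq M N -> quasi_iso (t M) -> quasi_iso (t N).
Proof.
case=> f [g [gf fg]] q.
have h : homotopic (bcomp (dFb G f) (t M)) (bcomp (t N) (dFb F f)).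
  by apply: eqb_homotopic => b a i x; rewrite !bcompE nat_bmap.
have qF : quasi_iso (dFb F f).
  by apply: (@heq_qis _ _ _ _ _ _ (dFb F g)); exact: dFb_inverse.
apply: quasi_iso_cancelr qF; apply: homotopic_qis h _; apply: quasi_iso_comp => //.
by apply: (@heq_qis _ _ _ _ _ _ (dFb G g)); exact: dFb_inverse.
Qed.

Lemma nat_shift_qis s M : quasi_iso (t M) -> quasi_iso (t (shift s M)).
Proof.
apply: (@shiftdata_qis _ _ _ s _ _ _ _ (dF_shiftdata F (shift_data s M))
  (dF_shiftdata G (shift_data s M))).
by move=> b a i j e x; rewrite -t_nat.
Qed.

Lemma dF_conedata_i M N (f : bmap M N) X (S : conedata (gofb f) X) (H : dgF A B C D) :
  co_i (dF_conedata H S) = dFm H (co_i S).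
Proof. exact: (conedata_cast _ _).1. Qed.

Lemma dF_conedata_p M N (f : bmap M N) X (S : conedata (gofb f) X) (H : dgF A B C D) :
  co_p (dF_conedata H S) = dFm H (co_p S).
Proof. exact: (conedata_cast _ _).2. Qed.

Lemma nat_cone_qis M N (f : bmap M N) :
  quasi_iso (t M) -> quasi_iso (t N) -> quasi_iso (t (cone f)).
Proof.
apply: (@conedata_qis _ _ _ _ _ _ _ _ _ _ _ (dF_conedata F (cone_data f))
  (dF_conedata G (cone_data f))).
- by move=> b a i n; rewrite /cfi !dF_conedata_i t_nat.
- by move=> b a i j e x; rewrite /cfp !dF_conedata_p t_nat.
Qed.

Lemma nat_summand_qis M N : quasi_iso (t (dsum M N)) -> quasi_iso (t M).
Proof.
have E (H : dgF A B C D) b a i x :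
    dFb H (dsum_p1 M N) b a i (dFb H (dsum_i1 M N) b a i x) = x.
  rewrite -[RHS]/(bid (H M) b a i x) -[LHS]/(bcomp (dFb H _) (dFb H _) b a i x).
  apply: gofb_inj; rewrite -gofb_dFb_comp gofb_dFb [RHS]gofb_id -(dFm_id H M) -(gofb_id M).
  by congr (dFm H _); apply: gmap0P => b' a' j y; rewrite !gofbE.
apply: (@quasi_iso_retract _ _ _ _ _ _ _ (dFb F (dsum_i1 M N)) (dFb F (dsum_p1 M N))
  (dFb G (dsum_i1 M N)) (dFb G (dsum_p1 M N))) => //.
- exact: nat_bmap.
- by move=> b a i x; rewrite nat_bmap.
Qed.

(** Naturality of [t] holds against graded maps of all degrees. It therefore covers the structure
    maps of shifts and cones, which have nonzero degree and need not be closed, and each step of the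
    induction applies. *)
Lemma thick_nat_qis (Q : resolution A B) (gen : bimod A B -> Prop) :
  (forall M, gen M -> hproj M /\ quasi_iso (t M)) ->
  forall M, thick gen M -> forall P, hproj P -> Diso P M -> quasi_iso (t P).
Proof.
move=> Hgen; apply: (thick_hproj_ind Q) => //.
- by move=> M N _ _; exact: nat_heq_qis.
- by move=> M _ cM; apply: contractible_qis; exact: dF_contractible.
- by move=> s M _; exact: nat_shift_qis.
- by move=> M N f _ _; exact: nat_cone_qis.
- by move=> M N _ _; exact: nat_summand_qis.
Qed.
End NaturalQuasiIso.

(** * Smoothness and perfect values *)

Section TensorQuasiIso.
Variables (k : comPzRingType) (A B C : dgcat k).

(** Restricted to an object [c], the map [g] is a quasi-isomorphism of h-projective left modules,
    hence a homotopy equivalence, and tensoring with an arbitrary [M] preserves it. *)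
Lemma tmap_r_qis (M : bimod A B) (G G' : bimod B C) (g : bmap G G') :
  (forall c, hproj (lcomponent G c)) -> (forall c, hproj (lcomponent G' c)) ->
  quasi_iso g -> quasi_iso (tmap (bid M) g).
Proof.
move=> hG hG' qg c a.
have h : homotopic
    (bcomp (tens_restr_r M G' (kpt c)) (tmap (bid M) (brestrict (idfunctor B) (kpt c) g)))
    (bcomp (brestrict (idfunctor A) (kpt c) (tmap (bid M) g)) (tens_restr_r M G (kpt c))).
  apply: tens_bhomotopic => c' a' n b i j e x y.
  rewrite !bcompE tmapE !tens_restr_rE brestrictE; symmetry; exact: (tmapE (bid M) g).
have q := quasi_iso_cancelr (homotopic_qis h _) (tens_restr_r_qis _ _ _).
apply: (q _ tt a); apply: quasi_iso_comp; first exact: tens_restr_r_qis.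
have [f' [f1 f2]] := hproj_qis_inv (hG c) (hG' c) (brestrict_qis (idfunctor B) (kpt c) qg).
by apply: (@heq_qis _ _ _ _ _ _ (tmap (bid M) f')); apply: tmap_heq => //; exact: eqb_homotopic.
Qed.

Lemma tmap_l_qis (F F' : bimod A B) (G : bimod B C) (f : bmap F F') :
  (forall a, hproj (rcomponent F a)) -> (forall a, hproj (rcomponent F' a)) ->
  quasi_iso f -> quasi_iso (tmap f (bid G)).
Proof.
move=> hF hF' qf c a.
have h : homotopic
    (bcomp (tens_restr_l F' G (kpt a)) (tmap (brestrict (kpt a) (idfunctor B) f) (bid G)))
    (bcomp (brestrict (kpt a) (idfunctor C) (tmap f (bid G))) (tens_restr_l F G (kpt a))).
  apply: tens_bhomotopic => c' a' n b i j e x y.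
  rewrite !bcompE tmapE !tens_restr_lE brestrictE; symmetry; exact: (tmapE f (bid G)).
have q := quasi_iso_cancelr (homotopic_qis h _) (tens_restr_l_qis _ _ _).
apply: (q _ c tt); apply: quasi_iso_comp; first exact: tens_restr_l_qis.
have [f' [f1 f2]] := hproj_qis_inv (hF a) (hF' a) (brestrict_qis (kpt a) (idfunctor B) qf).
by apply: (@heq_qis _ _ _ _ _ _ (tmap f' (bid G))); apply: tmap_heq => //; exact: eqb_homotopic.
Qed.
End TensorQuasiIso.

Section PerfectValues.
Variables (k : comPzRingType) (Q : forall A B : dgcat k, resolution A B).
Variable A : dgcat k.

Definition lperfect : bimod A (kcat k) -> Prop :=
  thick (fun M => exists X : ob A, M = hleft X).

Lemma bij_Diso (B C : dgcat k) (M N : bimod B C) (f : bmap M N) (g : forall b a i, bc N b a i ->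
  bc M b a i) :
  (forall b a i x, g b a i (f b a i x) = x) ->
  (forall b a i y, f b a i (g b a i y) = y) -> Diso M N.
Proof. by move=> gf fg; apply: (@qis_Diso _ _ _ _ _ f); exact: quasi_iso_bij gf fg. Qed.

Lemma rcomponent_hright (Y : ob A) t : Diso (rcomponent (hright Y) t) (hright Y).
Proof.
pose f := @rbmap k A A (rcomponent (hright Y) t) (hright Y)
  (fun b a i x => x) (fun b a i c x y => erefl) (fun _ _ _ _ _ _ => erefl)
  (fun _ _ _ _ _ _ _ _ _ => erefl).
exact: (@bij_Diso _ _ _ _ f (fun b a i x => x)).
Qed.

Lemma tens_hright_hright t (Y : ob A) : Diso (tens (hright t) (hright Y)) (hright Y).
Proof.
apply: Diso_trans (rcomponent_hright Y t); exact: qis_Diso (cyl_qis (hright Y) t).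
Qed.

Lemma tens_hleft_hright (X : ob A) t : Diso (tens (hleft X) (hright t)) (hleft X).
Proof.
pose f := @kbmap k (hright t) (diag (kcat k))
  (fun b a i x => x) (fun b a i c x y => erefl) (fun _ _ _ _ _ _ => erefl).
pose g := @kbmap k (diag (kcat k)) (hright t)
  (fun b a i x => x) (fun b a i c x y => erefl) (fun _ _ _ _ _ _ => erefl).
apply: Diso_trans (qis_Diso (tunitr_qis (hleft X))).
apply: (@qis_Diso _ _ _ _ _ (tmap (bid _) f)).
apply: (@heq_qis _ _ _ _ _ _ (tmap (bid _) g)); apply: tmap_heq; exact: eqb_homotopic.
Qed.

Lemma perfect_tens_hright (N : bimod (kcat k) (kcat k)) (Y : ob A) :
  hproj N -> perfect N -> perfect (tens N (hright Y)).
Proof.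
move=> hN pN; apply: (thick_functor (F := tensl (kcat k) (hright Y)) (Q (kcat k) (kcat k)) _ pN
  hN (Diso_refl N)).
move=> M [t ->]; split; first exact: hproj_hright.
apply: thick_iso (Diso_sym (tens_hright_hright t Y)) _.
by apply: thick_gen; exists Y.
Qed.

Lemma lperfect_tens_hleft (N : bimod (kcat k) (kcat k)) (X : ob A) :
  hproj N -> perfect N -> lperfect (tens (hleft X) N).
Proof.
move=> hN pN; apply: (thick_functor (F := tensr (kcat k) (hleft X)) (Q (kcat k) (kcat k)) _ pN hN
  (Diso_refl N)).
move=> M [t ->]; split; first exact: hproj_hright.
apply: thick_iso (Diso_sym (tens_hleft_hright X t)) _.
by apply: thick_gen; exists X.
Qed.

Lemma hproj_kcat : hproj_dgcat (kcat k).
Proof.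
move=> s t.
pose f := @kbmap k (homk s t) (hright t)
  (fun b a i x => x) (fun b a i c x y => erefl) (fun _ _ _ _ _ _ => erefl).
pose g := @kbmap k (hright t) (homk s t)
  (fun b a i x => x) (fun b a i c x y => erefl) (fun _ _ _ _ _ _ => erefl).
exact: (@hproj_kmod _ _ _ f g (fun _ _ _ _ => erefl) (@hproj_hright _ _ t)).
Qed.

Lemma hproj_birepresentable (X Y : ob A) : hproj (birepresentable X Y).
Proof.
apply: hproj_tens_hproj; first exact: hproj_hleft.
by move=> t; apply: hproj_rcomponent; [exact: hproj_kcat|exact: hproj_hright].
Qed.

Hypotheses (hA : hproj_dgcat A) (smA : bperfect (diag A)).

(** Tensoring a resolution of the diagonal, built from finitely many
    [A(X, -) (x) A(-, Y)], with [M] leaves only the values of [M]. *)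
Lemma perfect_of_values_r (M : rmod A) :
  hproj M -> (forall X, perfect (lcomponent M X)) -> perfect M.
Proof.
move=> hM pM; pose P := Qob (Q A A) (diag A).
have hP : hproj P by exact: Qob_hproj.
have qP : quasi_iso (Qpi (Q A A) (diag A)) by exact: Qpi_qis.
apply: (@thick_iso _ _ _ _ (tens M P)).
  apply: qis_Diso (quasi_iso_comp (tunitr_qis M) (tmap_r_qis M _ _ qP)).
    by move=> c; exact: hproj_lcomponent.
  by move=> c; exact: hproj_hleft.
apply: (thick_functor (F := tensr A M) (Q A A) _ smA hP (qis_Diso qP)).
move=> _ [X [Y ->]]; split; first exact: hproj_birepresentable.
apply: thick_iso (qis_Diso (tassoc_qis M (hleft X) (hright Y))) _.
(* By co-Yoneda the factor [tens M (hleft X)] is the value of [M] at [X], and tensoring this perfect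
   complex over [k] with [hright Y] gives a perfect module. *)
apply: (@thick_iso _ _ _ _ (tens (lcomponent M X) (hright Y))).
  apply: Diso_sym; apply: (@qis_Diso _ _ _ _ _ (tmap (cyr M X) (bid _))).
  have hL : hproj (lcomponent M X) by exact: hproj_lcomponent.
  have hT : hproj (tens M (hleft X)).
    by apply: hproj_tens_hproj => // Y'; exact: hproj_homk_r.
  apply: tmap_l_qis (cyr_qis M X) => t; apply: hproj_rcomponent => //; exact: hproj_kcat.
apply: perfect_tens_hright => //; exact: hproj_lcomponent.
Qed.

Lemma perfect_of_values_l (M : bimod A (kcat k)) :
  hproj M -> (forall X, perfect (rcomponent M X)) -> lperfect M.
Proof.
move=> hM pM; pose P := Qob (Q A A) (diag A).
have hP : hproj P by exact: Qob_hproj.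
have qP : quasi_iso (Qpi (Q A A) (diag A)) by exact: Qpi_qis.
apply: (@thick_iso _ _ _ _ (tens P M)).
  apply: qis_Diso (quasi_iso_comp (tunitl_qis M) (tmap_l_qis M _ _ qP)).
    by move=> c; exact: hproj_rcomponent.
  by move=> c; exact: hproj_hright.
apply: (thick_functor (F := tensl A M) (Q A A) _ smA hP (qis_Diso qP)).
move=> _ [X [Y ->]]; split; first exact: hproj_birepresentable.
apply: thick_iso (Diso_sym (qis_Diso (tassoc_qis (hleft X) (hright Y) M))) _.
apply: (@thick_iso _ _ _ _ (tens (hleft X) (rcomponent M Y))).
  apply: Diso_sym; apply: (@qis_Diso _ _ _ _ _ (tmap (bid _) (cyl M Y))).
  have hL : hproj (rcomponent M Y) by exact: hproj_rcomponent.
  have hT : hproj (tens (hright Y) M).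
    apply: hproj_tens_hproj; first exact: hproj_hright.
    by move=> X'; exact: hproj_rcomponent.
  apply: tmap_r_qis (cyl_qis M Y) => t; apply: hproj_lcomponent => //; exact: hproj_kcat.
apply: lperfect_tens_hleft => //; exact: hproj_rcomponent.
Qed.
End PerfectValues.

(** * Representing perfect modules over the h-projective resolution *)

Section Triangulated.
Variables (k : comPzRingType) (Q : forall A B : dgcat k, resolution A B).

Lemma yoneda_homotopic (A : dgcat k) (X Y : ob A) (f g : hom X Y 0) (Hf : closed0 f)
    (Hg : closed0 g) : cohomologous f g -> homotopic (yoneda Hf) (yoneda Hg).
Proof.
case=> h hh; apply/homotopicP; exists (rY (N := hright Y) (t := tt) (h : bc (hright Y) X tt (-1))).
rewrite rY_d -[cd _ _ _]hh; apply: gmap0P => b [] i x.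
rewrite gmD gmN !gofbE (rYE _ _ (add0r i)) /=.
by rewrite (linD (comp_linl _ _)) (linN (comp_linl _ _)).
Qed.

Lemma H0iso_Diso (A : dgcat k) (X Y : ob A) : H0iso X Y -> Diso (hright X) (hright Y).
Proof.
case=> f [g [cf cg gf fg]]; apply: heq_Diso; exists (yoneda cf), (yoneda cg).
have cid (Z : ob A) : closed0 (idm Z) by exact: idm_d.
have cc (U V W : ob A) (u : hom V W 0) (v : hom U V 0) :
    closed0 u -> closed0 v -> closed0 (comp (add0r 0) u v).
  move=> cu cv; rewrite /closed0 (comp_d (add0r 0) (add0r 1) (add0r 1) (add0r 1) (addr0 1) (add0r
    1)).
  by rewrite cu cv (lin0 (comp_linl _ _)) (lin0 (comp_linr _ _)) scaler0 addr0.
have key (U V : ob A) (u : hom U V 0) (v : hom V U 0) (cu : closed0 u) (cv : closed0 v) :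
    cohomologous (comp (add0r 0) v u) (idm U) ->
    homotopic (bcomp (yoneda cv) (yoneda cu)) (bid (hright U)).
  move=> /(yoneda_homotopic (cc _ _ _ _ _ cv cu) (cid U)) h.
  apply: homotopic_trans (homotopic_trans _ h) _; apply: eqb_homotopic => b a i x.
    by rewrite bcompE /=; exact: compA.
  exact: comp1m.
by split; exact: key.
Qed.

Variables (A A' : dgcat k) (p : dgfunctor A' A).

(** The target is written as an iterated restriction and not as [restrict p p (diag A)], so that
    [tens_restr_r] applies with the inner restriction as a tensor factor. *)
Definition fm_map : bmap (diag A') (restrict (idfunctor A') p (restrict p (idfunctor A) (diag A))).
Proof.
refine (@BMap k A' A' (diag A') (restrict (idfunctor A') p (restrict p (idfunctor A) (diag A)))
  (fun b a i x => fm p x) _ _ _ _).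
- by move=> b a i; exact: fm_lin.
- by move=> b a i j e x; exact: (fm_d p e x).
- by move=> b b' a i j n e x g; exact: (fm_comp p e x g).
- by move=> b a a' i j n e g x; exact: (fm_comp p e g x).
Defined.

Hypothesis res : hproj_resolution p.

Lemma fm_map_qis : quasi_iso fm_map.
Proof. by case: res => _ [ff _] b a; exact: ff. Qed.

Lemma smooth_diag : smooth p -> bperfect (diag A').
Proof.
apply: thick_iso; apply: Diso_sym.
pose f := @BMap k A' A' (diag A') (restrict p p (diag A)) (fun b a i x => fm p x)
  (fun b a i => @fm_lin _ _ _ p b a i) (fun b a i j e x => fm_d p e x)
  (fun b b' a i j n e x g => fm_comp p e x g) (fun b a a' i j n e g x => fm_comp p e g x).
exact: (@qis_Diso _ _ _ _ _ f fm_map_qis).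
Qed.

(** The bimodule [A(-, p(-))]. Tensoring with it is induction along [p], the left adjoint of
    restriction. *)
Let Ap := restrict p (idfunctor A) (diag A).

Lemma rcomponent_induced X : Diso (tens (hright X) Ap) (hright (p X)).
Proof.
apply: Diso_trans (qis_Diso (cyl_qis Ap X)) _.
pose f := @rbmap k A A (rcomponent Ap X) (hright (p X))
  (fun b a i x => x) (fun b a i c x y => erefl) (fun _ _ _ _ _ _ => erefl)
  (fun _ _ _ _ _ _ _ _ _ => erefl).
exact: (@bij_Diso _ _ _ _ _ f (fun b a i x => x)).
Qed.

Lemma perfect_induced (M : rmod A') : hproj M -> perfect M -> perfect (tens M Ap).
Proof.
move=> hM pM; apply: (thick_functor (F := tensl (kcat k) Ap) (Q _ _) _ pM hM (Diso_refl M)).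
move=> _ [X ->]; split; first exact: hproj_hright.
apply: thick_iso (Diso_sym (rcomponent_induced X)) _.
by apply: thick_gen; exists (p X).
Qed.

Lemma hright_restrict X : Diso (hright X) (restrict (idfunctor (kcat k)) p (hright (p X))).
Proof.
pose f := @rbmap k A' A' (hright X) (restrict (idfunctor (kcat k)) p (hright (p X)))
  (fun b a i x => fm p (x : hom b X i)) (fun b a i => @fm_lin _ _ _ p b X i)
  (fun b a i j e x => fm_d p e (x : hom b X i))
  (fun b b' a i j n e x g => fm_comp p e (x : hom b X i) g).
by apply: (@qis_Diso _ _ _ _ _ f) => b a; exact: fm_map_qis.
Qed.

(** On [hright X] the unit of induction and restriction is the map given by [p] on hom-complexes, a
    quasi-isomorphism; the case of perfect modules follows by induction over the thick
    subcategory. *)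
Lemma induced_unit (M : rmod A') :
  hproj M -> perfect M -> Diso M (restrict (idfunctor (kcat k)) p (tens M Ap)).
Proof.
move=> hM pM; apply: Diso_trans (qis_Diso (tens_restr_r_qis M Ap p)).
apply: Diso_trans (Diso_sym (qis_Diso (tunitr_qis M))) _.
apply: (@qis_Diso _ _ _ _ _ (tmap (bid M) fm_map)).
apply: (@thick_nat_qis _ _ _ _ _ (tensl (kcat k) (diag A'))
  (tensl (kcat k) (restrict (idfunctor A') p Ap)) (fun M => tmap (bid M) fm_map) _
  (Q _ _) _ _ _ pM _ hM (Diso_refl M)).
  move=> {hM pM}M N n f c a l m e; apply: tens_ext.
  - exact: lin_comp (@bm_lin _ _ _ _ _ (tmap (bid N) fm_map) c a m) (gm_tens_lin _ _).
  - exact: lin_comp (gm_tens_lin _ _) (@bm_lin _ _ _ _ _ (tmap (bid M) fm_map) c a l).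
  move=> b i j e1 x y; have E : i + n + j = m by rewrite -e -e1 addrAC.
  transitivity (tmap (bid N) fm_map c a m (tpure E (gm f erefl x) y)).
    by congr (tmap _ _ c a m _); exact: (gtenslE f e1 e erefl E).
  rewrite (tmapE (bid N) fm_map E) (tmapE (bid M) fm_map e1).
  by symmetry; exact: (gtenslE f e1 e erefl E).
move=> _ [X ->]; split; first exact: hproj_hright.
have h : homotopic (bcomp (brestrict (kpt X) (idfunctor A') fm_map) (cyl (diag A') X))
    (bcomp (cyl (restrict (idfunctor A') p Ap) X) (tmap (bid (hright X)) fm_map)).
  apply: tens_bhomotopic => c a n b i j e x y.
  rewrite !bcompE (tmapE (bid (hright X)) fm_map e) (cylE (N := diag A') a e x y) brestrictE.
  rewrite [RHS](cylE (N := restrict (idfunctor A') p Ap) a e x); exact: (fm_comp p e x y).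
apply: quasi_iso_cancell (cyl_qis _ _); apply: homotopic_qis h _.
by apply: quasi_iso_comp; [apply: brestrict_qis; exact: fm_map_qis|exact: cyl_qis].
Qed.

(** Only [A] is assumed triangulated. The induced module is represented by an object of [A], which
    essential surjectivity replaces by some [p X]; restricting back recovers [M] on one side and
    [hright X] on the other. *)
Lemma perfect_quasi_representable (M : rmod A') : triangulated A ->
  hproj M -> perfect M -> exists X, Diso M (hright X).
Proof.
move=> [_ _ tri] hM pM; have [Y MY] := tri _ (perfect_induced hM pM).
have [X XY] := res.2.2 Y; exists X.
apply: Diso_trans (induced_unit hM pM) _.
apply: Diso_trans (Diso_sym (hright_restrict X)).
apply: Diso_restrict; apply: Diso_trans MY _.
by apply: Diso_sym; exact: H0iso_Diso.
Qed.
End Triangulated.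

(** * The right adjoint *)

Section Transpose.
Variables (k : comPzRingType) (A B C : dgcat k).
Variables (X : bimod C A) (L : bimod A B) (N : bimod C B).

Lemma uncurry_closed (f : bmap X (RHom L N)) : gd (add0r 1) (uncurry (gofb f)) = 0.
Proof. by rewrite uncurry_d gofb_closed (lin0 (@uncurry_lin _ _ _ _ _ _ _ _)). Qed.

Definition uncurryb (f : bmap X (RHom L N)) : bmap (tens X L) N := bofg (uncurry_closed f).

Lemma curry_uncurryb (f : bmap X (RHom L N)) a c i x : curry (uncurryb f) a c i x = f a c i x.
Proof.
apply: gmapP => b [] j l e y; have E := cur_idx e.
rewrite (curry_pure _ _ _ _ E) bofgE (uncurryE _ _ _ (addr0 i) e).
by rewrite gofbE.
Qed.

Lemma curry_uncurryb_qis (f : bmap X (RHom L N)) : quasi_iso f -> quasi_iso (curry (uncurryb f)).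
Proof.
apply: homotopic_qis; apply: eqb_homotopic => a c i x.
by rewrite curry_uncurryb.
Qed.
End Transpose.

Section Evaluation.
Variables (k : comPzRingType) (B : dgcat k) (X : rmod B) (b0 b : ob B).

(** The cocycle [z] corresponds to the identity of the representing object. *)
Lemma evaluation_qis : heq X (hright b0) ->
  exists2 z : bc X b0 tt 0, cd _ (add0r 1) z = 0 &
  cx_quasi_iso (C := gHom X (hright b)) (D := hom b0 b)
    (fun i (phi : gmap X (hright b) i) => gm phi (add0r i) z).
Proof.
case=> g [f [/homotopicP[h1 hh1] /homotopicP[h2 hh2]]].
rewrite (gofb_comp _ _ (addr0 0)) gofb_id in hh1.
rewrite (gofb_comp _ _ (addr0 0)) gofb_id in hh2.
pose z := f b0 tt 0 (idm b0 : bc (hright b0) b0 tt 0); exists z.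
  by rewrite -bm_d [cd _ _ _]idm_d bm0.
have evE i (phi : gmap X (hright b) i) :
    gm phi (add0r i) z = gm (gcomp (addr0 i) phi (gofb f)) (add0r i) (idm b0 : bc (hright b0) b0
      tt 0).
  by rewrite (gcompE _ _ _ _ (addr0 0) (add0r i)) gofbE.
split=> i j l ei el.
- move=> phi y dphi hy; have Ej : i + -1 = j by rewrite -ei addrK.
  have cf : gcomp (addr0 i) phi (gofb f) = rY (N := hright b) (t := tt) (cd _ ei y : bc (hright
    b) b0 tt i).
    by rewrite -[LHS]rYK -evE hy.
  (* [phi f] is the Yoneda map of [d y], hence a boundary. As [phi] is closed, it differs from
     [phi f g] by the boundary [phi (d h1)]. *)
  exists (gcomp (addr0 j) (rY (N := hright b) (t := tt) (y : bc (hright b) b0 tt j)) (gofb g)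
      - ksgn k i *: gcomp Ej phi h1).
  rewrite (linD (cd_lin _)) (linN (cd_lin _)) (linZ (cd_lin _)) /=.
  rewrite (gd_comp_closedr _ ei ei (addr0 i) _ (gofb_closed g)) rY_d -cf.
  rewrite (gd_comp_closedl Ej ei (addNr 1) (addr0 i) _ dphi) -hh1 ksgn_mulKl.
  rewrite (linD (gcomp_linr _ _)) (linN (gcomp_linr _ _)) gcomp1r opprB addrC.
  by rewrite -(gcompA (addr0 0) (addr0 i) (addr0 i)) subrK.
- move=> y dy; have Ej : i + -1 = j by rewrite -ei addrK.
  pose u := rY (N := hright b) (t := tt) (y : bc (hright b) b0 tt i).
  have du : gd el u = 0.
    by rewrite rY_d -[cd _ _ _]/(cd (hom b0 b) el y) dy; apply: gmapP => b' [] m n e x; rewrite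
      (rYE _ _ (lm_idx e)) gm0 (lin0 (ract_linl _ _)).
  pose id0 : bc (hright b0) b0 tt 0 := idm b0.
  (* Evaluating [u g] at [z] is evaluating [u g f] at the identity, which gives [y] up to the
     boundary coming from [u h2]. *)
  exists (gcomp (addr0 i) u (gofb g)), (- ksgn k i *: gm (gcomp Ej u h2) (add0r j) id0).
  split.
    rewrite -[cd _ _ _]/(gd el (gcomp (addr0 i) u (gofb g))).
    by rewrite (gd_comp_closedr _ el el (addr0 l) _ (gofb_closed g)) du (lin0 (gcomp_linl _ _)).
  rewrite evE -(gcompA (addr0 0) (addr0 i) (addr0 i)).
  have -> : gcomp (addr0 0) (gofb g) (gofb f) = gid (hright b0) + gd (addNr 1) h2.
    by rewrite -hh2 addrC subrK.
  rewrite (linD (gcomp_linr _ _)) gcomp1r gmD.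
  have -> : gcomp (addr0 i) u (gd (addNr 1) h2) = ksgn k i *: gd ei (gcomp Ej u h2).
    by rewrite (gd_comp_closedl Ej ei (addNr 1) (addr0 i) _ du) ksgn_mulKl.
  rewrite gmZ (gm_d1 ei _ (add0r j) (add0r i) ei); last by move=> m em; exact: idm_d.
  rewrite (linZ (cd_lin _)) scaleNr -addrA.
  rewrite [X in _ + X]subrr addr0 (rYE _ _ (addr0 i)); symmetry; exact: compm1.
Qed.
End Evaluation.

Section RightAdjoint.
Variables (k : comPzRingType) (Q : forall A B : dgcat k, resolution A B).

Lemma perfect_homk_resolution (B B' : dgcat k) (p : dgfunctor B' B) :
  hproj_resolution p -> locally_perfect B -> locally_perfect B'.
Proof.
move=> [_ [ff _]] lp X Y; apply: thick_iso (lp (p X) (p Y)); apply: Diso_sym.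
pose f := @kbmap k (homk X Y) (homk (p X) (p Y)) (fun b a i (x : hom X Y i) => fm p x)
  (fun b a i => @fm_lin _ _ _ p X Y i) (fun b a i j e x => fm_d p e (x : hom X Y i)).
by apply: (@qis_Diso _ _ _ _ _ f) => b a; exact: ff.
Qed.

Variables (A A' : dgcat k) (p : dgfunctor A' A).
Hypotheses (res : hproj_resolution p) (triA : triangulated A) (smA : smooth p).

Lemma quasi_representable_of_values (M : rmod A') :
  (forall X, perfect (lcomponent M X)) -> exists X, Diso M (hright X).
Proof.
move=> pM; pose P := Qob (Q (kcat k) A') M.
have hP : hproj P by exact: Qob_hproj.
have iso : Diso P M by exact: qis_Diso (@Qpi_qis _ _ _ (Q (kcat k) A') M).
have pP : perfect P.
  apply: (perfect_of_values_r Q res.1 (smooth_diag res smA) hP) => X.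
  by apply: thick_iso (pM X); apply: Diso_restrict; exact: Diso_sym.
have [X PX] := perfect_quasi_representable Q res triA hP pP.
by exists X; exact: Diso_trans (Diso_sym iso) PX.
Qed.

Variables (B' : dgcat k) (hB : hproj_dgcat B') (lpB : locally_perfect B').

Lemma quasi_functor_resolution (T : bimod A' B') : quasi_functor T ->
  forall a, exists b, Diso (rcomponent (Qob (Q A' B') T) a) (hright b).
Proof.
move=> qT a; have [b Tb] := qT a; exists b; apply: Diso_trans Tb.
by apply: Diso_restrict; exact: qis_Diso (@Qpi_qis _ _ _ (Q A' B') T).
Qed.

(** The value at [a] of the module attached to [b] is the complex of maps from [L_a] to [h_b]. For
    [L_a] equivalent to [h_b0], Yoneda identifies it with [B(b0, b)], a perfect complex by local
    perfectness. *)
Lemma quasi_functor_RHom (L : bimod A' B') : hproj L ->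
  (forall a, exists b, Diso (rcomponent L a) (hright b)) ->
  quasi_functor (RHom L (diag B')).
Proof.
move=> hL rep b; apply: quasi_representable_of_values => a.
have [b0 iso] := rep a.
have h : heq (rcomponent L a) (hright b0).
  by apply: Diso_heq iso; [apply: hproj_rcomponent hL; exact: res.1|exact: hproj_hright].
have [z dz qz] := evaluation_qis b h.
apply: thick_iso (lpB b0 b); apply: Diso_sym.
have dz' m (em : 0 + 1 = m) : cd _ em z = 0 by subst m; rewrite -dz; exact: cd_irr.
pose ev := @kbmap k (lcomponent (rcomponent (RHom L (diag B')) b) a) (homk b0 b)
  (fun t t' i (phi : gmap (rcomponent L a) (hright b) i) => gm phi (b:=b0) (a:=tt) (add0r i) z)
  (fun t t' i c x y => erefl)
  (fun t t' i j e (phi : gmap (rcomponent L a) (hright b) i) =>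
     gm_d1 e phi (add0r i) (add0r j) e dz').
by apply: (@qis_Diso _ _ _ _ _ ev) => t t'; exact: qz.
Qed.

(** The pairing is the transpose of the resolution [Q(S) -> Hom_B(L, B)]. Transposing it again
    returns that resolution, so the criterion for adjoints is satisfied by construction. *)
Lemma right_adjoint (T : bimod A' B') : quasi_functor T ->
  exists S : bimod B' A', quasi_functor S /\ adjoint Q T S.
Proof.
move=> qT; pose L := Qob (Q A' B') T; pose S := RHom L (diag B').
have rep := quasi_functor_resolution qT.
exists S; split; first exact: (quasi_functor_RHom (@Qob_hproj _ _ _ (Q A' B') T) rep).
apply: (@adjoint_of_pairing k Q A' B' res.1 hB T S (uncurryb (Qpi (Q B' A') S))) => //.
by apply: curry_uncurryb_qis; exact: Qpi_qis.
Qed.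
End RightAdjoint.

(** * Duality *)

Section ContravariantFunctors.
Variables (k : comPzRingType) (A B C D : dgcat k).

(** The contravariant counterpart of [dgF]: exchanging the two factors of a composite brings in
    their Koszul sign. *)
Record cdgF := CDGF {
  cF :> bimod A B -> bimod C D;
  cFm : forall M N n, gmap M N n -> gmap (cF N) (cF M) n;
  cFm_lin : forall M N n, linear (@cFm M N n);
  cFm_d : forall M N n n' (e : n + 1 = n') (f : gmap M N n),
    gd e (cFm f) = cFm (gd e f);
  cFm_comp : forall L M N n m l (e : n + m = l) (e' : m + n = l) (g : gmap M N n)
    (f : gmap L M m), cFm (gcomp e g f) = ksgn k (n * m) *: gcomp e' (cFm f) (cFm g);
  cFm_id : forall M, cFm (gid M) = gid (cF M) }.

Variable F : cdgF.
Implicit Types M N P X : bimod A B.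

Lemma cFm_closed M N n n' (e : n + 1 = n') (f : gmap M N n) :
  gd e f = 0 -> gd e (cFm F f) = 0.
Proof. by move=> h; rewrite cFm_d h (lin0 (@cFm_lin _ _ _ _)). Qed.

Lemma cFm_comp0 L M N n m l (e : n + m = l) (e' : m + n = l) (g : gmap M N n)
    (f : gmap L M m) : ksgn k (n * m) = 1 ->
  gcomp e' (cFm F f) (cFm F g) = cFm F (gcomp e g f).
Proof. by move=> s; rewrite (cFm_comp _ e e') s scale1r. Qed.

Definition cFb M N (f : bmap M N) : bmap (F N) (F M) :=
  bofg (cFm_closed (gofb_closed f)).

Lemma gofb_cFb M N (f : bmap M N) : gofb (cFb f) = cFm F (gofb f).
Proof. exact: gofbK. Qed.

Lemma gofb_cFb_comp L M N (g : bmap M N) (f : bmap L M) :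
  gofb (cFb (bcomp g f)) = gofb (bcomp (cFb f) (cFb g)).
Proof.
by rewrite gofb_cFb !(gofb_comp _ _ (addr0 0)) (cFm_comp _ _ (addr0 0)) !gofb_cFb scale1r.
Qed.

Lemma cFb_homotopic M N (f g : bmap M N) : homotopic f g -> homotopic (cFb f) (cFb g).
Proof.
move=> /homotopicP[h hh]; apply/homotopicP; exists (cFm F h).
by rewrite !gofb_cFb cFm_d -hh (linD (@cFm_lin _ _ _ _)) (linN (@cFm_lin _ _ _ _)).
Qed.

Lemma cFb_id M : homotopic (cFb (bid M)) (bid (F M)).
Proof. by apply: gofb_homotopic; rewrite gofb_cFb !gofb_id cFm_id. Qed.

Lemma cFb_inverse M N (f : bmap M N) (g : bmap N M) :
  homotopic (bcomp g f) (bid M) -> homotopic (bcomp (cFb f) (cFb g)) (bid (F M)).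
Proof.
move=> h; apply: homotopic_trans (homotopic_sym (gofb_homotopic (gofb_cFb_comp _ _))) _.
exact: homotopic_trans (cFb_homotopic h) (cFb_id M).
Qed.

Lemma cF_heq M N : heq M N -> heq (F M) (F N).
Proof. by case=> f [g [gf fg]]; exists (cFb g), (cFb f); split; exact: cFb_inverse. Qed.

Lemma cF_contractible M : contractible M -> contractible (F M).
Proof.
move=> /cFb_homotopic h; apply: homotopic_trans (homotopic_sym (cFb_id M)) _.
apply: homotopic_trans h _; apply: gofb_homotopic.
by rewrite gofb_cFb !gofb0 (lin0 (@cFm_lin _ _ _ _)).
Qed.

End ContravariantFunctors.

Definition shiftdata_sym (k : comPzRingType) (A B : dgcat k) s (M X : bimod A B) :
  shiftdata s M X -> shiftdata (- s) X M.
Proof.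
move=> S; have E : s = - - s by rewrite opprK.
apply: (@ShiftData _ _ _ (- s) X M (ecast i (gmap X M i) E (sd_v S)) (sd_u S)).
- by move=> e; case: _ / E e => e; exact: sd_uv.
- by move=> e; case: _ / E e => e; exact: sd_vu.
- by move=> n e; case: _ / E e => e; exact: sd_dv.
- by move=> n e; exact: sd_du.
Defined.

Section ContravariantTriangles.
Variables (k : comPzRingType) (A B C D : dgcat k) (F : cdgF A B C D).
Implicit Types M N P X : bimod A B.

(** Reversing the identities between maps of degrees [s] and [- s] produces the sign of [s * s],
    which is absorbed into the first map. *)
Definition cF_shiftdata s M X : shiftdata s M X -> shiftdata s (F X) (F M).
Proof.
move=> S.
apply: (@ShiftData _ _ _ s _ _ (ksgn k (s * s) *: cFm F (sd_u S)) (cFm F (sd_v S))).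
- move=> e; have e' : - s + s = 0 by rewrite addNr.
  rewrite (linZ (gcomp_linr _ _)) -[gcomp _ _ _](ksgn_mulKl (- s * s)).
  rewrite -(cFm_comp F e') sd_uv cFm_id scalerA -ksgnD.
  have -> : ksgn k (s * s + - s * s) = 1 by rewrite mulNr subrr.
  by rewrite scale1r.
- move=> e; have e' : s + - s = 0 by rewrite subrr.
  rewrite (linZ (gcomp_linl _ _)) -[gcomp _ _ _](ksgn_mulKl (s * - s)).
  rewrite -(cFm_comp F e') sd_vu cFm_id scalerA -ksgnD.
  have -> : ksgn k (s * s + s * - s) = 1 by rewrite mulrN subrr.
  by rewrite scale1r.
- by move=> n e; rewrite (linZ (gd_lin _)) cFm_closed ?scaler0 //; exact: sd_du.
- by move=> n e; apply: cFm_closed; exact: sd_dv.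
Defined.

(** A contravariant functor rotates the triangle: the shift of [F X] is a cone of [F f], with [i],
    [q], [j], [p] coming from the images of [p], [j], [q], [i] in this order. The isomorphism with
    the shift adjusts the degrees. *)
Definition cF_conedata M N (f : bmap M N) X (S : conedata (gofb f) X) :
  conedata (gofb (cFb F f)) (shift 1 (F X)).
Proof.
have T := shift_data 1 (F X).
have E : -1 + 1 = 0 :> int by rewrite addNr.
have E' : 1 + -1 = 0 :> int by rewrite subrr.
have Fqi e : gcomp e (cFm F (co_i S)) (cFm F (co_q S)) = gid (F N).
  by rewrite (cFm_comp0 F e e) // co_qi cFm_id.
(* Both [co_p] and [co_j] have odd degree, so their reversal costs a sign; this is why the new [q]
   is taken with a minus. *)
have Fpj e : gcomp e (cFm F (co_j S)) (cFm F (co_p S)) = - gid (F M).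
  have := cFm_comp F E' e (co_p S) (co_j S); rewrite co_pj cFm_id => ->.
  by rewrite ksgnN1 scaleN1r opprK.
have Fqj (e : -1 + 0 = -1) : gcomp e (cFm F (co_j S)) (cFm F (co_q S)) = 0.
  by rewrite (cFm_comp0 F (add0r (-1)) e) // co_qj (lin0 (@cFm_lin _ _ _ _ _ _ _ _ _)).
have Fpi (e : 0 + 1 = 1) : gcomp e (cFm F (co_i S)) (cFm F (co_p S)) = 0.
  by rewrite (cFm_comp0 F (addr0 1) e) // co_pi (lin0 (@cFm_lin _ _ _ _ _ _ _ _ _)).
have Fsplit e e' : gcomp e (cFm F (co_q S)) (cFm F (co_i S))
    - gcomp e' (cFm F (co_p S)) (cFm F (co_j S)) = gid (F X).
  rewrite -(cFm_id F X) -(co_split S (addr0 0) E) (linD (@cFm_lin _ _ _ _ _ _ _ _ _)).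
  by rewrite (cFm_comp _ _ e) (cFm_comp _ _ e') scale1r ksgnN1 scaleN1r.
have mid Y Z n m n1 m1 l (e1 : n + 1 = n1) (e2 : -1 + m = m1) (e : n1 + m1 = l)
    (e' : n + m = l) (a : gmap (F X) Y n) (b : gmap Z (F X) m) :
    gcomp e (gcomp e1 a (sd_v T)) (gcomp e2 (sd_u T) b) = gcomp e' a b.
  have E2 : 1 + m1 = m by rewrite -e2 addrA subrr add0r.
  by rewrite -(gcompA E2 e' e1 e) (gcompA e2 E2 E' (add0r m)) sd_vu gcomp1l.
have out Y n m n1 m1 (e1 : -1 + n = n1) (e2 : m + 1 = m1) (e : n1 + m1 = 0)
    (e0 : n + m = 0) (a : gmap Y (F X) n) (b : gmap (F X) Y m) :
    gcomp e (gcomp e1 (sd_u T) a) (gcomp e2 b (sd_v T))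
    = gcomp E (sd_u T) (gcomp (add0r 1) (gcomp e0 a b) (sd_v T)).
  have E1 : n + m1 = 1 by rewrite -e2 addrA e0 add0r.
  by rewrite -(gcompA e2 E1 e0 (add0r 1)) (gcompA E1 E e1 e).
apply: (@ConeData _ _ _ _ _ _ _ (gcomp E (sd_u T) (cFm F (co_p S)))
   (- gcomp E (cFm F (co_j S)) (sd_v T))
   (gcomp (addr0 (-1)) (sd_u T) (cFm F (co_q S)))
   (gcomp (add0r 1) (cFm F (co_i S)) (sd_v T))).
- move=> e; rewrite (linN (gcomp_linl _ _)) (mid _ _ _ _ _ _ _ _ _ _ E) Fpj.
  by rewrite opprK.
- by move=> e; rewrite (mid _ _ _ _ _ _ _ _ _ _ (addr0 0)) Fqi.
- move=> e; rewrite (linN (gcomp_linl _ _)) (mid _ _ _ _ _ _ _ _ _ _ (addr0 (-1))).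
  by rewrite Fqj oppr0.
- by move=> e; rewrite (mid _ _ _ _ _ _ _ _ _ _ (add0r 1)) Fpi.
- move=> e e'; rewrite (linN (gcomp_linr _ _)) (out _ _ _ _ _ _ _ _ E').
  rewrite (out _ _ _ _ _ _ _ _ (addr0 0)) addrC -(linN (gcomp_linr _ _)) -(linN (gcomp_linl _ _)).
  by rewrite -(linD (gcomp_linr _ _)) -(linD (gcomp_linl _ _)) Fsplit gcomp1l sd_uv.
- move=> n e; have e2 : -1 + (1 + 1) = n by rewrite -e.
  rewrite (gd_comp_closedl _ _ erefl e2 _ (sd_du T erefl)) cFm_closed; last exact: co_dp.
  by rewrite (lin0 (gcomp_linr _ _)) scaler0.
- move=> n e; rewrite (gd_comp_closedr _ _ (add0r 1) e _ (sd_dv T erefl)).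
  by rewrite cFm_closed ?(lin0 (gcomp_linl _ _)) //; exact: co_di.
- move=> e e'; rewrite (gd_comp_closedl _ _ (add0r 1) E _ (sd_du T erefl)) cFm_d.
  rewrite (co_dq S _ (add0r 1)) (linN (@cFm_lin _ _ _ _ _ F _ _ _)) (cFm_comp _ _ (addr0 1)).
  rewrite mul0r scale1r ksgnN1 scaleN1r (linN (gcomp_linr _ _)) opprK gofb_cFb.
  exact: gcompA.
- move=> e e'; rewrite (linN (gd_lin _)) (gd_comp_closedr _ _ E (add0r 1) _ (sd_dv T erefl)).
  rewrite cFm_d (co_dj S _ (addr0 0)) (cFm_comp _ _ (addr0 0)) mul0r scale1r gofb_cFb.
  by congr (- _); symmetry; exact: gcompA.
Defined.

Lemma cF_dsum M N : Diso (F (dsum M N)) (dsum (F M) (F N)).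
Proof.
have E (L K P : bimod A B) (g : bmap K P) (f : bmap L K) (h : bmap L P) :
    gofb (bcomp g f) = gofb h ->
    forall b a i x, cFb F f b a i (cFb F g b a i x) = cFb F h b a i x.
  move=> gh b a i x; rewrite -[LHS]/(bcomp (cFb F f) (cFb F g) b a i x).
  apply: gofb_inj; rewrite -gofb_cFb_comp !gofb_cFb; congr (cFm F _).
  exact: gh.
have Eid (L : bimod A B) b a i x : cFb F (bid L) b a i x = x.
  rewrite -[RHS]/(bid (F L) b a i x); apply: gofb_inj.
  by rewrite gofb_cFb !gofb_id cFm_id.
have E0 (L K : bimod A B) b a i x : cFb F (bzero L K) b a i x = 0.
  rewrite -[RHS]/(bzero (F K) (F L) b a i x); apply: gofb_inj.
  by rewrite gofb_cFb !gofb0 (lin0 (@cFm_lin _ _ _ _ _ _ _ _ _)).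
apply: (@dsum_Diso _ _ _ _ _ _ (cFb F (dsum_i1 M N)) (cFb F (dsum_i2 M N))
  (cFb F (dsum_p1 M N)) (cFb F (dsum_p2 M N))).
- move=> b a i x; rewrite (E _ _ _ _ _ (bid M)) ?Eid //.
  by apply: gmap0P => b' a' j y; rewrite !gofbE.
- move=> b a i x; rewrite (E _ _ _ _ _ (bid N)) ?Eid //.
  by apply: gmap0P => b' a' j y; rewrite !gofbE.
- move=> b a i x; rewrite (E _ _ _ _ _ (bzero M N)) ?E0 //.
  by apply: gmap0P => b' a' j y; rewrite !gofbE.
- move=> b a i x; rewrite (E _ _ _ _ _ (bzero N M)) ?E0 //.
  by apply: gmap0P => b' a' j y; rewrite !gofbE.
- move=> b a i x.
  have := congr1 (fun g => gm (cFm F g) (addr0 i) x) (dsum_split M N (addr0 0)).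
  rewrite (linD (@cFm_lin _ _ _ _ _ _ _ _ _)) !(cFm_comp _ _ (addr0 0)) mul0r !scale1r.
  rewrite -!gofb_cFb cFm_id gidE gmD.
  by rewrite !(gcompE _ _ _ _ (addr0 i) (addr0 i)) !gofbE.
Qed.

Lemma cF_dsum_retract M N : hproj (F (dsum M N)) -> hproj (F M).
Proof.
apply: (hproj_retract (s := cFb F (dsum_p1 M N)) (r := cFb F (dsum_i1 M N))).
by apply: cFb_inverse; exact: eqb_homotopic.
Qed.

(** h-projectivity of [F P] does not come from that of [P] alone. It is built up through shifts,
    cones and retracts, together with membership in the thick subcategory. *)
Lemma cF_thick_hproj (Q : resolution A B) (gen : bimod A B -> Prop)
    (gen' : bimod C D -> Prop) :
  (forall M, gen M -> [/\ hproj M, hproj (F M) & thick gen' (F M)]) ->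
  forall M, thick gen M -> forall P, hproj P -> Diso P M -> hproj (F P) /\ thick gen' (F P).
Proof.
move=> Hgen; apply: (thick_hproj_ind Q).
- move=> M N _ _ /(cF_heq F) h [hM tM]; split; last exact: thick_iso (heq_Diso h) tM.
  by case: h => f [g [_ fg]]; exact: hproj_retract fg hM.
- move=> M _ /(cF_contractible F) cM; split; last by apply: thick_zero; exact: contractible_Dzero.
  move=> N _ f g.
  have z (h : bmap (F M) N) : homotopic h (bzero (F M) N).
    apply: homotopic_trans (homotopic_trans _ (homotopic_compl h cM)) _; apply: eqb_homotopic => //.
    by move=> b a i x; rewrite bcompE bm0.
  exact: homotopic_trans (z f) (homotopic_sym (z g)).
- move=> s M _ [hM tM].
  have S := shiftdata_sym (cF_shiftdata (shift_data s M)).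
  by split; [exact: hproj_shiftdata S hM|exact: thick_shiftdata S tM].
- move=> M N f _ _ [hM tM] [hN tN].
  have S := cF_conedata (cone_data f); have S' := shiftdata_sym (shift_data 1 (F (cone f))).
  split; first exact: hproj_shiftdata S' (hproj_conedata S hN hM).
  exact: thick_shiftdata S' (thick_conedata S tN tM).
- move=> M N _ _ [hMN tMN]; split; first exact: cF_dsum_retract hMN.
  exact: thick_summand (thick_iso (cF_dsum M N) tMN).
- by move=> M /Hgen[].
Qed.
End ContravariantTriangles.

Section ContravariantComposite.
Variables (k : comPzRingType) (A B C D E G : dgcat k).

Definition cdgF_comp (F2 : cdgF C D E G) (F1 : cdgF A B C D) : dgF A B E G.
Proof.
refine (@DGF k A B E G (fun M => F2 (F1 M)) (fun M N n f => cFm F2 (cFm F1 f)) _ _ _ _).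
- by move=> M N n; exact: lin_comp (@cFm_lin _ _ _ _ _ F2 _ _ _) (@cFm_lin _ _ _ _ _ F1 _ _ _).
- by move=> M N n n' e f; rewrite !cFm_d.
- move=> L M N n m l e g f; have e' : m + n = l by rewrite addrC.
  rewrite (cFm_comp F1 e e') (linZ (@cFm_lin _ _ _ _ _ F2 _ _ _)) (cFm_comp F2 e' e).
  by rewrite mulrC ksgn_mulKl.
- by move=> M; rewrite !cFm_id.
Defined.

Definition dgF_id : dgF A B A B.
Proof. by refine (@DGF k A B A B id (fun M N n f => f) _ _ _ _). Defined.
End ContravariantComposite.

Section HomContravariant.
Variables (k : comPzRingType) (A B : dgcat k).

Lemma grestrict_rmul (M N : bimod A B) n (f : gmap M N n) b b' p (h : hom b' b p)
    l (e : p + n = l) (e' : n + p = l) :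
  gcomp e (rmul N h) (grestrict (idfunctor A) (kpt b) f)
  = ksgn k (n * p) *: gcomp e' (grestrict (idfunctor A) (kpt b') f) (rmul M h).
Proof.
apply: gmapP => t a i j ej x.
have E1 : i + n + p = j by rewrite -ej -e; lia.
have E2 : i + p + n = j by rewrite -ej -e'; lia.
rewrite gmZ (gcompE _ _ _ _ erefl E1) (gcompE _ _ _ _ erefl E2) !rmulE.
rewrite (linZ (gm_lin _ _)) scalerA -ksgnD.
have -> : ksgn k (n * p + p * i) = ksgn k (p * (i + n)) by parity.
by congr (_ *: _); symmetry; exact: (gm_r f erefl erefl E2 E1).
Qed.

Lemma grestrict_lmul (M N : bimod A B) n (f : gmap M N n) a a' p (h : hom a a' p)
    l (e : n + p = l) (e' : p + n = l) :
  gcomp e (grestrict (kpt a') (idfunctor B) f) (lmul M h)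
  = ksgn k (n * p) *: gcomp e' (lmul N h) (grestrict (kpt a) (idfunctor B) f).
Proof.
apply: gmapP => b t i j ej x.
have E1 : i + n + p = j by rewrite -ej -e; lia.
have E2 : i + p + n = j by rewrite -ej -e'; lia.
rewrite gmZ (gcompE _ _ _ _ erefl E1) (gcompE _ _ _ _ erefl E2).
rewrite (lmulE _ _ _ (lm_idx erefl)) (lmulE _ _ _ (lm_idx E1)).
exact: (gm_l f (lm_idx erefl) erefl E2 (lm_idx E1)).
Qed.

Lemma grestrict_lin (A' B' : dgcat k) (phi : dgfunctor A' A) (psi : dgfunctor B' B)
    (M N : bimod A B) n : linear (@grestrict k A A' B B' phi psi M N n).
Proof. by move=> c f g; apply: gmapP. Qed.

Lemma grestrict_comp (A' B' : dgcat k) (phi : dgfunctor A' A) (psi : dgfunctor B' B)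
    (L M N : bimod A B) n m l (e : n + m = l) (g : gmap M N n) (f : gmap L M m) :
  grestrict phi psi (gcomp e g f) = gcomp e (grestrict phi psi g) (grestrict phi psi f).
Proof. by apply: gmapP. Qed.

Lemma grestrict_d (A' B' : dgcat k) (phi : dgfunctor A' A) (psi : dgfunctor B' B)
    (M N : bimod A B) n n' (e : n + 1 = n') (f : gmap M N n) :
  gd e (grestrict phi psi f) = grestrict phi psi (gd e f).
Proof. by apply: gmapP. Qed.

Lemma grestrict_id (A' B' : dgcat k) (phi : dgfunctor A' A) (psi : dgfunctor B' B)
    (M : bimod A B) : grestrict phi psi (gid M) = gid (restrict phi psi M).
Proof. by apply: gmapP. Qed.

Section Left.
Variables (C : dgcat k) (N : bimod A C).

Definition gLHomC (M M' : bimod A B) n (f : gmap M M' n) : gmap (LHom M' N) (LHom M N) n.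
Proof.
refine (@GMap k B C (LHom M' N) (LHom M N) n
  (fun c b i j e h => ksgn k (n * i) *: gcomp e h (grestrict (idfunctor A) (kpt b) f)) _ _ _).
- by intros; apply: lin_scale; exact: gcomp_linl.
- move=> c c' b i p j l m e el em e' h g.
  rewrite !LHom_ractE (linZ (gcomp_linl _ _)) (linZ (gcomp_linr _ _)) !scalerA -!ksgnD.
  rewrite -(gcompA el (lh_idx e')); congr (_ *: _).
  by subst j l; parity.
- move=> c b b' p i j l m e el em e' g h.
  have E : p + n = n + p by rewrite addrC.
  have E1 : i + (n + p) = m by rewrite -e' -el; lia.
  rewrite !LHom_lactE !(linZ (gcomp_linl _ _)) !scalerA -!ksgnD.
  rewrite -(gcompA E E1 (lh_idx e) em) -(gcompA erefl E1 el (lh_idx e')).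
  rewrite (grestrict_rmul _ _ E erefl).
  rewrite (linZ (gcomp_linr _ _)) scalerA -ksgnD; congr (_ *: _).
  by rewrite -e -el; parity.
Defined.

Definition LHomC : cdgF A B B C.
Proof.
refine (@CDGF k A B B C (fun M => LHom M N) gLHomC _ _ _ _).
- move=> M M' n c f g; apply: gmapP => c' b i j e h.
  rewrite gmD gmZ /= (grestrict_lin _ _ c) (gcomp_linr e h c) scalerDr !scalerA.
  by rewrite mulrC.
- move=> M M' n n' en f; apply: gmapP => c b i j e h.
  have E1 := gdeg1 en e; have E2 := gdeg2 en e.
  rewrite (gdE _ _ _ erefl E1 erefl E2) !cd_LHomE /= (linZ (gd_lin _)).
  rewrite (gcomp_d _ E1 erefl en E2 e) grestrict_d scalerDr !scalerA -!ksgnD.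
  have -> : ksgn k (n + n * (i + 1)) = ksgn k (n * i) by parity.
  by rewrite addrAC subrr add0r; congr (_ *: _); rewrite -en; parity.
- move=> L M M' n m l e e' g f; apply: gmapP => c b i j ej h.
  have E1 : i + n + m = j by rewrite -ej -e; lia.
  rewrite gmZ (gcompE _ _ _ _ erefl E1) /= grestrict_comp (linZ (gcomp_linl _ _)).
  rewrite !scalerA -!ksgnD (gcompA e ej erefl E1); congr (_ *: _).
  by rewrite -e; parity.
- move=> M; apply: gmap0P => c b i h; rewrite gidE /= mul0r ksgn0 scale1r.
  by rewrite grestrict_id gcomp1r.
Defined.

End Left.

Section Right.
Variables (C : dgcat k) (N : bimod C B).

Definition gRHomC (M M' : bimod A B) n (f : gmap M M' n) : gmap (RHom M' N) (RHom M N) n.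
Proof.
refine (@GMap k C A (RHom M' N) (RHom M N) n
  (fun a c i j e h => ksgn k (n * i) *: gcomp e h (grestrict (kpt a) (idfunctor B) f)) _ _ _).
- by intros; apply: lin_scale; exact: gcomp_linl.
- move=> a a' c i p j l m e el em e' h g.
  have E : p + n = n + p by rewrite addrC.
  have E1 : i + (n + p) = m by rewrite -e' -el; lia.
  rewrite !RHom_ractE (linZ (gcomp_linl _ _)).
  rewrite -(gcompA E E1 e em) -(gcompA erefl E1 el e') (grestrict_lmul _ _ erefl E).
  rewrite (linZ (gcomp_linr _ _)) scalerA -ksgnD; congr (_ *: _).
  by rewrite -e; parity.
- move=> a c c' p i j l m e el em e' g h.
  rewrite !RHom_lactE (linZ (gcomp_linr _ _)) scalerA -ksgnD -(gcompA el e').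
  by congr (_ *: _); rewrite -e; parity.
Defined.

Definition RHomC : cdgF A B C A.
Proof.
refine (@CDGF k A B C A (fun M => RHom M N) gRHomC _ _ _ _).
- move=> M M' n c f g; apply: gmapP => a c' i j e h.
  rewrite gmD gmZ /= (grestrict_lin _ _ c) (gcomp_linr e h c) scalerDr !scalerA.
  by rewrite mulrC.
- move=> M M' n n' en f; apply: gmapP => a c i j e h.
  have E1 := gdeg1 en e; have E2 := gdeg2 en e.
  rewrite (gdE _ _ _ erefl E1 erefl E2) !cd_RHomE /= (linZ (gd_lin _)).
  rewrite (gcomp_d _ E1 erefl en E2 e) grestrict_d scalerDr !scalerA -!ksgnD.
  have -> : ksgn k (n + n * (i + 1)) = ksgn k (n * i) by parity.
  by rewrite addrAC subrr add0r; congr (_ *: _); rewrite -en; parity.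
- move=> L M M' n m l e e' g f; apply: gmapP => a c i j ej h.
  have E1 : i + n + m = j by rewrite -ej -e; lia.
  rewrite gmZ (gcompE _ _ _ _ erefl E1) /= grestrict_comp (linZ (gcomp_linl _ _)).
  rewrite !scalerA -!ksgnD (gcompA e ej erefl E1); congr (_ *: _).
  by rewrite -e; parity.
- move=> M; apply: gmap0P => a c i h; rewrite gidE /= mul0r ksgn0 scale1r.
  by rewrite grestrict_id gcomp1r.
Defined.

Lemma RHomCE (M M' : bimod A B) (f : bmap M M') a c i (h : bc (RHom M' N) a c i) :
  cFb RHomC f a c i h = gcomp (addr0 i) h (grestrict (kpt a) (idfunctor B) (gofb f)).
Proof. by rewrite bofgE /= mul0r ksgn0 scale1r. Qed.
End Right.
End HomContravariant.

(** * Biduals and the biduality map *)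

Section Biduality.
Variables (k : comPzRingType) (A B : dgcat k).

Definition bidual (T : bimod A B) : bimod A B := RHom (LHom T (diag A)) (diag A).

Section At.
Variable T : bimod A B.

Lemma bidual_at_lin b a i (x : bc T b a i) c j l (e : j + i = l) :
  linear (fun phi : bc (LHom T (diag A)) c b j =>
    ksgn k (i * j) *: (gm phi (b:=tt) (a:=a) (lm_idx e) x : hom c a l)).
Proof. by move=> s f f'; rewrite gmD gmZ scalerDr !scalerA mulrC. Qed.

Definition bidual_at b a i (x : bc T b a i) :
  gmap (rcomponent (LHom T (diag A)) b) (rcomponent (diag A) a) i.
Proof.
refine (@rgmap k A (rcomponent (LHom T (diag A)) b) (rcomponent (diag A) a) i
  (fun c t j l e phi => ksgn k (i * j) *: (gm phi (b:=tt) (a:=a) (lm_idx e) x : hom c a l)) _ _).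
- by move=> c t j l e; exact: bidual_at_lin.
- move=> c c' t j p l m q e el em e' phi h.
  rewrite [ract (rcomponent (LHom T (diag A)) b) _ _ _]LHom_ractE gmZ.
  rewrite (gcompE _ _ _ _ (lm_idx el) e') rmulE [RHS](linZ (ract_linl (b0 := rcomponent (diag A)
    a) _ _)).
  rewrite !scalerA -!ksgnD; congr (_ *: _); subst l m; parity.
Defined.

Lemma bidual_atE b a i (x : bc T b a i) c t j l (e : j + i = l) (e' : i + j = l)
    (phi : bc (LHom T (diag A)) c b j) :
  gm (bidual_at x) (b:=c) (a:=t) e phi = ksgn k (i * j) *: gm phi (b:=tt) (a:=a) e' x.
Proof. by rewrite /= (eq_irrelevance (lm_idx e) e'). Qed.

Definition bidual_map : bmap T (bidual T).
Proof.
refine (@BMap k A B T (bidual T) bidual_at _ _ _ _).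
- move=> b a i s x y; apply: gmapP => c t j l e phi.
  rewrite gmD gmZ !(bidual_atE _ _ _ (lm_idx e)) (gm_lin phi _ s) scalerDr !scalerA.
  by rewrite mulrC.
- move=> b a i i' e x; apply: gmapP => c t j l ej phi.
  have E1 := gdeg1 e ej; have E2 := gdeg2 e ej.
  rewrite cd_RHomE (gdE _ _ _ erefl E1 erefl E2) (bidual_atE _ _ _ (lm_idx ej)).
  rewrite (bidual_atE _ _ _ (lm_idx erefl)) (bidual_atE _ _ _ (lm_idx E2)).
  rewrite [X in X - _](linZ (cd_lin E1)).
  rewrite [X in _ = _ - _ *: (_ *: X)](gdE erefl phi (lm_idx E2) (lm_idx erefl) E1 e (lm_idx ej)).
  rewrite !scalerDr opprD !scalerN !scalerA -!ksgnD.
  have -> : ksgn k (i + i * (j + 1)) = ksgn k (i * j) by parity.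
  rewrite addrA subrr add0r opprK; congr (_ *: _); rewrite -e; parity.
- move=> b b' a i p n e x h; apply: gmapP => c t j l ej phi.
  have E : j + p + i = l by rewrite -ej -e; lia.
  rewrite RHom_ractE (gcompE _ _ _ _ erefl E) (lmulE _ _ _ (lm_idx erefl)).
  rewrite (bidual_atE _ _ _ (lm_idx ej)) (bidual_atE _ _ _ (lm_idx E)).
  rewrite LHom_lactE gmZ (gcompE _ _ _ _ e (lm_idx ej)) rmulE (linZ (gm_lin _ _)).
  by rewrite !scalerA -!ksgnD; congr (_ *: _); rewrite -e; parity.
- move=> b a a' p i n e h x; apply: gmapP => c t j l ej phi.
  have E : j + i + p = l by rewrite -ej -e; lia.
  rewrite RHom_lactE (gcompE _ _ _ _ erefl E) (lmulE _ _ _ (lm_idx E)).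
  rewrite (bidual_atE _ _ _ (lm_idx ej)) (bidual_atE _ _ _ (lm_idx erefl)).
  rewrite (gm_l phi e (lm_idx erefl) (lm_idx ej) (lm_idx E)).
  rewrite [RHS](linZ (lact_linr (b0 := diag A) _ _)) !scalerA -!ksgnD.
  by congr (_ *: _); rewrite -e; parity.
Defined.

Lemma bidual_mapE b a i (x : bc T b a i) c t j l (e : j + i = l) (e' : i + j = l)
    (phi : bc (LHom T (diag A)) c b j) :
  gm (bidual_map b a i x) (b:=c) (a:=t) e phi = ksgn k (i * j) *: gm phi (b:=tt) (a:=a) e' x.
Proof. exact: bidual_atE. Qed.
End At.

Definition bidualF : dgF A B A B := cdgF_comp (RHomC B (diag A)) (LHomC B (diag A)).

Lemma bidual_nat (M N : bimod A B) n (f : gmap M N n) b a i j (e : i + n = j)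
    (x : bc M b a i) :
  bidual_map N b a j (gm (dFm (dgF_id A B) f) e x) = gm (dFm bidualF f) e (bidual_map M b a i x).
Proof.
apply: gmapP => c t u v ev phi.
have E : u + n + i = v by rewrite -ev -e; lia.
rewrite (bidual_mapE _ _ _ (lm_idx ev)) [dFm _ _]/= [gm (gRHomC _ _) _ _]/= gmZ.
rewrite (gcompE _ _ _ _ erefl E) [X in gm _ _ X]/= (linZ (gm_lin _ _)).
rewrite (bidual_mapE _ _ _ (lm_idx E)) !scalerA -!ksgnD.
rewrite (gcompE _ _ _ _ e (lm_idx ev)); congr (_ *: _).
by rewrite -e; parity.
Qed.
End Biduality.

Section BidualComponents.
Variables (k : comPzRingType) (A B : dgcat k).

(** A left linear [phi] on [A(b, -)] is right multiplication by its value [z] at the identity, so it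
    is the identity map acted on by [z]. An element of the bidual is right linear, hence determined
    by its value at the identity map. *)
Lemma bidual_diag_bij (b a : ob A) i :
  (forall x : hom b a i,
     gm (bidual_map (diag A) b a i x) (b:=b) (a:=tt) (add0r i) (gid (lcomponent (diag A) b)) = x) /\
  (forall y : bc (bidual (diag A)) b a i,
     bidual_map (diag A) b a i
       (gm y (b:=b) (a:=tt) (add0r i) (gid (lcomponent (diag A) b)) : hom b a i) = y).
Proof.
split=> [x|y].
  by rewrite (bidual_mapE _ _ _ (addr0 i)) mulr0 ksgn0 scale1r gidE.
apply: gmapP => c [] j l e phi; have e' := lm_idx e.
pose z : hom c b j := gm phi (b:=tt) (a:=b) (add0r j) (idm b : bc (lcomponent (diag A) b) tt b 0).
have phiE d u v (ev : u + j = v) (w : hom b d u) :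
    gm phi (b:=tt) (a:=d) ev (w : bc (lcomponent (diag A) b) tt d u) = ksgn k (j * u) *: comp ev
      w z.
  rewrite -[LHS]/(gm phi (b:=tt) (a:=d) ev (w : bc (lcomponent (diag A) b) tt d u)).
  transitivity (gm phi ev (lact (lcomponent (diag A) b) (addr0 u) w (idm b : bc (lcomponent (diag
    A) b) tt b 0))).
    by congr (gm phi ev _); symmetry; exact: compm1.
  exact: (gm_l phi (addr0 u) (add0r j) ev ev).
rewrite (bidual_mapE _ _ _ e') [X in _ *: X](phiE _ _ _ e') scalerA -ksgnD.
have -> : ksgn k (i * j + j * i) = ksgn k 0 by parity.
rewrite ksgn0 scale1r.
have phiR : phi = ract (LHom (diag A) (diag A)) (add0r j) (gid (lcomponent (diag A) b) : bc (LHom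
  (diag A) (diag A)) b b 0) z.
  rewrite LHom_ractE mul0r ksgn0 scale1r (eq_irrelevance (lh_idx _) (addr0 j)) gcomp1r.
  apply: gmapP => -[] d u v ev w; rewrite rmulE; exact: phiE.
rewrite [in RHS]phiR; symmetry; exact: (gm_r y (add0r j) (add0r i) e e').
Qed.

Lemma bidual_diag_qis : quasi_iso (bidual_map (diag A)).
Proof.
apply: (@quasi_iso_bij _ _ _ _ _ (bidual_map (diag A)) (fun b a i y =>
  gm y (b:=b) (a:=tt) (add0r i) (gid (lcomponent (diag A) b)) : hom b a i)).
  by move=> b a i x; exact: (bidual_diag_bij b a i).1.
by move=> b a i y; exact: (bidual_diag_bij b a i).2.
Qed.

Lemma hproj_bij (C D : dgcat k) (M N : bimod C D) (f : bmap M N)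
    (g : forall b a i, bc N b a i -> bc M b a i) :
  (forall b a i x, g b a i (f b a i x) = x) ->
  (forall b a i y, f b a i (g b a i y) = y) -> hproj M -> hproj N.
Proof.
move=> gf fg; have inj b a i x y : f b a i x = f b a i y -> x = y.
  by move=> h; rewrite -[x]gf h gf.
pose g' := @BMap k C D N M g
  (fun b a i c x y => inj _ _ _ _ _ (etrans (fg _ _ _ _) (esym (etrans (@bm_lin _ _ _ _ _ f b a i
    c _ _) (congr2 (fun u v => c *: u + v) (fg _ _ _ _) (fg _ _ _ _))))))
  (fun b a i j e x => inj _ _ _ _ _ (etrans (fg _ _ _ _) (esym (etrans (bm_d f e _) (congr1 _ (fg
    _ _ _ _))))))
  (fun b b' a i j n e x h => inj _ _ _ _ _ (etrans (fg _ _ _ _) (esym (etrans (bm_r f e _ h)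
    (congr1 (fun u => ract N e u h) (fg _ _ _ _))))))
  (fun b a a' i j n e h x => inj _ _ _ _ _ (etrans (fg _ _ _ _) (esym (etrans (bm_l f e h _)
    (congr1 _ (fg _ _ _ _)))))).
by apply: (hproj_retract (s := g') (r := f)); apply: eqb_homotopic => b a i x; exact: fg.
Qed.

Definition right_multiplication (b : ob A) : bmap (hright b) (rcomponent (LHom (diag A) (diag A))
  b).
Proof.
refine (@rbmap k A A (hright b) (rcomponent (LHom (diag A) (diag A)) b)
  (fun c t i (z : hom c b i) => rmul (diag A) z) _ _ _).
- by move=> c t i; exact: rmul_lin.
- by move=> c t i j e z; symmetry; exact: rmul_d.
- by move=> c c' t i j n e z g; exact: rmul_comp.
Defined.

Lemma right_multiplication_bij (b c : ob A) t i :
  (forall z : hom c b i,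
     gm (right_multiplication b c t i z) (b:=tt) (a:=b) (add0r i) (idm b) = z) /\
  (forall phi : bc (rcomponent (LHom (diag A) (diag A)) b) c t i,
     right_multiplication b c t i (gm phi (b:=tt) (a:=b) (add0r i) (idm b)) = phi).
Proof.
split=> [z|phi].
  rewrite -[LHS]/(gm (rmul (diag A) z) (b:=tt) (a:=b) (add0r i) (idm b)) rmulE mulr0 ksgn0 scale1r.
  exact: comp1m.
apply: gmapP => -[] d u v ev w; rewrite rmulE.
transitivity (gm phi ev (lact (lcomponent (diag A) b) (addr0 u) w (idm b : bc (lcomponent (diag
  A) b) tt b 0))).
  by symmetry; exact: (gm_l phi (addr0 u) (add0r i) ev ev).
by congr (gm phi ev _); exact: compm1.
Qed.

(** Duality takes the left representable [h^b] to the right representable [h_b]: left linear maps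
    out of [A(b, -)] are right multiplications. The bijection also carries h-projectivity over. *)
Lemma dual_hright (b : ob A) :
  hproj (rcomponent (LHom (diag A) (diag A)) b) /\
  Diso (hright b) (rcomponent (LHom (diag A) (diag A)) b).
Proof.
pose g c t i (phi : bc (rcomponent (LHom (diag A) (diag A)) b) c t i) :
  bc (hright b) c t i := gm phi (b:=tt) (a:=b) (add0r i) (idm b).
have gf c t i x : g c t i (right_multiplication b c t i x) = x.
  exact: (right_multiplication_bij b c t i).1.
have fg c t i y : right_multiplication b c t i (g c t i y) = y.
  exact: (right_multiplication_bij b c t i).2.
by split; [exact: hproj_bij gf fg (@hproj_hright _ _ b)|exact: bij_Diso gf fg].
Qed.

Lemma gofb_inverse (C D : dgcat k) (M N : bimod C D) (f : bmap M N) (g : bmap N M)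
    (e : 0 + 0 = 0 :> int) :
  (forall b a i x, g b a i (f b a i x) = x) -> gcomp e (gofb g) (gofb f) = gid M.
Proof. by move=> gf; apply: gmap0P => b a i x; rewrite -gofb_comp gofbE gidE bcompE gf. Qed.

(** [lcomponent (lcomponent T b) t] and [lcomponent T b] have the same underlying
    complexes, but they are not convertible as bimodules: the identity has to be
    inserted between them. *)
Section Retyping.
Variables (C : dgcat k) (T : bimod A B) (N : bimod A C) (b : ob B).

Definition lid t : bmap (lcomponent (lcomponent T b) t) (lcomponent T b) :=
  @lbmap k A (lcomponent (lcomponent T b) t) (lcomponent T b)
    (fun t' a i x => x) (fun t' a i c x y => erefl) (fun t' a i j e x => erefl)
    (fun t' a a' i j n e g x => erefl).

Definition lid' t : bmap (lcomponent T b) (lcomponent (lcomponent T b) t) :=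
  @lbmap k A (lcomponent T b) (lcomponent (lcomponent T b) t)
    (fun t' a i x => x) (fun t' a i c x y => erefl) (fun t' a i j e x => erefl)
    (fun t' a a' i j n e g x => erefl).

Lemma lidK t (e : 0 + 0 = 0 :> int) : gcomp e (gofb (lid t)) (gofb (lid' t)) = gid _.
Proof. by apply: gofb_inverse. Qed.
Lemma lidK' t (e : 0 + 0 = 0 :> int) : gcomp e (gofb (lid' t)) (gofb (lid t)) = gid _.
Proof. by apply: gofb_inverse. Qed.

Definition lret : bmap (LHom (lcomponent T b) N) (rcomponent (LHom T N) b).
Proof.
refine (@rbmap k C C (LHom (lcomponent T b) N) (rcomponent (LHom T N) b)
  (fun c t i h => gcomp (addr0 i) h (gofb (lid' t))) _ _ _).
- by move=> c t i; exact: gcomp_linl.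
- by move=> c t i j e h; symmetry; exact: gd_comp_closedr (gofb_closed _).
- move=> c c' t i j n e h g.
  rewrite [ract _ _ _ _]LHom_ractE (linZ (gcomp_linl _ _)).
  by rewrite -(gcompA (addr0 i) (lh_idx e)).
Defined.

Definition lret' : bmap (rcomponent (LHom T N) b) (LHom (lcomponent T b) N).
Proof.
refine (@rbmap k C C (rcomponent (LHom T N) b) (LHom (lcomponent T b) N)
  (fun c t i h => gcomp (addr0 i) h (gofb (lid t))) _ _ _).
- by move=> c t i; exact: gcomp_linl.
- by move=> c t i j e h; symmetry; exact: gd_comp_closedr (gofb_closed _).
- move=> c c' t i j n e h g.
  rewrite [X in gcomp _ X _]LHom_ractE (linZ (gcomp_linl _ _)).
  by rewrite -(gcompA (addr0 i) (lh_idx e)).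
Defined.

Lemma lretK c t i h : lret' c t i (lret c t i h) = h.
Proof.
rewrite -[LHS]/(gcomp (addr0 i) (gcomp (addr0 i) h (gofb (lid' t))) (gofb (lid t))).
by rewrite -(gcompA (addr0 0) (addr0 i)) lidK' gcomp1r.
Qed.
Lemma lretK' c t i h : lret c t i (lret' c t i h) = h.
Proof.
rewrite -[LHS]/(gcomp (addr0 i) (gcomp (addr0 i) h (gofb (lid t))) (gofb (lid' t))).
by rewrite -(gcompA (addr0 0) (addr0 i)) lidK gcomp1r.
Qed.

Lemma LHom_lcomponent_Diso : Diso (LHom (lcomponent T b) N) (rcomponent (LHom T N) b).
Proof. exact: bij_Diso lretK lretK'. Qed.

Lemma hproj_LHom_lcomponent :
  hproj (LHom (lcomponent T b) N) <-> hproj (rcomponent (LHom T N) b).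
Proof.
split; [apply: (hproj_retract (s := lret') (r := lret))|apply: (hproj_retract (s := lret) (r :=
  lret'))];
  apply: eqb_homotopic; [exact: lretK'|exact: lretK].
Qed.
End Retyping.
End BidualComponents.

Section BidualComponent.
Variables (k : comPzRingType) (A B : dgcat k) (T : bimod A B) (b : ob B).
Let M := lcomponent T b.
Let D := diag A.

(** These are the components of [lret] and [lret'] as plain functions; they also serve as the
    components of [rret] and [rret'], whose source and target are typed differently. *)
Definition gret t c i (h : gmap (lcomponent M t) (lcomponent D c) i) : gmap M (lcomponent D c) i :=
  gcomp (addr0 i) h (gofb (lid' T b t)).
Definition gret' t c i (h : gmap M (lcomponent D c) i) : gmap (lcomponent M t) (lcomponent D c) i :=
  gcomp (addr0 i) h (gofb (lid T b t)).

Lemma gretK t c i (h : gmap M (lcomponent D c) i) : gret (gret' t h) = h.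
Proof. by rewrite /gret /gret' -(gcompA (addr0 0) (addr0 i)) lidK gcomp1r. Qed.
Lemma gretK' t c i (h : gmap (lcomponent M t) (lcomponent D c) i) : gret' t (gret h) = h.
Proof. by rewrite /gret /gret' -(gcompA (addr0 0) (addr0 i)) lidK' gcomp1r. Qed.

Lemma gretE t c i (h : gmap (lcomponent M t) (lcomponent D c) i) s a u v (e : u + i = v) (x : bc
  T b a u) :
  gm (gret h) (b:=s) (a:=a) e x = gm h (b:=s) (a:=a) e (x : bc (lcomponent M t) s a u).
Proof. by rewrite /gret (gcompE _ _ _ _ (addr0 u) e) gofbE. Qed.

Definition rret t : bmap (rcomponent (LHom M D) t) (rcomponent (LHom T D) b) :=
  @rbmap k A A (rcomponent (LHom M D) t) (rcomponent (LHom T D) b)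
    (fun c t' i h => @gret t c i h)
    (fun c t' i => @bm_lin _ _ _ _ _ (lret T D b) c t i)
    (fun c t' i j e h => @bm_d _ _ _ _ _ (lret T D b) c t i j e h)
    (fun c c' t' i j n e h g => @bm_r _ _ _ _ _ (lret T D b) c c' t i j n e h g).

Definition rret' t : bmap (rcomponent (LHom T D) b) (rcomponent (LHom M D) t) :=
  @rbmap k A A (rcomponent (LHom T D) b) (rcomponent (LHom M D) t)
    (fun c t' i h => @gret' t c i h)
    (fun c t' i => @bm_lin _ _ _ _ _ (lret' T D b) c t i)
    (fun c t' i j e h => @bm_d _ _ _ _ _ (lret' T D b) c t i j e h)
    (fun c c' t' i j n e h g => @bm_r _ _ _ _ _ (lret' T D b) c c' t i j n e h g).

Lemma rretK t (e : 0 + 0 = 0 :> int) :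
  gcomp e (gofb (rret t)) (gofb (rret' t)) = gid (rcomponent (LHom T D) b).
Proof. exact: (gofb_inverse (g := rret t) (f := rret' t) e (fun c t' i h => @gretK t c i h)). Qed.
Lemma rretK' t (e : 0 + 0 = 0 :> int) :
  gcomp e (gofb (rret' t)) (gofb (rret t)) = gid (rcomponent (LHom M D) t).
Proof. exact: (gofb_inverse (g := rret' t) (f := rret t) e (fun c t' i h => @gretK' t c i h)). Qed.

(** It carries the component of the biduality map of [T] to the biduality map of the component.
    Reflexivity can then pass from a bimodule to its left modules and back. *)
Definition bret : bmap (lcomponent (bidual T) b) (bidual M).
Proof.
refine (@lbmap k A (lcomponent (bidual T) b) (bidual M)
  (fun t a i psi => gcomp (addr0 i) psi (gofb (rret t))) _ _ _).
- by move=> t a i; exact: gcomp_linl.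
- by move=> t a i j e h; symmetry; exact: gd_comp_closedr (gofb_closed _).
- move=> t a a' i j n e g h; rewrite [RHS]RHom_lactE.
  by rewrite (gcompA (addr0 j) e e (addr0 n)).
Defined.

Lemma bret_qis : quasi_iso bret.
Proof.
apply: (@quasi_iso_bij _ _ _ _ _ bret
  (fun t a i psi => gcomp (addr0 i) psi (gofb (rret' t)))).
- move=> t a i psi.
  rewrite -[LHS]/(gcomp (addr0 i) (gcomp (addr0 i) psi (gofb (rret t))) (gofb (rret' t))).
  by rewrite -(gcompA (addr0 0) (addr0 i)) rretK gcomp1r.
- move=> t a i psi.
  rewrite -[LHS]/(gcomp (addr0 i) (gcomp (addr0 i) psi (gofb (rret' t))) (gofb (rret t))).
  by rewrite -(gcompA (addr0 0) (addr0 i)) rretK' gcomp1r.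
Qed.

Lemma bret_bidual t a i (x : bc M t a i) :
  gcomp (addr0 i) (bidual_map T b a i x) (gofb (rret t)) = bidual_map M t a i x.
Proof.
apply: (@gmapP k (kcat k) A (rcomponent (LHom M D) t) (rcomponent D a) i) => c t' j l e phi.
have e' := lm_idx e.
rewrite (@gcompE k (kcat k) A (rcomponent (LHom M D) t) (rcomponent (LHom T D) b) (rcomponent D a)
  i 0 i (addr0 i) (bidual_map T b a i x) (gofb (rret t)) c t' j l j e (addr0 j) e phi).
rewrite (@gofbE k (kcat k) A _ _ (rret t) c t' j (addr0 j) phi).
transitivity (ksgn k (i * j) *: gm (gret phi) (b:=tt) (a:=a) e' x).
  exact: (bidual_mapE _ _ _ e').
rewrite gretE; symmetry; exact: (bidual_mapE _ _ _ e').
Qed.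

Lemma bidual_lcomponent_qis : quasi_iso (bidual_map T) -> quasi_iso (bidual_map M).
Proof.
move=> q; apply: (@homotopic_qis _ _ _ _ _ (bcomp bret (brestrict (idfunctor A) (kpt b)
  (bidual_map T)))).
  by apply: eqb_homotopic; exact: bret_bidual.
by apply: quasi_iso_comp; [exact: bret_qis|exact: brestrict_qis].
Qed.

Lemma bidual_qis_at a : quasi_iso (bidual_map M) -> cx_quasi_iso (bidual_map T b a).
Proof.
move=> q; suff h : quasi_iso (brestrict (idfunctor A) (kpt b) (bidual_map T)) by exact: (h tt a).
apply: quasi_iso_cancell bret_qis; apply: homotopic_qis q; apply: eqb_homotopic => t a' i x.
by symmetry; exact: bret_bidual.
Qed.
End BidualComponent.

Section Reflexivity.
Variables (k : comPzRingType) (A : dgcat k) (Q : resolution A (kcat k)).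

(** Everything reduces to [hleft X]. Its dual is [hright X], and it is reflexive as a component of
    the diagonal, whose biduality map is bijective. *)
Lemma lperfect_dual (M : bimod A (kcat k)) : lperfect M -> hproj M ->
  [/\ hproj (LHom M (diag A)), perfect (LHom M (diag A)) & quasi_iso (bidual_map M)].
Proof.
move=> pM hM.
have [h1 h2] : hproj (LHom M (diag A)) /\ perfect (LHom M (diag A)).
  apply: (cF_thick_hproj (F := LHomC (kcat k) (diag A)) Q _ pM hM (Diso_refl M)).
  move=> _ [X ->]; have [hX iso] := dual_hright X; split; first exact: hproj_hleft.
    exact/hproj_LHom_lcomponent.
  apply: thick_iso (Diso_sym (LHom_lcomponent_Diso (diag A) (diag A) X)) _.
  by apply: thick_iso iso _; apply: thick_gen; exists X.
split=> //; apply: (@thick_nat_qis k A (kcat k) A (kcat k) (dgF_id A (kcat k)) (bidualF A (kcat k))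
  (fun M => bidual_map M) (@bidual_nat k A (kcat k)) Q _ _ M pM M hM (Diso_refl M)).
move=> _ [X ->]; split; first exact: hproj_hleft.
exact: (@bidual_lcomponent_qis k A A (diag A) X (@bidual_diag_qis k A)).
Qed.
End Reflexivity.

(** * The left adjoint *)

Section LeftAdjoint.
Variables (k : comPzRingType) (Q : forall A B : dgcat k, resolution A B).

(** For closed [phi] and a homotopy [h], the map [phi (d h)] is a boundary up to sign. Composition
    with [g] is therefore inverse to composition with [f] on cohomology. *)
Lemma precomposition_qis (A B : dgcat k) (M N X : bimod A B) (f : bmap M N) (g : bmap N M) :
  homotopic (bcomp g f) (bid M) -> homotopic (bcomp f g) (bid N) ->
  cx_quasi_iso (C := gHom N X) (D := gHom M X)
    (fun i (phi : gmap N X i) => gcomp (addr0 i) phi (gofb f)).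
Proof.
move=> /homotopicP[h1 hh1] /homotopicP[h2 hh2].
rewrite (gofb_comp _ _ (addr0 0)) gofb_id in hh1.
rewrite (gofb_comp _ _ (addr0 0)) gofb_id in hh2.
split=> i j l ei el.
- move=> phi psi dphi hpsi; have Ej : i + -1 = j by rewrite -ei addrK.
  exists (gcomp (addr0 j) psi (gofb g) - ksgn k i *: gcomp Ej phi h2).
  rewrite (linD (cd_lin _)) (linN (cd_lin _)) (linZ (cd_lin _)) /=.
  rewrite (gd_comp_closedr _ ei ei (addr0 i) _ (gofb_closed g)) -[gd ei psi]hpsi.
  rewrite (gd_comp_closedl Ej ei (addNr 1) (addr0 i) _ dphi) -hh2 ksgn_mulKl.
  rewrite (linD (gcomp_linr _ _)) (linN (gcomp_linr _ _)) gcomp1r opprB addrC.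
  by rewrite -(gcompA (addr0 0) (addr0 i) (addr0 i)) subrK.
- move=> phi dphi; have Ej : i + -1 = j by rewrite -ei addrK.
  exists (gcomp (addr0 i) phi (gofb g)), (- ksgn k i *: gcomp Ej phi h1); split.
    rewrite -[cd _ _ _]/(gd el (gcomp (addr0 i) phi (gofb g))).
    by rewrite (gd_comp_closedr _ el el (addr0 l) _ (gofb_closed g)) [gd el phi]dphi (lin0
      (gcomp_linl _ _)).
  rewrite (linZ (cd_lin _)) scaleNr /= -(gcompA (addr0 0) (addr0 i) (addr0 i)).
  have -> : gcomp (addr0 0) (gofb g) (gofb f) = gid M + gd (addNr 1) h1.
    by rewrite -hh1 addrC subrK.
  rewrite (linD (gcomp_linr _ _)) gcomp1r.
  rewrite (gd_comp_closedl Ej ei (addNr 1) (addr0 i) _ dphi) ksgn_mulKl.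
  by rewrite addrK.
Qed.

Lemma RHomC_qis (A B C : dgcat k) (L L' : bimod A B) (N : bimod C B) (f : bmap L L') :
  (forall a, hproj (rcomponent L a)) -> (forall a, hproj (rcomponent L' a)) ->
  quasi_iso f -> quasi_iso (cFb (RHomC A N) f).
Proof.
move=> hL hL' qf a c.
have -> : cFb (RHomC A N) f a c = (fun i (phi : gmap (rcomponent L' a) (rcomponent N c) i) =>
    gcomp (addr0 i) phi (gofb (brestrict (kpt a) (idfunctor B) f))).
  apply: functional_extensionality_dep => i; apply/funext => phi; rewrite RHomCE.
  by congr (gcomp _ _ _); apply: gmapP.
have [g [gf fg]] := hproj_qis_inv (hL a) (hL' a) (brestrict_qis (kpt a) (idfunctor B) qf).
exact: precomposition_qis gf fg.
Qed.

Variables (A A' : dgcat k) (p : dgfunctor A' A).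
Hypotheses (res : hproj_resolution p) (triA : triangulated A) (smA : smooth p).
Variables (B' : dgcat k) (hB : hproj_dgcat B') (lpB : locally_perfect B').

Lemma lcomponent_rcomponent (R : bimod A' B') b a :
  Diso (lcomponent (rcomponent R a) b) (rcomponent (lcomponent R b) a).
Proof.
pose f := @kbmap k (lcomponent (rcomponent R a) b) (rcomponent (lcomponent R b) a)
  (fun s t i x => x) (fun s t i c x y => erefl) (fun s t i j e x => erefl).
exact: (@bij_Diso _ _ _ _ _ f (fun s t i x => x)).
Qed.

Lemma lcomponent_hright (b b0 : ob B') : Diso (homk b b0) (lcomponent (hright b0) b).
Proof.
pose f := @kbmap k (homk b b0) (lcomponent (hright b0) b)
  (fun s t i x => x) (fun s t i c x y => erefl) (fun s t i j e x => erefl).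
exact: (@bij_Diso _ _ _ _ _ f (fun s t i x => x)).
Qed.

(** The value at [a] of the left module [R(b, -)] is that of [R_a] at [b], hence equivalent to
    [B(b, b0)] when [h_b0] represents [R_a]. Local perfectness makes these values perfect, and
    smoothness does the rest. *)
Lemma lperfect_lcomponent (R : bimod A' B') b : hproj R ->
  (forall a, exists b0, Diso (rcomponent R a) (hright b0)) -> lperfect (lcomponent R b).
Proof.
move=> hR rep; apply: (perfect_of_values_l Q res.1 (smooth_diag res smA)).
  exact: hproj_lcomponent.
move=> a; have [b0 iso] := rep a.
apply: thick_iso (lcomponent_rcomponent R b a) _.
apply: thick_iso (Diso_restrict _ _ (Diso_sym iso)) _.
exact: thick_iso (lcomponent_hright b b0) (lpB b b0).
Qed.

(** The criterion for adjoints is applied with [S] on the left and [T] on the right, so the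
    transpose of the pairing must be a quasi-isomorphism from [R] to the dual of the resolution of
    [S]. This is the reflexivity of the left modules [R(b, -)], which are perfect. *)
Lemma left_adjoint (T : bimod A' B') : quasi_functor T ->
  exists S : bimod B' A', quasi_functor S /\ adjoint Q S T.
Proof.
move=> qT; pose R := Qob (Q A' B') T; pose S := LHom R (diag A').
have hR : hproj R by exact: Qob_hproj.
have rep := quasi_functor_resolution Q qT.
have dual b := lperfect_dual (Q A' (kcat k)) (lperfect_lcomponent b hR rep) (@hproj_lcomponent k
  A' B' R b hB hR).
have qS : quasi_functor S.
  move=> b; have [hD pD _] := dual b.
  have [X DX] := perfect_quasi_representable Q res triA hD pD; exists X.
  exact: Diso_trans (Diso_sym (LHom_lcomponent_Diso R (diag A') b)) DX.
exists S; split=> //; pose pi := Qpi (Q B' A') S.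
(* The biduality map lands in the dual of [S] itself; precomposition with [pi] passes to the dual of
   its resolution. *)
pose rho := bcomp (cFb (RHomC B' (diag A')) pi) (bidual_map R).
have qrho : quasi_iso rho.
  apply: quasi_iso_comp.
    apply: RHomC_qis; last exact: Qpi_qis.
      by move=> b; apply: hproj_rcomponent hB _; exact: Qob_hproj.
    (* [S] is not resolved, but its components are duals of perfect h-projective modules, hence
       h-projective, which is enough for precomposition with [pi]. *)
    by move=> b; have [hD _ _] := dual b; exact/hproj_LHom_lcomponent.
  by move=> b a; have [_ _ q] := dual b; exact: bidual_qis_at.
apply: (@adjoint_of_pairing k Q B' A' hB res.1 S T (uncurryb rho)).
  exact: curry_uncurryb_qis.
exact: (quasi_functor_resolution Q qS).
Qed.
End LeftAdjoint.

Theorem theorem1p3 (k : comPzRingType)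
    (Q : forall X Y : dgcat k, resolution X Y)
    (A B Ahp Bhp : dgcat k)
    (pA : dgfunctor Ahp A) (pB : dgfunctor Bhp B)
    (resA : hproj_resolution pA) (resB : hproj_resolution pB)
    (triA : triangulated A) (smoothA : smooth pA)
    (lperfB : locally_perfect B)
    (T : bimod Ahp Bhp) (qfT : quasi_functor T) :
  (exists S : bimod Bhp Ahp, quasi_functor S /\ adjoint Q S T) /\
  (exists S : bimod Bhp Ahp, quasi_functor S /\ adjoint Q T S).
Proof.
have [hB _] := resB; have lpB := perfect_homk_resolution resB lperfB.
split; first exact: (left_adjoint Q resA triA smoothA hB lpB qfT).
exact: (right_adjoint Q resA triA smoothA hB lpB qfT).
Qed.
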